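(* Let $n \geq 1$, $d \in [n-1,n[$, $u \in \mathrm{BV}^{d-(n-1)}_c(\mathbb R^n)$ and $\varphi=(\varphi^1,\dots,\varphi^n) : \mathbb R^n\to\mathbb R^n$. Assume that $r > 0$ and $\alpha_1,\dots,\alpha_n \in \,]0,1]$ are such that: (1) $\operatorname{spt}(u) \subset [-r,r]^n$; (2) $\max_{i=1,\dots,n}\mathrm{Lip}^{\alpha_i}(\varphi^i) < \infty$; (3) $\tau_n := \alpha_1 + \dots + \alpha_n > d$. Then $\varphi_\# [\![u]\!] = [\![v_{u,\varphi}]\!]$ is defined (by approximation) for some $v_{u,\varphi} \in L^1_c(\mathbb R^n)$, with \[\|v_{u,\varphi}\|_{L^p} \leq C(n,\tau_n,d,p,r)\, \mathbf V^{d-(n-1)}(u)\, \mathrm{Lip}^{\alpha_1}(\varphi^1)^{1/p} \cdots \mathrm{Lip}^{\alpha_n}(\varphi^n)^{1/p}\] for all $1 \leq p < \frac{\tau_n}{d}$ (or $1 \leq p < \infty$ if $d=n-1=0$), where $C(n,\tau_n,d,p,r)$ is a finite constant depending only on the indicated quantities. Further, if $(\varphi_k)_{k \in \mathbb N}$ is a sequence of maps $\mathbb R^n\to\mathbb R^n$ that converges uniformly to $\varphi$ with $\sup_{i,k}\mathrm{Lip}^{\alpha_i}(\varphi_k^i) < \infty$, then $v_{u,\varphi_k}$ converges in $L^p$ to $v_{u,\varphi}$ for any $p$ in the same range. Moreover, $v_{u,\varphi} \in \bigcap_{d'<\delta<n}\mathrm{BV}_c^{\delta-(n-1)}(\mathbb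 R^n)$ for $d' := n + \frac{d-\tau_{n}}{\max_i \alpha_i}$.
   Context: $L^1_c(\mathbb R^n)$ denotes integrable functions with (essentially) compact support. For $\alpha\in[0,1]$, $\mathrm{Lip}^\alpha(g)=\sup_{x\ne y}|g(x)-g(y)|/|x-y|^\alpha$ and $\mathrm{Lip}=\mathrm{Lip}^1$. For $u\in L^1_c(\mathbb R^n)$ and $\alpha\in[0,1]$, $\mathbf V^\alpha(u)$ is the smallest $C\in[0,\infty]$ such that $\bigl|\int_{\mathbb R^n} u\det D(f,g_1,\dots,g_{n-1})\,dx\bigr|\le C\,\mathrm{Lip}^\alpha(f)\,\mathrm{Lip}(g_1)\cdots\mathrm{Lip}(g_{n-1})$ for all $f,g_1,\dots,g_{n-1}\in\mathrm{Lip}(\mathbb R^n)$, and $\mathrm{BV}^\alpha_c(\mathbb R^n)=\{u\in L^1_c(\mathbb R^n):\mathbf V^\alpha(u)<\infty\}$. $[\![u]\!]$ is the current $(f,g^1,\dots,g^n)\mapsto\int_{\mathbb R^n} u f\det D(g^1,\dots,g^n)\,dx$ on $\mathrm{Lip}(\mathbb R^n)^{n+1}$. For a Lipschitz map $\psi:\mathbb R^n\to\mathbb R^n$, $\psi_\#[\![u]\!](f,g^1,\dots,g^n)=[\![u]\!](f\circ\psi,g^1\circ\psi,\dots,g^n\circ\psi)$, and $\psi_\#[\![u]\!]=[\![v_{u,\psi}]\!]$ with $v_{u,\psi}(y)=\sum_{x\in\psi^{-1}(y)}u(x)\operatorname{sign}(\det D\psi_x)$ for a.e. $y$. For $\varphi$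 as in the theorem (only Hölder), ''$\varphi_\#[\![u]\!]=[\![v_{u,\varphi}]\!]$ is defined'' means by approximation: for every sequence of Lipschitz maps $\psi_k$ converging uniformly to $\varphi$ with $\sup_{i,k}\mathrm{Lip}^{\alpha_i}(\psi_k^i)<\infty$, the functions $v_{u,\psi_k}$ converge in $L^1$ to a limit $v_{u,\varphi}\in L^1_c(\mathbb R^n)$ that does not depend on the sequence. *)

(* Defs.v *)
From HB Require Import structures.
From mathcomp Require Import all_boot all_order all_algebra.
From mathcomp Require Import all_classical all_reals all_analysis.

Set Implicit Arguments.
Unset Strict Implicit.
Unset Printing Implicit Defensive.

Import Order.TTheory GRing.Theory Num.Theory.
Import numFieldNormedType.Exports.

Local Open Scope classical_set_scope.
Local Open Scope ring_scope.

Definition measure_rV_display : measure_display.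
Proof. exact: (measure_tuple_display default_measure_display). Qed.

(* R^n is 'rV[R]_n.  The library has a sigma-algebra on n-tuples but none on
   row vectors; as for tuples, we take the one generated by the coordinate
   functions, which is the Borel sigma-algebra of R^n.  L^1 functions below are
   represented by Borel functions: each Lebesgue class contains one. *)
Section measurable_rV.
Context (R : realType) (n : nat).

Let coors : 'I_n -> 'rV[R]_n -> measurableTypeR R := fun i x => x ord0 i.

Let rV_set0 : g_sigma_preimage coors set0.
Proof. exact: sigma_algebra0. Qed.

Let rV_setC A : g_sigma_preimage coors A -> g_sigma_preimage coors (~` A).
Proof. exact: sigma_algebraC. Qed.

Let rV_bigcup (F : _^nat) : (forall i, g_sigma_preimage coors (F i)) ->
  g_sigma_preimage coors (\bigcup_i (F i)).
Proof. exact: sigma_algebra_bigcup. Qed.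

HB.instance Definition _ := @isMeasurable.Build measure_rV_display
  'rV[R]_n (g_sigma_preimage coors) rV_set0 rV_setC rV_bigcup.

End measurable_rV.

Lemma measurable_coord (R : realType) n (i : 'I_n) :
  measurable_fun [set: 'rV[R]_n] (fun x => x ord0 i : measurableTypeR R).
Proof.
move=> _ Y mY; rewrite setTI; apply: sub_sigma_algebra => /=.
rewrite -bigcup_seq/=; exists i => /=; first by rewrite mem_index_enum.
by exists Y => //; rewrite setTI.
Qed.

Lemma measurable_fun_rV d (T : measurableType d) (R : realType) n
    (f : T -> 'rV[R]_n) :
  (forall i, measurable_fun [set: T] (fun t => f t ord0 i : measurableTypeR R)) ->
  measurable_fun [set: T] f.
Proof.
move=> mf _ Y mY; rewrite setTI.
suff : measurable `<=` [set A | measurable (f @^-1` A)] by apply.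
apply: smallest_sub.
  split => /=.
  - by rewrite preimage_set0.
  - by move=> A mA; rewrite setTD preimage_setC; exact: measurableC.
  - by move=> F mF; rewrite preimage_bigcup; exact: bigcupT_measurable.
rewrite -bigcup_seq; apply: bigcup_sub => i _ A [B mB <-] /=.
rewrite setTI -[X in measurable X]setTI -comp_preimage; exact: mf.
Qed.

Definition rV_cons (R : realType) n (x : measurableTypeR R * 'rV[R]_n) :
  'rV[R]_n.+1 := row_mx ((x.1 : R)%:M : 'rV[R]_1) x.2.

Definition rV_uncons (R : realType) n (x : 'rV[R]_n.+1) :
  measurableTypeR R * 'rV[R]_n := (x ord0 ord0, rsubmx (x : 'rV_(1 + n))).

Lemma rV_consK (R : realType) n : cancel (@rV_cons R n) (@rV_uncons R n).
Proof.
move=> [a x]; rewrite /rV_uncons /rV_cons /= row_mxKr; congr pair.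
rewrite (_ : (ord0 : 'I_n.+1) = lshift n (ord0 : 'I_1)); last exact: val_inj.
by apply: etrans (row_mxEl _ _ _ _) _; rewrite mxE eqxx mulr1n.
Qed.

Lemma rV_cons_lift (R : realType) n (a : R) (x : 'rV[R]_n) j :
  rV_cons (a, x) ord0 (lift ord0 j) = x ord0 j.
Proof.
rewrite -[RHS](row_mxEr (a%:M : 'rV_1) x).
by congr (row_mx _ _ _ _); exact: val_inj.
Qed.

Lemma measurable_rV_cons (R : realType) n :
  measurable_fun [set: _] (@rV_cons R n).
Proof.
apply: measurable_fun_rV => i; rewrite /rV_cons.
rewrite -[i](splitK (m := 1)); case: (fintype.split _) => j /=.
  apply: (eq_measurable_fun fst) => // x _.
  by apply/esym; apply: etrans (row_mxEl _ _ _ _) _; rewrite (ord1 j) mxE eqxx mulr1n.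
apply: (eq_measurable_fun ((fun y : 'rV[R]_n => y ord0 j : measurableTypeR R)
  \o snd)) => [x _|]; first exact/esym/row_mxEr.
apply: measurableT_comp => //; exact: measurable_coord.
Qed.

HB.instance Definition _ (R : realType) n :=
  isMeasurableFun.Build _ _ _ _ (@rV_cons R n) (@measurable_rV_cons R n).

Lemma measurable_rV_uncons (R : realType) n :
  measurable_fun [set: _] (@rV_uncons R n).
Proof.
apply: measurable_fun_pair; first exact: measurable_coord.
apply: measurable_fun_rV => i /=.
apply: (eq_measurable_fun
  (fun x : 'rV[R]_n.+1 => x ord0 (rshift 1 i) : measurableTypeR R)) => [x _|].
  by rewrite mxE.
exact: measurable_coord.
Qed.

Section lebesgue_rV_step.
Context (R : realType) (n : nat).
Variable mu : {sigma_finite_measure set 'rV[R]_n -> \bar R}.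

Definition lebesgue_rV_step : set 'rV[R]_n.+1 -> \bar R :=
  pushforward (@lebesgue_measure R \x mu)%E (@rV_cons R n).

Let lebesgue_rV_step0 : lebesgue_rV_step set0 = 0%E.
Proof. exact: measure0. Qed.

Let lebesgue_rV_step_ge0 A : (0 <= lebesgue_rV_step A)%E.
Proof. exact: measure_ge0. Qed.

Let lebesgue_rV_step_sigma_additive : semi_sigma_additive lebesgue_rV_step.
Proof. exact: measure_semi_sigma_additive. Qed.

HB.instance Definition _ := isMeasure.Build _ _ _ lebesgue_rV_step
  lebesgue_rV_step0 lebesgue_rV_step_ge0 lebesgue_rV_step_sigma_additive.

Let lebesgue_rV_step_sigma_finite : sigma_finite setT lebesgue_rV_step.
Proof.
have /sigma_finiteP[F [FT ndF Foo]] := sigma_finiteT (@lebesgue_measure R).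
have /sigma_finiteP[G [GT ndG Goo]] := sigma_finiteT mu.
exists (fun k => @rV_uncons R n @^-1` (F k `*` G k)).
  rewrite -preimage_bigcup (_ : \bigcup_k _ = setT) ?preimage_setT//.
  rewrite -setXTT FT GT predeqE => -[x y]; split.
    by move=> [k _ []/= ? ?]; split; exists k.
  move=> [/= [k _ Fkx] [l _ Gly]]; exists (maxn k l) => //; split.
  - by move: x Fkx; exact/subsetPset/ndF/leq_maxl.
  - by move: y Gly; exact/subsetPset/ndG/leq_maxr.
move=> k; have [mF Fk] := Foo k; have [mG Gk] := Goo k; split.
  rewrite -[X in measurable X]setTI; apply: measurable_rV_uncons => //.
  exact: measurableX.
rewrite /lebesgue_rV_step /pushforward -comp_preimage.
rewrite (_ : _ \o _ = id) ?preimage_id; last first.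
  by apply/funext => x; exact: rV_consK.
by rewrite product_measure1E// lte_mul_pinfty// ge0_fin_numE.
Qed.

HB.instance Definition _ := Measure_isSigmaFinite.Build _ _ _
  lebesgue_rV_step lebesgue_rV_step_sigma_finite.

End lebesgue_rV_step.

Fixpoint lebesgue_rV (R : realType) (n : nat) :
    {sigma_finite_measure set 'rV[R]_n -> \bar R} :=
  match n with
  | 0 => \d_ (0 : 'rV[R]_0)
  | k.+1 => lebesgue_rV_step (lebesgue_rV R k)
  end.

Lemma lebesgue_rV_box (R : realType) n (a b : 'I_n -> R) :
  (forall i, a i <= b i) ->
  lebesgue_rV R n [set x | forall i, a i <= x ord0 i <= b i] =
  (\prod_i (b i - a i))%:E.
Proof.
elim: n a b => [|n IHn] a b ab.
  by rewrite big_ord0 /= diracE mem_set//= => -[].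
rewrite big_ord_recl /= /lebesgue_rV_step /pushforward.
pose B := [set x : 'rV[R]_n |
  forall i, a (lift ord0 i) <= x ord0 i <= b (lift ord0 i)].
have mB : measurable B.
  rewrite (_ : B = \big[setI/setT]_(i < n)
      ((fun x : 'rV[R]_n => x ord0 i : measurableTypeR R) @^-1`
       `[a (lift ord0 i), b (lift ord0 i)])).
    apply: bigsetI_measurable => i _.
    by rewrite -[X in measurable X]setTI; exact: measurable_coord.
  apply/seteqP; split => x; rewrite -bigcap_seq => Bx i.
    by move=> _ /=; rewrite in_itv; exact: Bx.
  by have /= := Bx i (mem_index_enum i); rewrite in_itv.
rewrite (_ : _ @^-1` _ = `[a ord0, b ord0] `*` B); last first.
  apply/seteqP; split => -[y x] /=.
    move=> yx; split => [|i]; rewrite ?in_itv/=.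
      have := yx ord0; rewrite (_ : rV_cons (y, x) ord0 ord0 = y)//.
      by have /(congr1 fst) := rV_consK (y, x).
    by have := yx (lift ord0 i); rewrite (rV_cons_lift y x).
  move=> [ay Bx] i; have [j ->|->] := unliftP ord0 i.
    by rewrite rV_cons_lift.
  have /(congr1 fst) /= -> := rV_consK (y, x).
  by move: ay; rewrite in_itv.
rewrite product_measure1E//= lebesgue_measure_itv/= lte_fin.
rewrite [X in (_ * X)%E]IHn => [|i]; last exact: ab.
rewrite EFinM; congr (_ * _)%E.
by case: ltgtP (ab ord0) => // -> _; rewrite subrr.
Qed.

Section functions_on_Rn.
Context (R : realType) (n : nat).
Local Notation Rn := 'rV[R]_n.
Local Notation mu := (lebesgue_rV R n).

(* The norm that the library puts on row vectors is the sup norm. *)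
Definition enorm (x : Rn) : R := Num.sqrt (\sum_i x ord0 i ^+ 2).

Definition Lip (alpha : R) (g : Rn -> R) : \bar R :=
  ereal_sup [set (`|g x.1 - g x.2| / enorm (x.1 - x.2) `^ alpha)%:E |
              x in [set x : Rn * Rn | x.1 != x.2]].

Definition is_Lip (g : Rn -> R) : Prop := (Lip 1 g < +oo)%E.

Definition component m (F : Rn -> 'rV[R]_m) (i : 'I_m) : Rn -> R :=
  fun x => F x ord0 i.

Definition is_Lip_map m (F : Rn -> 'rV[R]_m) : Prop :=
  forall i, is_Lip (component F i).

Definition ess_spt (u : Rn -> R) : set Rn :=
  [set x | forall U, nbhs x U -> ~ {ae mu, forall y, U y -> u y = 0}].

Definition L1c (u : Rn -> R) : Prop :=
  mu.-integrable setT (EFin \o u) /\ compact (ess_spt u).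

Definition Lp_norm (p : R) (u : Rn -> R) : \bar R :=
  'N[mu]_(p%:E)[EFin \o u]%E.

Definition Lp_cvg (p : R) (v_ : nat -> Rn -> R) (v : Rn -> R) : Prop :=
  Lp_norm p (v_ k \- v) @[k --> \oo] --> 0%E.

(* det D(g^1,...,g^n); the library's 'J g x is the transpose of the matrix
   whose rows are the gradients *)
Definition detD (g : Rn -> Rn) (x : Rn) : R := \det ('J g x).

(* the functionals (f, g^1, ..., g^n) |-> R on Lip(R^n)^(n+1), with
   g^1, ..., g^n grouped as one map to R^n *)
Definition functional := (Rn -> R) -> (Rn -> Rn) -> R.

Definition current_of (u : Rn -> R) : functional :=
  fun f g => \int[mu]_x (u x * f x * detD g x).

Definition pushforward_functional (psi : Rn -> Rn) (T : functional) :
  functional := fun f g => T (f \o psi) (g \o psi).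

Definition eq_on_Lip (T S : functional) : Prop :=
  forall f g, is_Lip f -> is_Lip_map g -> T f g = S f g.

(* For Lipschitz psi and u in L^1_c, almost every y has only finitely many
   preimages x with u x * sign (det D psi_x) != 0 (area formula), so the sum
   below, which by convention is 0 for infinitely many nonzero terms, is the
   intended one almost everywhere. *)
Definition is_pushforward_Lip (u : Rn -> R) (psi : Rn -> Rn) (v : Rn -> R)
    : Prop :=
  [/\ L1c v,
      eq_on_Lip (pushforward_functional psi (current_of u)) (current_of v) &
      {ae mu, forall y, v y =
        \sum_(x \in psi @^-1` [set y]) u x * Num.sg (detD psi x)}].

Definition cvg_bounded_Lip (alpha : 'I_n -> R) (psi_ : nat -> Rn -> Rn)
    (phi : Rn -> Rn) : Prop :=
  {uniform, psi_ @ \oo --> phi} /\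
  (ereal_sup [set Lip (alpha ik.1) (component (psi_ ik.2) ik.1) |
              ik in [set: 'I_n * nat]] < +oo)%E.

(* phi_# [[u]] = [[v]] is defined by approximation.  The limit v comes before
   the quantifier over psi_, hence does not depend on the sequence; it is
   determined a.e. when phi is Hoelder, since mollifying phi gives a sequence. *)
Definition is_pushforward (alpha : 'I_n -> R) (u : Rn -> R) (phi : Rn -> Rn)
    (v : Rn -> R) : Prop :=
  L1c v /\
  forall psi_ : nat -> Rn -> Rn,
    (forall k, is_Lip_map (psi_ k)) -> cvg_bounded_Lip alpha psi_ phi ->
    exists2 v_ : nat -> Rn -> R,
      forall k, is_pushforward_Lip u (psi_ k) (v_ k) & Lp_cvg 1 v_ v.

End functions_on_Rn.

(* In dimension n = m.+1, the functions g_1, ..., g_(n-1) form a map to R^m. *)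
Section bounded_variation.
Context (R : realType) (m : nat).
Local Notation Rn := 'rV[R]_m.+1.
Local Notation mu := (lebesgue_rV R m.+1).
Local Open Scope ereal_scope.

Definition Valpha (alpha : R) (u : Rn -> R) : \bar R :=
  ereal_inf [set C | 0 <= C /\
    forall (f : Rn -> R) (g : Rn -> 'rV[R]_m), is_Lip f -> is_Lip_map g ->
      `| \int[mu]_x (u x * detD (fun z => rV_cons (f z, g z)) x)%:E |
      <= C * Lip alpha f * \prod_(j < m) Lip 1 (component g j)].

Definition BVc (alpha : R) (u : Rn -> R) : Prop :=
  L1c u /\ Valpha alpha u < +oo.

End bounded_variation.

(* Main.v *)
(** By the area formula Lipschitz maps push [u] forward to a signed fiber sum.
Mollifying [u] and regularizing [phi] at scale 2^-k gives [U_k], [phi_k]. Each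
difference of consecutive push-forwards of [U_k] by [phi_k] has geometrically
small L^1 norm and controlled variation in every direction, because a
determinant can be integrated by parts. Testing against h in the dual of L^p
interpolates these two bounds into one on the L^p norm, so the series of
differences converges in L^p for p < tau_n / d. Its tail depends on [phi] only
through the Hölder constants, which yields independence of the approximation. *)
Require Import Defs.
From HB Require Import structures.
From mathcomp Require Import all_boot all_order all_algebra.
From mathcomp Require Import all_classical all_reals all_analysis.
From mathcomp Require Import measurable_realfun fingroup perm.
From mathcomp Require Import ring lra zify.

Set Implicit Arguments.
Unset Strict Implicit.
Unset Printing Implicit Defensive.

Import Order.TTheory GRing.Theory Num.Theory.
Import numFieldNormedType.Exports.

Local Open Scope classical_set_scope.
Local Open Scope ring_scope.
Local Notation measT := (measurable_fun setT).
Local Notation mR := measurableTypeR.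
Local Notation intf mu f := (integrable mu setT (EFin \o f)).
Local Notation nlip L f := (forall x y, `|f x - f y| <= L * `|x - y|).
Local Notation normle f M := (forall x, `|f x| <= M).
Local Notation allpos f := (forall x, 0 < f x).
Local Notation allnneg f := (forall x, 0 <= f x).

(** The range of [p] comes from the shape of the pieces. With [d = m + a], the [k]-th difference has
    mass about [B * PH * 2^(-k (tau - d))], where [PH] is the product of the Hölder constants [H i],
    and it varies in direction [i] as if this mass were spread over a box of sides
    [H i * 2^(-k al i)]. Such a box has volume [PH * 2^(-k tau)], so the [L^p] norm is about
    [B * PH^(1/p) * 2^(-k (tau / p - d))], which is summable when [tau / p > d]. Hence kernels,
    scales and Lipschitz bounds are kept separate for each coordinate: isotropic estimates would
    lose the exponent and the product of the Hölder constants. Two obstacles shape the rest. The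
    bound has to be linear in the variation of [u], without its [L^1] norm, so even the coarsest
    term of the series must be controlled by the variation. And Lipschitz maps have no second
    derivatives, so the vanishing of the integral of a Jacobian determinant is derived from the area
    formula for large multiples of the identity plus the map, followed by polynomial
    extrapolation. *)

Lemma eq_ler d (T : porderType d) (x y : T) : x = y -> (x <= y)%O.
Proof. by move=> ->. Qed.

Lemma le_mu_sub d (T : measurableType d) (R : realType)
  (mu : {measure set T -> \bar R}) (A B : set T) :
 measurable A -> measurable B -> A `<=` B -> (mu A <= mu B)%E.
Proof. by move=> mA mB AB; apply: le_measure => //; exact: mem_set. Qed.

(** * Boxes and Borel sets of row vectors *)

Section row_norm.
Context {R : realType} {n : nat}.
Implicit Types x y : 'rV[R]_n.

Lemma coord_le x i : `|x ord0 i| <= `|x|.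
Proof.
rewrite [leRHS]/Num.Def.normr/= mx_normrE.
by apply: (le_bigmax _ _ (ord0, i)).
Qed.

Lemma norm_row_le x (c : R) : 0 <= c -> (forall i, `|x ord0 i| <= c) -> `|x| <= c.
Proof.
move=> c0 xc; rewrite [leLHS]/Num.Def.normr/= mx_normrE.
by apply/bigmax_leP; split => // -[i j] _ /=; rewrite (ord1 i); exact: xc.
Qed.

Lemma norm_row_lt x (c : R) : 0 < c -> (forall i, `|x ord0 i| < c) -> `|x| < c.
Proof.
move=> c0 xc; rewrite [ltLHS]/Num.Def.normr/= mx_normrE.
by apply/bigmax_ltP; split => // -[i j] _ /=; rewrite (ord1 i); exact: xc.
Qed.

End row_norm.

Definition box {R : realType} {n : nat} (a b : 'I_n -> R) : set 'rV[R]_n :=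
 [set x | forall i, a i <= x ord0 i <= b i].

Section boxes.
Context {R : realType} {n : nat}.
Notation mu := (lebesgue_rV R n).
Implicit Types a b : 'I_n -> R.

Lemma meas_box a b : measurable (box a b).
Proof.
rewrite (_ : box a b = \big[setI/setT]_(i < n)
  ((fun x : 'rV[R]_n => x ord0 i : mR R) @^-1` `[a i, b i])).
 apply: bigsetI_measurable => i _.
 by rewrite -[X in measurable X]setTI; exact: measurable_coord.
apply/seteqP; split => x; rewrite -bigcap_seq => Bx i.
 by move=> _ /=; rewrite in_itv; exact: Bx.
by have /= := Bx i (mem_index_enum i); rewrite in_itv.
Qed.

Definition boxes := [set A : set 'rV[R]_n | exists a b, A = box a b].

Lemma setI_closed_boxes : setI_closed boxes.
Proof.
move=> _ _ [a [b ->]] [a' [b' ->]].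
exists (fun i => Num.max (a i) (a' i)), (fun i => Num.min (b i) (b' i)).
apply/seteqP; split => [x [Bx Bx'] i|x Bx].
 by have := Bx i; have := Bx' i => /andP[? ?] /andP[? ?];
  rewrite ge_max le_min; apply/andP; split; apply/andP.
by split => i; have := Bx i; rewrite ge_max le_min => /andP[/andP[? ?] /andP[? ?]];
 apply/andP.
Qed.

Definition cube (N : R) : set 'rV[R]_n := box (fun=> - N) (fun=> N).

Lemma cubeP N x : 0 <= N -> cube N x <-> `|x| <= N.
Proof.
move=> N0; split => [Bx|xN i].
 by apply: norm_row_le => // i; rewrite ler_norml; exact: Bx.
by rewrite -ler_norml; apply: le_trans xN; exact: coord_le.
Qed.

Lemma bigcup_cube : \bigcup_k cube k%:R = setT.
Proof.
rewrite -subTset => x _; exists (Num.bound `|x|) => //.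
by apply/cubeP => //; exact/ltW/archi_boundP.
Qed.

(** A slab over []u, v]] is a countable union of boxes: side [i] is [[u + 1/(k+1), v]] and the other
    sides grow with [N]. Boxes are closed under intersection, so measures finite on boxes can be
    compared on them alone. *)
Lemma measurable_boxesE : @measurable _ 'rV[R]_n = <<s boxes >>.
Proof.
apply/seteqP; split; last first.
 apply: smallest_sub; first exact: sigma_algebra_measurable.
 by move=> _ [a [b ->]]; exact: meas_box.
apply: smallest_sub; first exact: smallest_sigma_algebra.
rewrite -bigcup_seq; apply: bigcup_sub => i _ A [B mB <-] /=; rewrite setTI.
pose P := [set B : set (mR R) |
 <<s boxes >> ((fun x : 'rV[R]_n => x ord0 i : mR R) @^-1` B)].
have /sigma_algebraP[|sD sI _ _] := @smallest_sigma_algebra _ setT boxes; first by [].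
have := @smallest_sigma_algebra _ setT boxes => -[s0 sC sU].
suff : measurable `<=` P by apply.
apply: smallest_sub.
 split => /=.
 - by rewrite /P/= preimage_set0.
 - move=> C PC; rewrite /P/= setTD preimage_setC.
  by have := sC _ PC; rewrite setTD.
 - by move=> F PF; rewrite /P/= preimage_bigcup; exact: sU.
move=> _ [[u v] _ <-]; rewrite /P /=.
rewrite (_ : _ @^-1` _ = \bigcup_k \bigcup_N
 box (fun j => if j == i then u + k.+1%:R^-1 else - N%:R)
  (fun j => if j == i then v else N%:R)).
 apply: (sU) => k; apply: (sU) => N; apply: sub_sigma_algebra; by eexists; eexists.
apply/seteqP; split => x /=; last first.
 move=> [k _ [N _ /(_ i)]]; rewrite eqxx in_itv/= => /andP[ux ->]; rewrite andbT.
 by apply: lt_le_trans ux; rewrite ltrDl invr_gt0.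
rewrite in_itv/= => /andP[ux xv].
have d0 : 0 < x ord0 i - u by rewrite subr_gt0.
exists (Num.bound (x ord0 i - u)^-1) => //; exists (Num.bound `|x|) => // j.
case: eqP => [->|_].
 rewrite xv andbT -lerBrDl -[leRHS]invrK lef_pV2 ?posrE// ?invr_gt0//.
 apply/ltW/(lt_trans (archi_boundP _)) => //; first by rewrite invr_ge0 ltW.
 by rewrite ltr_nat.
rewrite -ler_norml; apply: (le_trans (coord_le _ _)); exact/ltW/archi_boundP.
Qed.

Lemma box_lty a b : (mu (box a b) < +oo)%E.
Proof.
have [ab|] := pselect (forall i, a i <= b i); first by rewrite lebesgue_rV_box// ltry.
move=> /existsNP[i /negP]; rewrite -ltNge => ba.
rewrite (_ : box a b = set0) ?measure0//.
by rewrite -subset0 => x /(_ i)/andP[/le_trans h] /h; rewrite leNgt ba.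
Qed.

Lemma measure_boxes_unique (m1 m2 : {measure set 'rV[R]_n -> \bar R}) :
 (forall a b, (forall i, a i <= b i) -> m1 (box a b) = m2 (box a b)) ->
 (forall a b, (m1 (box a b) < +oo)%E) ->
 forall A, measurable A -> m1 A = m2 A.
Proof.
move=> m12 m1oo A mA.
apply: (measure_unique boxes (fun k => cube k%:R)) => //.
- exact: measurable_boxesE.
- exact: setI_closed_boxes.
- by move=> k; eexists; eexists.
- exact: bigcup_cube.
- move=> _ [a [b ->]].
 have [ab|] := pselect (forall i, a i <= b i); first exact: m12.
 move=> /existsNP[i /negP]; rewrite -ltNge => ba.
 rewrite (_ : box a b = set0) ?measure0//.
 by rewrite -subset0 => x /(_ i)/andP[/le_trans h] /h; rewrite leNgt ba.
- by move=> k; exact: m1oo.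
Qed.

End boxes.

Local Notation vanish N f := (forall x, ~ cube N x -> f x = 0).
Arguments cube {R n}.

Section borel.
Context {R : realType} {n : nat}.
Notation Rn := 'rV[R]_n.

Lemma near_rat_row (x : Rn) e : 0 < e ->
 exists q : 'rV[rat]_n, `|x - map_mx ratr q| < e.
Proof.
move=> e0.
have h i : exists q : rat, `|x ord0 i - ratr q| < e.
 have [|q] := @rat_in_itvoo R (x ord0 i - e) (x ord0 i + e).
  by rewrite ltrD2l gtrN.
 by rewrite in_itv/= => /andP[? ?]; exists q; rewrite distrC ltr_distl; apply/andP.
have [f hf] := choice h.
exists (\row_i f i); apply: norm_row_lt => // i.
by rewrite !mxE; exact: hf.
Qed.

(** An open set is the union of the closed cubes inside it that have rational centre and radius
    [1/(k+1)]. [B qk] is empty for the other cubes, so that the union runs over a countable type. *)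
Lemma open_meas (U : set Rn) : open U -> measurable U.
Proof.
move=> oU.
pose D := [set qk : 'rV[rat]_n * nat |
 forall y : Rn, `|y - map_mx ratr qk.1| <= qk.2.+1%:R^-1 -> U y].
pose B (qk : 'rV[rat]_n * nat) : set Rn :=
 [set y | D qk /\ box (fun i => ratr (qk.1 ord0 i) - qk.2.+1%:R^-1)
  (fun i => ratr (qk.1 ord0 i) + qk.2.+1%:R^-1) y].
have BP qk y : D qk -> `|y - map_mx ratr qk.1| <= qk.2.+1%:R^-1 <-> B qk y.
 move=> Dqk; split => [yq|[_ Bq]].
  split => // i.
  rewrite -ler_distl; apply: le_trans yq.
  by have := coord_le (y - map_mx ratr qk.1) i; rewrite !mxE.
 apply: norm_row_le; first by rewrite invr_ge0.
 by move=> i; rewrite !mxE ler_distl; exact: Bq.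
have -> : U = \bigcup_qk B qk.
 apply/seteqP; split => [x Ux|x [qk _]]; last first.
  by move=> [Dqk Bx]; apply: (Dqk); apply/BP.
 have /nbhs_ballP[e /= e0 eU] : nbhs x U by exact: open_nbhs_nbhs.
 pose k := Num.bound (2 / e).
 have ke : k.+1%:R^-1 < e / 2.
  rewrite -[ltRHS]invrK invf_div ltf_pV2 ?posrE// ?divr_gt0//.
  apply: (lt_trans (archi_boundP _)); first by rewrite divr_ge0// ltW.
  by rewrite ltr_nat.
 have k0 : 0 < k.+1%:R^-1 :> R by rewrite invr_gt0.
 have [q xq] := near_rat_row x k0.
 have Dqk : D (q, k).
  move=> y /= yq; apply: eU; rewrite mx_norm_ball /ball_/=.
  rewrite (le_lt_trans (ler_distD (map_mx ratr q) _ _))//.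
  rewrite (splitr e) ltrD//; first exact: lt_trans ke.
  by rewrite distrC (le_lt_trans yq).
 by exists (q, k) => //; apply/BP => //; exact: ltW.
apply: countable_bigcupT_measurable; first exact: countableP.
move=> qk; have [Dqk|Dqk] := pselect (D qk).
 rewrite (_ : B qk = box (fun i => ratr (qk.1 ord0 i) - qk.2.+1%:R^-1)
  (fun i => ratr (qk.1 ord0 i) + qk.2.+1%:R^-1)); first exact: meas_box.
 by apply/seteqP; split => y // [].
rewrite (_ : B qk = set0); first exact: measurable0.
by rewrite -subset0 => y [].
Qed.

Lemma closed_meas (U : set Rn) : closed U -> measurable U.
Proof. by move=> /closed_openC/open_meas/measurableC; rewrite setCK. Qed.

Lemma compact_meas (K : set Rn) : compact K -> measurable K.
Proof. by move=> /(compact_closed (@norm_hausdorff _ _))/closed_meas. Qed.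

Lemma cont_meas_rV (f : Rn -> R) : continuous f -> measT f.
Proof.
move=> cf; apply: (measurability _ (RGenOInfty.measurableE R)) => //.
move=> _ [_ [a ->] <-]; rewrite setTI; apply: open_meas.
by apply: open_comp => //; move=> x _; exact: cf.
Qed.

Lemma cont_meas_map m (f : Rn -> 'rV[R]_m) :
 continuous f -> measT f.
Proof.
move=> cf; apply: measurable_fun_rV => i; apply: cont_meas_rV => x.
apply: (@continuous_comp _ _ _ f (fun y => y ord0 i)); first exact: cf.
exact: coord_continuous.
Qed.

End borel.

Lemma lip_continuous {R : realType} {V W : normedModType R} (f : V -> W) (k : R) :
 nlip k f -> continuous f.
Proof.
move=> fk x; apply/cvgrPdist_le => e e0.
have k0 : 0 < `|k| + 1 by rewrite ltr_wpDl.
near=> y; rewrite (le_trans (fk _ _))// (@le_trans _ _ ((`|k| + 1) * `|x - y|))//.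
 by rewrite ler_wpM2r// (le_trans (ler_norm _))// lerDl.
rewrite -ler_pdivlMl//; near: y; apply: cvgr_dist_le => //.
by rewrite mulr_gt0// invr_gt0.
Unshelve. all: by end_near. Qed.

Lemma norm_mulmx_le {R : realType} m n (x : 'rV[R]_m) (T : 'M[R]_(m, n)) :
 `|x *m T| <= (\sum_i \sum_j `|T i j|) * `|x|.
Proof.
have s0 : 0 <= \sum_i \sum_j `|T i j| by apply: sumr_ge0 => i _; apply: sumr_ge0.
apply: norm_row_le => [|j]; first by rewrite mulr_ge0.
rewrite mxE (le_trans (ler_norm_sum _ _ _))// mulr_suml; apply: ler_sum => i _.
rewrite normrM mulrC ler_pM// ?coord_le//.
by rewrite (bigD1 j)//= lerDl sumr_ge0.
Qed.

Lemma mulmxr_continuous {R : realType} m n (T : 'M[R]_(m, n)) :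
 continuous (fun x : 'rV[R]_m => x *m T).
Proof.
by apply: lip_continuous => x y; rewrite -mulmxBl; exact: norm_mulmx_le.
Qed.

(** * Lebesgue measure under affine and linear maps *)

Section invariances.
Context {R : realType} {n : nat}.
Notation Rn := 'rV[R]_n.
Notation mu := (lebesgue_rV R n).

Section preimage_scaling.
Variables (f : Rn -> Rn) (mf : measT f).

Let g : {mfun Rn >-> Rn} := mfun_Sub (mem_set mf).

(** The push-forward of [mu] by [f] and [c] times [mu] are two measures that agree on boxes. *)
Lemma measure_preimage_boxes (c : {nonneg R}) :
 (forall a b, (forall i, a i <= b i) ->
  mu (f @^-1` box a b) = (c%:num%:E * mu (box a b))%E) ->
 forall A, measurable A -> mu (f @^-1` A) = (c%:num%:E * mu A)%E.
Proof.
move=> fE A mA.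
apply: (@measure_boxes_unique _ _ (pushforward mu g) (mscale c mu)) => // a b.
have [ab|] := pselect (forall i, a i <= b i).
 rewrite [X in (X < _)%E](_ : _ = mu (f @^-1` box a b))// fE//.
 by rewrite lte_mul_pinfty// ?lee_fin//; exact: box_lty.
move=> /existsNP[i /negP]; rewrite -ltNge => ba.
rewrite (_ : box a b = set0) ?measure0//.
by rewrite -subset0 => x /(_ i)/andP[/le_trans h] /h; rewrite leNgt ba.
Qed.

Hypothesis (c : {nonneg R}).
Hypothesis fE : forall A, measurable A -> mu (f @^-1` A) = (c%:num%:E * mu A)%E.

Lemma ge0_integral_preimage (h : Rn -> \bar R) : measT h ->
 (forall x, 0 <= h x)%E ->
 (\int[mu]_x h (f x) = c%:num%:E * \int[mu]_x h x)%E.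
Proof.
move=> mh h0.
rewrite -(ge0_integral_mscale _ measurableT)//.
transitivity (\int[pushforward mu g]_x h x)%E.
 by rewrite ge0_integral_pushforward ?preimage_setT.
by apply: eq_measure_integral => A mA _; exact: fE.
Qed.

End preimage_scaling.

Lemma measurable_translate (c : Rn) : measT (fun x : Rn => x + c).
Proof.
apply: cont_meas_map; apply: (@lip_continuous _ _ _ _ 1) => x y.
by rewrite mul1r opprD addrACA subrr addr0.
Qed.

Lemma measurable_reflect (c : Rn) : measT (fun x : Rn => c - x).
Proof.
apply: cont_meas_map; apply: (@lip_continuous _ _ _ _ 1) => x y.
by rewrite mul1r opprD addrACA subrr add0r opprK addrC distrC.
Qed.

Lemma lebesgue_rV_translate (c : Rn) A : measurable A ->
 mu ((fun x => x + c) @^-1` A) = mu A.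
Proof.
move=> mA; rewrite -[RHS]mul1e.
apply: (measure_preimage_boxes (measurable_translate c) (c := 1%:nng)) => // a b ab.
rewrite mul1e (_ : _ @^-1` _ = box (fun i => a i - c ord0 i) (fun i => b i - c ord0 i)).
 rewrite [LHS]lebesgue_rV_box; last by move=> i; rewrite lerD2r.
 rewrite [RHS]lebesgue_rV_box//; congr EFin; apply: eq_bigr => i _.
 by rewrite opprB addrA subrK.
by apply/seteqP; split => x /= + i => /(_ i); rewrite !mxE lerBlDr lerBrDr.
Qed.

Lemma lebesgue_rV_reflect (c : Rn) A : measurable A ->
 mu ((fun x => c - x) @^-1` A) = mu A.
Proof.
move=> mA; rewrite -[RHS]mul1e.
apply: (measure_preimage_boxes (measurable_reflect c) (c := 1%:nng)) => // a b ab.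
rewrite mul1e (_ : _ @^-1` _ = box (fun i => c ord0 i - b i) (fun i => c ord0 i - a i)).
 rewrite [LHS]lebesgue_rV_box; last by move=> i; rewrite lerD2l lerN2.
 rewrite [RHS]lebesgue_rV_box//; congr EFin; apply: eq_bigr => i _.
 by rewrite opprB addrC addrA subrK.
apply/seteqP; split => x /= + i => /(_ i); rewrite !mxE lerBlDr lerBrDr.
 by move=> /andP[? ?]; rewrite lerBlDr lerBrDr addrC; apply/andP; split => //; rewrite addrC.
by move=> /andP[? ?]; apply/andP; split; lra.
Qed.

Lemma lebesgue_rV_perm (s : {perm 'I_n}) A : measurable A ->
 mu ((fun x => x *m perm_mx s) @^-1` A) = mu A.
Proof.
move=> mA; rewrite -[RHS]mul1e.
have pE (x : Rn) i : (x *m perm_mx s) ord0 (s i) = x ord0 i.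
 rewrite -[x in LHS](mulmx1) -[x *m _ *m _]mulmxA -[RHS](congr1 (fun y : Rn => y ord0 i) (mulmx1 x)) !mxE.
 apply: eq_bigr => j _; rewrite mul1mx !mxE; congr (_ * _%:R).
 by rewrite (inj_eq perm.perm_inj).
apply: (@measure_preimage_boxes _ _ 1%:nng) => // [|a b ab].
 apply: cont_meas_map; exact: mulmxr_continuous.
rewrite mul1e (_ : _ @^-1` _ = box (a \o s) (b \o s)).
 rewrite [LHS]lebesgue_rV_box//= [RHS]lebesgue_rV_box//; congr EFin.
 by rewrite [RHS](reindex_inj (@perm.perm_inj _ s)).
apply/seteqP; split => x /= xab i; first by have := xab (s i); rewrite pE.
by have := xab (perm.perm_inv s i); rewrite /= -pE perm.permKV.
Qed.

End invariances.

Section real_affine.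
Context {R : realType}.
Notation lam := (@lebesgue_measure R).

Lemma measurable_affine (t c : R) :
 measT (fun a : mR R => a * t + c : mR R).
Proof.
apply: (@continuous_measurable_fun _ (fun a : R => a * t + c)) => x.
by apply: cvgD; [apply: cvgM; [exact: cvg_id|exact: cvg_cst]|exact: cvg_cst].
Qed.

Lemma lebesgue_measure_affine (t c : R) (A : set (mR R)) : t != 0 -> measurable A ->
 lam ((fun a : mR R => a * t + c) @^-1` A) = (`|t|^-1%:E * lam A)%E.
Proof.
move=> t0 mA.
pose g : {mfun mR R >-> mR R} := mfun_Sub (mem_set (measurable_affine t c)).
pose c0 : {nonneg R} := NngNum (normr_ge0 t).
pose m0 : {measure set (mR R) -> \bar R} := pushforward lam g.
pose m : {measure set (mR R) -> \bar R} :=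
 mscale c0 (m0 (measurable_affine t c)).
suff -> : lam A = m A.
 by rewrite /m /mscale/= muleA -EFinM mulVf ?normr_eq0// mul1e.
apply: (@lebesgue_measure_unique R m) => // _ [[u v] _ <-] /=.
rewrite /m /mscale /= /m0 /= /pushforward.
have [tp|tn|/eqP] := ltgtP t 0; last by rewrite (negPf t0).
- rewrite (_ : _ @^-1` _ = `[(v - c) / t, (u - c) / t[%classic).
  rewrite !lebesgue_measure_itv/= !lte_fin ltr_ndivrMr// divfK// ltrD2r.
  case: ifPn => _; last by rewrite mule0.
  rewrite ltr0_norm// -!EFinB -EFinM; congr EFin.
  by field.
 apply/seteqP; split => x /=; rewrite !in_itv/= ler_ndivrMr// ltr_ndivlMr//;
  by rewrite lerBrDr ltrBlDr andbC.
- rewrite (_ : _ @^-1` _ = `](u - c) / t, (v - c) / t]%classic).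
  rewrite !lebesgue_measure_itv/= !lte_fin ltr_pdivrMr// divfK// ltrD2r.
  case: ifPn => _; last by rewrite mule0.
  rewrite gtr0_norm// -!EFinB -EFinM; congr EFin.
  by field.
 apply/seteqP; split => x /=; rewrite !in_itv/= ltr_pdivrMr// ler_pdivlMr//;
  by rewrite lerBrDr ltrBlDr.
Qed.

End real_affine.

Section linear_images.
Context {R : realType}.

Lemma measurable_mulmxD n (T : 'M[R]_n) (c : 'rV[R]_n) :
 measT (fun x : 'rV[R]_n => x *m T + c).
Proof.
apply: cont_meas_map.
apply: (@lip_continuous _ _ _ _ (\sum_i \sum_j `|T i j|)) => x y.
by rewrite opprD addrACA subrr addr0 -mulmxBl; exact: norm_mulmx_le.
Qed.

Lemma lebesgue_rVSE n (A : set 'rV[R]_n.+1) :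
 lebesgue_rV R n.+1 A = (\int[lebesgue_measure]_a
  lebesgue_rV R n ((fun x => rV_cons (a, x)) @^-1` A))%E.
Proof.
by apply: eq_integral => a _ /=; congr (lebesgue_rV R n _);
  apply/seteqP; split => x /=; rewrite /xsection/=; [move/set_mem|move=> ?; apply/mem_set].
Qed.

(** The recursive construction slices by the first coordinate. The opposite order of integration
    follows from the uniqueness of the product measure; the two kinds of triangular matrices need
    one order each. *)
Lemma lebesgue_rVSE2 n (A : set 'rV[R]_n.+1) : measurable A ->
 lebesgue_rV R n.+1 A = (\int[lebesgue_rV R n]_x
  lebesgue_measure ((fun a => rV_cons (a, x)) @^-1` A))%E.
Proof.
move=> mA.
have mB : measurable (@rV_cons R n @^-1` A).
 by rewrite -[X in measurable X]setTI; apply: measurable_rV_cons.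
transitivity ((@lebesgue_measure R \x^ lebesgue_rV R n)%E (@rV_cons R n @^-1` A)).
 apply: product_measure_unique => // C D mC mD; exact: product_measure2E.
by apply: eq_integral => a _ /=; congr (lebesgue_measure _);
  apply/seteqP; split => x /=; rewrite /ysection/=; [move/set_mem|move=> ?; apply/mem_set].
Qed.

Lemma measurable_cons_section n (A : set 'rV[R]_n.+1) : measurable A ->
 measT (fun a : mR R =>
  lebesgue_rV R n ((fun x => rV_cons (a, x)) @^-1` A)).
Proof.
move=> mA.
have mB : measurable (@rV_cons R n @^-1` A).
 by rewrite -[X in measurable X]setTI; apply: measurable_rV_cons.
apply: eq_measurable_fun (measurable_fun_xsection (lebesgue_rV R n) mB) => a _ /=.
congr (lebesgue_rV R n _);
  by apply/seteqP; split => x /=; rewrite /xsection/=; [move/set_mem|move=> ?; apply/mem_set].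
Qed.

Lemma measurable_cons_section2 n (A : set 'rV[R]_n.+1) : measurable A ->
 measT (fun x : 'rV[R]_n =>
  @lebesgue_measure R ((fun a => rV_cons (a, x)) @^-1` A)).
Proof.
move=> mA.
have mB : measurable (@rV_cons R n @^-1` A).
 by rewrite -[X in measurable X]setTI; apply: measurable_rV_cons.
apply: eq_measurable_fun (measurable_fun_ysection (@lebesgue_measure R) mB) => a _ /=.
congr (lebesgue_measure _);
  by apply/seteqP; split => x /=; rewrite /ysection/=; [move/set_mem|move=> ?; apply/mem_set].
Qed.

Lemma measurable_cons_preim n (A : set 'rV[R]_n.+1) (a : R) : measurable A ->
 measurable ((fun x => rV_cons (a, x)) @^-1` A).
Proof.
move=> mA; rewrite -[X in measurable X]setTI.
have h : measT (fun x : 'rV[R]_n => rV_cons (a : mR R, x)).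
 by apply: (measurableT_comp (@measurable_rV_cons R n)); exact: measurable_pair1.
exact: h.
Qed.

Lemma measurable_cons_preim2 n (A : set 'rV[R]_n.+1) (x : 'rV[R]_n) : measurable A ->
 measurable ((fun a : mR R => rV_cons (a, x)) @^-1` A).
Proof.
move=> mA; rewrite -[X in measurable X]setTI.
have h : measT (fun a : mR R => rV_cons (a, x)).
 by apply: (measurableT_comp (@measurable_rV_cons R n)); exact: measurable_pair2.
exact: h.
Qed.

Lemma rV_cons_block n (a : R) (x : 'rV[R]_n) (T : 'M[R]_(1 + n)) (c : 'rV[R]_(1 + n)) :
 rV_cons (a, x) *m T + c =
 rV_cons (a * ulsubmx T ord0 ord0 + (x *m dlsubmx T + lsubmx c) ord0 ord0 : mR R,
      a *: ursubmx T + x *m drsubmx T + rsubmx c).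
Proof.
rewrite /rV_cons/= -{1}[T]submxK -{1}[c]hsubmxK (@mul_row_block R 1 1 n 1 n) (@add_row_mx R 1 1 n).
congr row_mx; last by rewrite mul_scalar_mx.
apply/rowP => i; rewrite (ord1 i) mul_scalar_mx !mxE eqxx mulr1n addrA.
by congr (_ * _ + _ + _); rewrite mxE.
Qed.

Let prodV n (T : 'M[R]_n) : 0 <= \prod_i `|T i i|^-1.
Proof. by apply: prodr_ge0 => i _; rewrite invr_ge0. Qed.

Lemma prod_diag_block n (T : 'M[R]_(1 + n)) :
 \prod_i `|T i i|^-1 = `|ulsubmx T ord0 ord0|^-1 * \prod_i `|drsubmx T i i|^-1.
Proof.
rewrite big_split_ord/= big_ord1; congr (_ * _); first by rewrite !mxE.
by apply: eq_bigr => i _; rewrite !mxE.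
Qed.

(** The image of [(a, x)] has first coordinate [a * t + k x] and remaining coordinates [G x]. For
    fixed [x] this is affine in [a], so [a] is integrated first and the induction hypothesis handles
    [G]. *)
Lemma lebesgue_rV_lower n (T : 'M[R]_n) (c : 'rV[R]_n) A :
 (forall i j : 'I_n, (i < j)%N -> T i j = 0) -> (forall i, T i i != 0) ->
 measurable A ->
 lebesgue_rV R n ((fun x => x *m T + c) @^-1` A) =
 ((\prod_i `|T i i|^-1)%:E * lebesgue_rV R n A)%E.
Proof.
elim: n T c A => [|n IHn] T c A lowT T0 mA.
 rewrite big_ord0 mul1e; congr (lebesgue_rV R 0 _); apply/seteqP.
 by split => x /=; rewrite (thinmx0 (x *m T + c)) [x]thinmx0.
pose T' : 'M[R]_(1 + n) := T; pose c' : 'rV[R]_(1 + n) := c.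
pose t := ulsubmx T' ord0 ord0.
have t0 : t != 0 by rewrite /t !mxE; exact: T0.
have ur0 : ursubmx T' = 0.
 by apply/matrixP => i j; rewrite !mxE lowT//= (ord1 i).
pose k (x : 'rV[R]_n) := (x *m dlsubmx T' + lsubmx c') ord0 ord0.
pose G (x : 'rV[R]_n) := x *m drsubmx T' + rsubmx c'.
have eqG a x : rV_cons (a, x) *m T + c = rV_cons (a * t + k x : mR R, G x).
 by rewrite (rV_cons_block a x T' c') ur0 scaler0 add0r.
have mG : measT G by exact: measurable_mulmxD.
have mP : measurable ((fun x => x *m T + c) @^-1` A).
 by rewrite -[X in measurable X]setTI; apply: measurable_mulmxD.
rewrite lebesgue_rVSE2// (@prod_diag_block n T') lebesgue_rVSE2//.
pose h x := @lebesgue_measure R ((fun a => rV_cons (a, x)) @^-1` A).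
have mh : measT h by exact: measurable_cons_section2.
transitivity (\int[lebesgue_rV R n]_x (`|t|^-1%:E * h (G x)))%E.
 apply: eq_integral => x _.
 rewrite -(lebesgue_measure_affine (k x)) //; last exact: measurable_cons_preim2.
 by congr (lebesgue_measure _); apply/seteqP; split => a /=; rewrite eqG.
have mhG : measT (fun x => h (G x)) by exact: (measurableT_comp mh mG).
rewrite ge0_integralZl ?lee_fin ?invr_ge0//.
rewrite EFinM -muleA; congr (_ * _)%E.
pose cc := NngNum (prodV (drsubmx T')).
rewrite (@ge0_integral_preimage _ _ _ mG cc)// => B mB.
apply: IHn => // [i j ij|i]; first by rewrite !mxE lowT.
by rewrite !mxE; exact: T0.
Qed.

(** Mirror image of the lower triangular case: the first coordinate [a * t + k] depends on [a] alone
    and [G a] is a triangular map of [x] for fixed [a], so [x] is integrated first. *)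
Lemma lebesgue_rV_upper n (T : 'M[R]_n) (c : 'rV[R]_n) A :
 (forall i j : 'I_n, (j < i)%N -> T i j = 0) -> (forall i, T i i != 0) ->
 measurable A ->
 lebesgue_rV R n ((fun x => x *m T + c) @^-1` A) =
 ((\prod_i `|T i i|^-1)%:E * lebesgue_rV R n A)%E.
Proof.
elim: n T c A => [|n IHn] T c A lowT T0 mA.
 rewrite big_ord0 mul1e; congr (lebesgue_rV R 0 _); apply/seteqP.
 by split => x /=; rewrite (thinmx0 (x *m T + c)) [x]thinmx0.
pose T' : 'M[R]_(1 + n) := T; pose c' : 'rV[R]_(1 + n) := c.
pose t := ulsubmx T' ord0 ord0.
have t0 : t != 0 by rewrite /t !mxE; exact: T0.
have dl0 : dlsubmx T' = 0.
 by apply/matrixP => i j; rewrite !mxE lowT//= (ord1 j).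
pose k : R := c' ord0 ord0.
pose G (a : R) (x : 'rV[R]_n) := x *m drsubmx T' + (a *: ursubmx T' + rsubmx c').
have eqG a x : rV_cons (a, x) *m T + c = rV_cons (a * t + k : mR R, G a x).
 rewrite (rV_cons_block a x T' c') dl0 mulmx0 add0r.
 congr (rV_cons (_, _)); last by rewrite /G [_ *: _ + _ *m _]addrC addrA.
 congr (_ + _); rewrite /k /c' mxE; congr (c _ _); exact/val_inj.
have mP : measurable ((fun x => x *m T + c) @^-1` A).
 by rewrite -[X in measurable X]setTI; apply: measurable_mulmxD.
rewrite lebesgue_rVSE// (@prod_diag_block n T') lebesgue_rVSE//.
pose h (a : mR R) := lebesgue_rV R n ((fun x => rV_cons (a, x)) @^-1` A).
have mh : measT h by exact: measurable_cons_section.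
pose p := \prod_i `|drsubmx T' i i|^-1.
transitivity (\int[lebesgue_measure]_a (p%:E * h (a * t + k)%R))%E.
 apply: eq_integral => a _.
 rewrite -(IHn (drsubmx T') (a *: ursubmx T' + rsubmx c'))//.
 - by congr (lebesgue_rV R n _); apply/seteqP; split => x /=; rewrite eqG.
 - by move=> i j ij; rewrite !mxE lowT.
 - by move=> i; rewrite !mxE; exact: T0.
 - exact: measurable_cons_preim.
have mhG : measT (fun a : mR R => h (a * t + k)).
 exact: (measurableT_comp mh (measurable_affine t k)).
rewrite ge0_integralZl//; last exact: prodV.
rewrite [(`|_|^-1 * _)%R]mulrC EFinM -muleA; congr (_ * _)%E.
pose g : {mfun mR R >-> mR R} := mfun_Sub (mem_set (measurable_affine t k)).
have t0' : 0 <= `|t|^-1 by rewrite invr_ge0.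
transitivity (\int[mscale (NngNum t0') (@lebesgue_measure R)]_a h a)%E; last first.
 by rewrite (ge0_integral_mscale _ measurableT).
transitivity (\int[pushforward (@lebesgue_measure R) g]_a h a)%E.
 by rewrite ge0_integral_pushforward ?preimage_setT.
by apply: eq_measure_integral => B mB _; exact: lebesgue_measure_affine.
Qed.

(** The LUP decomposition writes [T] as a product of a permutation, a unit lower triangular and an
    upper triangular matrix. Only the last factor scales the measure, and its diagonal product is
    [\det T] up to sign. *)
Lemma lebesgue_rV_linear m (T : 'M[R]_m.+1) A : T \in unitmx -> measurable A ->
 lebesgue_rV R m.+1 ((fun x => x *m T) @^-1` A) =
 (`|\det T|^-1%:E * lebesgue_rV R m.+1 A)%E.
Proof.
move=> uT mA.
have := cormen_lup_correct T; have := cormen_lup_perm T.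
have := @cormen_lup_lower _ _ T; have := @cormen_lup_upper _ _ T.
have := cormen_lup_detL T.
case: (cormen_lup T) => -[P L] U /= dL upU lowL /is_perm_mxP[s Ps] PT.
have lowL' (i j : 'I_m.+1) : (i < j)%N -> L i j = 0.
 by move=> ij; rewrite lowL ?(ltnW ij)//; case: eqP ij => // ->; rewrite ltnn.
have L1 i : L i i = 1 by rewrite lowL// eqxx.
have dU : \det U = \prod_i U i i.
 rewrite -det_tr det_trig; first by apply: eq_bigr => i _; rewrite mxE.
 by apply/is_trig_mxP => i j ij; rewrite mxE upU.
have TE : T = perm_mx s^-1%g *m (L *m U).
 have -> : L *m U = P *m T by exact: esym.
 by rewrite mulmxA Ps -perm_mxM mulVg perm_mx1 mul1mx.
have dT : `|\det T| = `|\det U|.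
 rewrite TE !det_mulmx dL mul1r det_perm normrM normrX normrN1 expr1n mul1r//.
have U0 i : U i i != 0.
 have : \det U != 0 by rewrite -normr_eq0 -dT normr_eq0 -unitfE -unitmxE.
 by rewrite dU => /prodf_neq0; exact.
have -> : (fun x => x *m T) @^-1` A = (fun x => x *m perm_mx s^-1%g) @^-1`
  ((fun x => x *m L + 0) @^-1` ((fun x => x *m U + 0) @^-1` A)).
 by apply/seteqP; split => x /=; rewrite !addr0 TE !mulmxA.
have mU : measurable ((fun x => x *m U + 0) @^-1` A).
 by rewrite -[X in measurable X]setTI; apply: measurable_mulmxD.
rewrite lebesgue_rV_perm; last first.
 by rewrite -[X in measurable X]setTI; apply: measurable_mulmxD.
rewrite lebesgue_rV_lower//; last by move=> i; rewrite L1 oner_neq0.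
rewrite lebesgue_rV_upper// big1 ?mul1e; last by move=> i _; rewrite L1 normr1 invr1.
by rewrite dT dU normr_prod -prodfV.
Qed.

End linear_images.

(** * Regularity of finite Borel measures *)

Section finite_measure_regularity.
Context {R : realType} {n : nat}.
Notation Rn := 'rV[R]_n.
Variable nu : {finite_measure set Rn -> \bar R}.

Lemma finite_measure_empty_lt (F : (set Rn)^nat) (e : R) :
 (forall k, measurable (F k)) -> (forall k, F k.+1 `<=` F k) ->
 \bigcap_k F k = set0 -> 0 < e -> exists k, (nu (F k) < e%:E)%E.
Proof.
move=> mF dF F0 e0.
have ndF : {homo F : n0 m / (n0 <= m)%N >-> (m <= n0)%O}.
 apply: homo_leq => //; first by move=> ? ? ? h1 h2; exact: le_trans h2 h1.
 by move=> k; apply/subsetPset; exact: dF.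
have Foo : (nu (F 0%N) < +oo)%E by rewrite ltey_eq fin_num_measure.
have : (nu \o F) x @[x --> \oo] --> nu (\bigcap_k F k).
 by apply: nonincreasing_cvg_mu => //; rewrite F0.
rewrite F0 measure0 => /fine_cvgP[_ /cvgr0_norm_lt /(_ _ e0)[k _ /(_ k (leqnn _))/=]].
move=> h; exists k; rewrite -(fineK (fin_num_measure nu _ (mF k))) lte_fin.
by rewrite (le_lt_trans (ler_norm _)).
Qed.

Definition regular_set (A : set Rn) := forall e : R, 0 < e ->
 exists K U, [/\ closed K, open U, K `<=` A, A `<=` U & (nu (U `\` K) < e%:E)%E].

(** The open thickenings of a closed set decrease to it; continuity from above, available since [nu]
    is finite, makes the excess small. *)
Lemma closed_thickening_lt (C : set Rn) (e : R) : closed C -> 0 < e ->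
 exists k, (nu (\bigcup_(x in C) ball x (k.+1%:R^-1 : R) `\` C) < e%:E)%E.
Proof.
move=> cC e0.
pose U k := \bigcup_(x in C) (ball x (k.+1%:R^-1 : R) : set Rn).
have oU k : open (U k) by apply: bigcup_open => x _; exact: ball_open.
apply: (@finite_measure_empty_lt (fun k => U k `\` C)) => //.
- by move=> k; apply: measurableD; [exact: open_meas|exact: closed_meas].
- move=> k; apply: setSD => y [x Cx xy]; exists x => //.
 by apply: le_ball xy; rewrite lef_pV2 ?posrE// ler_nat.
- rewrite -subset0 => x Fx; have [_ nCx] := Fx 0%N Logic.I; apply: nCx.
 apply: cC => V /nbhs_ballP[d /= d0 dV].
 pose k := Num.bound d^-1.
 have [[y Cy yx] _] := Fx k Logic.I.
 exists y; split => //; apply: dV; apply: ball_sym; apply: le_ball yx.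
 rewrite -[leRHS]invrK lef_pV2 ?posrE// ?invr_gt0//.
 apply/ltW/(lt_trans (archi_boundP _)); first by rewrite invr_ge0 ltW.
 by rewrite ltr_nat.
Qed.

Lemma closed_regular (C : set Rn) : closed C -> regular_set C.
Proof.
move=> cC e e0; have [k kP] := closed_thickening_lt cC e0.
exists C, (\bigcup_(x in C) ball x (k.+1%:R^-1 : R)); split => //.
 by apply: bigcup_open => x _; exact: ball_open.
by move=> x Cx; exists x => //; apply: ballxx; rewrite invr_gt0.
Qed.

(** Regular sets form a sigma-algebra that contains the boxes. In a countable union the closed inner
    sets have a union [K'] that need not be closed; stopping at a finite stage [K N] repairs this at
    a cost below [e / 2], and the other [e / 2] is shared among the single gaps. *)
Lemma borel_regular (A : set Rn) : measurable A -> regular_set A.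
Proof.
rewrite measurable_boxesE; suff : <<s boxes >> `<=` regular_set by exact.
apply: smallest_sub; last first.
 move=> _ [a [b ->]]; apply: closed_regular.
 rewrite (_ : box a b = \bigcap_(i in [set: 'I_n])
   ((fun x : Rn => x ord0 i) @^-1` [set y | a i <= y <= b i])).
  apply: closed_bigI => i _; apply: closed_comp => [x _|]; first exact: coord_continuous.
  rewrite (_ : [set y | _] = [set y | a i <= y] `&` [set y | y <= b i]).
   by apply: closedI; [exact: closed_ge|exact: closed_le].
  by apply/seteqP; split => y /=; [move=> /andP[]|move=> [-> ->]].
 by apply/seteqP; split => [x Bx i _|x Bx i]; [exact: Bx|exact: (Bx i Logic.I)].
split.
- by apply: closed_regular; exact: closed0.
- move=> B rB e e0; have [K [U [cK oU KB BU UK]]] := rB e e0.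
 exists (~` U), (~` K); split; [exact: open_closedC|exact: closed_openC|..].
 + by move=> x Ux; split => // /BU.
 + by move=> x [_ Bx] /KB.
 + by rewrite (_ : ~` K `\` ~` U = U `\` K)// setDE setCK setIC -setDE.
- move=> B rB e e0.
 have d0 k : 0 < e / 2 / 2 ^+ k.+1 by rewrite !divr_gt0// exprn_gt0.
 have /choice[KU hKU] : forall k, exists KU : set Rn * set Rn,
   [/\ closed KU.1, open KU.2, KU.1 `<=` B k, B k `<=` KU.2 &
    (nu (KU.2 `\` KU.1) < (e / 2 / 2 ^+ k.+1)%:E)%E].
  by move=> k; have [K [U h]] := rB k _ (d0 k); exists (K, U).
 pose K N := \bigcup_(k in `I_N) (KU k).1.
 pose U := \bigcup_k (KU k).2.
 have mK1 k : measurable (KU k).1 by have [? _ _ _ _] := hKU k; exact: closed_meas.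
 have mK2 k : measurable (KU k).2 by have [_ ? _ _ _] := hKU k; exact: open_meas.
 have oU : open U by apply: bigcup_open => k _; have [] := hKU k.
 have cK N : closed (K N).
  by apply: closed_bigcup; [exact: finite_II|move=> k _; have [] := hKU k].
 have mK N : measurable (K N) by exact: closed_meas.
 have mU : measurable U by exact: open_meas.
 pose K' := \bigcup_k (KU k).1.
 have mK' : measurable K' by exact: bigcupT_measurable.
 have [||||N FN] := @finite_measure_empty_lt (fun N => K' `\` K N) (e / 2).
 + by move=> N; exact: measurableD.
 + move=> N; apply: setDS => x [k /= kN xk]; exists k => //=; exact: ltnW.
 + rewrite -subset0 => x Fx; have [[k _ xk] _] := Fx 0%N Logic.I.
  by have [_] := Fx k.+1 Logic.I; apply; exists k => /=.
 + by rewrite divr_gt0.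
 exists (K N), U; split => //.
 + by move=> x [k _ xk]; exists k => //; have [_ _ h _ _] := hKU k; exact: h.
 + by move=> x [k _ xk]; exists k => //; have [_ _ _ h _] := hKU k; exact: h.
 + have sub : U `\` K N `<=` (\bigcup_k ((KU k).2 `\` (KU k).1)) `|` (K' `\` K N).
   move=> x [[k _ xk] nK]; have [K'x|nK'x] := pselect (K' x); first by right.
   by left; exists k => //; split => // ?; apply: nK'x; exists k.
  have mb : measurable (\bigcup_k ((KU k).2 `\` (KU k).1)).
   by apply: bigcupT_measurable => k; exact: measurableD.
  apply: (@le_lt_trans _ _ (nu ((\bigcup_k ((KU k).2 `\` (KU k).1)) `|` (K' `\` K N)))).
   apply: le_mu_sub => //; first exact: measurableD.
   by apply: measurableU => //; exact: measurableD.
  apply: (@le_lt_trans _ _ (nu (\bigcup_k ((KU k).2 `\` (KU k).1)) + nu (K' `\` K N))%E).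
   by apply: measureU2 => //; exact: measurableD.
  rewrite [in ltRHS](splitr e) EFinD; apply: lee_ltD => //.
   by rewrite fin_num_measure.
  apply: le_trans.
   apply: (@measure_sigma_subadditive _ _ _ nu _ (fun k => (KU k).2 `\` (KU k).1)) => //.
   by move=> k; exact: measurableD.
  apply: (@le_trans _ _ (\sum_(0 <= k <oo) (e / 2 / (2 ^ k.+1)%:R)%:E)%E).
   apply: lee_nneseries => [k _ _|k _]; first exact: measure_ge0.
   by have [_ _ _ _ /ltW] := hKU k; rewrite natrX.
  by have := @epsilon_trick0 R (e / 2) xpredT; apply; rewrite divr_ge0// ltW.
Qed.

End finite_measure_regularity.

(** * Null sets by slices, and almost everywhere statements *)

Section slices.
Context {R : realType} {n : nat}.
Notation Rn := 'rV[R]_n.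
Notation mu := (lebesgue_rV R n).
Notation lam := (@lebesgue_measure R).

Lemma measurable_line (v : Rn) :
 measT (fun z : mR R * Rn => z.2 + (z.1 : R) *: v).
Proof.
apply: measurable_fun_rV => i.
rewrite (_ : (fun _ => _) = (fun z : mR R * Rn =>
  z.2 ord0 i + (z.1 : R) * v ord0 i)); last by apply/funext => z; rewrite !mxE.
apply: measurable_funD.
 by apply: (measurableT_comp (measurable_coord i)); exact: measurable_snd.
by apply: measurable_funM => //; exact: measurable_fst.
Qed.

(* The measure of [N] equals the average over [t] in [0, 1] of the measures of
  [N - t v], which by Tonelli is an integral of measures of slices. *)
Lemma measure0_slices (v : Rn) (N : set Rn) : measurable N ->
 (forall x, lam [set t : mR R | N (x + (t : R) *: v)] = 0%E) ->
 mu N = 0%E.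
Proof.
move=> mN N0.
pose S := [set z : mR R * Rn | `[0, 1]%classic z.1] `&`
 ((fun z : mR R * Rn => z.2 + (z.1 : R) *: v) @^-1` N).
have mS : measurable S.
 apply: measurableI.
  rewrite (_ : [set _ | _] = `[0, 1]%classic `*` setT); last first.
   by apply/seteqP; split => [z zz|z []].
  by apply: measurableX => //; exact: measurable_itv.
 by rewrite -[X in measurable X]setTI; apply: measurable_line.
have e12 : (lam \x mu)%E S = (lam \x^ mu)%E S.
 by apply: product_measure_unique => // C D mC mD; exact: product_measure2E.
have e2 : (lam \x^ mu)%E S = 0%E.
 apply: integral0_eq => x _ /=.
 apply: (@subset_measure0 _ _ _ lam _ [set t : mR R | N (x + (t : R) *: v)]) => //.
 - exact: measurable_ysection.
 - have h : measT (fun t : mR R => x + (t : R) *: v).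
   have := measurableT_comp (measurable_line v) (@measurable_pair2 _ _ _ _ x); exact.
  by rewrite -[X in measurable X]setTI; apply: h.
 - by move=> t; rewrite /ysection/= => /set_mem[].
 - exact: N0.
move: e12; rewrite e2 => <-.
transitivity (\int[lam]_t ((\1_(`[0, 1]%classic : set (mR R)) t)%:E * mu N))%E.
 have mi : measT (EFin \o (\1_(`[0, 1]%classic) : mR R -> R)).
  by apply/measurable_EFinP; apply: measurable_indic; exact: measurable_itv.
 rewrite ge0_integralZr//.
 have m01 : measurable (`[0, 1]%classic : set (mR R)) by exact: measurable_itv.
 rewrite [X in (_ = X * _)%E](integral_indic lam measurableT m01) setIT.
 by rewrite [X in (_ = X * _)%E]lebesgue_measure_itv/= lte_fin ltr01 oppr0 adde0 mul1e.
apply: eq_integral => t _; rewrite indicE.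
have [t01|t01] := boolP (t \in _).
 rewrite mul1e -(lebesgue_rV_translate ((t : R) *: v) mN) /=; congr (mu _).
 apply/seteqP; split => x; rewrite /xsection /=.
  by move=> Nx; apply/mem_set; split => //; exact: set_mem t01.
 by move/set_mem => [].
rewrite mul0e /= (_ : xsection S t = set0) ?measure0//.
rewrite -subset0 => x; rewrite /xsection /= => /set_mem[/= t01' _].
by move/negP: t01; apply; apply/mem_set.
Qed.

End slices.

Section almost_everywhere.
Context d (T : measurableType d) (R : realType) (mu : {measure set T -> \bar R}).
Implicit Types P Q : T -> Prop.

Lemma aeS P Q : (forall x, P x -> Q x) ->
 {ae mu, forall x, P x} -> {ae mu, forall x, Q x}.
Proof.
move=> PQ [N [mN N0 sub]]; exists N; split => // x nQ; apply: sub => Px; exact/nQ/PQ.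
Qed.

Lemma aeI P Q : {ae mu, forall x, P x} -> {ae mu, forall x, Q x} ->
 {ae mu, forall x, P x /\ Q x}.
Proof.
move=> [N [mN N0 sN]] [M [mM M0 sM]]; exists (N `|` M); split.
- exact: measurableU.
- by rewrite null_set_setU.
- by move=> x /not_andP[nP|nQ]; [left; exact: sN|right; exact: sM].
Qed.

Lemma aeS2 P Q S : (forall x, P x -> Q x -> S x) ->
 {ae mu, forall x, P x} -> {ae mu, forall x, Q x} -> {ae mu, forall x, S x}.
Proof. by move=> PQS aP aQ; apply: aeS (aeI aP aQ) => x []; exact: PQS. Qed.

Lemma ae_forall_nat (P : nat -> T -> Prop) :
 (forall k, {ae mu, forall x, P k x}) -> {ae mu, forall x, forall k, P k x}.
Proof.
move=> /choice[N hN]; exists (\bigcup_k N k); split.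
- by apply: bigcupT_measurable => k; have [] := hN k.
- apply/eqP; rewrite eq_le measure_ge0 andbT.
 apply: (le_trans (measure_sigma_subadditive mu (F := N) _ _ _)) => //.
 + by move=> k; have [] := hN k.
 + by apply: bigcupT_measurable => k; have [] := hN k.
 + by rewrite eseries0// => k _ _; have [] := hN k.
- by move=> x /= /existsNP[k nP]; exists k => //; have [_ _] := hN k; apply.
Qed.

Lemma ae_forall_countable (I : countType) (P : I -> T -> Prop) :
 (forall k, {ae mu, forall x, P k x}) -> {ae mu, forall x, forall k, P k x}.
Proof.
move=> aeP.
have : {ae mu, forall x, forall k : nat, if unpickle k is Some i then P i x else True}.
 apply: ae_forall_nat => k; case: (unpickle k) => [i|]; first exact: aeP.
 by exists set0; split => // x; apply.
by apply: aeS => x Px i; have := Px (pickle i); rewrite pickleK.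
Qed.

End almost_everywhere.

(** * Lipschitz functions and density points on the line *)

Section real_line.
Context {R : realType}.
Notation lam := (@lebesgue_measure R).
Implicit Types (f : R -> R) (L : R).

Lemma lebesgue_stieltjes_ocitv (f : cumulative R R) (a b : R) : a <= b ->
 lebesgue_stieltjes_measure f `]a, b]%classic = (f b - f a)%:E.
Proof.
by move=> ab; rewrite /lebesgue_stieltjes_measure /measure_extension/= measurable_mu_extE/= ?wlength_itv_bnd//; exact: is_ocitv.
Qed.

Section lipschitz_line.
Variables (f : R -> R) (L : R).
Hypothesis fL : nlip L f.

Let L0 : 0 <= L.
Proof. by have := fL 1 0; rewrite subr0 normr1 mulr1; exact: le_trans. Qed.

Let fcont : continuous f.
Proof. by apply: (@lip_continuous _ R^o R^o _ L). Qed.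

Let cont_lin : continuous (fun x : R => L * x).
Proof. by move=> x; apply: cvgM => //; exact: cvg_cst. Qed.

Let up x := L * x + f x.
Let dn x := L * x - f x.

Let ndup : {homo up : x y / x <= y}.
Proof.
move=> x y xy; have := fL y x; rewrite [`|y - x|]ger0_norm ?subr_ge0// ler_norml => /andP[+ _].
by rewrite /up -subr_ge0; lra.
Qed.

Let nddn : {homo dn : x y / x <= y}.
Proof.
move=> x y xy; have := fL y x; rewrite [`|y - x|]ger0_norm ?subr_ge0// ler_norml => /andP[_].
by rewrite /dn -subr_ge0; lra.
Qed.

Let rcup : right_continuous up.
Proof.
by apply: right_continuousW => x; apply: cvgD; [exact: cont_lin|exact: fcont].
Qed.

Let rcdn : right_continuous dn.
Proof.
by apply: right_continuousW => x; apply: cvgB; [exact: cont_lin|exact: fcont].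
Qed.

Let nd2 : {homo (fun x : R => 2 * L * x) : x y / x <= y}.
Proof. by move=> x y xy; rewrite ler_wpM2l// mulr_ge0. Qed.

Let rc2 : right_continuous (fun x : R => 2 * L * x).
Proof.
by apply: right_continuousW => x; apply: cvgM => //; exact: cvg_cst.
Qed.

HB.instance Definition _ := isCumulative.Build R _ R up ndup rcup.
HB.instance Definition _ := isCumulative.Build R _ R dn nddn rcdn.

Let nu := lebesgue_stieltjes_measure up.

(* The Stieltjes measures of [L x + f x] and [L x - f x] add up to [2 L] times
  Lebesgue measure. *)
Let nu_dominated (A : set (mR R)) : measurable A -> lam A = 0%E -> nu A = 0%E.
Proof.
move=> mA lA.
pose H : cumulative R R := HB.pack (fun x : R => 2 * L * x)
 (isCumulative.Build R _ R (fun x : R => 2 * L * x) nd2 rc2).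
pose c0 : {nonneg R} := NngNum (mulr_ge0 (ler0n R 2) L0).
have e1 : lebesgue_stieltjes_measure H A = (mscale c0 lam) A.
 apply: (@lebesgue_stieltjes_measure_unique R H (mscale c0 lam)) => // _ [[a b] _ <-].
 have [ab|ba] := leP a b.
  rewrite /= lebesgue_stieltjes_ocitv// -[RHS]/((2 * L)%:E * lam `]a, b]%classic)%E lebesgue_measure_itv/= lte_fin.
  move: ab; rewrite le_eqVlt => /orP[/eqP ->|ab]; first by rewrite ltxx mule0 subrr.
  by rewrite ab -EFinB -EFinM mulrBr.
 by rewrite set_itv_ge ?bnd_simp -?leNgt ?(ltW ba)// !measure0.
have e2 : lebesgue_stieltjes_measure H A =
  measure_add (lebesgue_stieltjes_measure up) (lebesgue_stieltjes_measure dn) A.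
 apply: (@lebesgue_stieltjes_measure_unique R H (measure_add
  (lebesgue_stieltjes_measure up) (lebesgue_stieltjes_measure dn))) => // _ [[a b] _ <-].
 rewrite [RHS](measure_addE (lebesgue_stieltjes_measure up) (lebesgue_stieltjes_measure dn)) /=; have [ab|ba] := leP a b.
  rewrite !lebesgue_stieltjes_ocitv//= -EFinD /up /dn; congr EFin; ring.
 by rewrite /= set_itv_ge ?bnd_simp -?leNgt ?(ltW ba)// !measure0 adde0.
apply/eqP; rewrite eq_le measure_ge0 andbT.
have : (nu A <= measure_add (lebesgue_stieltjes_measure up) (lebesgue_stieltjes_measure dn) A)%E.
 by rewrite measure_addE leeDl.
by rewrite -e2 e1 /mscale/= lA mule0.
Qed.

(** The monotone function [up] has an absolutely continuous Stieltjes measure, so on []-N, N]] it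
    is, up to a constant, the primitive of its Radon-Nikodym density and has a derivative almost
    everywhere; [f] differs from it by a linear function. Restriction to []-N, N]] makes the measure
    finite. *)
Lemma lipschitz_ae_derivable : {ae lam, forall x, derivable f x 1}.
Proof.
suff h (N : nat) : {ae lam, forall x, - N%:R < x < N%:R -> derivable f x 1}.
 apply: aeS (ae_forall_nat h) => x /(_ (Num.bound `|x|)); apply.
 by rewrite -ltr_norml; exact: archi_boundP.
pose D : set (mR R) := `](- N%:R), N%:R]%classic.
have mD : measurable D by exact: measurable_itv.
have N0 : - N%:R <= N%:R :> R by rewrite -subr_ge0 opprK addr_ge0.
have Doo : (nu D < +oo)%E by rewrite /nu lebesgue_stieltjes_ocitv// ltry.
pose nuN := charge_of_finite_measure (mfrestr mD Doo).
have dom : nuN `<< lam.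
 apply/null_content_dominatesP => A mA lA; rewrite /nuN /= /charge_of_finite_measure/= /mfrestr /mrestr.
 apply/eqP; rewrite eq_le measure_ge0 andbT -(nu_dominated mA lA).
 have mAD : measurable (A `&` D) := measurableI _ _ mA mD.
 by apply: le_mu_sub => //; exact: subIsetl.
pose rho := Radon_Nikodym nuN lam.
have rfin x : rho x \is a fin_num by exact: Radon_Nikodym_fin_num.
pose r (x : R) := fine (rho x).
have rE : EFin \o r = rho by apply/funext => x /=; rewrite fineK.
have ir : lam.-integrable setT (EFin \o r) by rewrite rE; exact: Radon_Nikodym_integrable.
have locr : locally_integrable setT r by apply: open_integrable_locally => //; exact: openT.
have := @FTC1 R r (BRight (- N%:R)) _ locr; case.
 by move=> y; apply: integrableS ir => //; exact: measurable_itv.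
move=> E0 [mE E00 subE].
exists E0; split => // x /= nd; apply: subE => /= h; apply: nd => /andP[Nx xN].
have [] := h _; first by rewrite lte_fin.
set F := (fun y => _) => dF _.
have upE y : - N%:R < y < N%:R -> up y = F y + up (- N%:R).
 move=> /andP[Ny yN]; rewrite /F /Rintegral.
 have -> : (\int[lam]_(t in [set` Interval (BRight (- N%:R)%R) (BRight y)]) (r t)%:E)%E
   = nuN `](- N%:R), y]%classic.
  transitivity (\int[lam]_(t in `](- N%:R)%R, y]%classic) rho t)%E.
   by apply: eq_integral => t _; rewrite -[LHS]/((EFin \o r) t) rE.
  by apply/esym/(Radon_Nikodym_integral dom); exact: measurable_itv.
 rewrite /nuN /= /charge_of_finite_measure/= /mfrestr /mrestr setIidl; last first.
  by move=> t; rewrite /D/= !in_itv/= => /andP[-> /le_trans]; apply; exact: ltW.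
 by rewrite [X in fine X]lebesgue_stieltjes_ocitv ?(ltW Ny)//= subrK.
have dup : derivable up x 1.
 apply: (@near_eq_derivable _ _ _ (fun y => F y + up (- N%:R))).
 - have : x \in `](- N%:R), N%:R[ by rewrite in_itv/= Nx.
  move/near_in_itvoo; apply: filterS => y; rewrite in_itv/= => yN.
  by apply/esym/upE.
 - by apply: derivableD => //; exact: derivable_cst.
have -> : f = up - (fun y => L * y) by apply/funext => y; rewrite /up/= fctE addrC addKr.
apply: derivableB => //; apply: derivableM => //; exact: derivable_cst.
Qed.

End lipschitz_line.

(** If [B] had no point within [e |s|] of [t + s], it would miss a fixed proportion of the ball of
    radius [(1 + e) |s|] about [t], which contains that gap. At a density point [t] this is
    impossible for small [s]. *)
Lemma ae_dense_points (B : set R) : measurable B ->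
 {ae lam, forall t, B t -> forall e, 0 < e -> exists2 d, 0 < d &
  forall s, `|s| <= d -> exists2 z, B z & `|z - (t + s)| <= e * `|s|}.
Proof.
move=> mB; apply: aeS (lebesgue_density mB) => t + Bt e e0.
rewrite indicE mem_set//= => /fine_cvgP[fin].
(* The gap occupies the fraction [e / (1 + e)] of the larger ball. *)
move=> /cvgrPdist_lt /(_ (e / (1 + e))) => /(_ _)[|d /= d0 dP].
 by rewrite divr_gt0// addr_gt0.
move: fin => [d' /= d'0 finP].
pose m := Num.min d d'.
have m0 : 0 < m by rewrite lt_min d0.
exists (m / 2 / (1 + e)); first by rewrite !divr_gt0// addr_gt0.
move=> s sm; apply: contrapT => /forall2NP nz.
have [s0|s0] := eqVneq s 0.
 by case: (nz t); apply; rewrite // s0 addr0 subrr normr0 mulr0.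
pose r := (1 + e) * `|s|.
have e1 : 0 < 1 + e by rewrite addr_gt0.
have sp : 0 < `|s| by rewrite normr_gt0.
have r0 : 0 < r by rewrite mulr_gt0.
have rm : r < m.
 rewrite /r mulrC -ltr_pdivlMr// (le_lt_trans sm)//.
 by rewrite ltr_pM2r ?invr_gt0// gtr_pMr// invf_lt1// ltr1n.
have rd : ball_ Num.Def.normr (0 : R) d r.
 by rewrite /ball_/= sub0r normrN gtr0_norm// (lt_le_trans rm)// ge_min lexx.
have := dP r rd r0.
apply/negP; rewrite -leNgt.
have mball : measurable (ball t r : set (mR R)) by exact: measurable_ball.
have mball2 : measurable (ball (t + s) (e * `|s|) : set (mR R)) by exact: measurable_ball.
have es0 : 0 <= e * `|s| by rewrite mulr_ge0// ltW.
have lr : lam (ball t r) = (r *+ 2)%:E by rewrite lebesgue_measure_ball// ltW.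
have le1 : (lam (B `&` ball t r) <= (r *+ 2 - (e * `|s|) *+ 2)%:E)%E.
 have sub : ball (t + s) (e * `|s|) `<=` ball t r.
  move=> z; rewrite /ball/= => zz.
  have := ler_normB (t + s - z) s; rewrite (_ : t + s - z - s = t - z); last by ring.
  by rewrite /r mulrDl mul1r => h; rewrite (le_lt_trans h)// addrC ltrD2l.
 have -> : (r *+ 2 - e * `|s| *+ 2)%:E = lam (ball t r `\` ball (t + s) (e * `|s|)).
  rewrite measureD//; last by rewrite [X in (X < _)%E]lr ltry.
  rewrite setIidr// [X in (X - _)%E]lr [X in (_ - X)%E]lebesgue_measure_ball//.
 apply: le_mu_sub; [exact: measurableI|exact: measurableD|].
 move=> z [Bz tz]; split => // zz; case: (nz z) => // -[].
 by rewrite distrC ltW.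
have fB : lam (B `&` ball t r) \is a fin_num.
 by rewrite ge0_fin_numE// (le_lt_trans le1)// ltry.
rewrite [X in (X / _)%E](_ : _ = (fine (lam (B `&` ball t r)))%:E); last by rewrite fineK.
rewrite lr inver mulrn_eq0/= gt_eqF//=.
set b := fine _.
have lb : b <= r *+ 2 - e * `|s| *+ 2 by rewrite -lee_fin /b fineK.
apply: le_trans (ler_norm _); rewrite lerBrDl.
rewrite -lerBrDr.
rewrite ler_pdivrMr ?mulrn_wgt0//.
apply: (le_trans lb).
rewrite /r; apply: eq_ler; field.
by rewrite gt_eqF.
Qed.

End real_line.

(** * Rademacher's theorem *)

Section differentials.
Context {R : realType}.

(** Differentiability with explicit bounds, for matrices acting on the right. Since ['J g x] also
    has a value where [g] is not differentiable, the usable hypothesis at a point is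
    [isdiff g x ('J g x)]. *)
Definition isdiff n m (g : 'rV[R]_n -> 'rV[R]_m) x (M : 'M[R]_(n, m)) :=
 forall e, 0 < e -> exists2 d, 0 < d &
  forall h, `|h| <= d -> `|g (x + h) - g x - h *m M| <= e * `|h|.

Lemma isdiff_jacobian n m (g : 'rV[R]_n -> 'rV[R]_m) x M :
 isdiff g x M -> 'J g x = M.
Proof.
move=> gM; have dE : 'd g x = mulmxr M :> ('rV_n -> 'rV_m).
 apply: diff_unique; first exact: mulmxr_continuous.
 apply/eqaddoP => _/posnumP[e]; have [d d0 dP] := gM _ (gt0 e).
 apply/nbhs_ballP; exists d => //= h; rewrite mx_norm_ball /ball_/= sub0r normrN => hd.
 change (`|g (h + x) - (g x + h *m M)| <= e%:num * `|h|).
 by rewrite [h + x]addrC opprD addrA; apply: dP; exact: ltW.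
apply/row_matrixP => i; rewrite !rowE /jacobian mul_rV_lin1 dE.
by rewrite /mulmxr/= -rowE.
Qed.

Definition sdiff n (f : 'rV[R]_n -> R) x (a : 'rV[R]_n) :=
 forall e, 0 < e -> exists2 d, 0 < d &
  forall h, `|h| <= d ->
   `|f (x + h) - f x - \sum_i a ord0 i * h ord0 i| <= e * `|h|.

End differentials.

Section rademacher.
Context {R : realType} {n : nat}.
Notation Rn := 'rV[R]_n.
Notation mu := (lebesgue_rV R n).
Notation lam := (@lebesgue_measure R).
Variables (f : Rn -> R) (L : R).
Hypothesis fL : nlip L f.
Hypothesis L0 : 0 <= L.

Definition lower_supp (j : nat) (h : Rn) := forall i : 'I_n, (j <= i)%N -> h ord0 i = 0.

Definition lin_approx j (a : Rn) (e d : R) : set Rn :=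
 [set x | forall h, lower_supp j h -> `|h| <= d ->
  `|f (x + h) - f x - \sum_i a ord0 i * h ord0 i| <= e * `|h|].

Lemma closed_lin_approx j a e d : closed (lin_approx j a e d).
Proof.
rewrite (_ : lin_approx j a e d =
 \bigcap_(h in [set h | lower_supp j h /\ `|h| <= d])
  ((fun x => `|f (x + h) - f x - \sum_i a ord0 i * h ord0 i|) @^-1`
    [set y | y <= e * `|h|])).
 apply: closed_bigI => h _; apply: closed_comp; last exact: closed_le.
 move=> x _; apply: (@lip_continuous _ _ R^o _ (2 * L)) => {}x y.
 rewrite (le_trans (ler_dist_dist _ _))//.
 rewrite (_ : _ - _ = (f (x + h) - f (y + h)) - (f x - f y)); last by ring.
 rewrite (le_trans (ler_normB _ _))// mulrDl mul1r mulrDl lerD//.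
 by rewrite (le_trans (fL _ _))// opprD addrACA subrr addr0.
apply/seteqP; split => x xA h; first by case; exact: xA.
by move=> h1 h2; exact: xA.
Qed.

(** Differentiability at [x] along the span of the first [j] basis vectors. Rational slopes that may
    change with the tolerance describe it by countably many closed sets, which makes it measurable
    before any gradient is chosen. *)
Definition good j (x : Rn) := forall m : nat, exists (a : 'rV[rat]_n) (k : nat),
 lin_approx j (map_mx ratr a) m.+1%:R^-1 k.+1%:R^-1 x.

Lemma measurable_good j : measurable [set x | good j x].
Proof.
rewrite (_ : [set x | _] = \bigcap_m \bigcup_(ak : 'rV[rat]_n * nat)
  lin_approx j (map_mx ratr ak.1) m.+1%:R^-1 ak.2.+1%:R^-1).
 apply: bigcapT_measurable => m; apply: countable_bigcupT_measurable.
  exact: countableP.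
 by move=> ak; apply: closed_meas; exact: closed_lin_approx.
apply/seteqP; split => [x gx m _|x gx m].
 by have [a [k ak]] := gx m; exists (a, k).
by have [[a k] _ ak] := gx m Logic.I; exists a, k.
Qed.

Lemma norm_scale_delta (i : 'I_n) (s : R) : `|s *: (delta_mx ord0 i : Rn)| <= `|s|.
Proof.
apply: norm_row_le => // l; rewrite !mxE /=.
by case: (l == i); rewrite ?mulr1 ?mulr0 ?normr0.
Qed.

Lemma exists_inv_nat (e : R) : 0 < e -> exists k : nat, k.+1%:R^-1 <= e.
Proof.
move=> e0; exists (Num.bound e^-1); rewrite -[leRHS]invrK lef_pV2 ?posrE ?invr_gt0//.
apply/ltW/(lt_trans (archi_boundP _)); first by rewrite invr_ge0 ltW.
by rewrite ltr_nat.
Qed.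

(* Any point [y + h] with [h] in the span of the first [i + 1] basis vectors is
  reached by moving first in direction [i] to a nearby point of the set
  [lin_approx i a e d], of which [y] is a density point in that direction. *)
Lemma good_step (i : 'I_n) (y : Rn) (b : R) : good i y ->
 (forall e, 0 < e -> exists2 d, 0 < d & forall s, `|s| <= d ->
  `|f (y + s *: delta_mx ord0 i) - f y - b * s| <= e * `|s|) ->
 (forall (a : 'rV[rat]_n) (m k : nat),
  lin_approx i (map_mx ratr a) m.+1%:R^-1 k.+1%:R^-1 y ->
  forall e, 0 < e -> exists2 d, 0 < d & forall s, `|s| <= d -> exists2 z,
   lin_approx i (map_mx ratr a) m.+1%:R^-1 k.+1%:R^-1 (y + z *: delta_mx ord0 i)
   & `|z - s| <= e * `|s|) ->
 good i.+1 y.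
Proof.
move=> gy dy dens m; set E := delta_mx ord0 i in dy dens *.
(* The errors [T1], [T2], [T3] and [T4] below add up to [(2 * L + 5) * e * |h|]. *)
have L5 : 0 < 2 * L + 5 by rewrite ltr_wpDl// mulr_ge0.
have [m0 m0P] : exists k : nat, k.+1%:R^-1 <= m.+1%:R^-1 / (2 * L + 5).
 by apply: exists_inv_nat; rewrite divr_gt0// invr_gt0.
set e := m0.+1%:R^-1 : R in m0P.
have e0 : 0 < e by rewrite invr_gt0.
have e1 : e <= 1 by rewrite invf_le1// ler1n.
have [a [k ak]] := gy m0; rewrite -/e in ak.
have [d1 d10 d1P] := dy e e0.
have [d2 d20 d2P] := dens a m0 k ak e e0.
have bL : `|b| <= L + 1.
 have := d1P d1; rewrite gtr0_norm// lexx => /(_ isT) h1.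
 rewrite -(ler_pM2r d10) -[X in _ * X <= _](gtr0_norm d10) -normrM.
 have := le_trans (fL (y + d1 *: E) y) (_ : _ <= L * d1).
 rewrite addrAC subrr add0r => h2.
 have {}h2 : `|f (y + d1 *: E) - f y| <= L * d1.
  by apply: h2; rewrite ler_wpM2l// -[leRHS](gtr0_norm d10); exact: norm_scale_delta.
 rewrite (_ : b * d1 = (f (y + d1 *: E) - f y) - (f (y + d1 *: E) - f y - b * d1)); last by ring.
 rewrite (le_trans (ler_normB _ _))// mulrDl lerD// mul1r (le_trans h1)//.
 by rewrite -[leRHS]mul1r ler_wpM2r// ltW.
have [b' bb'] : exists b' : rat, `|b - ratr b'| <= e.
 have [|q] := @rat_in_itvoo R (b - e) (b + e); first by rewrite ltrD2l gtrN.
 by rewrite in_itv/= => /andP[? ?]; exists q; rewrite ltW// distrC ltr_distl; apply/andP.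
have [k' k'P] : exists k' : nat, k'.+1%:R^-1 <= Num.min (d1 / 2) (Num.min d2 k.+1%:R^-1).
 by apply: exists_inv_nat; rewrite !lt_min d20 divr_gt0//= invr_gt0.
move: k'P; rewrite !le_min => /and3P[k'1 k'2 k'3].
exists (\row_l if l == i then b' else a ord0 l), k' => h hs hk.
pose s := h ord0 i; pose h' := h - s *: E.
have h'i : h' ord0 i = 0 by rewrite !mxE !eqxx /= mulr1 subrr.
have h'l l : l != i -> h' ord0 l = h ord0 l.
 by move=> li; rewrite !mxE (negPf li) /= mulr0 subr0.
have hs' : lower_supp i h'.
 move=> l il; have [->//|li] := eqVneq l i; rewrite h'l// hs//.
 by rewrite ltn_neqAle il andbT eq_sym.
have hh' : `|h'| <= `|h|.
 apply: norm_row_le => // l; have [->|li] := eqVneq l i; first by rewrite h'i normr0.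
 by rewrite h'l// coord_le.
have sh : `|s| <= `|h| by exact: coord_le.
have [z zA zs] := d2P s (le_trans sh (le_trans hk k'2)).
have zs1 : `|z - s| <= e * `|h| by rewrite (le_trans zs)// ler_wpM2l// ltW.
have z2 : `|z| <= 2 * `|h|.
 rewrite -(subrK s z) (le_trans (ler_normD _ _))// mulrDl mul1r lerD//.
 by rewrite (le_trans zs1)// -[leRHS]mul1r ler_wpM2r.
have T1 : `|f (y + h) - f (y + z *: E + h')| <= L * (e * `|h|).
 rewrite (le_trans (fL _ _))// ler_wpM2l//.
 rewrite (_ : _ - _ = (s - z) *: E).
  by rewrite (le_trans (norm_scale_delta _ _))// distrC.
 by rewrite /h' scalerBl; apply/rowP => l; rewrite !mxE; ring.
have T2 := zA h' hs' (le_trans hh' (le_trans hk k'3)); rewrite -/e in T2.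
have T3 : `|f (y + z *: E) - f y - b * z| <= e * (2 * `|h|).
 apply: (le_trans (d1P _ _)); last by rewrite ler_wpM2l// ltW.
 rewrite (le_trans z2)// -ler_pdivlMl// mulrC (le_trans hk)//.
have T4 : `|b * z - ratr b' * s| <= (L + 1) * (e * `|h|) + e * `|h|.
 rewrite (_ : _ - _ = b * (z - s) + (b - ratr b') * s); last by ring.
 rewrite (le_trans (ler_normD _ _))// !normrM lerD// ler_pM//.
have sumE : \sum_l map_mx ratr (\row_l (if l == i then b' else a ord0 l)) ord0 l * h ord0 l
  = \sum_l map_mx ratr a ord0 l * h' ord0 l + ratr b' * s :> R.
 rewrite (bigD1 i)//= [in RHS](bigD1 i)//= h'i mulr0 add0r addrC !mxE eqxx; congr (_ + _).
 by apply: eq_bigr => l li; rewrite h'l// !mxE (negPf li).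
rewrite sumE.
have -> : f (y + h) - f y - (\sum_l map_mx ratr a ord0 l * h' ord0 l + ratr b' * s) =
 (f (y + h) - f (y + z *: E + h')) +
 (f (y + z *: E + h') - f (y + z *: E) - \sum_l map_mx ratr a ord0 l * h' ord0 l) +
 ((f (y + z *: E) - f y - b * z) + (b * z - ratr b' * s)) by ring.
apply: (@le_trans _ _ ((2 * L + 5) * e * `|h|)); last first.
 by rewrite ler_wpM2r// mulrC -ler_pdivlMr.
rewrite (le_trans (ler_normD _ _))//.
have e1' : e * `|h'| <= e * `|h| by rewrite ler_wpM2l// ltW.
have := ler_normD (f (y + h) - f (y + z *: E + h'))
 (f (y + z *: E + h') - f (y + z *: E) - \sum_l map_mx ratr a ord0 l * h' ord0 l).
have := ler_normD (f (y + z *: E) - f y - b * z) (b * z - ratr b' * s).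
by lra.
Qed.

(** A line in direction [i] meets the set [N] of new exceptional points in a null set: almost every
    parameter is a point of differentiability of the Lipschitz function [gx] and a density point of
    each of the countably many sets [B q] that contain it, and [good_step] applies there. *)
Lemma good_ae j : (j <= n)%N -> mu (~` [set x | good j x]) = 0%E.
Proof.
elim: j => [_|j IHj jn].
 rewrite (_ : [set x | _] = setT) ?setCT ?measure0//; apply/seteqP; split => // x _ m.
 exists 0, 0%N => h hs _; have -> : h = 0 by apply/rowP => i; rewrite hs// mxE.
 rewrite addr0 subrr sub0r normrN normr0 mulr0 big1 ?normr0// => l _.
 by rewrite [X in _ * X]mxE mulr0.
pose i := Ordinal jn; pose E : Rn := delta_mx ord0 i.
pose N := [set x | good i x] `\` [set x | good i.+1 x].
have mN : measurable N by apply: measurableD; exact: measurable_good.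
have N0 : mu N = 0%E.
 apply: (@measure0_slices _ _ E) => // x.
 have mline : measT (fun t : mR R => x + (t : R) *: E).
  by have := measurableT_comp (measurable_line E) (@measurable_pair2 _ _ _ _ x); exact.
 have mS (A : set Rn) : measurable A -> measurable [set t : mR R | A (x + (t : R) *: E)].
  by move=> mA; rewrite -[X in measurable X]setTI; apply: mline.
 apply/negligibleP; first exact: mS.
 pose gx (t : R) := f (x + t *: E).
 have gxL s t : `|gx s - gx t| <= L * `|s - t|.
  rewrite (le_trans (fL _ _))// ler_wpM2l// opprD addrACA subrr add0r -scalerBl.
  exact: norm_scale_delta.
 pose B (q : 'rV[rat]_n * (nat * nat)) : set R := [set t : R |
   lin_approx i (map_mx ratr q.1) q.2.1.+1%:R^-1 q.2.2.+1%:R^-1 (x + t *: E)].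
 have mB q : measurable (B q).
  by apply: mS; apply: closed_meas; exact: closed_lin_approx.
 have aeB := ae_forall_countable (fun q => ae_dense_points (mB q)).
 suff : {ae lam, forall t : R, ~ N (x + t *: E)}.
  by apply: negligibleS => t /= Nt; exact.
 apply: aeS (aeI (lipschitz_ae_derivable gxL) aeB) => t [dt dens] [gt ngt]; apply: ngt => /=.
 have shiftE s : x + t *: E + s *: E = x + (t + s) *: E by rewrite scalerDl addrA.
 apply: (good_step (b := 'D_1 gx t) gt).
  move=> e e0; move: dt; rewrite /derivable => /cvgrPdist_le /(_ e e0)[d /= d0 dP].
  exists (d / 2); first by rewrite divr_gt0.
  move=> s sd; have [->|s0] := eqVneq s 0.
   by rewrite scale0r addr0 subrr mulr0 subrr !normr0 mulr0.
  have sd' : `|0 - s| < d.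
   by rewrite sub0r normrN (le_lt_trans sd)// ltr_pdivrMr// ltr_pMr// ltr1n.
  have := dP s sd' s0; rewrite -/('D_1 gx t) => h.
  rewrite -/E shiftE -/(gx (t + s)) -/(gx t).
  rewrite -(ler_pM2r (_ : 0 < `|s|^-1)) ?invr_gt0 ?normr_gt0// -mulrA divff ?normr_eq0// mulr1.
  rewrite -normfV -normrM distrC in h *.
  apply: le_trans h; apply: eq_ler; congr (`| _ |).
  rewrite [_%:A]mulr1 [in RHS](addrC s t) /GRing.scale/=; field; exact: s0.
 move=> a m k ak e e0.
 have [d d0 dP] := dens (a, (m, k)) ak e e0.
 exists d => // s sd; have [z Bz zs] := dP s sd.
 exists (z - t); first by rewrite -/E shiftE [t + _]addrC subrK.
 by rewrite -addrA -opprD.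
have mgj : measurable (~` [set x | good j x]) by apply: measurableC; exact: measurable_good.
apply: (@subset_measure0 _ _ _ mu _ (N `|` ~` [set x | good j x])).
- by apply: measurableC; exact: measurable_good.
- exact: measurableU.
- move=> x /= ngx; have [gx|ngx'] := pselect (good j x); [by left|by right].
- by apply: null_set_setU => //; exact: IHj (ltnW jn).
Qed.

(** Testing two approximations along the same small multiple of a basis vector shows that the
    intervals of radius [1/(m+1)] about the rational slopes meet pairwise ([cau]). The supremum of
    their left ends lies in all of them and is the partial derivative. *)
Lemma good_sdiff x : good n x -> exists a, sdiff f x a.
Proof.
move=> /choice[a /choice[k ak]].
have full h : lower_supp n h by move=> i; rewrite leqNgt ltn_ord.
have cau i m m' : ratr (a m ord0 i) - m.+1%:R^-1 <= ratr (a m' ord0 i) + m'.+1%:R^-1 :> R.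
 pose d : R := Num.min (k m).+1%:R^-1 (k m').+1%:R^-1.
 have d0 : 0 < d by rewrite lt_min !invr_gt0 !ltr0Sn.
 pose h : Rn := d *: delta_mx ord0 i.
 have hd : `|h| <= d by rewrite (le_trans (norm_scale_delta _ _))// gtr0_norm.
 have sE (c : 'rV[rat]_n) : \sum_l map_mx ratr c ord0 l * h ord0 l = ratr (c ord0 i) * d :> R.
  rewrite (bigD1 i)//= big1 ?addr0 => [|l li]; rewrite !mxE ?eqxx ?mulr1//.
  by rewrite (negPf li)/= mulr0 mulr0.
 have h1 := ak m h (full h) (le_trans hd (_ : d <= _)).
 have h2 := ak m' h (full h) (le_trans hd (_ : d <= _)).
 have {h1} := h1 _; rewrite ge_min lexx => /(_ isT) h1.
 have {h2} := h2 _; rewrite ge_min lexx orbT => /(_ isT).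
 move: h1.
 rewrite !sE => /ler_normlP[h1 h1'] /ler_normlP[h2 h2'].
 have hm : m.+1%:R^-1 * `|h| <= m.+1%:R^-1 * d by rewrite ler_wpM2l// invr_ge0.
 have hm' : m'.+1%:R^-1 * `|h| <= m'.+1%:R^-1 * d by rewrite ler_wpM2l// invr_ge0.
 rewrite -subr_le0 -(pmulr_lle0 _ d0).
 by move: h1 h1' h2 h2' hm hm'; set p := m.+1%:R^-1; set q := m'.+1%:R^-1; lra.
pose l i : R := sup [set ratr (a m ord0 i) - m.+1%:R^-1 | m in [set: nat]].
have lP i m : `|ratr (a m ord0 i) - l i| <= m.+1%:R^-1.
 have ub (m' : nat) : ubound [set (ratr (a m ord0 i) - m.+1%:R^-1 : R) | m in [set: nat]]
   (ratr (a m' ord0 i) + m'.+1%:R^-1).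
  by move=> _ [m1 _ <-]; exact: cau.
 have h1 : l i <= ratr (a m ord0 i) + m.+1%:R^-1.
  by apply: ge_sup; [exists (ratr (a 0%N ord0 i) - 1%:R^-1), 0%N|exact: ub].
 have h2 : ratr (a m ord0 i) - m.+1%:R^-1 <= l i.
  by apply: ub_le_sup; [exists (ratr (a 0%N ord0 i) + 1%:R^-1); exact: (ub 0%N)|exists m].
 by rewrite ler_distl lerBlDr h1 -lerBlDr.
exists (\row_i l i) => e e0.
have n1 : 0 < n%:R + 1 :> R by rewrite ltr_wpDl.
have [m me] : exists m : nat, m.+1%:R^-1 <= e / (n%:R + 1).
 by apply: exists_inv_nat; rewrite divr_gt0.
exists (k m).+1%:R^-1; first by rewrite invr_gt0.
move=> h hk; have hm := ak m h (full h) hk.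
have hs : `|\sum_i map_mx ratr (a m) ord0 i * h ord0 i - \sum_i (\row_i l i) ord0 i * h ord0 i|
  <= n%:R * (m.+1%:R^-1 * `|h|).
 rewrite -sumrB (le_trans (ler_norm_sum _ _ _))//.
 apply: (@le_trans _ _ (\sum_(i < n) (m.+1%:R^-1 * `|h|))).
  apply: ler_sum => i _; rewrite -mulrBl normrM ler_pM ?coord_le//.
  by rewrite !mxE; exact: lP.
 by rewrite sumr_const card_ord mulr_natl.
rewrite (_ : _ - _ = (f (x + h) - f x - \sum_i map_mx ratr (a m) ord0 i * h ord0 i) +
 (\sum_i map_mx ratr (a m) ord0 i * h ord0 i - \sum_i (\row_i l i) ord0 i * h ord0 i)); last by ring.
rewrite (le_trans (ler_normD _ _))//.
apply: (@le_trans _ _ ((n%:R + 1) * m.+1%:R^-1 * `|h|)).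
 by rewrite mulrDl mul1r mulrDl addrC lerD// -mulrA.
by rewrite ler_wpM2r// mulrC -ler_pdivlMr.
Qed.

Lemma ae_sdiff : {ae mu, forall x, exists a, sdiff f x a}.
Proof.
exists (~` [set x | good n x]); split.
- by apply: measurableC; exact: measurable_good.
- exact: good_ae.
- by move=> x /= nx gx; apply: nx; exact: good_sdiff.
Qed.

End rademacher.

Section rademacher_map.
Context {R : realType} {n m : nat}.

Lemma sdiff_isdiff (g : 'rV[R]_n -> 'rV[R]_m) x a :
 (forall j, sdiff (fun x => g x ord0 j) x (a j)) ->
 isdiff g x (\matrix_(i, j) a j ord0 i).
Proof.
move=> aP e e0.
have /choice[d dP] : forall j, exists d, 0 < d /\ forall h, `|h| <= d ->
  `|g (x + h) ord0 j - g x ord0 j - \sum_i a j ord0 i * h ord0 i| <= e * `|h|.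
 by move=> j; have [d d0 dP] := aP j e e0; exists d.
exists (\big[Num.min/1]_j d j).
 by apply: lt_bigmin => // j _; have [] := dP j.
move=> h hd; apply: norm_row_le => [|j]; first by rewrite mulr_ge0// ltW.
have [_ {}dP] := dP j; have := dP h; rewrite !mxE => /(_ _)/le_trans.
have -> : \sum_i h ord0 i * (\matrix_(i, j) a j ord0 i) i j = \sum_i a j ord0 i * h ord0 i.
 by apply: eq_bigr => i _; rewrite mxE mulrC.
by apply=> //; apply: (le_trans hd); exact: bigmin_le.
Qed.

Lemma ae_isdiff (g : 'rV[R]_n -> 'rV[R]_m) (L : R) :
 nlip L g ->
 {ae lebesgue_rV R n, forall x, isdiff g x ('J g x)}.
Proof.
move=> gL.
have gL' j x y : `|g x ord0 j - g y ord0 j| <= `|L| * `|x - y|.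
 have := coord_le (g x - g y) j; rewrite !mxE => /le_trans; apply.
 by rewrite (le_trans (gL x y))// ler_wpM2r// ler_norm.
have := ae_forall_countable (fun j => ae_sdiff (gL' j) (normr_ge0 L)).
apply: aeS => x /choice[a aP].
by have h := sdiff_isdiff aP; rewrite (isdiff_jacobian h).
Qed.

End rademacher_map.

(** * Measure of Lipschitz images *)

Section finite_unions.
Context d (T : measurableType d) (R : realType) (mu : {measure set T -> \bar R}).
Variables (I : choiceType) (F : I -> set T).
Hypothesis mF : forall i, measurable (F i).

Lemma measure_big_setU_le (s : seq I) :
 (mu (\big[setU/set0]_(i <- s) F i) <= \sum_(i <- s) mu (F i))%E.
Proof.
elim: s => [|i s IHs]; first by rewrite !big_nil measure0.
rewrite !big_cons (le_trans (measureU2 _ _ _))// ?leeD2l//.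
by apply: bigsetU_measurable.
Qed.

Lemma measure_big_setU (s : seq I) : uniq s ->
 (forall i j x, F i x -> F j x -> i = j) ->
 mu (\big[setU/set0]_(i <- s) F i) = (\sum_(i <- s) mu (F i))%E.
Proof.
move=> + Finj; elim: s => [|i s IHs]; first by rewrite !big_nil measure0.
move=> /= /andP[nis us]; rewrite !big_cons measureU//; last 2 first.
- by apply: bigsetU_measurable.
- rewrite -subset0 => x [Fi]; rewrite -bigcup_seq => -[j /= js Fj].
 by rewrite (Finj _ _ _ Fi Fj) js in nis.
by congr (_ + _)%E; exact: IHs.
Qed.

End finite_unions.

Section lipschitz_images.
Context {R : realType} {n : nat}.
Notation Rn := 'rV[R]_n.
Notation mu := (lebesgue_rV R n).

Lemma cube_lty (N : R) : (mu (cube N) < +oo)%E.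
Proof. exact: box_lty. Qed.

Lemma meas_cube (N : R) : measurable (cube N : set Rn).
Proof. exact: meas_box. Qed.

Lemma closed_box (a b : 'I_n -> R) : closed (box a b : set Rn).
Proof.
rewrite (_ : box a b = \bigcap_(i in [set: 'I_n])
  ((fun x : Rn => x ord0 i) @^-1` [set y | a i <= y <= b i])).
 apply: closed_bigI => i _; apply: closed_comp => [x _|]; first exact: coord_continuous.
 rewrite (_ : [set y | _] = [set y | a i <= y] `&` [set y | y <= b i]).
  by apply: closedI; [exact: closed_ge|exact: closed_le].
 by apply/seteqP; split => y /=; [move=> /andP[]|move=> [-> ->]].
by apply/seteqP; split => [x Bx i _|x Bx i]; [exact: Bx|exact: (Bx i Logic.I)].
Qed.

Lemma closed_cube_compact (N : R) (A : set Rn) : 0 <= N -> closed A ->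
 A `<=` cube N -> compact A.
Proof.
move=> N0 cA AN; apply: bounded_closed_compact => //.
exists N; split; first exact: num_real.
move=> M NM x /AN /(cubeP _ N0) xN; exact: le_trans xN (ltW NM).
Qed.

Lemma compact_cube (N : R) : compact (cube N : set Rn).
Proof.
have [N0|N0] := leP 0 N; first by apply: (closed_cube_compact N0) => //; exact: closed_box.
apply: (@closed_cube_compact 0) => //; first exact: closed_box.
by move=> x xN i; have := xN i => /andP[h1 h2]; have := le_trans h1 h2; lra.
Qed.

Lemma compact_sub_cube (C : set Rn) : compact C -> exists2 N, 0 <= N & C `<=` cube N.
Proof.
move=> /compact_bounded[M [_ MP]]; exists (`|M| + 1); first by rewrite addr_ge0.
move=> x Cx; apply/cubeP; first by rewrite addr_ge0.
by apply: MP => //; rewrite (le_lt_trans (ler_norm M))// ltrDl.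
Qed.

Lemma compact_lty (C : set Rn) : compact C -> (mu C < +oo)%E.
Proof.
move=> cC; have [N N0 CN] := compact_sub_cube cC.
apply: le_lt_trans (cube_lty N); apply: le_mu_sub => //.
 exact: compact_meas.
exact: meas_cube.
Qed.

Definition hobox (a b : 'I_n -> R) : set Rn := [set x | forall i, a i <= x ord0 i < b i].

Lemma measurable_hobox a b : measurable (hobox a b).
Proof.
rewrite (_ : hobox a b = \big[setI/setT]_(i < n)
  ((fun x : 'rV[R]_n => x ord0 i : mR R) @^-1` `[a i, b i[)).
 apply: bigsetI_measurable => i _.
 by rewrite -[X in measurable X]setTI; exact: measurable_coord.
apply/seteqP; split => x; rewrite -bigcap_seq => Bx i.
 by move=> _ /=; rewrite in_itv; exact: Bx.
by have /= := Bx i (mem_index_enum i); rewrite in_itv.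
Qed.

(** The closed box exceeds the half-open one by its upper faces, which are degenerate boxes of
    measure 0. Half-open cells are used because they tile a cube disjointly. *)
Lemma lebesgue_hobox (a b : 'I_n -> R) : (forall i, a i <= b i) ->
 mu (hobox a b) = (\prod_i (b i - a i))%:E.
Proof.
move=> ab; apply/eqP; rewrite eq_le; apply/andP; split.
 rewrite -(lebesgue_rV_box ab); apply: le_mu_sub.
 - exact: measurable_hobox.
 - exact: meas_box.
 - by move=> x xab i; have /andP[-> /ltW] := xab i.
pose F i : set Rn := box (fun j => if j == i then b i else a j) b.
have mF i : measurable (F i) by exact: meas_box.
have F0 i : mu (F i) = 0%E.
 rewrite [LHS]lebesgue_rV_box; last by move=> j; case: eqP => [->|].
 by rewrite (bigD1 i)//= eqxx subrr mul0r.
rewrite -(lebesgue_rV_box ab).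
have mU : measurable (\big[setU/set0]_(i < n) F i) by exact: bigsetU_measurable.
have U0 : mu (\big[setU/set0]_(i < n) F i) = 0%E.
 apply/eqP; rewrite eq_le measure_ge0 andbT.
 have := @Boole_inequality _ _ _ mu (fun k => if insub k is Some i then F i else set0) n.
 have -> : \big[setU/set0]_(i < n) (if insub (val i) is Some i0 then F i0 else set0) =
   \big[setU/set0]_(i < n) F i by apply: eq_bigr => i _; rewrite valK.
 move=> /(_ _)/le_trans; apply.
  by move=> k kn; case: insubP.
 by rewrite big1// => i _; rewrite valK; exact: F0.
apply: (@le_trans _ _ (mu (hobox a b `|` \big[setU/set0]_(i < n) F i))).
 apply: le_mu_sub; first exact: meas_box.
  by apply: measurableU => //; exact: measurable_hobox.
 move=> x xab; have [h|/existsNP[i ni]] := pselect (hobox a b x); first by left.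
 right; rewrite -bigcup_seq; exists i; first exact: mem_index_enum.
 move=> j; have /andP[h1 h2] := xab j; rewrite h2 andbT; case: eqP => // ->.
 by move/negP: ni; have /andP[-> _] := xab i; rewrite -leNgt.
apply: (le_trans (measureU2 _ _ _)) => //; first exact: measurable_hobox.
by rewrite [X in (_ + X)%E](_ : _ = 0%E) ?adde0//; exact: U0.
Qed.

(** For the sup norm a set of diameter [D] fits in a cube of side [D]. No dimensional factor
    appears, which is what gives Lipschitz images the sharp constant [L ^+ n]. *)
Lemma diam_sub_box (A : set Rn) (D : R) : A !=set0 ->
 (forall x y, A x -> A y -> `|x - y| <= D) ->
 exists a : 'I_n -> R, A `<=` box a (fun i => a i + D).
Proof.
move=> [x0 Ax0] AD.
have D0 : 0 <= D by have := AD x0 x0 Ax0 Ax0; rewrite subrr normr0.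
exists (fun i => inf [set y ord0 i | y in A]) => x Ax i.
have hd y : A y -> x ord0 i - D <= y ord0 i.
 move=> Ay; have := le_trans (coord_le (x - y) i) (AD x y Ax Ay).
 by rewrite !mxE ler_norml => /andP[_]; rewrite lerBlDr addrC -lerBlDr.
apply/andP; split.
 by apply: ge_inf; [exists (x ord0 i - D) => _ [y Ay <-]; exact: hd|exists x].
rewrite -lerBlDr; apply: lb_le_inf; first by exists (x ord0 i); exists x.
by move=> _ [y Ay <-]; exact: hd.
Qed.

(* Each cell of a fine grid that meets [C] is mapped into a cube whose side is
  [L] times that of the cell. *)
Lemma lipschitz_image_measure (C : set Rn) (f : Rn -> Rn) (L : R) :
 compact C -> measurable (f @` C) -> 0 <= L ->
 (forall x y, C x -> C y -> `|f x - f y| <= L * `|x - y|) ->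
 (mu (f @` C) <= (L ^+ n)%:E * mu C)%E.
Proof.
move=> cC mfC L0 fL.
have mC : measurable C by exact: compact_meas.
have Cfin : mu C \is a fin_num by rewrite ge0_fin_numE//; exact: compact_lty.
have [N0 N00 CN0] := compact_sub_cube cC.
have [N N1 CN] : exists2 N, 0 < N & C `<=` cube N.
 exists (N0 + 1); first by rewrite ltr_wpDl.
 by move=> x /CN0 xN i; have /andP[] := xN i; move=> *; apply/andP; split; lra.
apply/lee_addgt0Pr => e e0.
have [e' e'0 e'e] : exists2 e', 0 < e' & L ^+ n * e' <= e.
 exists (e / (L ^+ n + 1)); first by rewrite divr_gt0// ltr_wpDl ?exprn_ge0.
 rewrite mulrCA ger_pMr// ler_pdivrMr ?mul1r ?lerDl// ltr_wpDl ?exprn_ge0//.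
pose nu := mfrestr (meas_cube (N + 1)) (cube_lty (N + 1)).
have cCl : closed C by apply: compact_closed => //; exact: norm_hausdorff.
have [k kP] := @closed_thickening_lt _ _ nu C e' cCl e'0.
pose d : R := k.+1%:R^-1; have d0 : 0 < d by rewrite invr_gt0.
have d1 : d <= 1 by rewrite invf_le1// ler1n.
have [M M0 Md] : exists2 M : nat, (0 < M)%N & (2 * N + 1) / M%:R < d.
 exists (Num.bound ((2 * N + 1) / d)).+1 => //.
 rewrite ltr_pdivrMr// [d * _]mulrC -ltr_pdivrMr//.
 apply: (lt_trans (archi_boundP _)); last by rewrite ltr_nat.
 by rewrite divr_ge0// ?ltW// addr_gt0// mulr_gt0.
pose s : R := (2 * N + 1) / M%:R.
have s0 : 0 < s by rewrite divr_gt0// ?ltr0n// addr_gt0// mulr_gt0.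
have Ms : M%:R * s = 2 * N + 1 by rewrite mulrC divfK// pnatr_eq0 -lt0n.
pose lo (p : {ffun 'I_n -> 'I_M}) i : R := - N + (p i : nat)%:R * s.
pose cell p := hobox (lo p) (fun i => lo p i + s).
have mcell p : measurable (cell p) by exact: measurable_hobox.
have ccell p : mu (cell p) = (s ^+ n)%:E.
 rewrite lebesgue_hobox => [|i]; last by rewrite lerDl ltW.
 congr EFin; rewrite -[in RHS](card_ord n) -prodr_const; apply: eq_bigr => i _.
 by rewrite addrAC subrr add0r.
have cell_cover x : cube N x -> exists p, cell p x.
 move=> xN.
 have h i : exists q : 'I_M, q%:R * s <= x ord0 i + N < q%:R * s + s.
  have xi0 : 0 <= (x ord0 i + N) / s.
   by rewrite divr_ge0 ?(ltW s0)//; have /andP[? _] := xN i; rewrite -lerBlDr sub0r.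
  have lt1 : (Num.truncn ((x ord0 i + N) / s) < M)%N.
   have /andP[t1 _] := truncn_itv xi0; rewrite -(ltr_nat R); apply: (le_lt_trans t1).
   by rewrite ltr_pdivrMr// Ms; have /andP[_ ?] := xN i; lra.
  have /andP[t1 t2] := truncn_itv xi0.
  exists (Ordinal lt1) => /=; rewrite -ler_pdivlMr// t1/=.
  by rewrite -[X in _ < _ + X]mul1r -mulrDl -ltr_pdivrMr// natr1.
 have /choice[q hq] := h.
 exists [ffun i => q i] => i; rewrite /lo ffunE; have /andP[h1 h2] := hq i.
 by apply/andP; split; lra.
have cell_inj p q x : cell p x -> cell q x -> p = q.
 move=> px qx; apply/ffunP => i; apply: val_inj => /=.
 have /andP[p1 p2] := px i; have /andP[q1 q2] := qx i.
 have lt12 (a b : nat) : a%:R * s < b%:R * s + s -> (a <= b)%N.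
  by rewrite -[X in _ + X]mul1r -mulrDl ltr_pM2r// natr1 ltr_nat ltnS.
 by apply/eqP; rewrite eqn_leq; apply/andP; split; apply: lt12;
  move: p1 p2 q1 q2; rewrite /lo; lra.
pose hit p := `[< cell p `&` C !=set0 >].
pose hits := [seq p <- enum {ffun 'I_n -> 'I_M} | hit p].
have hitsP p : (p \in hits) = hit p by rewrite mem_filter mem_enum andbT.
pose U := \big[setU/set0]_(p <- hits) cell p.
have mU : measurable U by rewrite /U; apply: bigsetU_measurable.
have muU : mu U = (\sum_(p <- hits) (s ^+ n)%:E)%E.
 rewrite /U measure_big_setU//; last by rewrite filter_uniq// enum_uniq.
 by apply: eq_bigr => p _; exact: ccell.
have Usub : U `<=` \bigcup_(x in C) ball x d.
 move=> x; rewrite /U -bigcup_seq => -[p]; rewrite /= hitsP => /asboolP[y [py Cy]] px.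
 exists y => //; rewrite mx_norm_ball /ball_/=; apply: norm_row_lt => // i.
 rewrite !mxE; have /andP[p1 p2] := px i; have /andP[q1 q2] := py i.
 by rewrite ltr_distl; apply/andP; split; move: Md; rewrite -/s; lra.
have thick_cube : \bigcup_(x in C) ball x d `<=` cube (N + 1).
 move=> x [y Cy]; rewrite mx_norm_ball /ball_/= => yx i.
 have := le_lt_trans (coord_le (y - x) i) yx; rewrite !mxE ltr_distl => /andP[h1 h2].
 by have /andP[h3 h4] := CN y Cy i; apply/andP; split; lra.
have muUle : (mu U <= mu C + e'%:E)%E.
 have moB : measurable (\bigcup_(x in C) ball x d : set Rn).
  by apply: open_meas; apply: bigcup_open => x _; exact: ball_open.
 apply: (@le_trans _ _ (mu (C `|` (\bigcup_(x in C) ball x d `\` C)))).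
  apply: le_mu_sub => //; first by apply: measurableU => //; exact: measurableD.
  by move=> x /Usub xU; have [Cx|nCx] := pselect (C x); [left|right].
 apply: (le_trans (measureU2 _ _ _)) => //; first exact: measurableD.
 rewrite leeD2l//; apply: le_trans (ltW kP); rewrite /nu/= /mfrestr/= /mrestr setIidl//.
 by apply: subset_trans thick_cube; exact: subDsetl.
have img p : hit p -> exists a : 'I_n -> R, f @` (cell p `&` C) `<=` box a (fun i => a i + L * s).
 move=> /asboolP[y [py Cy]]; apply: diam_sub_box; first by exists (f y), y.
 move=> _ _ [x1 [p1 C1] <-] [x2 [p2 C2] <-].
 apply: (le_trans (fL _ _ C1 C2)); rewrite ler_wpM2l//.
 apply: norm_row_le => [|i]; first exact: ltW.
 rewrite !mxE ler_distl; have /andP[h1 h2] := p1 i; have /andP[h3 h4] := p2 i.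
 by apply/andP; split; lra.
have [a aP] : exists a : {ffun 'I_n -> 'I_M} -> 'I_n -> R, forall p, hit p ->
  f @` (cell p `&` C) `<=` box (a p) (fun i => a p i + L * s).
 suff /choice[a aP] : forall p, exists a : 'I_n -> R, hit p ->
  f @` (cell p `&` C) `<=` box a (fun i => a i + L * s) by exists a.
 move=> p; have [hp|hp] := boolP (hit p); last by exists (fun=> 0).
 by have [a ha] := img p hp; exists a.
pose B p := box (a p) (fun i => a p i + L * s).
have mB p : measurable (B p) by exact: meas_box.
have muB p : mu (B p) = (L ^+ n * s ^+ n)%:E.
 rewrite [LHS]lebesgue_rV_box => [|i]; last by rewrite lerDl mulr_ge0// ltW.
 congr EFin; rewrite -exprMn -[in RHS](card_ord n) -prodr_const; apply: eq_bigr => i _.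
 by rewrite addrAC subrr add0r.
have fsub : f @` C `<=` \big[setU/set0]_(p <- hits) B p.
 move=> _ [x Cx <-]; have [p px] := cell_cover x (CN x Cx).
 have hp : hit p by apply/asboolP; exists x.
 rewrite -bigcup_seq; exists p; first by rewrite /= hitsP.
 by apply: aP => //; exists x.
apply: (@le_trans _ _ (mu (\big[setU/set0]_(p <- hits) B p))).
 by apply: le_mu_sub => //; exact: bigsetU_measurable.
apply: (@le_trans _ _ (\sum_(p <- hits) mu (B p))%E).
 exact: measure_big_setU_le.
have -> : (\sum_(p <- hits) mu (B p) = \sum_(p <- hits) ((L ^+ n)%:E * (s ^+ n)%:E))%E.
 by apply: eq_bigr => p _; rewrite -EFinM; exact: muB.
rewrite -ge0_sume_distrr; last by move=> *; rewrite lee_fin exprn_ge0// ltW.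
rewrite -muU; apply: (@le_trans _ _ ((L ^+ n)%:E * (mu C + e'%:E))%E).
 by rewrite lee_wpmul2l// lee_fin exprn_ge0.
by rewrite muleDr// ?leeD2l// -?EFinM ?lee_fin// fin_num_adde_defl.
Qed.

End lipschitz_images.

Lemma negligible_small d (T : measurableType d) (R : realType)
  (mu : {measure set T -> \bar R}) (A : set T) :
 (forall e : R, 0 < e -> exists B, [/\ measurable B, A `<=` B & (mu B <= e%:E)%E]) ->
 mu.-negligible A.
Proof.
move=> H; have /choice[B hB] : forall k : nat, exists B,
  [/\ measurable B, A `<=` B & (mu B <= k.+1%:R^-1%:E)%E].
 by move=> k; apply: H; rewrite invr_gt0.
have mB : measurable (\bigcap_k B k) by apply: bigcapT_measurable => k; have [] := hB k.
exists (\bigcap_k B k); split => //; last by move=> x Ax k _; have [_ h _] := hB k; exact: h.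
apply/eqP; rewrite eq_le measure_ge0 andbT; apply/lee_addgt0Pr => e e0; rewrite add0e.
have [k ke] := exists_inv_nat e0.
have [mBk _ le1] := hB k.
apply: (le_trans _ (le_trans le1 _)); last by rewrite lee_fin.
by apply: le_mu_sub => // x; apply.
Qed.

Section lipschitz_null.
Context {R : realType} {n : nat}.
Notation Rn := 'rV[R]_n.
Notation mu := (lebesgue_rV R n).
Variables (f : Rn -> Rn) (L : R).
Hypothesis fL : nlip L f.

Let fcont : continuous f.
Proof. exact: lip_continuous fL. Qed.

Let fL' x y : `|f x - f y| <= `|L| * `|x - y|.
Proof. by rewrite (le_trans (fL _ _))// ler_wpM2r// ler_norm. Qed.

Lemma lipschitz_image_compact (C : set Rn) : compact C ->
 measurable (f @` C) /\ (mu (f @` C) <= (`|L| ^+ n)%:E * mu C)%E.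
Proof.
move=> cC; have mfC : measurable (f @` C).
 apply: compact_meas; apply: continuous_compact => //.
 exact: continuous_subspaceT.
by split => //; apply: lipschitz_image_measure.
Qed.

(** The compact sets [C j], made of the points that no ball of radius [1/(j+1)] about a point of the
    complement reaches, increase to [U]. Its image is thus a countable union of compact sets, and
    continuity from below passes to the limit. *)
Lemma lipschitz_image_open_bounded (U : set Rn) (r : R) : open U -> U `<=` cube r -> 0 <= r ->
 exists B, [/\ measurable B, f @` U `<=` B & (mu B <= (`|L| ^+ n)%:E * mu U)%E].
Proof.
move=> oU Ur r0.
pose C (j : nat) : set Rn := ~` \bigcup_(y in ~` U) ball y (j.+1%:R^-1 : R).
have cC j : closed (C j).
 by apply: open_closedC; apply: bigcup_open => y _; exact: ball_open.
have CU j : C j `<=` U.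
 move=> x Cx; apply: contrapT => nUx; apply: Cx; exists x => //.
 by apply: ballxx; rewrite invr_gt0.
have kC j : compact (C j).
 by apply: (closed_cube_compact r0) => //; exact: subset_trans (CU j) Ur.
have CUE : U = \bigcup_j C j.
 apply/seteqP; split => [x Ux|x [j _ /CU]//].
 have /nbhs_ballP[e /= e0 eU] : nbhs x U by exact: open_nbhs_nbhs.
 have [j je] := exists_inv_nat e0.
 exists j => // -[y nUy yx]; apply: nUy; apply: eU.
 by apply: ball_sym; exact: le_ball yx.
have mfC j : measurable (f @` C j) by exact: (lipschitz_image_compact (kC j)).1.
have mfU : measurable (\bigcup_j f @` C j) by exact: bigcupT_measurable.
have mU : measurable U by exact: open_meas.
exists (\bigcup_j f @` C j); split => //.
 by move=> _ [x + <-]; rewrite CUE => -[j _ Cx]; exists j => //; exists x.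
have nd : {homo (fun j => f @` C j) : a b / (a <= b)%N >-> (a <= b)%O}.
 move=> a b ab; apply/subsetPset => _ [x Cx <-]; exists x => // -[y nUy yx].
 apply: Cx; exists y => //; apply: le_ball yx.
 by rewrite lef_pV2 ?posrE// ler_nat.
have cv : (mu \o (fun j => f @` C j)) x @[x --> \oo] --> mu (\bigcup_j f @` C j).
 exact: (nondecreasing_cvg_mu _ _ nd).
rewrite -(cvg_lim _ cv)//; apply: lime_le; first by apply/cvg_ex; eexists; exact: cv.
apply: nearW => j /=; apply: (le_trans (lipschitz_image_compact (kC j)).2).
rewrite lee_wpmul2l// ?lee_fin ?exprn_ge0//; apply: le_mu_sub => //.
exact: closed_meas.
Qed.

(** The image of a Borel set need not be measurable, so a measurable superset is produced: outer
    regularity of [mu] restricted to a larger cube puts [A] inside a bounded open set of almost the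
    same measure. *)
Lemma lipschitz_image_cover (A : set Rn) (r e : R) : measurable A -> 0 <= r -> A `<=` cube r -> 0 < e ->
 exists B, [/\ measurable B, f @` A `<=` B & (mu B <= (`|L| ^+ n)%:E * mu A + e%:E)%E].
Proof.
move=> mA r0 Ar e0; pose r1 := r + 1; have r10 : 0 <= r1 by rewrite addr_ge0.
have mr := meas_cube r1 : measurable (cube r1 : set 'rV[R]_n).
pose nu := mfrestr mr (cube_lty r1).
have e'0 : 0 < e / (`|L| ^+ n + 1) by rewrite divr_gt0// ltr_wpDl// exprn_ge0.
have [K [U [cK oU KA AU UK]]] := @borel_regular _ _ nu _ mA _ e'0.
pose V := U `&` [set x : Rn | `|x| < r1].
have oV : open V.
 apply: openI => //.
 rewrite (_ : [set x : Rn | `|x| < r1] = ball (0 : Rn) r1); first exact: ball_open.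
 by apply/seteqP; split => x; rewrite mx_norm_ball /ball_/= sub0r normrN.
have Vr : V `<=` cube r1 by move=> x [_ /ltW] /(cubeP _ r10).
have mV : measurable V by exact: open_meas.
have mK : measurable K by exact: closed_meas.
have mU : measurable U by exact: open_meas.
have [B [mB fVB Ble]] := lipschitz_image_open_bounded oV Vr r10.
exists B; split => //.
 move=> _ [x Ax <-]; apply: fVB; exists x => //; split; first exact: AU.
 by have /(cubeP _ r0) xr := Ar _ Ax; rewrite /= (le_lt_trans xr)// ltrDl.
apply: (le_trans Ble).
have muV : (mu V <= (e / (`|L| ^+ n + 1))%:E + mu A)%E.
 apply: (@le_trans _ _ (mu (((U `\` K) `&` cube r1) `|` A))).
  apply: le_mu_sub => //.
   by apply: measurableU => //; apply: measurableI => //; exact: measurableD.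
  move=> x [Ux xr]; have [Kx|nKx] := pselect (K x); first by right; exact: KA.
  by left; split => //; apply: Vr.
 apply: (le_trans (measureU2 _ _ _)) => //.
  by apply: measurableI => //; exact: measurableD.
 by rewrite leeD2r//; exact: ltW UK.
apply: (@le_trans _ _ ((`|L| ^+ n)%:E * ((e / (`|L| ^+ n + 1))%:E + mu A))%E).
 by rewrite lee_wpmul2l// lee_fin exprn_ge0.
rewrite ge0_muleDr ?lee_fin ?(ltW e'0)// addeC leeD2l// -EFinM lee_fin mulrCA.
by rewrite ger_pMr// ler_pdivrMr ?mul1r ?lerDl// ltr_wpDl ?exprn_ge0.
Qed.

Lemma lipschitz_image_negligible (N : set Rn) : measurable N -> mu N = 0%E ->
 mu.-negligible (f @` N).
Proof.
move=> mN N0.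
have bdd (k : nat) : mu.-negligible (f @` (N `&` cube k%:R)).
 apply: negligible_small => e e0.
 have mNk : measurable (N `&` cube k%:R) by apply: measurableI => //; exact: meas_cube.
 have [B [mB fB Be]] := lipschitz_image_cover mNk (ler0n _ k) (@subIsetr _ _ _) e0.
 exists B; split => //; apply: (le_trans Be).
 have -> : mu (N `&` cube k%:R) = 0%E.
  by apply/eqP; rewrite eq_le measure_ge0 andbT -N0; apply: le_mu_sub.
 by rewrite mule0 add0e.
apply: negligibleS (negligible_bigcup bdd).
move=> _ [x Nx <-]; have : (\bigcup_k cube k%:R) x by rewrite bigcup_cube.
by move=> [k _ xk]; exists k => //; exists x.
Qed.

End lipschitz_null.

(** * Bounds on determinants, and measurability of the Jacobian *)

Section determinant_bounds.
Context {R : realType} {m : nat}.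
Notation Rn := 'rV[R]_m.+1.
Notation mu := (lebesgue_rV R m.+1).

Lemma linear_image (T : 'M[R]_m.+1) (A : set Rn) : T \in unitmx -> measurable A ->
 measurable ((fun x => x *m T) @` A) /\
 mu ((fun x => x *m T) @` A) = (`|\det T|%:E * mu A)%E.
Proof.
move=> uT mA.
have -> : (fun x => x *m T) @` A = (fun x => x *m invmx T) @^-1` A.
 apply/seteqP; split => [_ [x Ax <-]|x /= Ax]; first by rewrite /= mulmxK.
 by exists (x *m invmx T) => //; rewrite mulmxKV.
split.
 rewrite -[X in measurable X]setTI; apply: cont_meas_map => //.
 exact: mulmxr_continuous.
by rewrite lebesgue_rV_linear ?unitmx_inv// det_inv normfV invrK.
Qed.

Lemma unit_cube_measure : mu (box (fun=> 0) (fun=> 1)) = 1%E.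
Proof. by rewrite [LHS]lebesgue_rV_box// big1// => i _; rewrite subr0. Qed.

Lemma compact_unit_cube : compact (box (fun=> 0) (fun=> 1) : set Rn).
Proof.
apply: (@closed_cube_compact _ _ 1) => //; first exact: closed_box.
by move=> x h i; have /andP[h1 ->] := h i; rewrite andbT (le_trans _ h1)// lerN10.
Qed.

(** The image of the unit cube has measure [|\det T|], and at most [b ^+ m.+1] because the linear
    map is [b]-Lipschitz. *)
Lemma det_norm_le (T : 'M[R]_m.+1) (b : R) : 0 <= b ->
 (forall h : Rn, `|h *m T| <= b * `|h|) -> `|\det T| <= b ^+ m.+1.
Proof.
move=> b0 Tb; have [uT|] := boolP (T \in unitmx); last first.
 by rewrite unitmxE unitfE negbK => /eqP ->; rewrite normr0 exprn_ge0.
have cQ := compact_unit_cube; have mQ := compact_meas cQ.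
have [mTQ TQ] := linear_image uT mQ.
have := @lipschitz_image_measure R m.+1 _ (fun x => x *m T) b cQ mTQ b0.
rewrite TQ unit_cube_measure !mule1 lee_fin; apply => x y _ _.
by rewrite -mulmxBl.
Qed.

Lemma det_norm_ge (T : 'M[R]_m.+1) (a : R) : 0 < a ->
 (forall h : Rn, a * `|h| <= `|h *m T|) -> T \in unitmx /\ a ^+ m.+1 <= `|\det T|.
Proof.
move=> a0 Ta; have uT : T \in unitmx.
 rewrite unitmxE unitfE; apply/det0P => -[v v0 vT].
 by have := Ta v; rewrite vT normr0 pmulr_rle0// normr_le0 (negPf v0).
split => //.
have : `|\det (invmx T)| <= a^-1 ^+ m.+1.
 apply: det_norm_le; first by rewrite invr_ge0 ltW.
 move=> h; have := Ta (h *m invmx T); rewrite mulmxKV//.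
 by rewrite [a^-1 * _]mulrC ler_pdivlMr// mulrC.
rewrite det_inv normfV exprVn lef_pV2// ?posrE ?exprn_gt0// normr_gt0.
by rewrite -unitfE -unitmxE.
Qed.

Lemma isdiff_norm_le k (g : 'rV[R]_k -> Rn) (x : 'rV[R]_k) J (b : R) :
 isdiff g x J -> (exists2 d : R, 0 < d & forall h : 'rV[R]_k, `|h| <= d -> `|g (x + h) - g x| <= b * `|h|) ->
 forall h : 'rV[R]_k, `|h *m J| <= b * `|h|.
Proof.
move=> gJ [d d0 gb] h; apply/ler_addgt0Pr => e e0.
have [->|h0] := eqVneq h 0; first by rewrite mul0mx !normr0 mulr0 add0r ltW.
have hp : 0 < `|h| by rewrite normr_gt0.
have [d' d'0 gJd] := gJ (e / `|h|) (divr_gt0 e0 hp).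
pose t := Num.min d d' / `|h|.
have t0 : 0 < t by rewrite divr_gt0// lt_min d0.
have nt : `|t *: h| = Num.min d d'.
 by rewrite normrZ gtr0_norm// divfK// gt_eqF.
have h1 := gb (t *: h); have h2 := gJd (t *: h).
rewrite -scalemxAl in h2; rewrite nt !ge_min !lexx ?orbT in h1 h2.
have {}h1 := h1 isT; have {}h2 := h2 isT.
have := ler_normB (g (x + t *: h) - g x) (g (x + t *: h) - g x - t *: h *m J).
rewrite opprB addrCA subrr addr0 -scalemxAl normrZ gtr0_norm// => h3.
rewrite -(ler_pM2l t0) (le_trans h3)// mulrDr.
have -> : t * (b * `|h|) = b * Num.min d d' by rewrite /t mulrCA divfK// gt_eqF.
have -> : t * e = e / `|h| * Num.min d d' by rewrite /t; field; rewrite gt_eqF.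
exact: lerD.
Qed.

End determinant_bounds.

Section jacobian_measurability.
Context {R : realType} {n m : nat}.
Variables (g : 'rV[R]_n -> 'rV[R]_m).

Lemma isdiff_partial x J i j : isdiff g x J ->
 k.+1%:R * (g (x + k.+1%:R^-1 *: delta_mx ord0 i) ord0 j - g x ord0 j)
  @[k --> \oo] --> J i j.
Proof.
move=> gJ; apply/cvgrPdist_le => e e0; have [d d0 gd] := gJ e e0.
have [K Kd] := exists_inv_nat d0.
near=> k.
have kd : k.+1%:R^-1 <= d.
 apply: le_trans Kd; rewrite lef_pV2 ?posrE// ler_nat ltnS.
 by near: k; exact: nbhs_infty_ge.
have kp : 0 < k.+1%:R^-1 :> R by rewrite invr_gt0.
pose h : 'rV[R]_n := k.+1%:R^-1 *: delta_mx ord0 i.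
have hk : `|h| <= k.+1%:R^-1.
 by rewrite (le_trans (norm_scale_delta i _))// gtr0_norm.
have := gd h (le_trans hk kd).
move/(le_trans (coord_le _ j)); rewrite !mxE.
have -> : \sum_l h ord0 l * J l j = k.+1%:R^-1 * J i j.
 rewrite (bigD1 i)//= big1 ?addr0 => [|l li]; rewrite !mxE ?eqxx ?mulr1//.
 by rewrite (negPf li)/= mulr0 mul0r.
move=> h1; rewrite distrC -(ler_pM2l kp) -[X in X * `|_|](gtr0_norm kp) -normrM.
rewrite mulrBr mulKf ?pnatr_eq0//.
apply: (le_trans h1); rewrite mulrC; apply: ler_pM => //.
exact: ltW.
Unshelve. all: by end_near. Qed.

(** ['d g x] is obtained by choice and defaults to [point] where no differential exists. Hence
    ['J g x] is one fixed matrix off the points of differentiability, which keeps it measurable and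
    bounded everywhere. *)
Lemma isdiff_point x : isdiff g x ('J g x) \/ 'd g x = point.
Proof.
pose P (df : {linear 'rV[R]_n -> 'rV[R]_m}) := continuous df /\ forall y,
  g y = g (lim (nbhs x)) + df (y - lim (nbhs x)) +o_(y \near nbhs x) (y - lim (nbhs x)).
have [eP|nP] := pselect (exists df, P df).
 left; have /diff_locallyP[dc dE] : differentiable g x.
  by apply/diffP; exact: (getPex eP).
 move=> e e0; have := dE => /eqaddoP => /(_ e e0) /nbhs_ballP[d /= d0 hd].
 exists (d / 2); first by rewrite divr_gt0.
 move=> h hle; have := hd h.
 rewrite mx_norm_ball /ball_/= sub0r normrN => /(_ _)/(le_trans _).
 have hd2 : `|h| < d by rewrite (le_lt_trans hle)// ltr_pdivrMr// mulr_natr mulr2n ltrDl.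
 move=> /(_ `|g (x + h) - g x - h *m 'J g x|); apply => //.
 apply: eq_ler.
 change (`|g (x + h) - g x - h *m 'J g x| = `|g (h + x) - (g x + 'd g x h)|).
 by rewrite /jacobian mul_rV_lin1 opprD addrA [h + x]addrC.
by right; apply: (@getPN _ P) => df dP; apply: nP; exists df.
Qed.

Lemma jacobian_point x : 'd g x = point -> 'J g x = lin1_mx (point : {linear 'rV[R]_n -> 'rV[R]_m}).
Proof. by rewrite /jacobian => ->. Qed.

Lemma measurable_jacobian_on (D : set 'rV[R]_n) i j : measurable D -> continuous g ->
 (forall x, D x -> isdiff g x ('J g x)) ->
 measurable_fun D (fun x => ('J g x : 'M[R]_(n, m)) i j).
Proof.
move=> mD cg gD.
pose h (k : nat) (x : 'rV[R]_n) : R := k.+1%:R *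
  (g (x + k.+1%:R^-1 *: delta_mx ord0 i) ord0 j - g x ord0 j).
apply: (@measurable_fun_cvg _ _ _ D h).
- move=> k; apply: measurable_funTS; apply: measurable_funM => //; apply: measurable_funB.
  have mh : measT (fun x : 'rV[R]_n => g (x + k.+1%:R^-1 *: delta_mx ord0 i)).
   apply: (@measurableT_comp _ _ _ _ _ _ g); last exact: measurable_translate.
   exact: cont_meas_map.
  exact: (measurableT_comp (measurable_coord j) mh).
 apply: (measurableT_comp (measurable_coord j)).
 exact: cont_meas_map.
- by move=> x Dx; apply: isdiff_partial; exact: gD.
Qed.

End jacobian_measurability.

Section lipschitz_jacobian.
Context {R : realType}.

(** Converse of [good_sdiff]: the points of differentiability are exactly the good points, so they
    form a measurable set. *)
Lemma sdiff_good n (f : 'rV[R]_n -> R) (x a : 'rV[R]_n) : sdiff f x a -> good f n x.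
Proof.
move=> fa k; have e0 : 0 < k.+1%:R^-1 / 2 / (n%:R + 1) :> R.
 by rewrite !divr_gt0// ltr_wpDl.
have [q qa] := near_rat_row a e0.
have [|d d0 fd] := fa (k.+1%:R^-1 / 2); first by rewrite divr_gt0.
have [l ld] := exists_inv_nat d0.
exists q, l => h _ hl; have {}fd := fd h (le_trans hl ld).
rewrite (_ : _ - _ = (f (x + h) - f x - \sum_i a ord0 i * h ord0 i) +
 \sum_i (a ord0 i - map_mx ratr q ord0 i) * h ord0 i); last first.
 under [X in _ = _ + X]eq_bigr do rewrite mulrBl.
 by rewrite sumrB; ring.
rewrite (le_trans (ler_normD _ _))// [X in _ <= X * _]splitr mulrDl lerD//.
rewrite (le_trans (ler_norm_sum _ _ _))//.
apply: (@le_trans _ _ (\sum_(i < n) (k.+1%:R^-1 / 2 / (n%:R + 1) * `|h|))).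
 apply: ler_sum => i _; rewrite normrM ler_pM ?coord_le//.
 by have := coord_le (a - map_mx ratr q) i; rewrite !mxE => /le_trans; apply; exact: ltW.
rewrite sumr_const card_ord -[X in X <= _]mulr_natl mulrA ler_wpM2r// mulrCA ger_pMr ?divr_gt0//.
by rewrite ler_pdivrMr ?ltr_wpDl// mul1r lerDl.
Qed.

Variables (n m : nat) (g : 'rV[R]_n -> 'rV[R]_m) (L : R).
Hypothesis gL : nlip L g.

Lemma measurable_isdiff : measurable [set x | isdiff g x ('J g x)].
Proof.
have gL' j x y : `|g x ord0 j - g y ord0 j| <= `|L| * `|x - y|.
 have := coord_le (g x - g y) j; rewrite !mxE => /le_trans; apply.
 by rewrite (le_trans (gL x y))// ler_wpM2r// ler_norm.
rewrite (_ : [set x | _] = \big[setI/setT]_(j < m) [set x | good (fun x => g x ord0 j) n x]).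
 by apply: bigsetI_measurable => j _; exact: (measurable_good (gL' j)).
apply/seteqP; split => x; rewrite -bigcap_seq.
 move=> gx j _; apply: (@sdiff_good _ _ _ (\row_i 'J g x i j)) => e e0.
 have [d d0 gd] := gx e e0; exists d => // h hd.
 apply: le_trans (gd h hd); apply: le_trans (coord_le _ j); rewrite !mxE.
 apply: eq_ler.
 by congr (`|_ - _|); apply: eq_bigr => i _; rewrite mxE mulrC.
move=> gx.
have /choice[a aP] : forall j, exists a, sdiff (fun x => g x ord0 j) x a.
 by move=> j; apply: good_sdiff; exact: (gx j (mem_index_enum j)).
by have h := sdiff_isdiff aP; rewrite /= (isdiff_jacobian h).
Qed.

Lemma measurable_jacobian i j : measT (fun x => 'J g x i j).
Proof.
have mD := measurable_isdiff.
rewrite -(setUv [set x | isdiff g x ('J g x)]).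
apply/measurable_funU => //; first exact: measurableC.
split.
 by apply: measurable_jacobian_on => //; exact: lip_continuous gL.
apply: (@eq_measurable_fun _ _ _ _ _ (fun=> (lin1_mx (point : {linear 'rV[R]_n -> 'rV[R]_m})) i j)).
 move=> x /set_mem nx; rewrite /jacobian.
 by have [//|->] := isdiff_point g x.
exact: measurable_cst.
Qed.

End lipschitz_jacobian.

Lemma meas_detD {R : realType} {n} (g : 'rV[R]_n -> 'rV[R]_n) (L : R) :
 nlip L g -> measT (detD g).
Proof.
move=> gL; rewrite /detD /determinant.
apply: measurable_sum => s; apply: measurable_funM => //.
by apply: measurable_prod => i _; exact: measurable_jacobian gL _ _.
Qed.

(** * Bi-Lipschitz images and the area formula *)

Section bilipschitz_images.
Context {R : realType} {n : nat}.
Notation Rn := 'rV[R]_n.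
Notation mu := (lebesgue_rV R n).

Section injective_images.
Variables (f : Rn -> Rn) (E : set Rn).
Hypotheses (cf : continuous f) (cE : compact E) (fE : set_inj E f).

Let image_compact (C : set Rn) : compact C -> measurable (f @` C).
Proof.
move=> cC; apply: compact_meas; apply: continuous_compact => //.
exact: continuous_subspaceT.
Qed.

(** Injectivity on [E] makes the image commute with complements relative to [E], so the sets with
    measurable image form a sigma-algebra; boxes meet [E] in compact sets. *)
Lemma measurable_image_inj (A : set Rn) : measurable A -> measurable (f @` (A `&` E)).
Proof.
suff : measurable `<=` [set A : set Rn | measurable (f @` (A `&` E))] by apply.
rewrite [X in X `<=` _]measurable_boxesE; apply: smallest_sub.
 split => /=.
 - by rewrite set0I image_set0.
 - move=> B /= mB; rewrite setTD.
  rewrite (_ : f @` _ = f @` E `\` f @` (B `&` E)).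
   by apply: measurableD => //; exact: image_compact.
  apply/seteqP; split => [_ [x [nBx Ex] <-]|_ [[x Ex <-] nB]].
   split; first by exists x.
   by move=> [y [By Ey]] /(fE (mem_set Ey) (mem_set Ex)) yx; apply: nBx; rewrite -yx.
  by exists x => //; split => // Bx; apply: nB; exists x.
 - move=> F mF; rewrite setI_bigcupl image_bigcup; exact: bigcupT_measurable.
move=> _ [a [b ->]] /=; apply: image_compact; rewrite setIC.
by apply: compact_closedI => //; exact: closed_box.
Qed.

End injective_images.
Variables (f : Rn -> Rn) (L a b : R) (E : set Rn).
Hypotheses (fL : nlip L f).
Hypotheses (cE : compact E) (a0 : 0 < a) (b0 : 0 <= b).
Hypothesis fE : forall x y, E x -> E y ->
 a * `|x - y| <= `|f x - f y| <= b * `|x - y|.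

Let cf : continuous f. Proof. exact: lip_continuous fL. Qed.

Lemma bilipschitz_inj : set_inj E f.
Proof.
move=> x y /set_mem Ex /set_mem Ey fxy; apply/eqP; rewrite -subr_eq0 -normr_le0.
have /andP[+ _] := fE Ex Ey; rewrite fxy subrr normr0.
by rewrite pmulr_rle0.
Qed.

Let inner (A : set Rn) (e : R) : measurable A -> A `<=` E -> 0 < e ->
 exists C, [/\ compact C, C `<=` A & (mu (A `\` C) < e%:E)%E].
Proof.
move=> mA AE e0; have [N N0 EN] := compact_sub_cube cE.
have mr := meas_cube N : measurable (cube N : set 'rV[R]_n).
pose nu := mfrestr mr (cube_lty N).
have [K [U [cK oU KA AU UK]]] := @borel_regular _ _ nu _ mA _ e0.
have mK : measurable K by exact: closed_meas.
have mU : measurable U by exact: open_meas.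
exists K; split => //.
 by apply: (closed_cube_compact N0) => //; exact: subset_trans KA (subset_trans AE EN).
apply: le_lt_trans UK; apply: le_mu_sub => //.
- exact: measurableD.
- by apply: measurableI => //; exact: measurableD.
- by move=> x [Ax nK]; split; [split => //; exact: AU|exact/EN/AE].
Qed.

(** [A] is exhausted from inside by a compact set [C], on which [f] is [b]-Lipschitz and has an
    [a^-1]-Lipschitz inverse. The global constant [L] makes the image of the remainder small. *)
Lemma bilipschitz_image_measure (A : set Rn) : measurable A -> A `<=` E ->
 [/\ measurable (f @` A), (mu (f @` A) <= (b ^+ n)%:E * mu A)%E &
   ((a ^+ n)%:E * mu A <= mu (f @` A))%E].
Proof.
move=> mA AE; have [N N0 EN] := compact_sub_cube cE.
have mfA : measurable (f @` A).
 by rewrite -(setIidl AE); apply: measurable_image_inj => //; exact: bilipschitz_inj.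
have imC C : compact C -> measurable (f @` C).
 move=> cC; apply: compact_meas; apply: continuous_compact => //.
 exact: continuous_subspaceT.
split => //.
 apply/lee_addgt0Pr => e e0.
 pose e' := e / (`|L| ^+ n + 1); have e'0 : 0 < e'.
  by rewrite divr_gt0// ltr_wpDl// exprn_ge0.
 have [C [cC CA AC]] := inner mA AE e'0.
 have mC := compact_meas cC.
 have mAC : measurable (A `\` C) by exact: measurableD.
 have ACN : A `\` C `<=` cube N by move=> x [/AE/EN].
 have [B [mB fB Ble]] := lipschitz_image_cover fL mAC N0 ACN e'0.
 apply: (@le_trans _ _ (mu (f @` C `|` B))).
  apply: le_mu_sub => //; first by apply: measurableU => //; exact: imC.
  move=> _ [x Ax <-]; have [Cx|nCx] := pselect (C x); first by left; exists x.
  by right; apply: fB; exists x.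
 apply: (le_trans (measureU2 _ (imC _ cC) mB)); apply: leeD.
  apply: (@le_trans _ _ ((b ^+ n)%:E * mu C)%E).
   apply: lipschitz_image_measure => //; first exact: imC.
   by move=> x y /CA/AE Ex /CA/AE Ey; have /andP[] := fE Ex Ey.
  by rewrite lee_wpmul2l ?lee_fin ?exprn_ge0//; apply: le_mu_sub.
 apply: (le_trans Ble); apply: (@le_trans _ _ ((`|L| ^+ n)%:E * e'%:E + e'%:E)%E).
  by rewrite leeD2r// lee_wpmul2l ?lee_fin ?exprn_ge0// ltW.
 by rewrite -EFinM -EFinD lee_fin /e' -[X in _ + X]mul1r -mulrDl mulrC divfK// gt_eqF// ltr_wpDl// exprn_ge0.
apply/lee_addgt0Pr => e e0.
pose e' := e / a ^+ n; have e'0 : 0 < e' by rewrite divr_gt0// exprn_gt0.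
have [C [cC CA AC]] := inner mA AE e'0.
have mC := compact_meas cC.
have mAC : measurable (A `\` C) by exact: measurableD.
have /choice[g gP] : forall y, exists x, (f @` C) y -> C x /\ f x = y.
 move=> y; have [[x Cx fx]|ny] := pselect ((f @` C) y); last by exists 0.
 by exists x.
have gfE : g @` (f @` C) = C.
 apply/seteqP; split => [_ [_ [x Cx <-] <-]|x Cx].
  by have [] := gP (f x) (imageP f Cx).
 exists (f x); first exact: imageP.
 have [Cg fg] := gP (f x) (imageP f Cx).
 by apply: bilipschitz_inj => //; apply/mem_set/AE/CA.
have Cle : (mu C <= (a^-1 ^+ n)%:E * mu (f @` C))%E.
 rewrite -[X in (mu X <= _)%E]gfE; apply: lipschitz_image_measure.
 - by apply: continuous_compact => //; exact: continuous_subspaceT.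
 - by rewrite gfE.
 - by rewrite invr_ge0 ltW.
 - move=> x y Cx Cy; have [Cgx fgx] := gP _ Cx; have [Cgy fgy] := gP _ Cy.
  rewrite [a^-1 * _]mulrC ler_pdivlMr// mulrC.
  have /andP[+ _] := fE (AE _ (CA _ Cgx)) (AE _ (CA _ Cgy)).
  by rewrite fgx fgy.
apply: (@le_trans _ _ ((a ^+ n)%:E * (mu C + e'%:E))%E).
 rewrite lee_wpmul2l ?lee_fin ?exprn_ge0 ?(ltW a0)//.
 apply: (@le_trans _ _ (mu (C `|` (A `\` C)))).
  apply: le_mu_sub => //; first exact: measurableU.
  by move=> x Ax; have [Cx|nCx] := pselect (C x); [left|right].
 by apply: (le_trans (measureU2 _ mC mAC)); rewrite leeD2l// ltW.
rewrite ge0_muleDr ?lee_fin ?(ltW e'0)//; apply: leeD; last first.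
 by rewrite -EFinM lee_fin /e' mulrC divfK// gt_eqF// exprn_gt0.
apply: (@le_trans _ _ ((a ^+ n)%:E * ((a^-1 ^+ n)%:E * mu (f @` C)))%E).
 by rewrite lee_wpmul2l ?lee_fin ?exprn_ge0 ?(ltW a0).
rewrite muleA -EFinM exprVn mulfV ?gt_eqF ?exprn_gt0// mul1e.
by apply: le_mu_sub => //; [exact: imC|exact: image_subset].
Qed.

End bilipschitz_images.

Lemma norm_near_bounds (R : realType) (V : normedModType R) (e : R) (v w : V) :
 `|w - v| <= e * `|v| -> (1 - e) * `|v| <= `|w| <= (1 + e) * `|v|.
Proof.
move=> h; rewrite mulrBl mulrDl mul1r; apply/andP; split.
 rewrite lerBlDr (le_trans _ (lerD (lexx _) h))//.
 by have := ler_normB w (w - v); rewrite opprB addrC subrK.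
by rewrite -{1}[w](subrK v) addrC (le_trans (ler_normD _ _))// lerD2l.
Qed.

Section change_of_variables.
Context {R : realType} {d1 d2 : measure_display}.
Context {X : measurableType d1} {Y : measurableType d2}.
Variables (muX : {measure set X -> \bar R}) (muY : {measure set Y -> \bar R}).
Variables (t : Y -> X) (B : set Y) (w : X -> R).
Hypotheses (mt : measT t) (mB : measurable B).
Hypotheses (mw : measT w) (w0 : forall x, 0 <= w x).
Hypothesis tw : forall A, measurable A ->
 muY (B `&` t @^-1` A) = (\int[muX]_(x in A) (w x)%:E)%E.

Import HBNNSimple.

Let nnsfun_change (h : {nnsfun X >-> R}) :
 (\int[muY]_(y in B) (h (t y))%:E = \int[muX]_x ((h x)%:E * (w x)%:E))%E.
Proof.
transitivity (\int[muY]_(y in B) (\sum_(r \in range h) (r * \1_(h @^-1` [set r]) (t y))%:E))%E.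
 by apply: eq_integral => y _; rewrite fimfunE -fsumEFin.
have mh r : measurable (h @^-1` [set r]) by exact: measurable_sfunP.
rewrite ge0_integral_fsum//; last 2 first.
- move=> r; apply/measurable_EFinP/measurable_funTS.
 apply: measurable_funM => //.
 exact: (measurableT_comp (@measurable_indic _ _ R setT _ (mh r)) mt).
- by move=> r y _; exact: nnfun_muleindic_ge0.
transitivity (\int[muX]_x (\sum_(r \in range h) (r * \1_(h @^-1` [set r]) x)%:E * (w x)%:E))%E; last first.
 apply: eq_integral => x _.
 rewrite -ge0_mule_fsuml => [|r]; last exact: nnfun_muleindic_ge0.
 by rewrite fsumEFin// -(fimfunE _ x).
rewrite ge0_integral_fsum//; last 2 first.
- move=> r; apply: emeasurable_funM; apply/measurable_EFinP => //.
 exact: measurable_funM.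
- by move=> r x _; rewrite mule_ge0 ?lee_fin//; exact: nnfun_muleindic_ge0.
apply: eq_fsbigr => r /set_mem[x0 _ rE].
have r0 : 0 <= r by rewrite -rE.
under eq_integral do rewrite EFinM.
rewrite ge0_integralZl//; last first.
 apply/measurable_EFinP/measurable_funTS.
 exact: (measurableT_comp (@measurable_indic _ _ R setT _ (mh r)) mt).
under [RHS]eq_integral do rewrite EFinM -muleA.
rewrite ge0_integralZl//; last 2 first.
- by apply: emeasurable_funM; apply/measurable_EFinP => //; exact: measurable_indic.
- by move=> x _; rewrite mule_ge0 ?lee_fin.
congr (_ * _)%E.
rewrite (_ : (fun y => (\1_(h @^-1` [set r]) (t y))%:E) = EFin \o \1_(t @^-1` (h @^-1` [set r]))); last first.
 by apply/funext => y /=; rewrite !indicE.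
rewrite integral_indic//; last by rewrite -[X in measurable X]setTI; exact: mt.
rewrite setIC tw// integral_mkcond; apply: eq_integral => x _.
by rewrite patchE indicE; case: (_ \in _); rewrite ?mul1e ?mul0e.
Qed.

(** Monotone approximation by simple functions. In the area formula [t] is an inverse branch of the
    map, [B] its domain and [w] the Jacobian factor. *)
Lemma ge0_change_of_variables (H : X -> \bar R) : measT H ->
 (forall x, (0 <= H x)%E) ->
 (\int[muY]_(y in B) H (t y) = \int[muX]_x (H x * (w x)%:E))%E.
Proof.
move=> mH H0; pose h := nnsfun_approx measurableT mH.
have hH x : (EFin \o h n) x @[n --> \oo] --> H x by exact: cvg_nnsfun_approx.
have hnd x : {homo (fun n => (h n x)%:E) : a b / (a <= b)%N >-> (a <= b)%E}.
 by move=> a b ab; rewrite lee_fin; exact/lefP/nd_nnsfun_approx.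
have -> : (\int[muY]_(y in B) H (t y) =
  lim (\int[muY]_(y in B) (h n (t y))%:E @[n --> \oo]))%E.
 rewrite -monotone_convergence//.
 - by apply: eq_integral => y _; apply/esym/cvg_lim => //; exact: hH.
 - by move=> n; apply/measurable_EFinP/measurable_funTS/(measurableT_comp _ mt)/measurable_funP.
 - by move=> n y _; rewrite lee_fin.
have -> : (\int[muX]_x (H x * (w x)%:E) =
  lim (\int[muX]_x ((h n x)%:E * (w x)%:E) @[n --> \oo]))%E.
 rewrite -monotone_convergence//.
 - by apply: eq_integral => x _; apply/esym/cvg_lim => //; apply: cvgeZr => //; exact: hH.
 - by move=> n; apply: emeasurable_funM; apply/measurable_EFinP => //; exact/measurable_funP.
 - by move=> n x _; rewrite mule_ge0 ?lee_fin.
 - by move=> x _ a b ab; rewrite lee_wpmul2r ?lee_fin//; exact: hnd.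
by congr (limn _); apply/funext => n; exact: nnsfun_change.
Qed.

End change_of_variables.

Lemma le_of_ratio (R : realType) (x y : \bar R) : (0 <= y)%E -> (y < +oo)%E ->
 (forall c : R, 1 < c -> (x <= c%:E * y)%E) -> (x <= y)%E.
Proof.
move=> y0 yoo H; have yf : y \is a fin_num by rewrite ge0_fin_numE.
have fy0 : 0 <= fine y by exact: fine_ge0.
apply/lee_addgt0Pr => e e0.
have d0 : 0 < e / (fine y + 1) by rewrite divr_gt0// ltr_wpDl.
apply: (le_trans (H (1 + e / (fine y + 1)) _)); first by rewrite ltrDl.
rewrite -(fineK yf) -EFinM -EFinD lee_fin mulrDl mul1r lerD2l.
by rewrite mulrAC -mulrA ger_pMr// ler_pdivrMr ?ltr_wpDl// mul1r lerDl.
Qed.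

Section area_formula.
Context {R : realType} {m : nat}.
Notation Rn := 'rV[R]_m.+1.
Notation mu := (lebesgue_rV R m.+1).
Variables (f : Rn -> Rn) (L : R).
Hypotheses (fL : nlip L f).

(** [S] plays the role of an approximate inverse of the Jacobian: on the piece, [f] followed by [S]
    differs from the identity by at most the fraction [e] of the displacement. Two points of the
    piece are at distance at most [d], so the composite is bi-Lipschitz there, with constants
    [1 - e] and [1 + e]. *)
Definition affine_piece (S : 'M[R]_m.+1) (e d : R) (q : Rn) : set Rn :=
 [set x | (forall h, `|h| <= d -> `|(f (x + h) - f x) *m S - h| <= e * `|h|) /\
      `|x - q| <= d / 2].

Lemma compact_affine_piece S e d q : compact (affine_piece S e d q).
Proof.
pose N := `|q| + `|d| / 2.
have N0 : 0 <= N by rewrite addr_ge0// divr_ge0.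
apply: (closed_cube_compact N0).
 rewrite (_ : affine_piece _ _ _ _ = (\bigcap_(h in [set h : Rn | `|h| <= d])
   ((fun x => `|(f (x + h) - f x) *m S - h|) @^-1` [set y | y <= e * `|h|])) `&`
   ((fun x => `|x - q|) @^-1` [set y | y <= d / 2])).
  have c1 (h : Rn) : continuous (fun x : Rn => `|(f (x + h) - f x) *m S - h|).
   apply: (@lip_continuous _ _ R^o _ ((\sum_i \sum_j `|S i j|) * (2 * L))) => x y.
   rewrite (le_trans (ler_dist_dist _ _))//.
   rewrite (_ : _ - _ = ((f (x + h) - f (y + h)) - (f x - f y)) *m S); last first.
    rewrite !mulmxBl; move: (_ *m S) (_ *m S) (_ *m S) (_ *m S) => u v w z.
    by apply/rowP => i; rewrite !mxE; ring.
   rewrite (le_trans (norm_mulmx_le _ _))// -mulrA ler_wpM2l//.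
    by apply: sumr_ge0 => i _; apply: sumr_ge0.
   rewrite (le_trans (ler_normB _ _))// mulrDl mul1r mulrDl lerD//.
   by rewrite (le_trans (fL _ _))// opprD addrACA subrr addr0.
  have c2 : continuous (fun x : Rn => `|x - q|).
   apply: (@lip_continuous _ _ R^o _ 1) => x y.
   by rewrite (le_trans (ler_dist_dist _ _))// opprB addrA subrK mul1r.
  apply: closedI.
   by apply: closed_bigI => h _; apply: closed_comp; [move=> x _; exact: c1|exact: closed_le].
  by apply: closed_comp; [move=> x _; exact: c2|exact: closed_le].
 by apply/seteqP; split => x [h1 h2]; split => // h hd; exact: h1.
move=> x [_ xq]; apply/(cubeP _ N0); rewrite -[x](subrK q) (le_trans (ler_normD _ _))//.
by rewrite addrC lerD2l (le_trans xq)// ler_pM2r// ler_norm.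
Qed.

Lemma affine_piece_near S e d q x y : affine_piece S e d q x -> affine_piece S e d q y ->
 `|(f x - f y) *m S - (x - y)| <= e * `|x - y|.
Proof.
move=> [xE xq] [yE yq]; have := yE (x - y).
rewrite [y + _]addrC subrK; apply; rewrite [d]splitr (_ : x - y = (x - q) - (y - q)).
 by rewrite (le_trans (ler_normB _ _))// lerD.
by rewrite opprB addrA subrK.
Qed.

Lemma affine_piece_bilipschitz S e d q x y : affine_piece S e d q x -> affine_piece S e d q y ->
 (1 - e) * `|x - y| <= `|f x *m S - f y *m S| <= (1 + e) * `|x - y|.
Proof.
by move=> Ex Ey; rewrite -mulmxBl; apply: norm_near_bounds; exact: (affine_piece_near Ex Ey).
Qed.

Lemma affine_piece_det S e d q x J : 0 < d -> 0 <= e < 1 -> affine_piece S e d q x ->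
 isdiff f x J ->
 (1 - e) ^+ m.+1 <= `|\det J| * `|\det S| <= (1 + e) ^+ m.+1.
Proof.
move=> d0 /andP[e0 e1] [xE _] fJ.
have gJ : isdiff (fun y => f y *m S - y) x (J *m S - 1%:M).
 have s0 : 0 <= \sum_i \sum_j `|S i j| by apply: sumr_ge0 => i _; apply: sumr_ge0.
 have s1 : 0 < \sum_i \sum_j `|S i j| + 1 by rewrite ltr_wpDl.
 move=> c c0; have [d' d'0 fd'] := fJ _ (divr_gt0 c0 s1).
 exists d' => // h hd'.
 rewrite (_ : _ - _ = (f (x + h) - f x - h *m J) *m S); last first.
  rewrite mulmxBr mulmx1 !mulmxBl mulmxA.
  set u := _ *m S; set v := f x *m S; set w := _ *m S.
  by apply/rowP => i; rewrite !mxE; ring.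
 rewrite (le_trans (norm_mulmx_le _ _))//.
 apply: (@le_trans _ _ ((\sum_i \sum_j `|S i j|) * (c / (\sum_i \sum_j `|S i j| + 1) * `|h|))).
  by rewrite ler_wpM2l// fd'.
 rewrite mulrA ler_wpM2r// mulrCA ger_pMr// ler_pdivrMr// mul1r lerDl//.
have JS (h : Rn) : `|h *m (J *m S) - h| <= e * `|h|.
 rewrite (_ : _ - h = h *m (J *m S - 1%:M)); last by rewrite mulmxBr mulmx1.
 apply: (isdiff_norm_le gJ).
 exists d => // {}h hd; have := xE h hd.
 rewrite mulmxBl; congr (`|_| <= _).
 set u := _ *m S; set v := f x *m S.
 by apply/rowP => i; rewrite !mxE; ring.
rewrite -normrM -det_mulmx; apply/andP; split.
 apply: (det_norm_ge _ _).2; first by rewrite subr_gt0.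
 by move=> h; have /andP[] := norm_near_bounds (JS h).
apply: det_norm_le => [|h]; first by rewrite addr_ge0.
by have /andP[] := norm_near_bounds (JS h).
Qed.

(** A rational [S] close to [invmx J] takes half of the tolerance, the differentiability of [f] at
    [x] the other half. Rational parameters keep the family of pieces countable. *)
Lemma affine_piece_cover e x J : 0 < e < 1 -> isdiff f x J -> \det J != 0 ->
 exists (S : 'M[rat]_m.+1) (k : nat) (q : 'rV[rat]_m.+1),
  (map_mx ratr S : 'M[R]_m.+1) \in unitmx /\
  affine_piece (map_mx ratr S) e k.+1%:R^-1 (map_mx ratr q) x.
Proof.
move=> /andP[e0 e1] fJ J0.
have uJ : J \in unitmx by rewrite unitmxE unitfE.
pose s : R := \sum_i \sum_j `|J i j|.
have s0 : 0 <= s by apply: sumr_ge0 => i _; apply: sumr_ge0.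
pose N : R := m.+1%:R; have N0 : 0 < N by rewrite ltr0n.
pose c := e / 2 / ((s + 1) * (N * N)).
have c0 : 0 < c by rewrite !divr_gt0// !mulr_gt0// ltr_wpDl.
have /choice[Sr SrP] i : exists q : 'rV[rat]_m.+1, `|row i (invmx J) - map_mx ratr q| < c.
 exact: near_rat_row.
pose S := \matrix_i Sr i.
have SJ (h : Rn) : `|h *m (J *m map_mx ratr S) - h| <= e / 2 * `|h|.
 have -> : h *m (J *m map_mx ratr S) - h = (h *m J) *m (map_mx ratr S - invmx J).
  by rewrite mulmxBr mulmxK// mulmxA.
 rewrite (le_trans (norm_mulmx_le _ _))//.
 apply: (@le_trans _ _ (N * N * c * (s * `|h|))).
  apply: ler_pM => //; first by apply: sumr_ge0 => i _; apply: sumr_ge0.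
   apply: (@le_trans _ _ (\sum_(i < m.+1) \sum_(j < m.+1) c)).
    apply: ler_sum => i _; apply: ler_sum => j _.
    have := coord_le (row i (invmx J) - map_mx ratr (Sr i)) j.
    by rewrite !mxE distrC => /le_trans; apply; exact/ltW/SrP.
   by rewrite !sumr_const !card_ord -mulrnA -mulr_natl natrM.
  exact: norm_mulmx_le.
 rewrite mulrA ler_wpM2r// /c.
 rewrite (_ : N * N * _ * s = e / 2 * (s / (s + 1))).
  by rewrite ger_pMr ?divr_gt0// ler_pdivrMr ?ltr_wpDl// mul1r lerDl.
 by field; rewrite !gt_eqF// ltr_wpDl.
have uS : (map_mx ratr S : 'M[R]_m.+1) \in unitmx.
 have e2 : 0 < 1 - e / 2 by rewrite subr_gt0 ltr_pdivrMr// mul1r (lt_trans e1)// ltr1n.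
 have [] := @det_norm_ge R m (J *m map_mx ratr S) (1 - e / 2) e2.
  by move=> h; have /andP[] := norm_near_bounds (SJ h).
 by rewrite unitmx_mul => /andP[].
pose t : R := \sum_i \sum_j `|(map_mx ratr S : 'M[R]_m.+1) i j|.
have t0 : 0 <= t by apply: sumr_ge0 => i _; apply: sumr_ge0.
have t1 : 0 < t + 1 by rewrite ltr_wpDl.
have [|d d0 fd] := fJ (e / 2 / (t + 1)); first by rewrite !divr_gt0.
have [k kd] := exists_inv_nat d0.
have [|q qx] := @near_rat_row _ _ x (k.+1%:R^-1 / 2); first by rewrite divr_gt0.
exists S, k, q; split => //; split; last exact: ltW.
move=> h hk; have {}fd := fd h (le_trans hk kd).
rewrite (_ : _ - h = (f (x + h) - f x - h *m J) *m map_mx ratr S +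
  (h *m (J *m map_mx ratr S) - h)); last first.
 by rewrite [X in _ = X + _]mulmxBl -mulmxA addrA subrK.
rewrite (le_trans (ler_normD _ _))// [e]splitr mulrDl lerD//.
rewrite (le_trans (norm_mulmx_le _ _))//.
apply: (@le_trans _ _ (t * (e / 2 / (t + 1) * `|h|))); first by rewrite ler_wpM2l.
by rewrite mulrA ler_wpM2r// mulrCA ger_pMr ?divr_gt0// ler_pdivrMr// mul1r lerDl.
Qed.

Let D := detD f.
Let mD : measT (fun x => (`|D x|)%:E).
Proof. apply/measurable_EFinP; apply: measurableT_comp => //; exact: meas_detD fL. Qed.

Definition regular_points : set Rn := [set x | isdiff f x ('J f x) /\ detD f x != 0].
Let good := regular_points.

Lemma measurable_regular_points : measurable regular_points.
Proof.
apply: measurableI; first exact: (measurable_isdiff fL).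
rewrite [X in measurable X](_ : _ = D @^-1` (~` [set 0])).
 by rewrite -[X in measurable X]setTI; apply: (meas_detD fL) => //; exact: measurableC.
by apply/seteqP; split => x /= /eqP.
Qed.

Definition almost_affine (c : R) (E : set Rn) := [/\ compact E, set_inj E f &
 forall A, measurable A -> A `<=` E -> A `<=` good ->
 [/\ measurable (f @` A), (mu (f @` A) <= c%:E * \int[mu]_(x in A) (`|D x|)%:E)%E &
   (\int[mu]_(x in A) (`|D x|)%:E <= c%:E * mu (f @` A))%E]].

(** The measure of the image of [A] times [|\det T|] and the integral of [|D x| * |\det T|] over [A]
    both lie between [(1 - e) ^+ m.+1] and [(1 + e) ^+ m.+1] times [mu A], so they differ at most by
    the factor [c]. *)
Lemma almost_affine_piece (T : 'M[R]_m.+1) e d q c : 0 < e < 1 -> 0 < d -> T \in unitmx ->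
 (1 + e) ^+ m.+1 <= c * (1 - e) ^+ m.+1 -> almost_affine c (affine_piece T e d q).
Proof.
move=> /andP[e0 e1] d0 uS ec.
have cE : compact (affine_piece T e d q) by exact: compact_affine_piece.
have a0 : 0 < 1 - e by rewrite subr_gt0.
have b0 : 0 <= 1 + e by rewrite addr_ge0// ltW.
have aN : 0 < (1 - e) ^+ m.+1 by exact: exprn_gt0.
have bN : 0 < (1 + e) ^+ m.+1 by rewrite exprn_gt0// addr_gt0.
have dS : 0 < `|\det T| by rewrite normr_gt0 -unitfE -unitmxE.
have c0 : 0 < c by rewrite -(pmulr_lgt0 _ aN) (lt_le_trans bN).
pose g x := f x *m T.
have gL x y : `|g x - g y| <= ((\sum_i \sum_j `|T i j|) * L) * `|x - y|.
 rewrite /g -mulmxBl (le_trans (norm_mulmx_le _ _))// -mulrA ler_wpM2l//.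
 by apply: sumr_ge0 => i _; apply: sumr_ge0.
have gE := affine_piece_bilipschitz (S := T) (e := e) (d := d) (q := q).
split => //.
 move=> x y Ex Ey fxy; apply: (bilipschitz_inj a0 gE) => //.
 by rewrite fxy.
move=> A mA AE AG.
have [mgA gA1 gA2] := bilipschitz_image_measure gL cE a0 b0 gE mA AE.
have gAE : g @` A = (fun x => x *m T) @` (f @` A) by rewrite image_comp.
have mfA : measurable (f @` A).
 rewrite -(setIidl AE); apply: measurable_image_inj => //.
  exact: lip_continuous fL.
 move=> x y Ex Ey fxy; apply: (bilipschitz_inj a0 gE) => //.
 by rewrite fxy.
have [_ Sf] := linear_image uS mfA; rewrite gAE Sf in gA1 gA2.
have mDA : measurable_fun A (fun x => (`|D x|)%:E) by apply: measurable_funTS; exact: mD.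
have intE : (\int[mu]_(x in A) (`|D x| * `|\det T|)%:E =
  `|\det T|%:E * \int[mu]_(x in A) (`|D x|)%:E)%E.
 under eq_integral do rewrite EFinM muleC.
 by rewrite ge0_integralZl// => x _; rewrite lee_fin.
have mDS : measurable_fun A (fun x => (`|D x| * `|\det T|)%:E).
 by apply/measurable_EFinP; apply: measurable_funM => //; exact/measurable_EFinP.
have DS x : A x -> (1 - e) ^+ m.+1 <= `|D x| * `|\det T| <= (1 + e) ^+ m.+1.
 move=> Ax; have [fx _] := AG _ Ax.
 by apply: (affine_piece_det d0 _ (AE _ Ax) fx); rewrite (ltW e0).
have lo : (((1 - e) ^+ m.+1)%:E * mu A <= `|\det T|%:E * \int[mu]_(x in A) (`|D x|)%:E)%E.
 rewrite -intE -integral_cst//; apply: ge0_le_integral => //.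
 - by move=> x _; rewrite lee_fin ltW.
 - by move=> x Ax; rewrite lee_fin; have /andP[] := DS x Ax.
have hi : (`|\det T|%:E * \int[mu]_(x in A) (`|D x|)%:E <= ((1 + e) ^+ m.+1)%:E * mu A)%E.
 rewrite -intE -integral_cst//; apply: ge0_le_integral => //.
 - by move=> x Ax; rewrite lee_fin; have /andP[] := DS x Ax.
have ecE (z : \bar R) : (0 <= z)%E -> (((1 + e) ^+ m.+1)%:E * z <= c%:E * (((1 - e) ^+ m.+1)%:E * z))%E.
 by move=> z0; rewrite muleA -EFinM lee_wpmul2r// lee_fin.
split => //; rewrite -(@lee_pmul2l _ `|\det T|%:E)// muleCA.
 apply: (le_trans gA1); apply: (le_trans (ecE _ _)) => //.
 by rewrite lee_wpmul2l// lee_fin ltW.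
apply: (le_trans hi); apply: (le_trans (ecE _ _)) => //.
by rewrite lee_wpmul2l// lee_fin ltW.
Qed.

Lemma almost_affine_cover (c : R) : 1 < c ->
 exists2 E : (set Rn)^nat, forall i, almost_affine c (E i) & good `<=` \bigcup_i E i.
Proof.
move=> c1.
have [e e01 ec] : exists2 e, 0 < e < 1 & (1 + e) ^+ m.+1 <= c * (1 - e) ^+ m.+1.
 pose F (e : R) := c * (1 - e) ^+ m.+1 - (1 + e) ^+ m.+1.
 have cF : continuous F.
  move=> x; apply: cvgB; first apply: cvgM; first exact: cvg_cst.
   apply: (@cvg_comp _ _ _ (fun e : R => 1 - e) (fun z : R => z ^+ m.+1)); last exact: exprn_continuous.
   by apply: cvgB; [exact: cvg_cst|exact: cvg_id].
  apply: (@cvg_comp _ _ _ (fun e : R => 1 + e) (fun z : R => z ^+ m.+1)); last exact: exprn_continuous.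
  by apply: cvgD; [exact: cvg_cst|exact: cvg_id].
 have F0 : 0 < F 0 by rewrite /F subr0 addr0 expr1n mulr1 subr_gt0.
 have /nbhs_ballP[d /= d0 dF] : \forall x \near (0 : R), 0 < F x.
  exact: (cvgr_gt (F 0) (cF 0)).
 exists (Num.min (d / 2) 2^-1).
  rewrite lt_min divr_gt0//= invr_gt0 ltr0n/= gt_min; apply/orP; right.
  by rewrite invf_lt1// ltr1n.
 rewrite -subr_ge0; apply/ltW/dF.
 rewrite /ball/= sub0r normrN gtr0_norm ?lt_min ?divr_gt0 ?invr_gt0 ?ltr0n// gt_min.
 by rewrite ltr_pdivrMr// ltr_pMr// ltr1n.
pose I := ('M[rat]_m.+1 * nat * 'rV[rat]_m.+1)%type.
pose E i := if @unpickle I i is Some (T, k, q) then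
  if (map_mx ratr T : 'M[R]_m.+1) \in unitmx then
   affine_piece (map_mx ratr T) e k.+1%:R^-1 (map_mx ratr q) else set0
 else set0.
have set0P : almost_affine c set0.
 split; first exact: compact0.
  by move=> x y /set_mem[].
 move=> A mA; rewrite subset0 => ->; rewrite image_set0 integral_set0 measure0.
 by rewrite mule0; split.
exists E => [i|x [fx Dx]]; last first.
 have [T [k [q [uS xE]]]] := affine_piece_cover e01 fx Dx.
 by exists (pickle (T, k, q)) => //; rewrite /E pickleK uS.
rewrite /E; case: unpickle => // -[[T k] q]; case: ifPn => // uS.
by apply: almost_affine_piece => //; rewrite invr_gt0.
Qed.

(** Since [f] is injective on [K], both sides are countably additive over the disjoint version of a
    cover by pieces, hence equal up to any factor [c > 1]. The image of [K] is compact, so both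
    sides are finite and [c] may tend to 1. *)
Lemma area_inj_compact (K A : set Rn) : compact K -> set_inj K f ->
 measurable A -> A `<=` K -> A `<=` good ->
 measurable (f @` A) /\ mu (f @` A) = (\int[mu]_(x in A) (`|D x|)%:E)%E.
Proof.
move=> cK iK mA AK AG.
have cf : continuous f := lip_continuous fL.
have mim B : measurable B -> B `<=` A -> measurable (f @` B).
 by move=> mB BA; rewrite -(setIidl (subset_trans BA AK)); exact: measurable_image_inj.
split; first exact: mim.
have mDB B : measurable_fun B (fun x => (`|D x|)%:E) by apply: measurable_funTS; exact: mD.
have fK : (mu (f @` A) < +oo)%E.
 apply: le_lt_trans (compact_lty (continuous_compact (continuous_subspaceT cf) cK)).
 apply: le_mu_sub; [exact: mim| |exact: image_subset].
 by apply: compact_meas; apply: continuous_compact => //; exact: continuous_subspaceT.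
have key c : 1 < c -> (mu (f @` A) <= c%:E * \int[mu]_(x in A) (`|D x|)%:E)%E /\
  (\int[mu]_(x in A) (`|D x|)%:E <= c%:E * mu (f @` A))%E.
 move=> c1; have c0 : 0 <= c by rewrite ltW// (lt_trans ltr01).
 have [E EP Ecov] := almost_affine_cover c1.
 pose B := seqDU (fun i => A `&` E i).
 have mE i : measurable (A `&` E i).
  by apply: measurableI => //; apply: compact_meas; have [] := EP i.
 have mB i : measurable (B i) by apply: measurableD => //; exact: bigsetU_measurable.
 have BAE i : B i `<=` A `&` E i by move=> x [].
 have BA i : B i `<=` A by move=> x /BAE[].
 have BE i : B i `<=` E i by move=> x /BAE[].
 have tB : trivIset setT B := trivIset_seqDU _.
 have AB : A = \bigcup_i B i.
  rewrite -seqDU_bigcup_eq; apply/seteqP; split => [x Ax|x [i _ []]//].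
  by have [i _ Ei] := Ecov _ (AG _ Ax); exists i.
 have mfB i : measurable (f @` B i) by exact: mim.
 have fAE : mu (f @` A) = (\sum_(i <oo) mu (f @` B i))%E.
  rewrite [in LHS]AB image_bigcup measure_semi_bigcup//; last exact: bigcupT_measurable.
  move=> i j _ _ [_ [[x Bx <-] [y By fyx]]]; apply: tB => //; exists x; split => //.
  by rewrite -(iK y x (mem_set (AK _ (BA _ _ By))) (mem_set (AK _ (BA _ _ Bx))) fyx).
 have intE : (\int[mu]_(x in A) (`|D x|)%:E = \sum_(i <oo) \int[mu]_(x in B i) (`|D x|)%:E)%E.
  by rewrite [in LHS]AB ge0_integral_bigcup.
 rewrite fAE intE; split; (rewrite -nneseriesZl; last first).
 - by move=> i _; apply: integral_ge0 => x _; rewrite lee_fin.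
 - apply: lee_nneseries => i _; first by move=> _; exact: measure_ge0.
  by have [_ _ /(_ (B i) (mB i) (BE i))[]] := EP i => //; exact: subset_trans AG.
 - by move=> i _; exact: measure_ge0.
 - apply: lee_nneseries => i _; first by move=> _; apply: integral_ge0 => x _; rewrite lee_fin.
  by have [_ _ /(_ (B i) (mB i) (BE i))[]] := EP i => //; exact: subset_trans AG.
have fI : (\int[mu]_(x in A) (`|D x|)%:E < +oo)%E.
 apply: le_lt_trans (key 2 _).2 _; first by rewrite ltr1n.
 by apply: lte_mul_pinfty.
apply/eqP; rewrite eq_le; apply/andP; split; apply: le_of_ratio => //.
- exact: integral_ge0.
- by move=> c /key[].
- by move=> c /key[].
Qed.

Lemma measurable_abs_detD : measT (fun x => `|detD f x|).
Proof. by apply: measurableT_comp => //; exact: meas_detD fL. Qed.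

(** A cover with factor [c = 2] cuts the regular points into countably many pieces on which [f] is
    injective. [t j] inverts [f] on the image of [P j] and is 0 elsewhere, which makes it measurable
    on the whole space. *)
Lemma area_pieces : exists (P : (set Rn)^nat) (t : nat -> Rn -> Rn),
 [/\ (forall j, measurable (P j) /\ measurable (f @` P j)), trivIset setT P,
   \bigcup_j P j = regular_points,
   (forall j, measT (t j) /\ forall x, P j x -> t j (f x) = x) &
   forall j (H : Rn -> \bar R), measT H -> (forall x, (0 <= H x)%E) ->
   (\int[mu]_(y in f @` P j) H (t j y) = \int[mu]_(x in P j) (H x * (`|detD f x|)%:E))%E].
Proof.
have [K KP Kcov] := almost_affine_cover (ltr1n R 2 : 1 < 2%:R).
have mreg := measurable_regular_points.
have mK i : measurable (K i) by apply: compact_meas; have [] := KP i.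
have mF i : measurable (regular_points `&` K i) by exact: measurableI.
pose P := seqDU (fun i => regular_points `&` K i).
have mP j : measurable (P j) by apply: measurableD => //; exact: bigsetU_measurable.
have PK j : P j `<=` K j by move=> x [[]].
have Preg j : P j `<=` regular_points by move=> x [[]].
have area j A : measurable A -> measurable (f @` (A `&` P j)) /\
  mu (f @` (A `&` P j)) = (\int[mu]_(x in A `&` P j) (`|detD f x|)%:E)%E.
 move=> mA; have [cK iK _] := KP j.
 by apply: (area_inj_compact cK iK) => [|x [_ /PK]//|x [_ /Preg]//]; exact: measurableI.
have inj j x y : P j x -> P j y -> f x = f y -> x = y.
 by move=> Px Py; have [_ iK _] := KP j; apply: iK; apply/mem_set/PK.
have mfP j : measurable (f @` P j) by rewrite -[P j]setTI; have [] := area j setT measurableT.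
have /choice[t tP] j : exists t : Rn -> Rn, forall y,
  ((f @` P j) y -> P j (t y) /\ f (t y) = y) /\ (~ (f @` P j) y -> t y = 0).
 have /choice[t tP] : forall y, exists x, ((f @` P j) y -> P j x /\ f x = y) /\ (~ (f @` P j) y -> x = 0).
  move=> y; have [[x Px fx]|ny] := pselect ((f @` P j) y); last by exists 0.
  by exists x; split => // -[]; exists x.
 by exists t.
have tf j x : P j x -> t j (f x) = x.
 by move=> Px; have [/(_ (imageP f Px))[Pt ft] _] := tP j (f x); exact: inj Pt Px ft.
have tpre j A : f @` P j `&` t j @^-1` A = f @` (A `&` P j).
 apply/seteqP; split => [y [fPy tA]|_ [x [Ax Px] <-]].
  by have [/(_ fPy)[Pt ft] _] := tP j y; exists (t j y).
 by split; [exact: imageP|rewrite /= tf].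
have mt j : measT (t j).
 move=> _ A mA; rewrite setTI.
 have tc y : ~ (f @` P j) y -> t j y = 0 by move=> ny; have [_ ->] := tP j y.
 rewrite (_ : _ @^-1` _ = (f @` (A `&` P j)) `|` (~` (f @` P j) `&` [set _ | A 0])).
  apply: measurableU; first by have [] := area j A mA.
  apply: measurableI; [exact: measurableC|rewrite -[X in measurable X]setTI].
  exact: (@measurable_cst _ _ Rn Rn setT 0 measurableT _ mA).
 apply/seteqP; split => [y tA|y [|[/tc + A0]]]; last 2 first.
 - by rewrite -tpre => -[].
 - by move=> ty; rewrite /= ty.
 have [fPy|nfPy] := pselect ((f @` P j) y); first by left; rewrite -tpre.
 by right; split => //; rewrite /= -(tc _ nfPy).
exists P, t; split => //.
- exact: trivIset_seqDU.
- by rewrite -seqDU_bigcup_eq; apply/seteqP; split => [x [i _ []]//|x rx];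
  have [i _ Ki] := Kcov _ rx; exists i.
- by move=> j; split; [exact: mt|exact: tf].
- move=> j H mH H0.
 pose w (x : Rn) := `|detD f x| * \1_(P j) x.
 have mw : measT w.
  by apply: measurable_funM; [exact: measurable_abs_detD|exact: measurable_indic].
 rewrite (@ge0_change_of_variables _ _ _ _ _ mu mu (t j) (f @` P j) w)//.
 + rewrite [RHS]integral_mkcond; apply: eq_integral => x _; rewrite patchE /w indicE.
  by case: (_ \in _); rewrite ?mulr1// mulr0 mule0.
 + by move=> x; rewrite mulr_ge0.
 + move=> A mA; rewrite tpre; apply: etrans (area j A mA).2 _; rewrite integral_mkcondr.
  apply: eq_integral => x _; rewrite patchE /w indicE.
  by case: (_ \in _); rewrite ?mulr1// mulr0.
Qed.

Variables (P : (set Rn)^nat) (t : nat -> Rn -> Rn).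
Hypotheses (mP : forall j, measurable (P j) /\ measurable (f @` P j)).
Hypotheses (tP : trivIset setT P) (UP : \bigcup_j P j = regular_points).
Hypothesis mt : forall j, measT (t j) /\ forall x, P j x -> t j (f x) = x.
Hypothesis change : forall j (H : Rn -> \bar R), measT H -> (forall x, (0 <= H x)%E) ->
 (\int[mu]_(y in f @` P j) H (t j y) = \int[mu]_(x in P j) (H x * (`|detD f x|)%:E))%E.

Definition branch (w : Rn -> R) j (y : Rn) : R := w (t j y) * \1_(f @` P j) y.

(** Sum of [w] over the regular points of the fibre of [y]: each piece contains at most one of them.
    The extended real series makes sense for [w >= 0] without knowing that the fibre is finite. *)
Definition fiber_sum (w : Rn -> R) (y : Rn) : \bar R := (\sum_(j <oo) (branch w j y)%:E)%E.

Lemma measurable_branch w j : measT w -> measT (branch w j).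
Proof.
move=> mw; apply: measurable_funM; last by apply: measurable_indic; have [] := mP j.
by apply: measurableT_comp => //; have [] := mt j.
Qed.

Lemma measurable_fiber_sum (w : Rn -> R) : measT w -> allnneg w ->
 measT (fiber_sum w).
Proof.
move=> mw w0; apply: ge0_emeasurable_sum => j *; first by rewrite lee_fin mulr_ge0.
by apply/measurable_EFinP; exact: measurable_branch.
Qed.

Lemma fiber_sum_ge0 w y : allnneg w -> (0 <= fiber_sum w y)%E.
Proof. by move=> w0; apply: nneseries_ge0 => j _ _; rewrite lee_fin mulr_ge0. Qed.

Lemma integral_regular_points (g : Rn -> \bar R) : measT g -> (forall x, (0 <= g x)%E) ->
 (forall x, detD f x = 0 -> g x = 0%E) ->
 (\int[mu]_x g x = \int[mu]_(x in regular_points) g x)%E.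
Proof.
move=> mg g0 gD; have mreg := measurable_regular_points.
rewrite [RHS]integral_mkcond; apply: ae_eq_integral => //.
 by apply/(measurable_restrictT _ mreg); exact: measurable_funTS.
have := ae_isdiff fL; apply: aeS => x fx _; rewrite patchE.
case: ifPn => // /negP nx; have [/gD//|Dx] := eqVneq (detD f x) 0.
by exfalso; apply: nx; apply/mem_set.
Qed.

(** The injective case summed over the pieces. Points with zero Jacobian contribute nothing to the
    right-hand side, and the points of non-differentiability form a null set. *)
Lemma integral_fiber_sum (w h : Rn -> R) : measT w -> allnneg w ->
 measT h -> allnneg h ->
 (\int[mu]_y (fiber_sum w y * (h y)%:E) = \int[mu]_x (w x * h (f x) * `|detD f x|)%:E)%E.
Proof.
move=> mw w0 mh h0.
have mf : measT f.
 by apply: cont_meas_map; exact: lip_continuous fL.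
have mhf : measT (fun x => h (f x)) by exact: measurableT_comp.
have mg : measT (fun x => (w x * h (f x) * `|detD f x|)%:E).
 apply/measurable_EFinP; apply: measurable_funM; first exact: measurable_funM.
 exact: measurable_abs_detD.
have b0 j y : (0 <= (branch w j y)%:E)%E by rewrite lee_fin mulr_ge0.
rewrite [RHS]integral_regular_points//; last 2 first.
- by move=> x; rewrite lee_fin !mulr_ge0.
- by move=> x ->; rewrite normr0 mulr0.
rewrite -UP ge0_integral_bigcup//; last 3 first.
- by move=> j; have [] := mP j.
- exact: measurable_funTS.
- by move=> x _; rewrite lee_fin !mulr_ge0.
transitivity (\int[mu]_y (\sum_(j <oo) ((h y)%:E * (branch w j y)%:E)))%E.
 by apply: eq_integral => y _; rewrite muleC -nneseriesZl.
rewrite integral_nneseries//; last 2 first.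
- move=> j; apply: emeasurable_funM; apply/measurable_EFinP => //; exact: measurable_branch.
- by move=> j y _; rewrite mule_ge0// lee_fin.
apply: eq_eseriesr => j _.
under [RHS]eq_integral do rewrite EFinM.
rewrite -(@change j (fun x => (w x * h (f x))%:E)); last 2 first.
- by apply/measurable_EFinP; exact: measurable_funM.
- by move=> x; rewrite lee_fin mulr_ge0.
rewrite [RHS]integral_mkcond; apply: eq_integral => y _; rewrite patchE /branch indicE.
case: ifPn => [/set_mem[x Px <-]|_]; last by rewrite mulr0 mule0.
by rewrite mulr1 (mt j).2// -EFinM mulrC.
Qed.

Lemma fiber_sum_ord (w : Rn -> R) y (J : nat) : allnneg w ->
 (forall j, (J <= j)%N -> branch w j y = 0) ->
 fiber_sum w y = (\sum_(0 <= j < J) branch w j y)%:E.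
Proof.
move=> w0 wJ; rewrite /fiber_sum (nneseries_split 0 J); last first.
 by move=> k _; rewrite lee_fin mulr_ge0.
rewrite eseries0 ?adde0 ?sumEFin// => j Jj _; by rewrite wJ.
Qed.

(** The series for the indicator of the cube has terms 0 and 1. Once it is finite, a tail below 1
    must vanish, so that only the first [J] branches can meet the cube and the series becomes the
    finite sum over the fibre. *)
Lemma fiber_sum_finite (w : Rn -> R) (N : R) y :
 (forall x, w x != 0 -> cube N x /\ (f x = y -> regular_points x)) ->
 (fiber_sum (\1_(cube N)) y < +oo)%E -> exists J : nat,
 (forall (w' : Rn -> R) j, (forall x, w x = 0 -> w' x = 0) -> (J <= j)%N -> branch w' j y = 0) /\
 \sum_(0 <= j < J) branch w j y = \sum_(x \in f @^-1` [set y]) w x.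
Proof.
move=> wN fin.
have b0 k : (0 <= (branch (\1_(cube N)) k y)%:E)%E by rewrite lee_fin mulr_ge0.
have [J J1] : exists J : nat, (\sum_(J <= j <oo) (branch (\1_(cube N)) j y)%:E < 1)%E.
 have /fine_cvgP[[n1 _ h1] h2] := nneseries_tail_cvg fin (fun k _ => b0 k).
 move: h2 => /cvgr0_norm_lt /(_ _ ltr01)[n2 _ h2].
 exists (maxn n1 n2); rewrite -[X in (X < _)%E]fineK; last by apply: h1; exact: leq_maxl.
 by rewrite lte_fin (le_lt_trans (ler_norm _))//; apply: h2; exact: leq_maxr.
have Jout j : (J <= j)%N -> ~ ((f @` P j) y /\ cube N (t j y)).
 move=> Jj [Py tN]; move: J1; apply/negP; rewrite -leNgt.
 apply: (le_trans _ (nneseries_lim_ge j.+1 (fun k _ _ => b0 k))).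
 rewrite (bigD1_seq j) ?mem_index_iota ?Jj ?ltnSn ?iota_uniq//=.
 rewrite [X in (X + _)%E](_ : _ = 1%E); first by rewrite leeDl// sume_ge0.
 by rewrite /branch !indicE !mem_set// mulr1.
have branch0 (w' : Rn -> R) j : (forall x, w x = 0 -> w' x = 0) -> (J <= j)%N -> branch w' j y = 0.
 move=> w'0 Jj; rewrite /branch indicE.
 have [Py|nPy] := pselect ((f @` P j) y); last by rewrite memNset// mulr0.
 rewrite w'0 ?mul0r//; apply/eqP/negPn/negP => /wN[tN _].
 exact: (Jout _ Jj).
exists J; split => //.
pose I := [set j | (j < J)%N /\ (f @` P j) y].
have tI j : I j -> P j (t j y) /\ f (t j y) = y.
 by move=> [_ [x Px <-]]; rewrite (mt j).2.
rewrite /index_iota subn0 fsbig_seq ?iota_uniq//.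
rewrite -(@fsbig_widen _ _ _ _ I).
- transitivity (\sum_(j \in I) w (t j y)).
  apply: eq_fsbigr => j /set_mem[_ Py].
  by rewrite /branch indicE mem_set// mulr1.
 rewrite -(@reindex_fsbig _ _ _ _ _ (fun j => t j y) I ((fun j => t j y) @` I)).
  apply: fsbig_widen => [_ [j /tI[_ ?] <-]//|x [fx nx]].
  apply/eqP/negPn/negP => wx; have [xN /(_ fx)] := wN x wx.
  rewrite -UP => -[j _ Pj]; apply: nx; exists j; last by rewrite -fx (mt j).2.
  split; last by exists x.
  rewrite ltnNge; apply/negP => /Jout; apply; split; first by exists x.
  by rewrite -fx (mt j).2.
 split => [j Ij|i j /set_mem Ii /set_mem Ij tij|x//]; first by exists j.
 by apply: tP => //; exists (t i y); split; [exact: (tI i Ii).1|rewrite tij; exact: (tI j Ij).1].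
- by move=> j [jJ _]; rewrite /= mem_iota add0n.
- move=> j [/=]; rewrite mem_iota add0n /= => jJ nI.
 by rewrite /branch indicE memNset ?mulr0// => Py; apply: nI.
Qed.

End area_formula.

(** * Push-forward of integrable functions by Lipschitz maps *)

Section real_integrable.
Context d {T : measurableType d} {R : realType} (mu : {measure set T -> \bar R}).
Implicit Types u h : T -> R.

Lemma intg_meas u : intf mu u -> measT u.
Proof. by move=> /measurable_int /measurable_EFinP. Qed.

Lemma intg_le u h : measT h -> (forall x, `|h x| <= u x) ->
 intf mu u -> intf mu h.
Proof.
move=> mh hu; apply: le_integrable => //; first exact/measurable_EFinP.
by move=> x _ /=; rewrite lee_fin (le_trans (hu x))// ler_norm.
Qed.

Lemma intg_abs u : intf mu u ->
 intf mu (fun x => `|u x|).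
Proof. by move=> iu; have := integrable_abse iu; apply: eq_integrable. Qed.

Lemma intg_mulb u h M : intf mu u ->
 measT h -> normle h M ->
 intf mu (fun x => u x * h x).
Proof.
move=> iu mh hM.
apply: (@intg_le (fun x => M * `|u x|)).
- by apply: measurable_funM => //; exact: intg_meas.
- by move=> x; rewrite normrM mulrC ler_wpM2r.
- by have := integrableZl measurableT M (intg_abs iu); apply: eq_integrable.
Qed.

Lemma eq_Rint_ae u h : measT u -> measT h ->
 {ae mu, forall x, u x = h x} -> \int[mu]_x u x = \int[mu]_x h x.
Proof.
move=> mue mh uh; rewrite /Rintegral; congr fine; apply: ae_eq_integral => //.
- exact/measurable_EFinP.
- exact/measurable_EFinP.
- by apply: aeS uh => x -> _.
Qed.

Lemma eq_Rint u h : (forall x, u x = h x) -> \int[mu]_x u x = \int[mu]_x h x.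
Proof. by move=> uh; apply: eq_Rintegral => x _. Qed.

Lemma intg_fine (g : T -> \bar R) : mu.-integrable setT g ->
 intf mu (fine \o g).
Proof.
move=> ig; apply: (le_integrable measurableT _ _ ig) => //.
 apply/measurable_EFinP; apply: measurableT_comp; first exact: fine_measurable.
 exact: measurable_int ig.
by move=> x _; rewrite /comp; case: (g x) => [r||] //=; rewrite normr0 leey.
Qed.

Lemma intg_indic (A : set T) : measurable A -> (mu A < +oo)%E ->
 intf mu (\1_A : T -> R).
Proof.
move=> mA Aoo; apply/integrableP; split; first exact/measurable_EFinP.
under eq_integral do rewrite /= ger0_norm//.
by rewrite integral_indic// setIT.
Qed.

Lemma measurable_sg : measT (@Num.sg R).
Proof.
rewrite (_ : @Num.sg R = (fun x : R => \1_(`]0, +oo[%classic) x - \1_(`]-oo, 0[%classic) x)).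
 by apply: measurable_funB; apply: measurable_indic.
apply/funext => x; rewrite !indicE !mem_setE !in_itv/= andbT.
by case: sgrP => [|?|?]; rewrite ?ltxx ?subrr ?subr0 ?sub0r// ltNge ltW// ?subr0// sub0r.
Qed.

End real_integrable.

Section determinant_estimate.
Context {R : realType} {m : nat}.
Notation Rn := 'rV[R]_m.+1.
Notation mu := (lebesgue_rV R m.+1).

Lemma detD_isdiff_le (f : Rn -> Rn) (L : R) x : 0 <= L ->
 nlip L f -> isdiff f x ('J f x) -> `|detD f x| <= L ^+ m.+1.
Proof.
move=> L0 fL fx; apply: det_norm_le => //.
apply: (isdiff_norm_le fx); exists 1 => // h _.
by rewrite (le_trans (fL _ _))// addrAC subrr add0r.
Qed.

Lemma detD_bounded (f : Rn -> Rn) (L : R) :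
 nlip L f -> exists M, forall x, `|detD f x| <= M.
Proof.
move=> fL; pose c := `|\det (lin1_mx (point : {linear Rn -> Rn}))|.
exists (Num.max (`|L| ^+ m.+1) c) => x; rewrite le_max.
have fL' y z : `|f y - f z| <= `|L| * `|y - z|.
 by rewrite (le_trans (fL _ _))// ler_wpM2r// ler_norm.
have [fx|fx] := isdiff_point f x; first by rewrite (detD_isdiff_le _ fL').
by rewrite /detD /jacobian fx /c lexx orbT.
Qed.

Record pushforward_spec (u : Rn -> R) (f : Rn -> Rn) (N : R) (v : Rn -> R) : Prop := {
 push_int : intf mu v;
 push_supp : forall y, ~ (f @` cube N) y -> v y = 0;
 push_change : forall (h : Rn -> R) M, measT h -> normle h M ->
  \int[mu]_y (v y * h y) = \int[mu]_x (u x * h (f x) * detD f x);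
 push_fiber : {ae mu, forall y, v y = \sum_(x \in f @^-1` [set y]) u x * Num.sg (detD f x)} }.

(** The signed fibre sum is the difference of the fibre sums of the positive and negative parts of
    [w], which are integrable and so finite almost everywhere. Change of variables is proved for
    [h >= 0] and extended to bounded [h] by adding a constant. For the fibre formula, the points of
    non-differentiability have a null image, so on almost every fibre the points with [w x != 0] are
    regular. *)
Lemma pushforward_exists (u : Rn -> R) (f : Rn -> Rn) (L N : R) :
 nlip L f -> 0 <= N ->
 intf mu u -> vanish N u ->
 exists v, pushforward_spec u f N v.
Proof.
move=> fL N0 iu uN.
have [P [t [mP tP UP mt change]]] := area_pieces fL.
have mDf := meas_detD fL.
have mu_ := intg_meas iu.
have mf : measT f.
 by apply: cont_meas_map; exact: lip_continuous fL.
pose w x := u x * Num.sg (detD f x).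
have msg : measT (fun x => Num.sg (detD f x)).
 exact: (measurableT_comp measurable_sg).
have mw : measT w by exact: measurable_funM.
pose wp x := Num.max (w x) 0; pose wn x := Num.max (- w x) 0.
have mwp : measT wp by apply: measurable_maxr.
have mwn : measT wn by apply: measurable_maxr => //; exact: measurableT_comp.
have wp0 x : 0 <= wp x by rewrite le_max lexx orbT.
have wn0 x : 0 <= wn x by rewrite le_max lexx orbT.
have wE x : w x = wp x - wn x.
 by rewrite /wp /wn !maxEle oppr_le0; case: (leP (w x) 0) => ?; case: (leP 0 (w x)) => ?; lra.
have [MD MDP] := detD_bounded fL.
pose S := fiber_sum f P t.
have iwD (z h : Rn -> R) M : intf mu z ->
  measT h -> normle h M ->
  intf mu (fun x => z x * h (f x) * `|detD f x|).
 move=> iz mh hM; apply: (@intg_mulb _ _ _ _ _ _ MD).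
 - by apply: (@intg_mulb _ _ _ _ _ _ M) => //; exact: measurableT_comp.
 - exact: measurable_abs_detD fL.
 - by move=> x; rewrite normr_id.
have wu x : `|w x| <= `|u x|.
 by rewrite /w normrM ler_piMr// normr_sg; case: (_ != 0).
have wpu x : `|wp x| <= `|u x|.
 by rewrite ger0_norm// ge_max normr_ge0 andbT (le_trans (ler_norm _)).
have wnu x : `|wn x| <= `|u x|.
 by rewrite ger0_norm// ge_max normr_ge0 andbT (le_trans (ler_norm _))// normrN.
have iwp : intf mu wp by apply: (intg_le mwp wpu); exact: intg_abs.
have iwn : intf mu wn by apply: (intg_le mwn wnu); exact: intg_abs.
have Sint (z : Rn -> R) : intf mu z -> allnneg z ->
  mu.-integrable setT (S z).
 move=> iz z0; have mz := intg_meas iz; apply/integrableP; split.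
  exact: (measurable_fiber_sum mP mt).
 have m1 : measurable_fun [set: Rn] (fun _ : Rn => 1 : R) by exact: measurable_cst.
 under eq_integral do rewrite gee0_abs ?fiber_sum_ge0//.
 have := integral_fiber_sum fL mP tP UP mt change mz z0 m1 (fun=> ler01).
 have -> : (\int[mu]_x S z x = \int[mu]_y (fiber_sum f P t z y * 1))%E.
  by apply: eq_integral => y _; rewrite mule1.
 move=> ->; have := iwD z (fun=> 1) 1 iz m1.
 by rewrite normr1 => /(_ (fun=> lexx _)) /(integrable_lty measurableT).
pose v y := fine (S wp y) - fine (S wn y).
have iSp := Sint wp iwp wp0; have iSn := Sint wn iwn wn0.
have ip := intg_fine iSp; have in_ := intg_fine iSn.
have iv : intf mu v.
 by have := integrableB measurableT ip in_; apply: eq_integrable.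
have S0 (z : Rn -> R) y : vanish N z -> ~ (f @` cube N) y -> S z y = 0%E.
 move=> zN ny; rewrite /S /fiber_sum eseries0// => j _ _.
 rewrite /branch indicE; have [[x Px fx]|nPy] := pselect ((f @` P j) y); last by rewrite memNset// mulr0.
 rewrite zN ?mul0r// -fx (mt j).2// => xN; apply: ny; rewrite -fx; exact: imageP.
have wN x : ~ cube N x -> w x = 0 by move=> /uN ux; rewrite /w ux mul0r.
have wpN x : ~ cube N x -> wp x = 0 by move=> /wN wx; rewrite /wp wx maxxx.
have wnN x : ~ cube N x -> wn x = 0 by move=> /wN wx; rewrite /wn wx oppr0 maxxx.
exists v; split => //.
- by move=> y ny; rewrite /v !S0// subr0.
- have pos (h : Rn -> R) M : measT h -> allnneg h -> normle h M ->
   \int[mu]_y (v y * h y) = \int[mu]_x (u x * h (f x) * detD f x).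
  move=> mh h0 hM.
  have part (z : Rn -> R) : intf mu z -> allnneg z ->
    \int[mu]_y (fine (S z y) * h y) = \int[mu]_x (z x * h (f x) * `|detD f x|).
   move=> iz z0; have mz := intg_meas iz; have iS := Sint _ iz z0.
   rewrite /Rintegral; congr fine.
   rewrite -(integral_fiber_sum fL mP tP UP mt change mz z0 mh h0).
   apply: ae_eq_integral => //.
   + apply/measurable_EFinP; apply: measurable_funM => //.
    exact: intg_meas (intg_fine iS).
   + apply: emeasurable_funM; last exact/measurable_EFinP.
    exact: (measurable_fiber_sum mP mt).
   + have := integrable_ae measurableT iS; apply: aeS => y /(_ Logic.I) Sy _.
    by rewrite EFinM fineK.
  transitivity (\int[mu]_y (fine (S wp y) * h y - fine (S wn y) * h y)).
   by apply: eq_Rint => y; rewrite /v mulrBl.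
  rewrite RintegralB//; last 2 first.
  + exact: (intg_mulb ip mh hM).
  + exact: (intg_mulb in_ mh hM).
  rewrite !part// -RintegralB//; last 2 first.
  + exact: (iwD _ _ M).
  + exact: (iwD _ _ M).
  apply: eq_Rint => x; rewrite -!mulrBl -wE /w.
  by rewrite [in RHS](numEsg (detD f x)); ring.
 move=> h M mh hM.
 have M0 : 0 <= M by rewrite (le_trans _ (hM 0)).
 have cM (x : Rn) : `|(fun=> M) x| <= M by rewrite /= ger0_norm.
 have mM : measT ((fun=> M) : Rn -> R) by exact: measurable_cst.
 have mhM : measT (fun x => h x + M) by exact: measurable_funD.
 have hM0 x : 0 <= h x + M by rewrite -lerBlDr sub0r; have := hM x; rewrite ler_norml => /andP[].
 have hM2 x : `|h x + M| <= M + M by rewrite (le_trans (ler_normD _ _))// lerD// ger0_norm.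
 have iD (k : Rn -> R) M' : measT k -> normle k M' ->
   intf mu (fun x => u x * k (f x) * detD f x).
  move=> mk kM; apply: (@intg_mulb _ _ _ _ _ _ MD) => //.
  by apply: (@intg_mulb _ _ _ _ _ _ M') => //; exact: measurableT_comp.
 transitivity (\int[mu]_y (v y * (h y + M) - v y * M)).
  by apply: eq_Rint => y; rewrite mulrDr addrK.
 rewrite RintegralB//; last 2 first.
 + exact: (intg_mulb iv mhM hM2).
 + exact: (intg_mulb iv mM cM).
 rewrite (pos _ (M + M))// (pos (fun=> M) M)// -RintegralB//; last 2 first.
 + exact: iD mhM hM2.
 + exact: (iD (fun=> M)).
 by apply: eq_Rint => x; ring.
- have finite1 : {ae mu, forall y, (S (\1_(cube N)) y < +oo)%E}.
  have mN : measurable (cube N : set Rn) by exact: meas_cube.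
  have iN : intf mu (\1_(cube N) : Rn -> R).
   by apply: intg_indic => //; exact: cube_lty.
  have : mu.-integrable setT (S (\1_(cube N))).
   by apply: Sint => // x; rewrite indicE.
  move=> /(integrable_ae measurableT); apply: aeS => y /(_ Logic.I).
  by rewrite ge0_fin_numE// fiber_sum_ge0.
 have nullf : {ae mu, forall y, forall x, f x = y -> isdiff f x ('J f x)}.
  have [B [mB B0 sB]] := ae_isdiff fL.
  apply: negligibleS (lipschitz_image_negligible fL mB B0) => y /existsNP[x /not_implyP[fx nx]].
  by exists x => //; apply: sB.
 apply: aeS2 finite1 nullf => y fin dif.
 have [|J [J0 JE]] := fiber_sum_finite (w := w) (y := y) tP UP mt _ fin.
  move=> x wx; split; first by apply: contrapT => /wN /eqP; exact/negP.
  by move=> /dif dx; split => //; apply: contraNneq wx; rewrite /w => ->; rewrite sgr0 mulr0.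
 rewrite /v /S (fiber_sum_ord _ (J := J))//; last first.
  by move=> j; apply: J0 => x wx; rewrite /wp wx maxxx.
 rewrite (fiber_sum_ord _ (J := J))//; last first.
  by move=> j; apply: J0 => x wx; rewrite /wn wx oppr0 maxxx.
 rewrite /= -JE -sumrB; apply: eq_bigr => j _.
 by rewrite /branch -mulrBl -wE.
Qed.

End determinant_estimate.

Opaque jacobian.

(** * Partial derivatives, and determinants with one component changed *)

Section differential_calculus.
Context {R : realType}.

Lemma isdiff_sdiff n m (g : 'rV[R]_n -> 'rV[R]_m) x M j : isdiff g x M ->
 sdiff (fun y => g y ord0 j) x (\row_i M i j).
Proof.
move=> gx e e0; have [d d0 gd] := gx e e0; exists d => // h hd.
apply: le_trans (gd h hd); apply: le_trans (coord_le _ j); rewrite !mxE.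
apply: eq_ler.
by congr (`|_ - _|); apply: eq_bigr => i _; rewrite mxE mulrC.
Qed.

Lemma isdiff_comp n m k (f : 'rV[R]_n -> 'rV[R]_m) (g : 'rV[R]_m -> 'rV[R]_k) x J K :
 isdiff f x J -> isdiff g (f x) K -> isdiff (g \o f) x (J *m K).
Proof.
move=> fJ gK e e0.
pose s : R := \sum_i \sum_j `|K i j|; pose t : R := \sum_i \sum_j `|J i j|.
have s0 : 0 <= s by apply: sumr_ge0 => i _; apply: sumr_ge0.
have t0 : 0 <= t by apply: sumr_ge0 => i _; apply: sumr_ge0.
have [|d1 d10 gd] := gK (e / 2 / (t + 1)); first by rewrite !divr_gt0// ltr_wpDl.
have c0 : 0 < Num.min 1 (e / 2 / (s + 1)) by rewrite lt_min ltr01 !divr_gt0// ltr_wpDl.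
have [d2 d20 fd] := fJ _ c0.
exists (Num.min d2 (d1 / (t + 1))); first by rewrite lt_min d20 divr_gt0// ltr_wpDl.
move=> h; rewrite le_min => /andP[hd2 hd1]; have {}fd := fd h hd2.
have fh : `|f (x + h) - f x| <= (t + 1) * `|h|.
 rewrite -[f _ - _](subrK (h *m J)) (le_trans (ler_normD _ _))// mulrDl mul1r addrC lerD//.
  exact: norm_mulmx_le.
 by rewrite (le_trans fd)// ler_piMl// ge_min lexx.
have := gd (f (x + h) - f x); rewrite [f x + _]addrC subrK => /(_ _)/le_trans {}gd.
have {}gd : `|g (f (x + h)) - g (f x) - (f (x + h) - f x) *m K| <= e / 2 * `|h|.
 apply: gd; first by rewrite (le_trans fh)// mulrC -ler_pdivlMr// ltr_wpDl.
 have := ler_wpM2l _ fh => /(_ (e / 2 / (t + 1))) /(_ _)/le_trans; apply.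
  by rewrite !divr_ge0// ?addr_ge0// ltW.
 by rewrite mulrA divfK// gt_eqF// ltr_wpDl.
rewrite /= (_ : _ - _ = (g (f (x + h)) - g (f x) - (f (x + h) - f x) *m K) +
  (f (x + h) - f x - h *m J) *m K); last first.
 by rewrite mulmxA [X in _ = _ + X]mulmxBl addrA subrK.
rewrite (le_trans (ler_normD _ _))// [e]splitr mulrDl lerD//.
rewrite (le_trans (norm_mulmx_le _ _))// -/s.
apply: (@le_trans _ _ (s * (e / 2 / (s + 1) * `|h|))).
 rewrite ler_wpM2l// (le_trans fd)// ler_wpM2r// ge_min lexx orbT//.
by rewrite mulrA ler_wpM2r// mulrCA ger_pMr ?divr_gt0// ler_pdivrMr ?ltr_wpDl// mul1r lerDl.
Qed.

Lemma isdiff_local n m (f g : 'rV[R]_n -> 'rV[R]_m) x J e : 0 < e ->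
 (forall y, `|y - x| <= e -> f y = g y) -> isdiff f x J -> isdiff g x J.
Proof.
move=> e0 fg fJ c c0; have [d d0 fd] := fJ c c0.
exists (Num.min d e); first by rewrite lt_min d0.
move=> h; rewrite le_min => /andP[hd he].
by rewrite -!fg ?subrr ?normr0 ?(ltW e0)//; [exact: fd|rewrite addrC addKr].
Qed.

Definition row1 {T} (F : T -> R) : T -> 'rV[R]_1 := fun y => \row_(j < 1) F y.

(** Taken from the Jacobian of a map to ['rV_1], so that measurability and boundedness of ['J] carry
    over at all points, differentiable or not. *)
Definition pd n (i : 'I_n) (F : 'rV[R]_n -> R) (x : 'rV[R]_n) : R := ('J (row1 F) x) i ord0.

Lemma eq_sdiff n (F G : 'rV[R]_n -> R) x a : (forall y, F y = G y) -> sdiff F x a -> sdiff G x a.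
Proof. by move=> FG; rewrite (_ : F = G)//; apply/funext. Qed.

Lemma sdiff_const n (F : 'rV[R]_n -> R) x a (c : R) : sdiff (fun y => F y + c) x a -> sdiff F x a.
Proof.
move=> Fa e e0; have [d d0 Fd] := Fa e e0; exists d => // h /Fd.
by rewrite opprD addrACA subrr addr0.
Qed.

Lemma sdiff_row1 n (F : 'rV[R]_n -> R) x a : sdiff F x a -> isdiff (row1 F) x (a^T).
Proof.
move=> Fa; have -> : a^T = \matrix_(i < n, j < 1) a ord0 i.
 by apply/matrixP => i j; rewrite !mxE (ord1 j).
by apply: (@sdiff_isdiff R n 1 (row1 F) x (fun=> a)) => j; apply: (eq_sdiff _ Fa) => y; rewrite mxE.
Qed.

Lemma sdiff_pd n (F : 'rV[R]_n -> R) x a i : sdiff F x a -> pd i F x = a ord0 i.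
Proof. by move=> /sdiff_row1/isdiff_jacobian; rewrite /pd => ->; rewrite mxE. Qed.

Lemma sdiff_pd_row n (F : 'rV[R]_n -> R) x a : sdiff F x a -> sdiff F x (\row_i pd i F x).
Proof.
by move=> Fa; rewrite (_ : \row_i _ = a)//; apply/rowP => i; rewrite mxE (sdiff_pd _ Fa).
Qed.

Lemma sdiffD n (F G : 'rV[R]_n -> R) x a b : sdiff F x a -> sdiff G x b ->
 sdiff (fun y => F y + G y) x (a + b).
Proof.
move=> Fa Gb e e0; have e2 : 0 < e / 2 by rewrite divr_gt0.
have [d d0 Fd] := Fa _ e2; have [d' d'0 Gd] := Gb _ e2.
exists (Num.min d d'); first by rewrite lt_min d0.
move=> h; rewrite le_min => /andP[/Fd {}Fd /Gd {}Gd].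
under eq_bigr do rewrite mxE mulrDl.
rewrite big_split/= (_ : _ - _ = (F (x + h) - F x - \sum_i a ord0 i * h ord0 i) +
  (G (x + h) - G x - \sum_i b ord0 i * h ord0 i)); last by ring.
by rewrite (le_trans (ler_normD _ _))// [e]splitr mulrDl lerD.
Qed.

Lemma sdiffZ n (F : 'rV[R]_n -> R) x a c : sdiff F x a -> sdiff (fun y => c * F y) x (c *: a).
Proof.
move=> Fa e e0; have c1 : 0 < `|c| + 1 by rewrite ltr_wpDl.
have [d d0 Fd] := Fa _ (divr_gt0 e0 c1).
exists d => // h /Fd {}Fd.
under eq_bigr do rewrite mxE -mulrA.
rewrite -mulr_sumr -!mulrBr normrM (le_trans (ler_wpM2l _ Fd))//.
by rewrite mulrA ler_wpM2r// mulrCA ger_pMr// ler_pdivrMr// mul1r lerDl.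
Qed.

Lemma sdiff_lip n (F : 'rV[R]_n -> R) x a : sdiff F x a -> exists K, 0 <= K /\
 exists2 d, 0 < d & forall h, `|h| <= d -> `|F (x + h) - F x| <= K * `|h|.
Proof.
move=> Fa; have [d d0 Fd] := Fa 1 ltr01.
exists (1 + \sum_i `|a ord0 i|); split; first by rewrite addr_ge0// sumr_ge0.
exists d => // h /Fd {}Fd.
rewrite -[F _ - _](subrK (\sum_i a ord0 i * h ord0 i)) (le_trans (ler_normD _ _))//.
rewrite mulrDl lerD// (le_trans (ler_norm_sum _ _ _))// mulr_suml; apply: ler_sum => i _.
by rewrite normrM ler_wpM2l// coord_le.
Qed.

(** [(F y - F x) * (G y - G x)] is of second order at [x], and the rest of the product is affine in
    [F] and [G]. *)
Lemma sdiffM n (F G : 'rV[R]_n -> R) x a b : sdiff F x a -> sdiff G x b ->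
 sdiff (fun y => F y * G y) x (G x *: a + F x *: b).
Proof.
move=> Fa Gb.
have [K [K0 [d d0 Kd]]] := sdiff_lip Fa; have [K' [K'0 [d' d'0 Kd']]] := sdiff_lip Gb.
pose FG y := (F y - F x) * (G y - G x).
have FG0 : sdiff FG x 0.
 move=> e e0; have KK : 0 < K * K' + 1 by rewrite ltr_wpDl// mulr_ge0.
 exists (Num.min (Num.min d d') (e / (K * K' + 1))); first by rewrite !lt_min d0 d'0 divr_gt0.
 move=> h; rewrite !le_min -andbA => /and3P[/Kd h1 /Kd' h2 h3].
 rewrite big1 ?subr0 => [|i _]; last by rewrite mxE mul0r.
 rewrite /FG !subrr mulr0 subr0 normrM (le_trans (ler_pM _ _ h1 h2))//.
 rewrite mulrACA mulrA ler_wpM2r// (le_trans (ler_wpM2l _ h3)) ?mulr_ge0//.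
 by rewrite mulrCA ger_pMr// ler_pdivrMr// mul1r lerDl.
have := sdiffD (sdiffD FG0 (sdiffZ (G x) Fa)) (sdiffZ (F x) Gb).
rewrite add0r => h; apply: (@sdiff_const _ _ _ _ (F x * G x - 2 * (F x * G x) + F x * G x * 2)).
by apply: eq_sdiff h => y; rewrite /FG; ring.
Qed.

End differential_calculus.

Section partial_derivatives.
Context {R : realType} {n : nat}.
Notation Rn := 'rV[R]_n.
Notation mu := (lebesgue_rV R n).

Definition lip (L : R) (F : Rn -> R) := nlip L F.

Lemma lip_row1 L F : 0 <= L -> lip L F -> forall x y, `|row1 F x - row1 F y| <= L * `|x - y|.
Proof. by move=> L0 FL x y; apply: norm_row_le => [|j]; rewrite ?mulr_ge0// !mxE; exact: FL. Qed.

Lemma lip_norm L F : lip L F -> lip `|L| F.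
Proof. by move=> FL x y; rewrite (le_trans (FL _ _))// ler_wpM2r// ler_norm. Qed.

Lemma lip_cont L F : lip L F -> continuous F.
Proof. by move=> FL; apply: (@lip_continuous _ _ R^o _ L). Qed.

Lemma lip_meas L F : lip L F -> measT F.
Proof. by move=> /lip_cont cF; exact: cont_meas_rV. Qed.

Lemma ae_sdiff_pd L F : lip L F -> {ae mu, forall x, sdiff F x (\row_i pd i F x)}.
Proof.
move=> FL; have := ae_sdiff (lip_norm FL) (normr_ge0 L).
by apply: aeS => x [a Fa]; exact: sdiff_pd_row Fa.
Qed.

Lemma meas_pd L F i : lip L F -> measT (pd i F).
Proof. by move=> FL; exact: (measurable_jacobian (lip_row1 (normr_ge0 _) (lip_norm FL))). Qed.

Lemma sdiff_pd_le L F x a i : 0 <= L -> lip L F -> sdiff F x a -> `|a ord0 i| <= L.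
Proof.
move=> L0 FL Fa; apply/ler_addgt0Pr => e e0; have [d d0 Fd] := Fa e e0.
pose h : Rn := d *: delta_mx ord0 i.
have hd : `|h| <= d by rewrite (le_trans (norm_scale_delta _ _))// gtr0_norm.
have := Fd h hd; have := FL (x + h) x; rewrite addrAC subrr add0r.
have -> : \sum_i0 a ord0 i0 * h ord0 i0 = a ord0 i * d.
 rewrite (bigD1 i)//= big1 ?addr0 => [|l li]; rewrite !mxE ?eqxx ?mulr1//.
 by rewrite (negPf li)/= mulr0 mulr0.
move=> h1 h2; rewrite -(ler_pM2r d0) -[X in _ * X <= _](gtr0_norm d0) -normrM.
rewrite -[X in `|X|](subKr (F (x + h) - F x)) (le_trans (ler_normB _ _))// mulrDl lerD//.
 by rewrite (le_trans h1)// ler_wpM2l.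
by rewrite (le_trans h2)// ler_wpM2l// ltW.
Qed.

Lemma pd_bounded L F i : lip L F -> exists M, forall x, `|pd i F x| <= M.
Proof.
move=> /lip_norm FL; pose c := `|(lin1_mx (point : {linear Rn -> 'rV[R]_1})) i ord0|.
exists (Num.max `|L| c) => x; rewrite le_max.
have [fx|fx] := isdiff_point (row1 F) x.
 have := sdiff_pd_le i (normr_ge0 _) FL (eq_sdiff _ (isdiff_sdiff ord0 fx)).
 by rewrite mxE => -> // y; rewrite mxE.
by rewrite /pd (jacobian_point fx) /c lexx orbT.
Qed.

End partial_derivatives.

Section determinants.
Context {R : realType} {m : nat}.
Notation n := m.+1.
Notation Rn := 'rV[R]_n.
Notation mu := (lebesgue_rV R n).

(** One Lipschitz constant per component, because the estimates must keep products such as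
    [\prod_(k | k != j) L k]. *)
Definition lips (L : 'I_n -> R) (f : Rn -> Rn) := forall j, lip (L j) (fun x => f x ord0 j).

Lemma lips_lip (L : 'I_n -> R) f : lips L f -> exists2 K, 0 <= K & nlip K f.
Proof.
move=> fL; exists (\sum_j `|L j|); first exact: sumr_ge0.
move=> x y; apply: norm_row_le => [|j]; first by rewrite mulr_ge0// sumr_ge0.
rewrite !mxE (le_trans (lip_norm (fL j) x y))// ler_wpM2r// (bigD1 j)//= lerDl.
exact: sumr_ge0.
Qed.

Lemma ae_lips_isdiff (L : 'I_n -> R) f : lips L f -> {ae mu, forall x, isdiff f x ('J f x)}.
Proof. by move=> /lips_lip[K _ fK]; exact: ae_isdiff fK. Qed.

Lemma lips_meas (L : 'I_n -> R) f : lips L f -> measT f.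
Proof.
by move=> /lips_lip[K _ fK]; apply: cont_meas_map; exact: lip_continuous fK.
Qed.

Lemma lips_meas_detD (L : 'I_n -> R) f : lips L f -> measT (detD f).
Proof. by move=> /lips_lip[K _ fK]; exact: meas_detD fK. Qed.

Lemma detD_bnd (L : 'I_n -> R) f : lips L f -> exists M, forall x, `|detD f x| <= M.
Proof. by move=> /lips_lip[K _ fK]; exact: detD_bounded fK. Qed.

Lemma jacobian_bounded (f : Rn -> Rn) (L : R) :
 nlip L f -> exists M, forall x i j, `|'J f x i j| <= M.
Proof.
move=> fL; pose c : R := \sum_i \sum_j `|lin1_mx (point : {linear Rn -> Rn}) i j|.
exists (Num.max `|L| c) => x i j; rewrite le_max.
have [fx|fx] := isdiff_point f x; last first.
 rewrite (jacobian_point fx) /c (bigD1 i)//= (bigD1 j)//= -addrA lerDl.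
 by rewrite addr_ge0 ?orbT// sumr_ge0// => k _; exact: sumr_ge0.
have fj : lip `|L| (fun y => f y ord0 j).
 move=> y z; have := coord_le (f y - f z) j; rewrite !mxE => /le_trans; apply.
 by rewrite (le_trans (fL _ _))// ler_wpM2r// ler_norm.
by have := sdiff_pd_le i (normr_ge0 _) fj (isdiff_sdiff j fx); rewrite mxE => ->.
Qed.

Lemma jacobian_pd (f : Rn -> Rn) x i j : isdiff f x ('J f x) ->
 'J f x i j = pd i (fun y => f y ord0 j) x.
Proof. by move=> fx; rewrite (sdiff_pd _ (isdiff_sdiff j fx)) mxE. Qed.

Lemma detD_isdiff (f : Rn -> Rn) x M : isdiff f x M -> detD f x = \det M.
Proof. by move=> /isdiff_jacobian; rewrite /detD => ->. Qed.

Lemma detD_isdiff_comp (f g : Rn -> Rn) x A B : isdiff f x A -> isdiff g (f x) B ->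
 detD (g \o f) x = detD g (f x) * detD f x.
Proof.
move=> fA gB; apply: etrans (detD_isdiff (isdiff_comp fA gB)) _; rewrite det_mulmx mulrC.
by rewrite (detD_isdiff gB) (detD_isdiff fA).
Qed.

Definition updc (j : 'I_n) (F : Rn -> R) (f : Rn -> Rn) : Rn -> Rn :=
 fun x => \row_i (if i == j then F x else f x ord0 i).

Lemma updc_id (j : 'I_n) (f : Rn -> Rn) : updc j (fun x => f x ord0 j) f = f.
Proof. by apply/funext => x; apply/rowP => i; rewrite !mxE; case: eqP => // ->. Qed.

Lemma updcK (j : 'I_n) (F G : Rn -> R) (f : Rn -> Rn) : updc j F (updc j G f) = updc j F f.
Proof. by apply/funext => x; apply/rowP => i; rewrite !mxE; case: eqP. Qed.

Lemma lips_updc (L : 'I_n -> R) f K F j : lips L f -> lip K F ->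
 lips (fun i => if i == j then K else L i) (updc j F f).
Proof. by move=> fL FK i x y; rewrite !mxE; case: eqP => _; [exact: FK|exact: fL]. Qed.

Lemma det_updc (A B : 'M[R]_n) j : (forall i k, k != j -> A i k = B i k) ->
 \det A = \sum_i A i j * cofactor B i j.
Proof.
move=> AB; rewrite (expand_det_col _ j); apply: eq_bigr => i _; congr (_ * _).
rewrite /cofactor; congr (_ * \det _); apply/matrixP => a b; rewrite !mxE.
by apply: AB; rewrite eq_sym neq_lift.
Qed.

(** Expansion along column [j]: the cofactors involve the other components alone, so the determinant
    is linear in the component [F]. *)
Lemma ae_detD_updc (L : 'I_n -> R) f K F j : lips L f -> lip K F ->
 {ae mu, forall x, detD (updc j F f) x = \sum_i pd i F x * cofactor ('J f x) i j}.
Proof.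
move=> fL FK; have := ae_lips_isdiff fL; apply: aeS2 (ae_lips_isdiff (@lips_updc L f K F j fL FK)).
move=> x ux fx.
have E : (fun y => updc j F f y ord0 j) = F by apply/funext => y; rewrite mxE eqxx.
have Ek k : k != j -> (fun y => updc j F f y ord0 k) = (fun y => f y ord0 k).
 by move=> kj; apply/funext => y; rewrite mxE (negPf kj).
have JE i k : k != j -> 'J (updc j F f) x i k = 'J f x i k.
 move=> kj.
 exact: etrans (jacobian_pd i k ux) (etrans (congr1 (fun G => pd i G x) (Ek k kj)) (esym (jacobian_pd i k fx))).
apply: etrans (det_updc JE) _; apply: eq_bigr => i _.
exact: (congr1 (fun z => z * cofactor ('J f x) i j)
 (etrans (jacobian_pd i j ux) (congr1 (fun G => pd i G x) E))).
Qed.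

Lemma detD_leibniz_le (A : 'M[R]_n) (L : 'I_n -> R) :
 (forall i j, `|A i j| <= L j) -> `|\det A| <= n`!%:R * \prod_j L j.
Proof.
move=> AL; rewrite /determinant (le_trans (ler_norm_sum _ _ _))//.
apply: (@le_trans _ _ (\sum_(s : 'S_n) \prod_j L j)).
 apply: ler_sum => s _; rewrite normrM normrX normrN1 expr1n mul1r normr_prod.
 rewrite [leRHS](reindex_inj (@perm_inj _ s)); apply: ler_prod => i _.
 by rewrite normr_ge0 AL.
by rewrite sumr_const card_Sn mulr_natl.
Qed.

Lemma ae_detD_le (L : 'I_n -> R) f : allnneg L -> lips L f ->
 {ae mu, forall x, `|detD f x| <= n`!%:R * \prod_j L j}.
Proof.
move=> L0 fL; have := ae_lips_isdiff fL; apply: aeS => x fx; apply: detD_leibniz_le => i j.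
by have := sdiff_pd_le i (L0 j) (fL j) (isdiff_sdiff j fx); rewrite mxE.
Qed.

(** A cofactor is the determinant of the matrix with column [j] replaced by a basis vector, so the
    Leibniz bound applies with constant 1 for that column. *)
Lemma cofactor_le (A : 'M[R]_n) (L : 'I_n -> R) i j :
 (forall i k, k != j -> `|A i k| <= L k) -> `|cofactor A i j| <= n`!%:R * \prod_(k | k != j) L k.
Proof.
move=> AL.
pose B : 'M[R]_n := \matrix_(a, b) if b == j then (a == i)%:R else A a b.
have -> : cofactor A i j = \det B.
 rewrite (@det_updc _ A j) => [|a k kj]; last by rewrite mxE (negPf kj).
 rewrite (bigD1 i)//= big1 ?addr0 => [|a ai]; rewrite mxE eqxx ?eqxx ?mul1r//.
 by rewrite (negPf ai) mul0r.
rewrite (_ : \prod_(k | k != j) L k = \prod_k (if k == j then 1 else L k)).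
 apply: detD_leibniz_le => a b; rewrite mxE; case: eqP => [_|/eqP bj]; last exact: AL.
 by case: (a == i); rewrite ?normr1 ?normr0.
by rewrite [RHS](bigD1 j)//= eqxx mul1r; apply: eq_bigr => k /negPf ->.
Qed.

Lemma ae_cofactor_le (L : 'I_n -> R) f i j : allnneg L -> lips L f ->
 {ae mu, forall x, `|cofactor ('J f x) i j| <= n`!%:R * \prod_(k | k != j) L k}.
Proof.
move=> L0 fL; have := ae_lips_isdiff fL; apply: aeS => x fx; apply: cofactor_le => a k _.
by have := sdiff_pd_le a (L0 k) (fL k) (isdiff_sdiff k fx); rewrite mxE.
Qed.

Lemma isdiff_id (x : Rn) : isdiff id x 1%:M.
Proof.
by move=> e e0; exists 1 => // h _; rewrite /= mulmx1 [x + h]addrC addrK subrr normr0 mulr_ge0// ltW.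
Qed.

Lemma lips_id : lips (fun=> 1) id.
Proof. by move=> j x y; rewrite mul1r; have := coord_le (x - y) j; rewrite !mxE. Qed.

Lemma ae_detD_updc_id K F i : lip K F -> {ae mu, forall x, detD (updc i F id) x = pd i F x}.
Proof.
move=> FK; have := ae_detD_updc i lips_id FK; apply: aeS => x ->.
rewrite (isdiff_jacobian (isdiff_id x)).
have cof a : cofactor (1%:M : 'M[R]_n) a i = (a == i)%:R.
 have := congr1 (fun M : 'M[R]_n => M i a) (mulmx1 (\adj (1%:M : 'M[R]_n))).
 by rewrite mul_adj_mx det1 !mxE eq_sym => <-.
rewrite (bigD1 i)//= big1 ?addr0 => [|a ai]; rewrite cof ?eqxx ?mulr1//.
by rewrite (negPf ai) mulr0.
Qed.

End determinants.

(** * Chain rule for Jacobian determinants *)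

Section chain_rule.
Context {R : realType} {m : nat}.
Notation Rn := 'rV[R]_m.+1.
Notation mu := (lebesgue_rV R m.+1).
Variables (f g : Rn -> Rn) (L K : R).
Hypotheses (fL : nlip L f).
Hypotheses (gK : nlip K g).

(** The preimage of a null set may have positive measure. Pushing forward the sign of [detD f] on a
    cube and testing against the indicator of [B] gives 0 on one side and, on the other, the
    integral of [|detD f|] over the part of the preimage in that cube. *)
Lemma null_preimage_regular (B : set Rn) : measurable B -> mu B = 0%E ->
 {ae mu, forall x, B (f x) -> detD f x = 0}.
Proof.
move=> mB B0.
have mf : measT f.
 by apply: cont_meas_map; exact: lip_continuous fL.
have mDf := meas_detD fL.
suff H (N : nat) : {ae mu, forall x, cube N%:R x -> B (f x) -> detD f x = 0}.
 have := ae_forall_nat H; apply: aeS => x Hx Bx.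
 have : (\bigcup_k cube k%:R) x by rewrite bigcup_cube.
 by move=> [k _ /Hx]; exact.
have mN : measurable (cube N%:R : set Rn) by exact: meas_cube.
pose u (x : Rn) : R := \1_(cube N%:R) x * Num.sg (detD f x).
have msg : measT (fun x => Num.sg (detD f x)).
 exact: (measurableT_comp measurable_sg).
have sg1 (x : Rn) : `|Num.sg (detD f x)| <= 1 by rewrite normr_sg; case: (_ != 0).
have iu : intf mu u.
 apply: intg_mulb msg sg1.
 by apply: intg_indic => //; exact: cube_lty.
have [|v [iv _ vch _]] := pushforward_exists fL (ler0n R N) iu.
 by move=> x xN; rewrite /u indicE memNset// mul0r.
have m1B : measT (\1_B : Rn -> R) by exact: measurable_indic.
have B1 (x : Rn) : `|\1_B x : R| <= 1 by rewrite indicE; case: (_ \in _); rewrite ?normr1 ?normr0.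
have := vch _ _ m1B B1.
have [MD MDP] := detD_bounded fL.
have mBf : measT (fun x => \1_B (f x) : R) by exact: measurableT_comp.
have -> : \int[mu]_y (v y * \1_B y) = 0.
 transitivity (\int[mu]_(y in [set: Rn]) (0 : R)); last by rewrite /Rintegral integral0_eq.
 apply: eq_Rint_ae => //.
  by apply: measurable_funM => //; exact: intg_meas iv.
 exists B; split => // x /= nx; apply: contrapT => nB; apply: nx.
 by rewrite indicE memNset// mulr0.
have ig : intf mu (fun x => u x * \1_B (f x) * detD f x).
 apply: intg_mulb MDP => //.
 by apply: intg_mulb iu mBf _ => x; exact: B1.
have uE x : u x * \1_B (f x) * detD f x = \1_(cube N%:R) x * \1_B (f x) * `|detD f x|.
 by rewrite /u [X in _ * X = _](numEsg (detD f x)); case: sgrP => _; ring.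
have g0 (x : Rn) : 0 <= u x * \1_B (f x) * detD f x.
 by rewrite uE !indicE !mulr_ge0.
have ig' := measurable_int _ ig.
move=> /esym I0; have /(ae_eq_integral_abs _ measurableT ig') :
  (\int[mu]_x `|(u x * \1_B (f x) * detD f x)%R%:E| = 0)%E.
 under eq_integral do rewrite /= ger0_norm//.
 rewrite -[LHS](fineK (integrable_fin_num measurableT ig)); congr EFin.
 exact: I0.
apply: aeS => x /(_ Logic.I) /= [] + xN Bx.
rewrite uE !indicE (mem_set xN) (mem_set Bx) !mul1r => /eqP.
by rewrite normr_eq0 => /eqP.
Qed.

(** Where [detD f x != 0], the point [f x] avoids the null set where [g] is not differentiable.
    Where it vanishes, [g] may fail to be differentiable at [f x], but [f] is stationary to first
    order along a kernel vector [v]; so is the composite with the Lipschitz map [g], whose Jacobian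
    is therefore singular too. *)
Lemma ae_detD_comp : {ae mu, forall x, detD (g \o f) x = detD g (f x) * detD f x}.
Proof.
have [B [mB B0 sB]] := ae_isdiff gK.
have gfK x y : `|g (f x) - g (f y)| <= `|K| * `|L| * `|x - y|.
 rewrite (le_trans (gK _ _))// (le_trans (ler_wpM2r _ (ler_norm K)))// -mulrA ler_wpM2l//.
 by rewrite (le_trans (fL _ _))// ler_wpM2r// ler_norm.
have := aeI (ae_isdiff gfK) (ae_isdiff fL); apply: aeS2 (null_preimage_regular mB B0).
move=> x Bx [gfx fx].
have [Dx|Dx] := eqVneq (detD f x) 0; last first.
 have nB : ~ B (f x) by move=> /Bx /eqP; exact/negP.
 have gx : isdiff g (f x) ('J g (f x)) by apply: contrapT => nx; apply: nB; exact: sB.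
 exact: detD_isdiff_comp fx gx.
rewrite Dx mulr0; move/eqP: Dx => /det0P[v v0 vJ].
apply: etrans (detD_isdiff gfx) _.
move: gfx; move: ('J _ x) => A gfx.
apply/eqP/det0P; exists v; first exact: v0.
apply/eqP; rewrite -normr_le0; apply/ler_addgt0Pr => e e0.
rewrite add0r; have vp : 0 < `|v| by rewrite normr_gt0.
have K1 : 0 < `|K| + 1 by rewrite ltr_wpDl.
have [|d d0 fd] := fx (e / 2 / `|v| / (`|K| + 1)); first by rewrite !divr_gt0.
have [|d' d'0 gd] := gfx (e / 2 / `|v|); first by rewrite !divr_gt0.
pose t := Num.min d d' / `|v|; have t0 : 0 < t by rewrite divr_gt0// lt_min d0.
have nt : `|t *: v| = Num.min d d' by rewrite normrZ gtr0_norm// divfK// gt_eqF.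
have := fd (t *: v); rewrite nt ge_min lexx => /(_ isT).
rewrite -scalemxAl vJ scaler0 subr0 => h1.
have := gd (t *: v); rewrite nt ge_min lexx orbT => /(_ isT).
rewrite -scalemxAl => h2.
have h3 : `|g (f (x + t *: v)) - g (f x)| <= e / 2 / `|v| * Num.min d d'.
 rewrite (le_trans (gK _ _))// (le_trans (ler_wpM2r _ (ler_norm K)))//.
 rewrite (le_trans (ler_wpM2l _ h1))// mulrA; apply: ler_wpM2r; first by rewrite le_min !ltW.
 by rewrite mulrCA ger_pMr ?divr_gt0// ler_pdivrMr// mul1r lerDl.
rewrite -(ler_pM2l t0) -[X in X * `|_| <= _](gtr0_norm t0) -normrZ.
have := ler_normB (g (f (x + t *: v)) - g (f x))
 (g (f (x + t *: v)) - g (f x) - t *: (v *m A)).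
rewrite opprB addrCA subrr addr0 => /le_trans; apply.
have -> : t * e = e / 2 / `|v| * Num.min d d' + e / 2 / `|v| * Num.min d d'.
 by rewrite /t; field; rewrite gt_eqF.
exact: lerD.
Qed.

End chain_rule.

(** * Infimal convolution, and duality of [L^1] with Lipschitz functions *)

Section infimal_convolution.
Context {R : realType} {n : nat}.
Notation Rn := 'rV[R]_n.
Implicit Types (f g : Rn -> R) (c E : R).

(** A regularization that makes sense for unbounded functions and is exact in its constants: for
    [almost_lip] functions the result is [c]-Lipschitz, keeps every modulus of continuity and does
    not increase sup distances. *)
Definition infconv c f (x : Rn) : R := inf [set f y + c * `|x - y| | y in [set: Rn]].

Definition almost_lip c E f := forall x y, f x <= f y + c * `|x - y| + E.

Let has_lb c E f x : almost_lip c E f -> has_lbound [set f y + c * `|x - y| | y in [set: Rn]].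
Proof. by move=> fE; exists (f x - E) => _ [y _ <-]; rewrite lerBlDr. Qed.

Lemma infconv_leP c E f x y : almost_lip c E f -> infconv c f x <= f y + c * `|x - y|.
Proof. by move=> fE; apply: ge_inf; [exact: has_lb fE|exists y]. Qed.

Lemma le_infconv c f x b : (forall y, b <= f y + c * `|x - y|) -> b <= infconv c f x.
Proof.
move=> H; apply: lb_le_inf; first by exists (f x + c * `|x - x|), x.
by move=> _ [y _ <-].
Qed.

Lemma infconv_le c E f x : almost_lip c E f -> infconv c f x <= f x.
Proof. by move=> fE; have := infconv_leP x x fE; rewrite subrr normr0 mulr0 addr0. Qed.

Lemma infconv_ge c E f x : almost_lip c E f -> f x - E <= infconv c f x.
Proof. by move=> fE; apply: le_infconv => y; rewrite lerBlDr. Qed.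

Lemma infconv_lip c E f : 0 <= c -> almost_lip c E f -> lip c (infconv c f).
Proof.
move=> c0 fE; have H x y : infconv c f x <= infconv c f y + c * `|x - y|.
 rewrite -lerBlDr; apply: le_infconv => z; rewrite lerBlDr.
 rewrite (le_trans (infconv_leP x z fE))// -addrA lerD2l -mulrDr ler_wpM2l//.
 by rewrite [leRHS]addrC ler_distD.
by move=> x y; rewrite ler_distl lerBlDr H andbT distrC H.
Qed.

Lemma infconv_close c E E' f g e : almost_lip c E f -> almost_lip c E' g ->
 (forall x, `|f x - g x| <= e) -> forall x, `|infconv c f x - infconv c g x| <= e.
Proof.
move=> fE gE fg x; have [H1 H2] : infconv c f x <= infconv c g x + e /\
  infconv c g x <= infconv c f x + e.
 split; rewrite -lerBlDr; apply: le_infconv => y; rewrite lerBlDr.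
  rewrite (le_trans (infconv_leP x y fE))// addrAC lerD2r//.
  by have := fg y; rewrite ler_distl => /andP[_].
 rewrite (le_trans (infconv_leP x y gE))// addrAC lerD2r//.
 by have := fg y; rewrite distrC ler_distl => /andP[_].
by rewrite ler_distl lerBlDr H2 H1.
Qed.

(** A competitor [z] for [y] is translated to the competitor [z + (x - y)] for [x], which is at the
    same distance. *)
Lemma infconv_modulus c E f (w : R -> R) : almost_lip c E f ->
 (forall x y, `|f x - f y| <= w `|x - y|) ->
 forall x y, `|infconv c f x - infconv c f y| <= w `|x - y|.
Proof.
move=> fE fw; have H x y : infconv c f x <= infconv c f y + w `|x - y|.
 rewrite -lerBlDr; apply: le_infconv => z; rewrite lerBlDr.
 rewrite (le_trans (infconv_leP x (z + (x - y)) fE))//.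
 rewrite (_ : x - (z + (x - y)) = y - z); last first.
   by apply/rowP => i; rewrite !mxE; ring.
 rewrite addrAC lerD2r//; have := fw (z + (x - y)) z.
 rewrite [z + _]addrC addrK ler_distl => /andP[_].
 by [].
by move=> x y; rewrite ler_distl lerBlDr H andbT distrC H.
Qed.

End infimal_convolution.

Lemma aeE d (T : measurableType d) (R : realType) (mu : {measure set T -> \bar R}) (P : T -> Prop) :
 (forall x, P x) -> {ae mu, forall x, P x}.
Proof. by move=> HP; exists set0; split => // x nPx; exfalso; exact: nPx. Qed.

Section real_dominated_convergence.
Context d {T : measurableType d} {R : realType} (mu : {measure set T -> \bar R}).

Lemma Rintegral_dominated_cvg (f_ : nat -> T -> R) (f g : T -> R) :
 (forall k, measT (f_ k)) -> measT f ->
 {ae mu, forall x, f_ k x @[k --> \oo] --> f x} ->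
 intf mu g ->
 (forall k x, `|f_ k x| <= g x) ->
 \int[mu]_x f_ k x @[k --> \oo] --> \int[mu]_x f x.
Proof.
move=> mf_ mf cf ig fg.
have H1 : {ae mu, forall x, setT x -> (EFin \o f_ k) x @[k --> \oo] --> (EFin \o f) x}.
 by apply: aeS cf => x cx _; apply/fine_cvgP; split; [exact: nearW|exact: cx].
have H2 : {ae mu, forall x k, setT x -> (`|(EFin \o f_ k) x| <= (EFin \o g) x)%E}.
 by apply: aeE => x k _; rewrite /= lee_fin.
have m1 k : measT (EFin \o f_ k) by exact/measurable_EFinP.
have m2 : measT (EFin \o f) by exact/measurable_EFinP.
have [iF _ cv] := dominated_convergence measurableT m1 m2 H1 ig H2.
have /fine_cvgP[_] : (\int[mu]_x (f_ k x)%:E)%E @[k --> \oo] --> (fine (\int[mu]_x (f x)%:E)%E)%:E.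
 by rewrite fineK// integrable_fin_num.
by [].
Qed.

End real_dominated_convergence.

Lemma Rintegral_sum d {T : measurableType d} {R : realType} (mu : {measure set T -> \bar R})
  (I : Type) (s : seq I) (F : I -> T -> R) :
 (forall i, intf mu (F i)) ->
 \int[mu]_x (\sum_(i <- s) F i x) = \sum_(i <- s) \int[mu]_x F i x.
Proof.
move=> iF; elim: s => [|i s IHs].
 under eq_Rint do rewrite big_nil.
 by rewrite big_nil /Rintegral integral0_eq.
under eq_Rint do rewrite big_cons.
rewrite RintegralD//; first by rewrite IHs big_cons.
have := integrable_sum measurableT s (P := xpredT) (fun i _ => iF i).
by apply: eq_integrable => // x _; rewrite /= sumEFin.
Qed.

Section duality.
Context {R : realType} {n : nat}.
Notation Rn := 'rV[R]_n.
Notation mu := (lebesgue_rV R n).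

Section absolute_density.
Variables (g : Rn -> R) (ig : intf mu g).

Let nu (A : set Rn) : \bar R := (\int[mu]_(x in A) (`|g x|)%:E)%E.

Let mg : measT (fun x => (`|g x|)%:E).
Proof. by apply/measurable_EFinP; apply: measurableT_comp => //; exact: intg_meas ig. Qed.

Let nu0 : nu set0 = 0%E.
Proof. exact: integral_set0. Qed.

Let nu_ge0 A : (0 <= nu A)%E.
Proof. by apply: integral_ge0 => x _; rewrite lee_fin. Qed.

Let nu_sigma_additive : semi_sigma_additive nu.
Proof. by apply: semi_sigma_additive_nng_induced => // x; rewrite lee_fin. Qed.

HB.instance Definition _ := isMeasure.Build _ _ _ nu nu0 nu_ge0 nu_sigma_additive.

Let nu_fin : fin_num_fun nu.
Proof.
move=> A mA; rewrite ge0_fin_numE//.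
have := intg_abs ig => /(integrable_lty measurableT).
by apply: le_lt_trans; apply: ge0_subset_integral.
Qed.

HB.instance Definition _ := Measure_isFinite.Build _ _ _ nu nu_fin.

(** Borel regularity of the finite measure with density [|g|]. *)
Lemma integrable_open_cover (A : set Rn) (e : R) : measurable A -> 0 < e -> exists U,
 [/\ open U, A `<=` U & \int[mu]_x (`|g x| * \1_(U `\` A) x) <= e].
Proof.
move=> mA e0; have [K [U [cK oU KA AU UK]]] := @borel_regular R n nu A mA e e0.
have mU : measurable U by exact: open_meas.
have mUA : measurable (U `\` A) by exact: measurableD.
exists U; split => //.
have iUA : intf mu (fun x => `|g x| * \1_(U `\` A) x).
 apply: (@intg_mulb _ _ _ _ _ _ 1); first exact: intg_abs.
  exact: measurable_indic.
 by move=> x; rewrite indicE; case: (_ \in _); rewrite ?normr1 ?normr0.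
rewrite -lee_fin (fineK (integrable_fin_num measurableT iUA)).
apply: le_trans (ltW UK); apply: (@le_trans _ _ (nu (U `\` A))).
 rewrite /nu [leRHS]integral_mkcond; apply: eq_ler.
 by apply: eq_integral => x _; rewrite patchE /= indicE; case: (_ \in _); rewrite ?mulr1 ?mulr0.
by apply: le_mu_sub => //; [apply: measurableD => //; exact: closed_meas|
 exact: setDS].
Qed.

End absolute_density.

Let one_almost_lip c (U : set Rn) : 0 <= c -> almost_lip c 1 (\1_U : Rn -> R).
Proof.
move=> c0 x y; rewrite !indicE.
have : 0 <= c * `|x - y| by rewrite mulr_ge0.
by case: (x \in U); case: (y \in U) => /=; lra.
Qed.

Lemma infconv_indic01 (c : R) (U : set Rn) x : 0 <= c -> 0 <= infconv c (\1_U) x <= 1.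
Proof.
move=> c0; apply/andP; split.
 by apply: le_infconv => y; rewrite addr_ge0// mulr_ge0.
rewrite (le_trans (infconv_le x (one_almost_lip U c0)))// indicE.
Qed.

Lemma infconv_indic_cvg (U : set Rn) x : open U ->
 infconv k%:R (\1_U) x @[k --> \oo] --> (\1_U x : R).
Proof.
move=> oU; have [Ux|nUx] := pselect (U x); last first.
 rewrite indicE memNset//; apply: (@cvg_near_cst _ _ _ (fun k : nat => infconv k%:R (\1_U) x)).
 apply: nearW => k; apply/eqP; rewrite eq_le.
 have /andP[-> _] := infconv_indic01 U x (ler0n R k); rewrite andbT.
 by rewrite (le_trans (infconv_le x (one_almost_lip U (ler0n R k))))// indicE memNset.
have /nbhs_ballP[e /= e0 eU] : nbhs x U by exact: open_nbhs_nbhs.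
rewrite indicE mem_set//; apply: (@cvg_near_cst _ _ _ (fun k : nat => infconv k%:R (\1_U) x)).
near=> k; apply/eqP; rewrite eq_le.
have /andP[_ ->] := infconv_indic01 U x (ler0n R k); rewrite /=.
apply: le_infconv => y; rewrite indicE.
have [Uy|nUy] := pselect (U y); first by rewrite mem_set// lerDl mulr_ge0.
rewrite memNset// add0r.
have exy : e <= `|x - y|.
 rewrite leNgt; apply/negP => xy; apply: nUy; apply: eU.
 by rewrite mx_norm_ball.
rewrite (@le_trans _ _ (k%:R * e))//; last by rewrite ler_wpM2l.
rewrite -ler_pdivrMr//; near: k; exact: nbhs_infty_ger.
Unshelve. all: by end_near. Qed.

(* The set [g > 0] is exhausted from outside by open sets, whose indicators
  are increasing limits of the Lipschitz functions [infconv k \1_U]. *)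
Lemma L1_le_lip_dual (g : Rn -> R) (M : R) : intf mu g ->
 (forall (h : Rn -> R) L, 0 <= L -> lip L h -> normle h 1 -> \int[mu]_x (g x * h x) <= M) ->
 \int[mu]_x `|g x| <= M.
Proof.
move=> ig H; have mg := intg_meas ig; have iag := intg_abs ig.
apply/ler_addgt0Pr => e e0; have e2 : 0 < e / 2 by rewrite divr_gt0.
pose P := [set x | 0 < g x].
have mP : measurable P.
 rewrite (_ : P = g @^-1` `]0, +oo[); last by apply/seteqP; split => x /=; rewrite in_itv/= andbT.
 by rewrite -[X in measurable X]setTI; exact: mg.
have [U [oU PU Ule]] := integrable_open_cover ig mP e2.
have mU : measurable U by exact: open_meas.
have mI (A : set Rn) : measurable A -> measT (\1_A : Rn -> R) by exact: measurable_indic.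
pose h k (x : Rn) : R := 2 * infconv k%:R (\1_U) x - 1.
have h1 k x : `|h k x| <= 1.
 have /andP[a1 a2] := infconv_indic01 U x (ler0n R k).
 by rewrite ler_norml /h; apply/andP; split; lra.
have hL k : lip (2 * k%:R) (h k).
 move=> x y; rewrite /h opprB addrA subrK -mulrBr normrM ger0_norm// -mulrA ler_wpM2l//.
 by apply: infconv_lip => //; exact: one_almost_lip.
have mh k : measT (h k) by exact: lip_meas (hL k).
have mU2 : measT (fun x => 2 * \1_U x - 1 : R).
 by apply: measurable_funB => //; apply: measurable_funM => //; exact: mI.
have cv : \int[mu]_x (g x * h k x) @[k --> \oo] --> \int[mu]_x (g x * (2 * \1_U x - 1)).
 apply: (@Rintegral_dominated_cvg _ _ _ _ (fun k x => g x * h k x) _ (fun x => `|g x|)) => //.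
 - by move=> k; exact: measurable_funM.
 - exact: measurable_funM.
 - apply: aeE => x; apply: cvgMr; apply: cvgB; last exact: cvg_cst.
  by apply: cvgMr; exact: infconv_indic_cvg.
 - by move=> k x; rewrite normrM ler_piMr.
have le1 : \int[mu]_x (g x * (2 * \1_U x - 1)) <= M.
 rewrite -(cvg_lim _ cv)//; apply: limr_le; first by apply/cvg_ex; eexists; exact: cv.
 by apply: nearW => k; apply: (H _ (2 * k%:R)) => //; rewrite mulr_ge0.
have i1 : intf mu (fun x => g x * (2 * \1_U x - 1)).
 apply: (@intg_mulb _ _ _ _ _ _ 1) => // x.
 by rewrite indicE ler_norml; case: (_ \in _) => /=; apply/andP; split; lra.
have i2 : intf mu (fun x => `|g x| * \1_(U `\` P) x).
 apply: (@intg_mulb _ _ _ _ _ _ 1) => // [|x]; first by apply: mI; exact: measurableD.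
 by rewrite indicE; case: (_ \in _); rewrite ?normr1 ?normr0.
have i3 : intf mu (fun x => 2 * (`|g x| * \1_(U `\` P) x)).
 by have := integrableZl measurableT 2 i2; apply: eq_integrable.
have -> : \int[mu]_x `|g x| = \int[mu]_x (g x * (2 * \1_U x - 1) + 2 * (`|g x| * \1_(U `\` P) x)).
 apply: eq_Rint => x; rewrite !indicE in_setD.
 have [gx|gx] := ltP 0 (g x).
  have [Px Ux] : x \in P /\ x \in U by split; apply/mem_set => //; exact: PU.
  by rewrite Px Ux/= gtr0_norm//; ring.
 have -> : (x \in P) = false by apply/negbTE/negP => /set_mem; rewrite /P/= ltNge gx.
 by rewrite ler0_norm// andbT; case: (x \in U) => /=; ring.
rewrite RintegralD// lerD// RintegralZl// mulrC -ler_pdivlMr//.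
Qed.

End duality.

(** * The integral of a Jacobian determinant vanishes *)

Section polynomial_extrapolation.
Context {R : realType}.

(** Meant for [\det (t%:M + 'J f x)], a polynomial in [t] whose integral is known for large [t] and
    wanted at [t = 0]; nodes and weights must not depend on the polynomial. A node [a] is added by
    writing [p] as [q * ('X - a%:P)] plus the constant [p.[a]] and extrapolating [q] from nodes
    beyond [a]. *)
Lemma poly_extrapolation (T : R) (n : nat) : exists s : seq (R * R),
 (forall z, z \in s -> T < z.1) /\
 forall p : {poly R}, (size p <= n)%N -> p.[0] = \sum_(z <- s) z.2 * p.[z.1].
Proof.
elim: n T => [|n IHn] T.
 by exists [::]; split => // p; rewrite leqn0 size_poly_eq0 => /eqP ->; rewrite horner0 big_nil.
pose a : R := `|T| + 1.
have Ta : T < a by rewrite (le_lt_trans (ler_norm _))// ltrDl.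
have [s [sT sP]] := IHn a.
exists ((a, 1 + \sum_(z <- s) a * z.2 / (z.1 - a)) :: [seq (z.1, - (a * z.2 / (z.1 - a))) | z <- s]).
split=> [z|p sp].
 by rewrite inE => /orP[/eqP ->//|/mapP[w ws ->] /=]; exact: lt_trans (sT _ ws).
have : root (p - p.[a]%:P) a by rewrite /root !hornerE subrr.
move=> /factor_theorem[q pq].
have pE z : p.[z] = q.[z] * (z - a) + p.[a].
 by have /(congr1 (horner^~ z)) := pq; rewrite !hornerE => <-; rewrite subrK.
have sq : (size q <= n)%N.
 have [->|q0] := eqVneq q 0; first by rewrite size_poly0.
 have sM : size (q * ('X - a%:P)) = (size q).+1.
  by rewrite size_Mmonic ?monicXsubC// size_XsubC addn2.
 rewrite -ltnS -sM -pq (leq_trans (size_polyD _ _))//.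
 by rewrite geq_max sp size_polyN (leq_trans (size_polyC_leq1 _)).
rewrite big_cons big_map/= [LHS]pE (sP q sq) sub0r mulrN mulr_suml -sumrN mulrDl mul1r mulr_suml.
rewrite addrC -addrA; congr (_ + _); rewrite -big_split/=; apply: eq_big_seq => z zs.
rewrite (pE z.1); field.
by rewrite subr_eq0 gt_eqF// sT.
Qed.

End polynomial_extrapolation.

Lemma clamp_nonexpansive (R : realType) (a b : R) :
 `|Num.min 1 (Num.max 0 a) - Num.min 1 (Num.max 0 b)| <= `|a - b|.
Proof.
have h1 := ler_norm (a - b); have := ler_norm (b - a); rewrite distrC => h2.
have m0 : Num.min 1 0 = 0 :> R by apply/min_idPr; exact: ler01.
rewrite ler_norml; apply/andP.
by case: (leP 0 a) => ?; case: (leP 0 b) => ?; case: (leP 1 a) => ?; case: (leP 1 b) => ?;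
 rewrite ?m0; split; lra.
Qed.

Section stokes.
Context {R : realType} {m : nat}.
Notation n := m.+1.
Notation Rn := 'rV[R]_n.
Notation mu := (lebesgue_rV R n).
Implicit Types (J : 'M[R]_n).

Lemma det_shift_poly J : exists2 p : {poly R}, (size p <= n.+1)%N &
 forall t, p.[t] = \det (t%:M + J).
Proof.
exists (char_poly (- J)); first by rewrite size_char_poly.
move=> t; rewrite /char_poly -[LHS]/(horner_eval t _) -det_map_mx; congr (\det _).
by apply/matrixP => i j; rewrite !mxE /= /horner_eval; case: (i == j); rewrite /= !hornerE opprK.
Qed.

(** Along the segment [t + s J] with [s] in [[0, 1]] the matrix stays invertible, so its
    determinant, a polynomial in [s], keeps the positive sign that it has at [s = 0]. *)
Lemma det_shift_gt0 J (K t : R) : 0 <= K -> K < t ->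
 (forall h : 'rV[R]_n, `|h *m J| <= K * `|h|) -> 0 < \det (t%:M + J).
Proof.
move=> K0 Kt JK; have t0 : 0 < t by exact: le_lt_trans Kt.
pose q : {poly R} := \det (t%:P%:M + 'X *: map_mx polyC J).
have qE s : q.[s] = \det (t%:M + s *: J).
 rewrite -[LHS]/(horner_eval s _) -det_map_mx; congr (\det _).
 by apply/matrixP => i j; rewrite !mxE /= /horner_eval; case: (i == j); rewrite /= !hornerE.
have unit s : 0 <= s <= 1 -> q.[s] != 0.
 move=> /andP[s0 s1]; rewrite qE -unitfE -unitmxE.
 apply: (@det_norm_ge _ _ _ (t - K) _ _).1; first by rewrite subr_gt0.
 move=> h; rewrite mulmxDr mul_mx_scalar -scalemxAr mulrBl lerBlDr.
 have := ler_normB (t *: h + s *: (h *m J)) (s *: (h *m J)).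
 rewrite addrK normrZ gtr0_norm// => /le_trans; apply; rewrite lerD2l normrZ ger0_norm//.
 by rewrite (le_trans _ (JK h))// ler_piMl.
have q0 : 0 < q.[0] by rewrite qE scale0r addr0 det_scalar exprn_gt0.
rewrite ltNge; apply/negP => q1.
have [|x x01] := @poly_ivt R (- q) 0 1 ler01.
 by rewrite !hornerN oppr_le0 (ltW q0) oppr_ge0 qE scale1r.
by rewrite /root !hornerE oppr_eq0; apply/negP; exact: unit.
Qed.

Section compact_support.
Variables (f : Rn -> Rn) (K N : R).
Hypotheses (K0 : 0 <= K) (N0 : 0 <= N).
Hypotheses (fK : nlip K f).
Hypothesis fN : vanish N f.

Variable t : R.
Hypothesis Kt : K < t.

(** For [t > K] the linear part dominates: [T] is a Lipschitz bijection. It equals the dilation by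
    [t] outside [cube N], and so carries [cube N] onto [cube (t * N)]. *)
Let T (x : Rn) : Rn := t *: x + f x.

Let t0 : 0 < t. Proof. exact: le_lt_trans Kt. Qed.

Let TL x y : `|T x - T y| <= (t + K) * `|x - y|.
Proof.
rewrite /T opprD addrACA -scalerBr mulrDl (le_trans (ler_normD _ _))// lerD//.
by rewrite normrZ gtr0_norm.
Qed.

Let Tinj x y : T x = T y -> x = y.
Proof.
move=> Txy; apply/eqP; rewrite -subr_eq0 -normr_le0.
have : t * `|x - y| <= K * `|x - y|.
 rewrite -[X in X * _ <= _](gtr0_norm t0) -normrZ scalerBr.
 rewrite (_ : t *: x - t *: y = - (f x - f y)) ?normrN//.
 by apply/eqP; rewrite opprB subr_eq addrAC eq_sym subr_eq [f y + _]addrC eq_sym; apply/eqP.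
by rewrite -subr_ge0 -mulrBl nmulr_rge0// subr_lt0.
Qed.

(** At a minimizer [c] of [|T x - y|] over a large cube, a nonzero minimum is impossible: the fixed
    point step [t^-1 *: (y - f c)] stays in the cube and reduces the value by the factor
    [K / t < 1]. *)
Let Tsurj y : exists x, T x = y.
Proof.
have tK : 0 < t - K by rewrite subr_gt0.
pose r : R := (`|y| + `|f 0|) / (t - K).
have r0 : 0 <= r by apply: divr_ge0; [exact: addr_ge0|exact: ltW].
pose F (x : Rn) := `|T x - y|.
have cF : continuous F.
 apply: (@lip_continuous _ _ R^o _ (t + K)) => x z.
 by rewrite (le_trans (ler_dist_dist _ _))// opprB addrA subrK.
have cc : compact (cube r : set Rn) by exact: compact_cube.
have [||c /set_mem /(cubeP _ r0) cr cP] := @EVT_min_rV R n F (cube r) _ cc.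
- by exists 0; apply/(cubeP _ r0); rewrite normr0.
- exact: continuous_subspaceT.
exists c; apply/eqP; rewrite -subr_eq0 -normr_le0 leNgt; apply/negP => Fc.
pose x := t^-1 *: (y - f c).
have xr : `|x| <= r.
 rewrite normrZ gtr0_norm ?invr_gt0// ler_pdivrMl// (le_trans (ler_normB _ _))//.
 have fc : `|f c| <= `|f 0| + K * r.
  rewrite -[f c](subrK (f 0)) (le_trans (ler_normD _ _))// addrC lerD2l.
  by rewrite (le_trans (fK _ _))// subr0 ler_wpM2l.
 rewrite (le_trans (lerD (lexx _) fc))// addrA -lerBrDr -mulrBl /r mulrC divfK//.
 by rewrite gt_eqF.
have := cP x (mem_set ((cubeP _ r0).2 xr)); apply/negP; rewrite -ltNge /F.
have -> : T x - y = f x - f c.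
 have tx : t *: x = y - f c by rewrite scalerA divff ?gt_eqF// scale1r.
 by rewrite /T tx; apply/rowP => i; rewrite !mxE; ring.
rewrite (le_lt_trans (fK _ _))//.
have -> : x - c = - (t^-1 *: (T c - y)).
 by apply/rowP => i; rewrite !mxE; field; rewrite gt_eqF.
rewrite normrN normrZ gtr0_norm ?invr_gt0// mulrA gtr_pMl// ltr_pdivrMr// mul1r//.
Qed.

Let T_cube x : cube (t * N) (T x) <-> cube N x.
Proof.
have tN : 0 <= t * N by rewrite mulr_ge0// ltW.
have scale (z : Rn) : cube (t * N) (t *: z) <-> cube N z.
 split=> [/(cubeP _ tN)|/(cubeP _ N0) zN]; last first.
  by apply/(cubeP _ tN); rewrite normrZ gtr0_norm// ler_wpM2l// ltW.
 by rewrite normrZ gtr0_norm// ler_pM2l// => zN; exact/(cubeP _ N0).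
split=> [Tx|xN]; apply: contrapT => nx.
 by apply: (nx); apply: (scale x).1; move: Tx; rewrite /T (fN nx) addr0.
have tz : t *: (t^-1 *: T x) = T x by rewrite scalerA divff ?gt_eqF// scale1r.
have nz : ~ cube N (t^-1 *: T x) by move=> /scale; rewrite tz.
have : T (t^-1 *: T x) = T x by rewrite {1}/T fN// addr0.
by move=> /Tinj xE; apply: nz; rewrite xE.
Qed.

(** Area formula for [T]: its Jacobian is positive almost everywhere and [T] is a bijection, so the
    indicator of [cube N] is pushed forward to that of [cube (t * N)]. *)
Lemma shifted_detD_integral : \int[mu]_x (\1_(cube N) x * \det (t%:M + 'J f x)) =
 t ^+ n * fine (mu (cube N)).
Proof.
have mN : measurable (cube N : set Rn) by exact: meas_cube.
have mtN : measurable (cube (t * N) : set Rn) by exact: meas_cube.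
pose u : Rn -> R := \1_(cube N).
have iu : intf mu u by apply: intg_indic => //; exact: cube_lty.
have [|v [iv _ vch vf]] := pushforward_exists TL N0 iu.
 by move=> x nx; rewrite /u indicE memNset.
have m1 : measurable_fun [set: Rn] (fun _ : Rn => 1 : R) by exact: measurable_cst.
have := vch (fun=> 1) 1 m1; rewrite normr1 => /(_ (fun=> lexx _)) vE.
have Tdiff x : isdiff f x ('J f x) -> isdiff T x (t%:M + 'J f x).
 move=> fx e e0; have [d d0 fd] := fx e e0; exists d => // h /fd.
 rewrite mulmxDr mul_mx_scalar /T scalerDr.
 by move: (h *m 'J f x) => w; congr (`|_| <= _); apply/rowP => i; rewrite !mxE; ring.
have fKh x : isdiff f x ('J f x) -> forall h : Rn, `|h *m 'J f x| <= K * `|h|.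
 move=> fx; apply: (isdiff_norm_le fx); exists 1 => // h _.
 by rewrite (le_trans (fK _ _))// addrAC subrr add0r.
have Tpos x : isdiff f x ('J f x) -> detD T x = \det (t%:M + 'J f x) /\ 0 < detD T x.
 move=> fx; have E := detD_isdiff (Tdiff x fx); split; first exact: E.
 by rewrite E; apply: (det_shift_gt0 K0 Kt); exact: fKh.
have vE1 : {ae mu, forall y, v y = \1_(cube (t * N)) y}.
 have [B [mB B0 sB]] := ae_isdiff fK.
 have := lipschitz_image_negligible TL mB B0 => nB.
 have good : {ae mu, forall y, forall x, T x = y -> isdiff f x ('J f x)}.
  apply: negligibleS nB => y /existsNP[x /not_implyP[Tx nx]].
  by exists x => //; exact: sB.
 apply: aeS2 vf good => y -> yg.
 have [x Tx] := Tsurj y.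
 have -> : T @^-1` [set y] = [set x].
  by apply/seteqP; split => [z /= Tz|z /= ->//]; apply: Tinj; rewrite Tz Tx.
 rewrite fsbig_set1 gtr0_sg ?mulr1; last by have [] := Tpos x (yg x Tx).
 rewrite /u !indicE -Tx; congr (_%:R); congr nat_of_bool.
 by apply/idP/idP => /set_mem h; apply/mem_set; apply/T_cube.
have mD := meas_detD fK.
have mTD := meas_detD TL.
have aeD : {ae mu, forall x, detD T x = \det (t%:M + 'J f x)}.
 by have := ae_isdiff fK; apply: aeS => x /Tpos[].
have mdet : measT (fun x => \det (t%:M + 'J f x)).
 rewrite /determinant; apply: measurable_sum => s; apply: measurable_funM => //.
 apply: measurable_prod => i _.
 rewrite (_ : (fun x => _) = (fun x => (t%:M : 'M[R]_n) i (s i) + 'J f x i (s i))); last first.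
  by apply/funext => x; rewrite mxE.
 by apply: measurable_funD => //; exact: measurable_jacobian fK _ _.
have mu1 : measT u by exact: measurable_indic.
transitivity (\int[mu]_x (u x * 1 * detD T x)).
 apply: eq_Rint_ae; [exact: measurable_funM|apply: measurable_funM => //; exact: measurable_funM|].
 by apply: aeS aeD => x ->; rewrite mulr1.
rewrite -vE; transitivity (\int[mu]_y (\1_(cube (t * N)) y : R)).
 apply: eq_Rint_ae; [|exact: measurable_indic|].
  by apply: measurable_funM => //; exact: intg_meas iv.
 by apply: aeS vE1 => y ->; rewrite mulr1.
have box_cube s : 0 <= s -> mu (cube s) = ((s + s) ^+ n)%:E.
 move=> s0; rewrite [LHS]lebesgue_rV_box => [|i]; last by rewrite lerNl (le_trans _ s0)// oppr_le0.
 by rewrite opprK prodr_const card_ord.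
have tN : 0 <= t * N by rewrite mulr_ge0// ltW.
rewrite (box_cube _ N0) /Rintegral integral_indic// setIT.
apply: etrans (congr1 fine (box_cube _ tN)) _.
by rewrite -mulrDr exprMn.
Qed.

End compact_support.

(** For [t > K] the integral of [\det (t%:M + 'J f x)] over the cube is a constant times the
    monomial [t ^+ n]. Extrapolated to [t = 0] it gives 0, since [n] is positive. *)
Lemma stokes_compact (f : Rn -> Rn) (K N : R) : 0 <= K -> 0 <= N ->
 nlip K f -> vanish N f ->
 \int[mu]_x detD f x = 0.
Proof.
move=> K0 N0 fK fN.
have [s [sK sP]] := poly_extrapolation K n.+1.
have mN : measurable (cube N : set Rn) by exact: meas_cube.
pose u : Rn -> R := \1_(cube N).
have iu : intf mu u by apply: intg_indic => //; exact: cube_lty.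
have mJ i j := measurable_jacobian fK i j.
pose D (t : R) (x : Rn) : R := \det (t%:M + 'J f x).
have mD t : measT (D t).
 rewrite /D /determinant; apply: measurable_sum => p; apply: measurable_funM => //.
 apply: measurable_prod => i _.
 rewrite (_ : (fun x => _) = (fun x => (t%:M : 'M[R]_n) i (p i) + 'J f x i (p i))); last first.
  by apply/funext => x; rewrite mxE.
 by apply: measurable_funD => //; exact: mJ.
have iD t : intf mu (fun x => u x * D t x).
 have [M MP] := jacobian_bounded fK.
 apply: (intg_mulb (M := n`!%:R * \prod_(j < n) (`|t| + M)) iu (mD t)) => x.
 apply: detD_leibniz_le => i j.
 have -> : (t%:M + 'J f x) i j = (t%:M : 'M[R]_n) i j + 'J f x i j by rewrite mxE.
 apply: (le_trans (ler_normD _ _)); apply: lerD; last exact: MP.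
 by rewrite mxE; case: (i == j); rewrite ?mulr1n ?mulr0n ?normr0.
transitivity (\int[mu]_x (\sum_(z <- s) z.2 * (u x * D z.1 x))).
 apply: eq_Rint_ae.
 - exact: meas_detD fK.
 - apply: measurable_sum => z; apply: measurable_funM => //; apply: measurable_funM => //.
  exact: measurable_indic.
 have := ae_isdiff fK; apply: aeS => x fx.
 have [p sp pE] := det_shift_poly ('J f x).
 have -> : \sum_(z <- s) z.2 * (u x * D z.1 x) = u x * \sum_(z <- s) z.2 * p.[z.1].
  by rewrite mulr_sumr; apply: eq_bigr => z _; rewrite pE mulrCA.
 rewrite -sP// pE raddf0 add0r.
 have [xN|nxN] := pselect (cube N x); first by rewrite /u indicE mem_set// mul1r.
 rewrite /u indicE memNset// mul0r.
 have [d d0 dN] : exists2 d : R, 0 < d & forall y, `|y - x| <= d -> ~ cube N y.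
  have : open (~` (cube N : set Rn)) by apply: closed_openC; exact: closed_box.
  move=> /(_ x nxN)/nbhs_ballP[d /= d0 dN]; exists (d / 2); first by rewrite divr_gt0.
  move=> y yx; apply: dN; rewrite mx_norm_ball /ball_/= distrC (le_lt_trans yx)//.
  by rewrite ltr_pdivrMr// ltr_pMr// ltr1n.
 have f0 : isdiff f x 0.
  apply: (isdiff_local d0 (f := fun=> 0)); first by move=> y /dN /fN ->.
  by move=> e e0; exists 1 => // h _; rewrite mulmx0 !subrr normr0 mulr_ge0// ltW.
 by rewrite (detD_isdiff f0) det0.
have iz (z : R * R) : intf mu (fun x => z.2 * (u x * D z.1 x)).
 by have := integrableZl measurableT z.2 (iD z.1); apply: eq_integrable.
rewrite (Rintegral_sum _ iz).
transitivity (\sum_(z <- s) z.2 * (z.1 ^+ n * fine (mu (cube N)))).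
 apply: eq_big_seq => z zs; rewrite RintegralZl//; congr (_ * _).
 by apply: (shifted_detD_integral K0 N0 fK fN); exact: sK.
have := sP ((fine (mu (cube N))) *: 'X^n) _.
rewrite (leq_trans (size_scale_leq _ _)) ?size_polyXn// => /(_ isT).
rewrite !hornerE expr0n mulr0 => H; rewrite [RHS]H; apply: eq_bigr => z _.
by rewrite hornerZ hornerXn; congr (_ * _); exact: mulrC.
Qed.

Lemma exists_cutoff (N : R) : 0 <= N -> exists c : Rn -> R,
 [/\ lip 1 c, forall x, 0 <= c x <= 1, forall x, `|x| <= N -> c x = 1 &
   forall x, N + 1 <= `|x| -> c x = 0].
Proof.
move=> N0; pose c (x : Rn) := Num.min 1 (Num.max 0 (N + 1 - `|x|)).
exists c; split.
- move=> x y; rewrite mul1r (le_trans (clamp_nonexpansive _ _))//.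
 rewrite (_ : _ - _ = `|y| - `|x|); last by ring.
 by rewrite [leRHS]distrC ler_dist_dist.
- by move=> x; rewrite /c le_min ler01 le_max lexx/= ge_min lexx.
- by move=> x xN; rewrite /c (max_idPr _) ?(min_idPl _)//; lra.
- by move=> x xN; rewrite /c (max_idPl _) ?(min_idPr _)//; lra.
Qed.

(* Multiplying the other components by a cutoff changes neither side. *)
Lemma stokes (L : 'I_n -> R) (f : Rn -> Rn) (j : 'I_n) (N : R) : 0 <= N ->
 lips L f -> (forall x, ~ cube N x -> f x ord0 j = 0) -> \int[mu]_x detD f x = 0.
Proof.
move=> N0 fL fN; have [K K0 fK] := lips_lip fL.
have N1 : 0 <= N + 1 by rewrite addr_ge0.
have [c [c1 c01 cin cout]] := exists_cutoff N1.
pose g (x : Rn) := c x *: f x.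
have N2 : 0 <= N + 1 + 1 by rewrite addr_ge0.
have gN x : ~ cube (N + 1 + 1) x -> g x = 0.
 move=> nx; rewrite /g cout ?scale0r//; rewrite leNgt; apply/negP => xN.
 by apply: nx; apply/(cubeP _ N2); exact: ltW.
pose B := `|f 0| + K * (N + 1 + 1).
have B0 : 0 <= B by rewrite addr_ge0// mulr_ge0.
have fB x : `|x| <= N + 1 + 1 -> `|f x| <= B.
 move=> xN; rewrite -[f x](subrK (f 0)) (le_trans (ler_normD _ _))// addrC lerD2l.
 by rewrite (le_trans (fK _ _))// subr0 ler_wpM2l.
have gK x y : `|g x - g y| <= (K + B) * `|x - y|.
 wlog xy : x y / `|x| <= `|y|.
  move=> H; have [|/ltW yx] := leP `|x| `|y|; first exact: H.
  by rewrite distrC [`|x - y|]distrC; exact: H.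
 have [xN|xN] := leP `|x| (N + 1 + 1); last first.
  have out (z : Rn) : `|x| <= `|z| -> g z = 0.
   move=> xz; apply: gN => /(cubeP _ N2) zN.
   by have := lt_le_trans xN (le_trans xz zN); rewrite ltxx.
  by rewrite !out// subrr normr0 mulr_ge0// addr_ge0.
 rewrite /g (_ : _ - _ = (c x - c y) *: f x + c y *: (f x - f y)); last first.
  by apply/rowP => i; rewrite !mxE; ring.
 rewrite (le_trans (ler_normD _ _))// !normrZ addrC mulrDl lerD//.
  have /andP[c0 c1'] := c01 y; rewrite ger0_norm// (le_trans _ (fK x y))//.
  by rewrite ler_piMl.
 rewrite mulrC ler_pM//; first exact: fB.
 by have := c1 x y; rewrite mul1r.
have KB : 0 <= K + B by rewrite addr_ge0.
rewrite -[RHS](stokes_compact KB N2 gK gN).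
apply: eq_Rint_ae; [exact: meas_detD fK|exact: meas_detD gK|].
apply: aeS2 (ae_isdiff fK) (ae_isdiff gK) => x fx gx.
have [xN|xN] := ltP `|x| (N + 1).
 have e0 : 0 < N + 1 - `|x| by rewrite subr_gt0.
 have fgx : isdiff g x ('J f x).
  apply: (isdiff_local e0 _ fx) => y yx; rewrite /g cin ?scale1r//.
  by rewrite -[y](subrK x) (le_trans (ler_normD _ _))// addrC -lerBrDl.
 by rewrite (detD_isdiff fx) (detD_isdiff fgx).
have zero (h : Rn -> Rn) : isdiff h x ('J h x) ->
  (forall y, `|y - x| <= 1 / 2 -> h y ord0 j = 0) -> detD h x = 0.
 move=> hx h0; have hj : sdiff (fun y => h y ord0 j) x 0.
  move=> e e0; exists (1 / 2); first by rewrite divr_gt0.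
  move=> k k1; rewrite !h0 ?subrr ?normr0 ?divr_ge0//; last by rewrite addrC addKr.
  by rewrite big1 ?subrr ?normr0 ?mulr_ge0 ?(ltW e0)// => i _; rewrite mxE mul0r.
 rewrite (detD_isdiff hx) (expand_det_col _ j) big1// => i _.
 by rewrite (jacobian_pd _ _ hx) (sdiff_pd _ hj) mxE mul0r.
have out y : `|y - x| <= 1 / 2 -> ~ cube N y.
 move=> yx /(cubeP _ N0) yN.
 have : `|x| <= N + 1 / 2.
  by rewrite -[x](subrK y) (le_trans (ler_normD _ _))// addrC lerD// distrC.
 by move=> xN'; move: (le_trans xN xN'); rewrite lerD2l; apply/negP; rewrite -ltNge ltr_pdivrMr// mul1r ltr1n.
by rewrite !zero// => y /out/fN; rewrite ?mxE => -> //; rewrite mulr0.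
Qed.

End stokes.

(** * Tent and ramp functions *)

Section hat_function.
Context {R : realType}.
Implicit Types s h : R.

Let c s : R := Num.max 0 s.
Let q s : R := c s ^+ 2 / 2.

(** The tent [1 - |s|] cut off at 0; [ramp] is its antiderivative, rising from 0 to 1. As second
    differences of the positive part [c] and of its primitive [q], all their properties reduce to
    polynomial inequalities on finitely many cases. *)
Definition hat s : R := c (s + 1) - 2 * c s + c (s - 1).
Definition ramp s : R := q (s + 1) - 2 * q s + q (s - 1).

Let cE s : (c s = 0 /\ s <= 0) \/ (c s = s /\ 0 <= s).
Proof. by rewrite /c; case: (leP 0 s) => s0; [right|left; split => //; exact: ltW]. Qed.

Lemma hat01 s : 0 <= hat s <= 1.
Proof.
rewrite /hat; apply/andP.
by case: (cE s) => -[-> ?]; case: (cE (s + 1)) => -[-> ?]; case: (cE (s - 1)) => -[-> ?]; split; lra.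
Qed.

Lemma hat_out s : 1 <= `|s| -> hat s = 0.
Proof.
rewrite /hat ler_normr => /orP s1.
by case: (cE s) => -[-> ?]; case: (cE (s + 1)) => -[-> ?]; case: (cE (s - 1)) => -[-> ?]; case: s1 => ?; lra.
Qed.

Lemma hat_half s : `|s| <= 2^-1 -> 2^-1 <= hat s.
Proof.
rewrite /hat ler_norml => /andP[? ?].
by case: (cE s) => -[-> ?]; case: (cE (s + 1)) => -[-> ?]; case: (cE (s - 1)) => -[-> ?]; lra.
Qed.

Lemma hat_lip s h : `|hat s - hat h| <= 4 * `|s - h|.
Proof.
have cl a b : `|c a - c b| <= `|a - b|.
 have h1 := ler_norm (a - b); have := ler_norm (b - a); rewrite distrC => h2.
 rewrite ler_norml; apply/andP.
 by case: (cE a) => -[-> ?]; case: (cE b) => -[-> ?]; split; lra.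
have := cl (s + 1) (h + 1); have := cl s h; have := cl (s - 1) (h - 1).
rewrite (_ : s + 1 - (h + 1) = s - h); last by ring.
rewrite (_ : s - 1 - (h - 1) = s - h); last by ring.
rewrite /hat !ler_norml => /andP[? ?] /andP[? ?] /andP[? ?]; apply/andP; split; lra.
Qed.

Lemma ramp01 s : 0 <= ramp s <= 1.
Proof.
rewrite /ramp /q; apply/andP.
by case: (cE s) => -[-> ?]; case: (cE (s + 1)) => -[-> ?]; case: (cE (s - 1)) => -[-> ?]; split; nra.
Qed.

Lemma ramp_left s : s <= -1 -> ramp s = 0.
Proof.
rewrite /ramp /q => s1.
by case: (cE s) => -[-> ?]; case: (cE (s + 1)) => -[-> ?]; case: (cE (s - 1)) => -[-> ?]; nra.
Qed.

Lemma ramp_right s : 1 <= s -> ramp s = 1.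
Proof.
rewrite /ramp /q => s1.
by case: (cE s) => -[-> ?]; case: (cE (s + 1)) => -[-> ?]; case: (cE (s - 1)) => -[-> ?]; nra.
Qed.

Lemma ramp_taylor s h : `|ramp (s + h) - ramp s - h * hat s| <= 2 * h ^+ 2.
Proof.
have ql a : `|q (a + h) - q a - h * c a| <= h ^+ 2 / 2.
 rewrite ler_norml /q; apply/andP.
 by case: (cE a) => -[-> ?]; case: (cE (a + h)) => -[-> ?]; split; nra.
have := ql (s + 1); have := ql s; have := ql (s - 1).
rewrite [s - 1 + h]addrAC [s + 1 + h]addrAC /ramp /hat.
rewrite !ler_norml => /andP[? ?] /andP[? ?] /andP[? ?]; apply/andP; split; nra.
Qed.

Lemma ramp_lip s h : `|ramp s - ramp h| <= 3 * `|s - h|.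
Proof.
have /andP[r0 r1] := ramp01 s; have /andP[r0' r1'] := ramp01 h.
have /andP[k0 k1] := hat01 h.
have [sh|sh] := leP 1 `|s - h|.
 by rewrite ler_norml; apply/andP; split; lra.
have := ramp_taylor h (s - h); rewrite [h + _]addrC subrK => rt.
have e1 : (s - h) ^+ 2 <= `|s - h|.
 by rewrite -[X in X <= _]real_normK ?num_real// expr2 ler_piMl// ltW.
have e2 : `|(s - h) * hat h| <= `|s - h| by rewrite normrM (ger0_norm k0) ler_piMr.
rewrite -[ramp s - ramp h](subrK ((s - h) * hat h)) (le_trans (ler_normD _ _))//.
by rewrite (le_trans (lerD rt e2))//; lra.
Qed.

Lemma ramp_quotient_cvg (a s : R) :
 k.+1%:R * (ramp (s + a * k.+1%:R^-1) - ramp s) @[k --> \oo] --> a * hat s.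
Proof.
apply/cvgrPdist_le => e e0.
have a0 : 0 < 2 * a ^+ 2 + 1 by rewrite ltr_wpDl// mulr_ge0// sqr_ge0.
have [K Ke] := exists_inv_nat (divr_gt0 e0 a0).
near=> k.
have kp : 0 < k.+1%:R :> R by [].
have kK : k.+1%:R^-1 <= e / (2 * a ^+ 2 + 1).
 apply: le_trans Ke; rewrite lef_pV2 ?posrE// ler_nat ltnS.
 by near: k; exact: nbhs_infty_ge.
have -> : a * hat s - k.+1%:R * (ramp (s + a * k.+1%:R^-1) - ramp s) =
  - (k.+1%:R * (ramp (s + a * k.+1%:R^-1) - ramp s - a * k.+1%:R^-1 * hat s)) by field.
rewrite normrN normrM gtr0_norm// -ler_pdivlMl// (le_trans (ramp_taylor _ _))//.
rewrite exprMn (_ : 2 * _ = k.+1%:R^-1 * (2 * a ^+ 2 * k.+1%:R^-1)); last by ring.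
rewrite ler_wpM2l ?invr_ge0//.
have q0 : 0 <= 2 * a ^+ 2 by rewrite mulr_ge0// sqr_ge0.
apply: le_trans (ler_wpM2l q0 kK) _.
by rewrite mulrCA ger_pMr// ler_pdivrMr// mul1r lerDl.
Unshelve. all: by end_near. Qed.

End hat_function.

Lemma prod_le1 {R : realType} (I : Type) (s : seq I) (c : I -> R) :
 normle c 1 -> `|\prod_(i <- s) c i| <= 1.
Proof.
move=> c1; elim: s => [|k r IHr]; first by rewrite big_nil normr1.
by rewrite big_cons normrM mulr_ile1.
Qed.

Lemma prod_dist_le {R : realType} (I : Type) (s : seq I) (a b : I -> R) :
 normle a 1 -> normle b 1 ->
 `|\prod_(i <- s) a i - \prod_(i <- s) b i| <= \sum_(i <- s) `|a i - b i|.
Proof.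
move=> a1 b1; elim: s => [|i s IHs]; first by rewrite !big_nil subrr normr0.
rewrite !big_cons (_ : _ - _ = (a i - b i) * \prod_(k <- s) a k +
  b i * (\prod_(k <- s) a k - \prod_(k <- s) b k)); last by ring.
rewrite (le_trans (ler_normD _ _))// lerD// normrM; first by rewrite ler_piMr// prod_le1.
by rewrite (le_trans _ IHs)// ler_piMl.
Qed.

(** * Anisotropic product kernels *)

Section kernels.
Context {R : realType} {m : nat}.
Notation n := m.+1.
Notation Rn := 'rV[R]_n.
Notation mu := (lebesgue_rV R n).
Implicit Types (t : 'I_n -> R) (i l : 'I_n) (z : Rn).

Definition ker (M L : R) t (K : Rn -> R) :=
 [/\ 0 <= L, lip L K, forall z, `|K z| <= M & forall z l, t l <= `|z ord0 l| -> K z = 0].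

Definition hats t (z : Rn) : R := \prod_l hat (z ord0 l / t l).

Lemma prod_kernel (c L : R) (k : 'I_n -> R -> R) t : 0 <= L ->
 (forall l s, `|k l s| <= 1) -> (forall l s h, `|k l s - k l h| <= L * `|s - h|) ->
 (forall l s, t l <= `|s| -> k l s = 0) ->
 ker `|c| (`|c| * (n%:R * L)) t (fun z => c * \prod_l k l (z ord0 l)).
Proof.
move=> L0 k1 kL k0; split.
- by rewrite !mulr_ge0.
- move=> x y; rewrite -mulrBr normrM -mulrA ler_wpM2l//.
 rewrite (le_trans (prod_dist_le _ _ _))//.
 apply: (@le_trans _ _ (\sum_(l < n) L * `|x - y|)).
  apply: ler_sum => l _; rewrite (le_trans (kL _ _ _))// ler_wpM2l//.
  by have := coord_le (x - y) l; rewrite !mxE.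
 by rewrite sumr_const card_ord -[X in X <= _]mulr_natl mulrA.
- by move=> z; rewrite normrM ler_piMr// prod_le1.
- by move=> z l zl; rewrite (bigD1 l)//= k0// mul0r mulr0.
Qed.

Let hat1 (s : R) : `|hat s| <= 1.
Proof. by have /andP[h0 h1] := hat01 s; rewrite ger0_norm. Qed.

Let hat_scale_lip (a s h : R) : 0 <= a -> `|hat (s * a) - hat (h * a)| <= 4 * a * `|s - h|.
Proof. by move=> a0; rewrite (le_trans (hat_lip _ _))// -mulrBl normrM (ger0_norm a0) -mulrA [a * _]mulrC. Qed.

Let hat_scale_out (a s : R) : 0 < a -> a <= `|s| -> hat (s / a) = 0.
Proof. by move=> a0 sa; apply: hat_out; rewrite normrM normfV (gtr0_norm a0) ler_pdivlMr// mul1r. Qed.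

Lemma hats_ker t T : allpos t -> (forall l, (t l)^-1 <= T) -> ker 1 (n%:R * (4 * T)) t (hats t).
Proof.
move=> t0 tT; have T0 : 0 <= T by rewrite (le_trans _ (tT ord0))// invr_ge0 ltW.
have := @prod_kernel 1 (4 * T) (fun l s => hat (s / t l)) t.
rewrite normr1 mul1r (_ : (fun z => _) = hats t); last by apply/funext => z; rewrite mul1r.
apply=> //; first by rewrite mulr_ge0.
 by move=> l s h; rewrite (le_trans (hat_scale_lip _ _ _)) ?invr_ge0 ?(ltW (t0 l))// ler_wpM2r// ler_wpM2l.
by move=> l s; apply: hat_scale_out.
Qed.

Lemma hats_ge0 t z : 0 <= hats t z.
Proof. by apply: prodr_ge0 => l _; have /andP[] := hat01 (z ord0 l / t l). Qed.

Lemma ker_measurable M L t K : ker M L t K -> measT K.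
Proof. by case=> _ KL _ _; exact: lip_meas KL. Qed.

Definition tbox t : set Rn := box (fun l => - t l) t.

Lemma measure_tbox t : allpos t -> mu (tbox t) = (\prod_l (2 * t l))%:E.
Proof.
move=> t0; rewrite [LHS]lebesgue_rV_box => [|l]; last by rewrite ge0_cp// ltW.
by congr EFin; apply: eq_bigr => l _; rewrite opprK mulr_natl mulr2n.
Qed.

Lemma ker_le_indic M L t K z : ker M L t K -> `|K z| <= M * \1_(tbox t) z.
Proof.
move=> [_ _ KM K0]; rewrite indicE.
have [zt|nzt] := pselect (tbox t z); first by rewrite mem_set// mulr1.
rewrite memNset// mulr0; suff -> : K z = 0 by rewrite normr0.
move/existsNP: nzt => [l nl]; apply: (K0 z l); rewrite leNgt; apply/negP => zl.
by apply: nl; rewrite -ler_norml ltW.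
Qed.

Lemma ker_integrable M L t K : ker M L t K -> intf mu K.
Proof.
move=> kK; apply: (@intg_le _ _ _ _ (fun z => M * \1_(tbox t) z)).
- exact: ker_measurable kK.
- by move=> z; exact: ker_le_indic kK.
- have i1 : intf mu (\1_(tbox t) : Rn -> R).
  by apply: intg_indic; [exact: meas_box|exact: box_lty].
 by have := integrableZl measurableT M i1; apply: eq_integrable.
Qed.

Definition hat_mass : R := \int[mu]_z hats (fun=> 1) z.

Let one0 (l : 'I_n) : 0 < (fun=> 1 : R) l. Proof. exact: ltr01. Qed.
Let one1 (l : 'I_n) : ((fun=> 1 : R) l)^-1 <= 1. Proof. by rewrite invr1. Qed.

Lemma hat_mass_gt0 : 0 < hat_mass.
Proof.
have kh := hats_ker one0 one1; have ih := ker_integrable kh.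
pose B : set Rn := tbox (fun=> 2^-1).
have mB : measurable B by exact: meas_box.
have half0 (l : 'I_n) : 0 < (fun=> 2^-1 : R) l by rewrite invr_gt0.
have hB z : (2^-1 ^+ n) * \1_B z <= hats (fun=> 1) z.
 rewrite indicE; have [Bz|nBz] := pselect (B z); last by rewrite memNset// mulr0 hats_ge0.
 rewrite mem_set// mulr1 /hats -[X in _ ^+ X](card_ord n) -prodr_const.
 apply: ler_prod => l _; rewrite invr_ge0 ler0n/= divr1.
 by apply: hat_half; rewrite ler_norml; exact: Bz.
have iB : intf mu (\1_B : Rn -> R).
 by apply: intg_indic => //; exact: box_lty.
have : \int[mu]_z (2^-1 ^+ n * \1_B z) <= hat_mass.
 apply: le_Rintegral => //.
 by have := integrableZl measurableT (2^-1 ^+ n) iB; apply: eq_integrable.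
apply: lt_le_trans; rewrite RintegralZl//.
rewrite {1}/Rintegral integral_indic// setIT.
have -> : fine (mu B) = \prod_(l < n) (2 * 2^-1 : R) := congr1 fine (measure_tbox half0).
by rewrite mulr_gt0 ?exprn_gt0// prodr_gt0.
Qed.

Lemma integral_hats t : allpos t -> \int[mu]_z hats t z = (\prod_l t l) * hat_mass.
Proof.
move=> t0.
pose T : 'M[R]_n := diag_mx (\row_l (t l)^-1).
have dT : \det T = \prod_l (t l)^-1.
 by rewrite det_diag; apply: eq_bigr => l _; rewrite mxE.
have pt : 0 < \prod_l t l by exact: prodr_gt0.
have uT : T \in unitmx.
 by rewrite unitmxE unitfE dT gt_eqF// prodr_gt0// => l _; rewrite invr_gt0.
have cT : continuous (fun x : Rn => x *m T) by exact: mulmxr_continuous.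
have mT : measT (fun x : Rn => x *m T) by exact: cont_meas_map.
pose c : {nonneg R} := NngNum (ltW pt).
have preT A : measurable A -> mu ((fun x : Rn => x *m T) @^-1` A) = (c%:num%:E * mu A)%E.
 move=> mA; rewrite lebesgue_rV_linear// dT prodfV normfV gtr0_norm// invrK//.
have hE z : hats t z = hats (fun=> 1) (z *m T).
 by apply: eq_bigr => l _; rewrite mul_mx_diag !mxE divr1.
have k1 := hats_ker one0 one1.
have m1 : measT (EFin \o hats (fun=> 1)) by apply/measurable_EFinP; exact: ker_measurable k1.
have h0 z : (0 <= (EFin \o hats (fun=> 1%R)) z)%E by rewrite lee_fin hats_ge0.
rewrite /hat_mass /Rintegral.
have <- : fine ((\prod_l t l)%:E * \int[mu]_z (hats (fun=> 1%R) z)%:E)%E =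
  (\prod_l t l) * fine (\int[mu]_z (hats (fun=> 1%R) z)%:E)%E.
 by rewrite fineM//; apply: integrable_fin_num => //; exact: ker_integrable k1.
congr fine; apply: etrans _ (ge0_integral_preimage mT preT m1 h0).
by apply: eq_integral => z _; rewrite hE.
Qed.

Definition rho t (z : Rn) : R := (hat_mass * \prod_l t l)^-1 * hats t z.

Lemma rho_ge0 t z : allpos t -> 0 <= rho t z.
Proof.
move=> t0; rewrite mulr_ge0 ?hats_ge0// invr_ge0 mulr_ge0 ?(ltW hat_mass_gt0)//.
by apply: prodr_ge0 => l _; exact: ltW.
Qed.

Lemma ker_scale M L t K c : ker M L t K -> ker (`|c| * M) (`|c| * L) t (fun z => c * K z).
Proof.
move=> [L0 KL KM K0]; split.
- by rewrite mulr_ge0.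
- by move=> x y; rewrite -mulrBr normrM -mulrA ler_wpM2l.
- by move=> z; rewrite normrM ler_wpM2l.
- by move=> z l zl; rewrite (K0 z l)// mulr0.
Qed.

Lemma rho_ker t T : allpos t -> (forall l, (t l)^-1 <= T) ->
 ker ((hat_mass * \prod_l t l)^-1) ((hat_mass * \prod_l t l)^-1 * (n%:R * (4 * T))) t (rho t).
Proof.
move=> t0 tT; have := ker_scale ((hat_mass * \prod_l t l)^-1) (hats_ker t0 tT).
rewrite mulr1 ger0_norm// invr_ge0 mulr_ge0 ?(ltW hat_mass_gt0)//.
by apply: prodr_ge0 => l _; exact: ltW.
Qed.

Lemma integral_rho t : allpos t -> \int[mu]_z rho t z = 1.
Proof.
move=> t0; pose T : R := \sum_l (t l)^-1.
have tT l : (t l)^-1 <= T.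
 by rewrite /T (bigD1 l)//= lerDl sumr_ge0// => k _; rewrite invr_ge0 ltW.
rewrite RintegralZl//; last exact: ker_integrable (hats_ker t0 tT).
rewrite integral_hats// [X in _ * X]mulrC mulVf// mulf_neq0 ?gt_eqF ?hat_mass_gt0//.
exact: prodr_gt0.
Qed.

(* Antiderivatives, one coordinate at a time, of [rho (t / 2) - rho t]. *)
Definition ramps t i (z : Rn) : R := \prod_(l < n)
 (if (l < i)%N then hat (z ord0 l / (t l / 2))
  else if l == i then ramp (z ord0 l / (t l / 2)) - ramp (z ord0 l / t l)
  else hat (z ord0 l / t l)).

Definition ramp_scale t i : R := (hat_mass * \prod_(l < n)
 (if (l < i)%N then t l / 2 else if l == i then 1 else t l))^-1.

Definition ramp_ker t i (z : Rn) : R := ramp_scale t i * ramps t i z.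

Lemma ramp_scale_ge0 t i : allpos t -> 0 <= ramp_scale t i.
Proof.
move=> t0; rewrite invr_ge0 mulr_ge0 ?(ltW hat_mass_gt0)// prodr_ge0// => l _.
by case: ifP => _; [rewrite divr_ge0// ltW|case: ifP => _ //; exact: ltW].
Qed.

(** Integrating in direction [i] gains one factor [t i] over the size of [rho t]; the factor
    [2 ^+ n] pays for the coordinates already at scale [t l / 2]. *)
Lemma ramp_scale_le t i : allpos t ->
 ramp_scale t i <= 2 ^+ n * t i * (hat_mass * \prod_l t l)^-1.
Proof.
move=> t0; rewrite /ramp_scale !invfM mulrCA ler_wpM2l ?invr_ge0 ?(ltW hat_mass_gt0)//.
rewrite -!prodfV; apply: (@le_trans _ _ (\prod_(l < n) (2 * (if l == i then t i else 1) * (t l)^-1))).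
 apply: ler_prod => l _; have tl := t0 l; apply/andP; split.
  by rewrite invr_ge0; case: ifP => _; [rewrite divr_ge0// ltW|case: ifP => _ //; exact: ltW].
 case: ifP => [li|_].
  rewrite (_ : (l == i) = false) ?mulr1 ?invf_div//.
  by apply/negP => /eqP li'; move: li; rewrite li' ltnn.
 case: eqP => [->|_]; first by rewrite mulfK ?gt_eqF// invr1 ler1n.
 by rewrite mulr1 ler_pMl ?invr_gt0// ler1n.
rewrite !big_split/= prodr_const card_ord ler_wpM2r//.
 by apply: prodr_ge0 => l _; rewrite invr_ge0 ltW.
rewrite ler_wpM2l ?exprn_ge0// (bigD1 i)//= eqxx big1 ?mulr1// => l li.
by rewrite (negPf li).
Qed.

(** Neither ramp has compact support, but both are 0 to the left and 1 to the right of
    [[- t i, t i]], so their difference vanishes there. The constant 9 is [6 + 3], from slope 3 at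
    the scales [t l / 2] and [t l]; it also covers the slopes 8 and 4 of the tents. *)
Lemma ramp_ker_ker t i T : allpos t -> (forall l, (t l)^-1 <= T) ->
 ker (ramp_scale t i) (ramp_scale t i * (n%:R * (9 * T))) t (ramp_ker t i).
Proof.
move=> t0 tT; have T0 : 0 <= T by rewrite (le_trans _ (tT ord0))// invr_ge0 ltW.
have h0 l : 0 < t l / 2 by rewrite divr_gt0.
have hT l : (t l / 2)^-1 <= 2 * T by rewrite invf_div mulrC mulrC ler_wpM2l.
have := @prod_kernel (ramp_scale t i) (9 * T) (fun l s => if (l < i)%N then hat (s / (t l / 2))
  else if l == i then ramp (s / (t l / 2)) - ramp (s / t l) else hat (s / t l)) t.
rewrite (ger0_norm (ramp_scale_ge0 i t0)); apply.
- by rewrite mulr_ge0.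
- move=> l s; case: ifP => _; first exact: hat1.
 case: ifP => _; last exact: hat1.
 have /andP[a0 a1] := ramp01 (s / (t l / 2)); have /andP[b0 b1] := ramp01 (s / t l).
 by rewrite ler_norml; apply/andP; split; lra.
- have sl (a s h : R) : 0 <= a -> `|ramp (s * a) - ramp (h * a)| <= 3 * a * `|s - h|.
  by move=> a0; rewrite (le_trans (ramp_lip _ _))// -mulrBl normrM (ger0_norm a0) -mulrA [a * _]mulrC.
 move=> l s h; case: ifP => _.
  rewrite (le_trans (hat_scale_lip _ _ _)) ?invr_ge0 ?(ltW (h0 l))// ler_wpM2r//.
  by rewrite (le_trans (ler_wpM2l _ (hT l)))//; lra.
 case: ifP => _; last first.
  rewrite (le_trans (hat_scale_lip _ _ _)) ?invr_ge0 ?(ltW (t0 l))// ler_wpM2r//.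
  by rewrite (le_trans (ler_wpM2l _ (tT l)))//; lra.
 rewrite (_ : _ - _ - _ = (ramp (s / (t l / 2)) - ramp (h / (t l / 2))) -
   (ramp (s / t l) - ramp (h / t l))); last by ring.
 rewrite (le_trans (ler_normB _ _))// (le_trans (lerD (sl _ _ _ _) (sl _ _ _ _))) ?invr_ge0 ?(ltW (h0 l)) ?(ltW (t0 l))//.
 rewrite -mulrDl ler_wpM2r//.
 have := hT l; have := tT l; lra.
- move=> l s ts.
 have ts2 : t l / 2 <= `|s|.
  by rewrite (le_trans _ ts)// ler_pdivrMr// ler_pMr// ler1n.
 case: ifP => _; first exact: hat_scale_out.
 case: ifP => _; last exact: hat_scale_out.
 have [s0|s0] := leP 0 s.
  rewrite !ramp_right ?subrr//; rewrite ler_pdivlMr// mul1r.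
   by rewrite -[s]ger0_norm.
  by rewrite -[s]ger0_norm.
 rewrite !ramp_left ?subrr//; rewrite ler_pdivrMr// mulN1r lerNr.
  by rewrite -[- s]ltr0_norm// normrN.
 by rewrite -(ltr0_norm s0).
Qed.

Let A t l (z : Rn) : R := (t l / 2)^-1 * hat (z ord0 l / (t l / 2)).
Let B t l (z : Rn) : R := (t l)^-1 * hat (z ord0 l / t l).

Definition ramp_deriv t i (z : Rn) : R := hat_mass^-1 * \prod_(l < n)
 (if (l < i)%N then A t l z else if l == i then A t l z - B t l z else B t l z).

Let rhoA t z : rho (fun l => t l / 2) z = hat_mass^-1 * \prod_l A t l z.
Proof. by rewrite /rho invfM -mulrA /hats -prodfV -big_split. Qed.

Let rhoB t z : rho t z = hat_mass^-1 * \prod_l B t l z.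
Proof. by rewrite /rho invfM -mulrA /hats -prodfV -big_split. Qed.

(** Telescoping sum: [P k] has the first [k] coordinates at scale [t l / 2] and the others at scale
    [t l]. *)
Lemma rho_half_sub t z : rho (fun l => t l / 2) z - rho t z = \sum_i ramp_deriv t i z.
Proof.
rewrite rhoA rhoB -mulrBr -mulr_sumr; congr (_ * _).
pose P (k : nat) := \prod_(l < n) (if (l < k)%N then A t l z else B t l z).
have -> : \prod_l A t l z = P n by apply: eq_bigr => l _; rewrite ltn_ord.
have -> : \prod_l B t l z = P 0%N by apply: eq_bigr.
rewrite -(telescope_sumr _ (leq0n n)) big_mkord; apply: eq_bigr => i _.
rewrite /P [X in X - _](bigD1 i)//= [X in _ - X](bigD1 i)//= [RHS](bigD1 i)//=.
rewrite !ltnn eqxx ltnSn.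
have E1 : \prod_(l < n | l != i) (if (l < i.+1)%N then A t l z else B t l z) =
  \prod_(l < n | l != i) (if (l < i)%N then A t l z else if l == i then A t l z - B t l z else B t l z).
 by apply: eq_bigr => l li; rewrite ltnS leq_eqVlt (negPf (_ : val l != val i))//= (negPf li).
have E2 : \prod_(l < n | l != i) (if (l < i)%N then A t l z else B t l z) =
  \prod_(l < n | l != i) (if (l < i)%N then A t l z else if l == i then A t l z - B t l z else B t l z).
 by apply: eq_bigr => l li; rewrite (negPf li).
by rewrite E1 E2 mulrBl.
Qed.

Lemma ramp_deriv_bounded t i : allpos t ->
 measT (ramp_deriv t i) /\ exists C, forall z, `|ramp_deriv t i z| <= C * \1_(tbox t) z.
Proof.
move=> t0.
have mh (a : R) l : measT (fun z : Rn => hat (z ord0 l / a)).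
 apply: (@lip_meas _ _ (4 * `|a^-1|)) => x y; rewrite (le_trans (hat_lip _ _))// -mulrBl normrM.
 by rewrite -mulrA ler_wpM2l// [leRHS]mulrC ler_wpM2r//; have := coord_le (x - y) l; rewrite !mxE.
have mA l : measT (A t l) by apply: measurable_funM => //; exact: mh.
have mB l : measT (B t l) by apply: measurable_funM => //; exact: mh.
have A2 l z : `|A t l z| <= 2 * (t l)^-1.
 rewrite /A invf_div normrM (ger0_norm (x := 2 / t l)) ?divr_ge0 ?(ltW (t0 l))// ler_piMr ?divr_ge0 ?(ltW (t0 l))//.
have B1 l z : `|B t l z| <= (t l)^-1.
 by rewrite /B normrM ger0_norm ?invr_ge0 ?(ltW (t0 l))// ler_piMr ?invr_ge0 ?(ltW (t0 l)).
split.
 apply: measurable_funM => //; apply: measurable_prod => l _.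
 case: (l < i)%N; first exact: mA.
 by case: (l == i); [exact: measurable_funB|exact: mB].
exists (hat_mass^-1 * \prod_l (3 * (t l)^-1)) => z.
have hm := hat_mass_gt0; have hm0 : 0 <= hat_mass^-1 by rewrite invr_ge0 ltW.
rewrite indicE; have [zt|nzt] := pselect (tbox t z).
 rewrite mem_set// mulr1 normrM ger0_norm// ler_wpM2l// normr_prod.
 apply: ler_prod => l _; rewrite normr_ge0/=.
 have := A2 l z; have := B1 l z; have : 0 <= (t l)^-1 by rewrite invr_ge0 ltW.
 move=> ? ? ?; case: ifP => _; first lra.
 by case: ifP => _; [rewrite (le_trans (ler_normB _ _))//; lra|lra].
rewrite memNset// mulr0; move/existsNP: nzt => [l nl].
have zl : t l <= `|z ord0 l|.
 by rewrite leNgt; apply/negP => zl; apply: nl; rewrite -ler_norml; exact: ltW.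
have Bz : B t l z = 0 by rewrite /B hat_scale_out ?mulr0.
have Az : A t l z = 0.
 by rewrite /A hat_scale_out ?mulr0 ?divr_gt0// (le_trans _ zl)// ler_pdivrMr// ler_pMr// ler1n.
suff -> : ramp_deriv t i z = 0 by rewrite normr0.
rewrite /ramp_deriv (bigD1 l)//= Az Bz subr0.
by case: ifP => _; [|case: ifP => _]; rewrite mul0r mulr0.
Qed.

Lemma ramp_ker_deriv t i z : allpos t ->
 k.+1%:R * (ramp_ker t i (z + k.+1%:R^-1 *: delta_mx ord0 i) - ramp_ker t i z)
  @[k --> \oo] --> ramp_deriv t i z.
Proof.
move=> t0.
pose C := hat_mass^-1 * \prod_(l < n | l != i) (if (l < i)%N then A t l z else B t l z).
have CE : ramp_deriv t i z = C * (A t i z - B t i z).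
 rewrite /ramp_deriv (bigD1 i)//= ltnn eqxx [X in _ * X]mulrC mulrA; congr (_ * _ * _).
 by apply: eq_bigr => l li; rewrite (negPf li).
pose g (s : R) : R := ramp (s / (t i / 2)) - ramp (s / t i).
have kE (w : Rn) : (forall l, l != i -> w ord0 l = z ord0 l) -> ramp_ker t i w = C * g (w ord0 i).
 move=> wz; rewrite /ramp_ker /ramp_scale /ramps /C invfM -!mulrA; congr (_ * _).
 rewrite -prodfV -big_split/=.
 rewrite (bigD1 i)//= ltnn eqxx invr1 mul1r mulrC; congr (_ * _).
 apply: eq_bigr => l li; rewrite (negPf li) wz//; by case: ifP.
rewrite CE; have -> : (fun k => k.+1%:R * (ramp_ker t i (z + k.+1%:R^-1 *: delta_mx ord0 i) - ramp_ker t i z)) =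
 (fun k => C * (k.+1%:R * (ramp (z ord0 i / (t i / 2) + (t i / 2)^-1 * k.+1%:R^-1) - ramp (z ord0 i / (t i / 2))) -
  k.+1%:R * (ramp (z ord0 i / t i + (t i)^-1 * k.+1%:R^-1) - ramp (z ord0 i / t i)))).
 apply/funext => k; rewrite !kE//; last first.
  by move=> l li; rewrite !mxE (negPf li) andbF mulr0 addr0.
 have -> : (z + k.+1%:R^-1 *: delta_mx ord0 i) ord0 i = z ord0 i + k.+1%:R^-1.
  by rewrite !mxE !eqxx mulr1.
 rewrite /g !mulrDl [k.+1%:R^-1 * (t i)^-1]mulrC [k.+1%:R^-1 * (t i / 2)^-1]mulrC.
 move: (ramp _) (ramp _) (ramp _) (ramp _) => r1 r2 r3 r4; move: C {CE kE} => C; ring.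
apply: cvgM; first exact: cvg_cst.
by apply: cvgB; exact: ramp_quotient_cvg.
Qed.

End kernels.

Lemma Rint_abs_le d {T : measurableType d} {R : realType} (mu : {measure set T -> \bar R})
  (f g : T -> R) : measT f -> (forall x, `|f x| <= g x) ->
 intf mu g -> `|\int[mu]_x f x| <= \int[mu]_x g x.
Proof.
move=> mf fg ig; have iff := intg_le mf fg ig.
rewrite (le_trans (le_normr_Rintegral measurableT iff))//.
by apply: le_Rintegral => //; exact: intg_abs.
Qed.

Section real_integrable_arithmetic.
Context d {T : measurableType d} {R : realType} (mu : {measure set T -> \bar R}).
Implicit Types u h : T -> R.

Lemma intg_scale c u : intf mu u -> intf mu (fun x => c * u x).
Proof. by move=> iu; have := integrableZl measurableT c iu; apply: eq_integrable. Qed.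

Lemma intg_add u h : intf mu u -> intf mu h -> intf mu (fun x => u x + h x).
Proof. by move=> iu ih; have := integrableD measurableT iu ih; apply: eq_integrable. Qed.

Lemma intg_sub u h : intf mu u -> intf mu h -> intf mu (fun x => u x - h x).
Proof.
by move=> iu ih; have := integrableB measurableT iu ih; apply: eq_integrable => // x _ /=; rewrite EFinB.
Qed.

Lemma intg_mulC u h : intf mu (fun x => u x * h x) -> intf mu (fun x => h x * u x).
Proof. by apply: eq_integrable => // x _ /=; rewrite mulrC. Qed.

Lemma intg_dist u h : intf mu u -> intf mu h -> intf mu (fun x => `|u x - h x|).
Proof. by move=> iu ih; apply: intg_abs; exact: intg_sub. Qed.

Lemma L1_dual_bnd u h M : intf mu u -> measT h -> normle h M ->
 `|\int[mu]_x (u x * h x)| <= M * \int[mu]_x `|u x|.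
Proof.
move=> iu mh hM; rewrite -RintegralZl//; last exact: intg_abs.
apply: Rint_abs_le; [|move=> x|exact: intg_scale (intg_abs iu)].
 exact: measurable_funM (intg_meas iu) mh.
by rewrite normrM mulrC ler_wpM2r.
Qed.

Lemma Rint_subM u v h M : intf mu u -> intf mu v -> measT h -> normle h M ->
 \int[mu]_x (u x * h x) - \int[mu]_x (v x * h x) = \int[mu]_x ((u x - v x) * h x).
Proof.
move=> iu iv mh hM; rewrite -RintegralB//; try exact: intg_mulb mh hM.
by apply: eq_Rint => x; rewrite mulrBl.
Qed.
End real_integrable_arithmetic.

(** * Convolution with a kernel *)

Section reflection.
Context {R : realType} {n : nat}.
Notation Rn := 'rV[R]_n.
Notation mu := (lebesgue_rV R n).

Lemma meas_shift (K : Rn -> R) (x : Rn) : measT K ->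
 measT (fun y : Rn => K (x - y)).
Proof. by move=> mK; exact: (measurableT_comp mK (measurable_reflect x)). Qed.

Lemma ge0_integral_reflect (c : Rn) (f : Rn -> \bar R) : measT f -> (forall x, 0 <= f x)%E ->
 (\int[mu]_x f (c - x)%R = \int[mu]_x f x)%E.
Proof.
move=> mf f0.
have pre A : measurable A -> mu ((fun x : Rn => c - x) @^-1` A) = ((1%:nng)%:num%:E * mu A)%E.
 by move=> mA; rewrite mul1e; exact: lebesgue_rV_reflect.
by have := ge0_integral_preimage (measurable_reflect c) pre mf f0; rewrite mul1e.
Qed.

Lemma integral_reflect (c : Rn) (f : Rn -> \bar R) : measT f ->
 (\int[mu]_x f (c - x)%R = \int[mu]_x f x)%E.
Proof.
move=> mf; rewrite integralE [RHS]integralE; congr (_ - _)%E.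
 apply: etrans _ (ge0_integral_reflect c (measurable_funepos mf) (funepos_ge0 f)).
 by apply: eq_integral => x _; rewrite !funeposE.
apply: etrans _ (ge0_integral_reflect c (measurable_funeneg mf) (funeneg_ge0 f)).
by apply: eq_integral => x _; rewrite !funenegE.
Qed.

Lemma Rintegral_reflect (c : Rn) (f : Rn -> R) : measT f ->
 \int[mu]_x f (c - x) = \int[mu]_x f x.
Proof. by move=> mf; congr fine; apply: (@integral_reflect c (EFin \o f)); exact/measurable_EFinP. Qed.

Lemma integrable_reflect (c : Rn) (f : Rn -> R) : intf mu f ->
 intf mu (fun x => f (c - x)).
Proof.
move=> iff; have mf := intg_meas iff; apply/integrableP; split.
 by apply/measurable_EFinP; exact: meas_shift.
have ma : measT (fun x => `|(f x)%:E|)%E.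
 by apply: measurableT_comp => //; exact/measurable_EFinP.
have -> : (\int[mu]_x `|(EFin \o (fun x => f (c - x)%R)) x| = \int[mu]_x `|(f x)%:E|)%E.
 exact: (@ge0_integral_reflect c (fun x => `|(f x)%:E|)%E).
by case/integrableP: iff.
Qed.

Lemma ae_reflect (c : Rn) (P : Rn -> Prop) : {ae mu, forall x, P x} -> {ae mu, forall x, P (c - x)}.
Proof.
move=> [N [mN N0 PN]]; exists ((fun x => c - x) @^-1` N); split.
- by rewrite -[X in measurable X]setTI; apply: measurable_reflect.
- by have := lebesgue_rV_reflect c mN; rewrite N0.
- by move=> x /= Px; apply: PN.
Qed.

Lemma measurable_sub_pair : measT (fun z : Rn * Rn => z.1 - z.2).
Proof.
apply: measurable_fun_rV => i; apply: (eq_measurable_fun (fun z : Rn * Rn => z.1 ord0 i - z.2 ord0 i)).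
 by move=> z _; rewrite !mxE.
by apply: measurable_funB; (apply: (measurableT_comp (measurable_coord i)); first [exact: measurable_fst|exact: measurable_snd]).
Qed.
End reflection.

Section convolution.
Context {R : realType} {m : nat}.
Notation n := m.+1.
Notation Rn := 'rV[R]_n.
Notation mu := (lebesgue_rV R n).

Implicit Types h w : Rn -> R.

Definition conv (K h : Rn -> R) (x : Rn) : R := \int[mu]_y (K (x - y) * h y).

Lemma convE K h x : conv K h x = \int[mu]_y (K (x - y) * h y).
Proof. by []. Qed.

Lemma conv_reflect K h x : measT K -> measT h ->
 conv K h x = \int[mu]_z (K z * h (x - z)).
Proof.
move=> mK mh; rewrite -(@Rintegral_reflect _ _ x (fun z => K z * h (x - z))).
 by apply: eq_Rint => y; congr (_ * h _); rewrite opprB addrC subrK.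
by apply: measurable_funM => //; exact: meas_shift.
Qed.

Lemma intg_tbox_shift t (x : Rn) : intf mu (fun y => \1_(tbox t) (x - y) : R).
Proof.
by apply: (integrable_reflect x); apply: intg_indic; [exact: meas_box|exact: box_lty].
Qed.

Lemma tbox_shift_integral t (x : Rn) : \int[mu]_y (\1_(tbox t) (x - y) : R) = fine (mu (tbox t)).
Proof.
rewrite (@Rintegral_reflect _ _ x (\1_(tbox t))); last first.
 by apply: measurable_indic; exact: meas_box.
by rewrite /Rintegral integral_indic ?setIT//; exact: meas_box.
Qed.

Section one_kernel.
Variables (M L : R) (t : 'I_n -> R) (K : Rn -> R).
Hypothesis kK : ker M L t K.

Let mK : measT K. Proof. exact: ker_measurable kK. Qed.
Let L0 : 0 <= L. Proof. by case: kK. Qed.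
Let KL : lip L K. Proof. by case: kK. Qed.
Let KM z : `|K z| <= M. Proof. by case: kK. Qed.
Let M0 : 0 <= M. Proof. by rewrite (le_trans _ (KM 0)). Qed.

Lemma ker_opp : ker M L t (fun z => K (- z)).
Proof.
case: kK => _ _ _ K0; split => // [x y|z l zl].
 by rewrite (le_trans (KL _ _))// -opprD normrN.
by apply: (K0 _ l); rewrite mxE normrN.
Qed.

Lemma ker_shift_integrable x : intf mu (fun y => K (x - y)).
Proof. exact: (integrable_reflect x (ker_integrable kK)). Qed.

Lemma conv_intg h A x : measT h -> normle h A ->
 intf mu (fun y => K (x - y) * h y).
Proof. by move=> mh hA; apply: intg_mulb mh hA => //; exact: ker_shift_integrable. Qed.

Lemma conv_integrable h x : intf mu h -> intf mu (fun y => K (x - y) * h y).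
Proof.
move=> ih; have := @intg_mulb _ _ _ mu h (fun y => K (x - y)) M ih.
move=> H; have : intf mu (fun y => h y * K (x - y)).
 by apply: H => //; exact: meas_shift.
by apply: eq_integrable => // y _ /=; rewrite mulrC.
Qed.

Let ker_diff x y : `|K x - K y| <= L * `|x - y| * (\1_(tbox t) x + \1_(tbox t) y).
Proof.
have h0 z : K z = 0 \/ (\1_(tbox t) z : R) = 1.
 have := ker_le_indic z kK; rewrite indicE; case: (_ \in _); first by right.
 by rewrite mulr0 normr_le0 => /eqP; left.
have h1 z : 0 <= (\1_(tbox t) z : R) by rewrite indicE.
have [Kx|->] := h0 x; last first.
 by rewrite (le_trans (KL _ _))// ler_peMr ?mulr_ge0// lerDl.
have [Ky|->] := h0 y; first by rewrite Kx Ky subrr normr0 !mulr_ge0// addr_ge0.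
by rewrite (le_trans (KL _ _))// ler_peMr ?mulr_ge0// lerDr.
Qed.

(** The difference of two translates of the kernel lives on two translates of [tbox t], hence the
    factor 2. *)
Lemma conv_lip_bounded h A : measT h -> normle h A ->
 lip (L * A * (2 * fine (mu (tbox t)))) (conv K h).
Proof.
move=> mh hA x x'; have A0 : 0 <= A by rewrite (le_trans _ (hA 0)).
rewrite /conv -RintegralB//; try exact: (conv_intg _ mh hA).
pose g y := L * A * `|x - x'| * (\1_(tbox t) (x - y) + \1_(tbox t) (x' - y)).
have i2 : intf mu (fun y => \1_(tbox t) (x - y) + \1_(tbox t) (x' - y)).
 by apply: intg_add; exact: intg_tbox_shift.
have ig : intf mu g by exact: intg_scale.
apply: (@le_trans _ _ (\int[mu]_y g y)).
 apply: Rint_abs_le => //.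
  by apply: measurable_funB; apply: measurable_funM => //; exact: meas_shift.
 move=> y; rewrite -mulrBl normrM /g.
 have := ker_diff (x - y) (x' - y).
 rewrite (_ : x - y - (x' - y) = x - x'); last by apply/rowP => i; rewrite !mxE; ring.
 move=> /(ler_pM (normr_ge0 _) (normr_ge0 _))/(_ (hA y)) /le_trans; apply.
 by apply: eq_ler; ring.
rewrite /g RintegralZl// RintegralD//; try exact: intg_tbox_shift.
rewrite (tbox_shift_integral t x) (tbox_shift_integral t x').
by apply: eq_ler; ring.
Qed.

Lemma conv_lip_integrable h : intf mu h -> lip (L * \int[mu]_y `|h y|) (conv K h).
Proof.
move=> ih x x'; rewrite /conv -RintegralB//; try exact: conv_integrable.
have mh := intg_meas ih.
have ia := intg_abs ih.
have ig : intf mu (fun y => L * `|x - x'| * `|h y|).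
 exact: (intg_scale _ ia).
rewrite mulrAC -RintegralZl//.
apply: Rint_abs_le => //.
 by apply: measurable_funB; apply: measurable_funM => //; exact: meas_shift.
move=> y; rewrite -mulrBl normrM ler_wpM2r// (le_trans (KL _ _))//.
by rewrite (_ : x - y - (x' - y) = x - x')//; apply/rowP => i; rewrite !mxE; ring.
Qed.

Lemma conv_le_box h A x : measT h -> normle h A ->
 `|conv K h x| <= M * \int[mu]_y (`|h y| * \1_(tbox t) (x - y)).
Proof.
move=> mh hA; have i1 : intf mu (fun y => `|h y| * \1_(tbox t) (x - y)).
 have : intf mu (fun y => \1_(tbox t) (x - y) * `|h y|).
  apply: (intg_mulb (M := A)); first exact: intg_tbox_shift.
   exact: measurableT_comp.
  by move=> y; rewrite normr_id.
 exact: intg_mulC.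
rewrite -RintegralZl//; apply: Rint_abs_le.
- by apply: measurable_funM => //; exact: meas_shift.
- move=> y; rewrite normrM mulrA mulrAC; apply: ler_wpM2r => //; exact: ker_le_indic kK.
- exact: (intg_scale _ i1).
Qed.

Lemma conv_supp h N T x : (forall l, t l <= T) -> 0 <= N + T -> vanish N h ->
 ~ cube (N + T) x -> conv K h x = 0.
Proof.
move=> tT NT hN /existsNP[l xl]; rewrite /conv.
rewrite [LHS](@eq_Rint _ _ _ _ _ (fun=> 0)) ?/Rintegral ?integral0// => y.
have [yN|yN] := pselect (cube N y); last by rewrite hN// mulr0.
case: kK => _ _ _ /(_ (x - y) l) ->; rewrite ?mul0r// !mxE (le_trans (tT l))//.
have : N + T < `|x ord0 l| by rewrite ltNge; apply/negP; rewrite ler_norml.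
have : `|y ord0 l| <= N by rewrite ler_norml; exact: yN.
by have := lerB_dist (x ord0 l) (y ord0 l); lra.
Qed.

End one_kernel.

Lemma conv_fubini M L t K w h A : ker M L t K -> intf mu w -> measT h -> normle h A ->
 \int[mu]_x (w x * conv K h x) = \int[mu]_y (conv (fun z => K (- z)) w y * h y).
Proof.
move=> kK iw mh hA; have mw := intg_meas iw; have mK := ker_measurable kK.
have M0 : 0 <= M by case: kK => _ _ KM _; rewrite (le_trans _ (KM 0)).
pose f (z : Rn * Rn) : R := w z.1 * (K (z.1 - z.2) * h z.2).
have mf : measT f.
 apply: measurable_funM; first by apply: (measurableT_comp mw); exact: measurable_fst.
 apply: measurable_funM; first by apply: (measurableT_comp mK); exact: measurable_sub_pair.
 by apply: (measurableT_comp mh); exact: measurable_snd.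
have mfE : measT (EFin \o f) by exact/measurable_EFinP.
have A0 : 0 <= A by rewrite (le_trans _ (hA 0)).
have ifx : (mu \x mu)%E.-integrable setT (EFin \o f).
 apply/(integrable12ltyP _ _ mfE).
 have iwa := intg_abs iw.
 have ig : intf mu (fun x => M * A * fine (mu (tbox t)) * `|w x|).
  exact: (intg_scale _ iwa).
 apply: le_lt_trans (_ : \int[mu]_x (M * A * fine (mu (tbox t)) * `|w x|)%:E < +oo)%E.
  have mF : measT (fun x => \int[mu]_y `|(EFin \o f) (x, y)|)%E.
   apply: (@measurable_fun_fubini_tonelli_F _ _ _ _ _ mu (fun z => `|(EFin \o f) z|)%E) => //.
   exact: measurableT_comp.
  apply: ge0_le_integral => //.
  - by move=> x _; exact: integral_ge0.
  - by apply/measurable_EFinP; exact: intg_meas ig.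
  move=> x _; have i1 : intf mu (fun y => `|w x| * (K (x - y) * h y)).
   by have := integrableZl measurableT `|w x| (conv_intg kK x mh hA); apply: eq_integrable.
  have i2 : intf mu (fun y => M * A * `|w x| * \1_(tbox t) (x - y)).
   exact: (intg_scale _ (intg_tbox_shift t x)).
  apply: (@le_trans _ _ (\int[mu]_y (M * A * `|w x| * \1_(tbox t) (x - y))%:E)%E).
   apply: ge0_le_integral => //.
   - apply: measurableT_comp => //; apply/measurable_EFinP.
    exact: measurable_funM (measurable_cst (w x)) (measurable_funM (meas_shift x mK) mh).
   - by apply/measurable_EFinP; exact: intg_meas i2.
   - move=> y _; rewrite lee_fin /= /f/= !normrM.
    apply: (@le_trans _ _ (`|w x| * (M * \1_(tbox t) (x - y) * A))).
     by rewrite ler_wpM2l// ler_pM//; exact: ker_le_indic kK.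
    by apply: eq_ler; ring.
  rewrite -[X in (X <= _)%E]fineK ?integrable_fin_num// lee_fin.
  have -> : fine (\int[mu]_y (M * A * `|w x| * \1_(tbox t) (x - y))%:E)%E =
   \int[mu]_y (M * A * `|w x| * \1_(tbox t) (x - y)) by [].
  rewrite RintegralZl ?(tbox_shift_integral t x)//; last exact: intg_tbox_shift.
  by apply: eq_ler; ring.
 have := integrable_fin_num measurableT ig; rewrite ge0_fin_numE//.
 by apply: integral_ge0 => x _; rewrite lee_fin !mulr_ge0// fine_ge0.
transitivity (fine (\int[mu]_x \int[mu]_y (EFin \o f) (x, y))%E).
 congr fine; apply: eq_integral => x _ /=.
 have -> : (w x * conv K h x)%:E = (\int[mu]_y (w x * (K (x - y) * h y))%:E)%E.
  rewrite /conv -RintegralZl//; last exact: (conv_intg kK _ mh hA).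
  rewrite /Rintegral fineK// integrable_fin_num//.
  exact: (intg_scale _ (conv_intg kK x mh hA)).
 by [].
rewrite (Fubini ifx); congr fine; apply: eq_integral => y _ /=.
have iy : intf mu (fun x => K (- (y - x)) * w x) by exact: (conv_integrable (ker_opp kK)).
rewrite /conv -RintegralZr// /Rintegral fineK; last first.
 rewrite integrable_fin_num//.
 by have := integrableZr measurableT (h y) iy; apply: eq_integrable.
by apply: eq_integral => x _; rewrite opprB /f/=; congr EFin; ring.
Qed.

(** [conv G h] is Lipschitz, so differentiable almost everywhere, and its derivative there can be
    computed along the steps [1/(k+1)], for which dominated convergence applies under the
    integral. *)
Lemma conv_deriv M L t (G D h : Rn -> R) A i : ker M L t G -> measT D ->
 (forall z, k.+1%:R * (G (z + k.+1%:R^-1 *: delta_mx ord0 i) - G z) @[k --> \oo] --> D z) ->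
 measT h -> normle h A ->
 {ae mu, forall x, pd i (conv G h) x = conv D h x}.
Proof.
move=> kG mD GD mh hA; have A0 : 0 <= A by rewrite (le_trans _ (hA 0)).
have [L0 GL _ G0] := kG.
have mG := ker_measurable kG.
have cl := conv_lip_bounded kG mh hA.
apply: filterS (ae_sdiff_pd cl) => x dx.
have d1 := sdiff_row1 dx.
have := @isdiff_partial _ _ _ _ _ _ i ord0 d1.
have -> : (\row_j pd j (conv G h) x)^T i ord0 = pd i (conv G h) x by rewrite !mxE.
move=> c1; apply: (cvg_unique _ c1) => //.
pose q k (y : Rn) : R := k.+1%:R * (G (x - y + k.+1%:R^-1 *: delta_mx ord0 i) - G (x - y)) * h y.
have -> : (fun k => k.+1%:R * (row1 (conv G h) (x + k.+1%:R^-1 *: delta_mx ord0 i) ord0 ord0 -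
  row1 (conv G h) x ord0 ord0)) = (fun k => \int[mu]_y q k y).
 apply/funext => k; rewrite !mxE /conv -RintegralB//; try exact: (conv_intg kG _ mh hA).
 rewrite -RintegralZl//; last first.
  have := integrableB measurableT (conv_intg kG (x + k.+1%:R^-1 *: delta_mx ord0 i) mh hA)
   (conv_intg kG x mh hA).
  by apply: eq_integrable => // y _ /=; rewrite EFinB.
 by apply: eq_Rint => y; rewrite /q addrAC -mulrBl mulrA.
have mG' (c : Rn) : measT (fun y : Rn => G (x - y + c)).
 have : measT (fun y : Rn => G (x + c - y)).
  exact: meas_shift.
 by apply: eq_measurable_fun => y _; rewrite addrAC.
have mG1 : measT (fun y : Rn => G (x - y)).
 exact: meas_shift.
change ((fun k => \int[mu]_y q k y) @ \oo --> \int[mu]_y (D (x - y) * h y)).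
(* The steps are at most 1, so all quotients vanish outside the box enlarged by 1. *)
apply: (@Rintegral_dominated_cvg _ _ _ mu q (fun y => D (x - y) * h y) (fun y => L * A * \1_(tbox (fun l => t l + 1)) (x - y))).
- by move=> k; apply: measurable_funM => //; apply: measurable_funM => //; apply: measurable_funB.
- exact: measurable_funM (meas_shift x mD) mh.
- by apply: aeE => y; apply: cvgMl; exact: GD.
- have i1 : intf mu (\1_(tbox (fun l => t l + 1)) : Rn -> R).
  by apply: intg_indic; [exact: meas_box|exact: box_lty].
 exact: (intg_scale _ (integrable_reflect x i1)).
move=> k y; rewrite /q !normrM; set z := x - y; set e := _ *: _.
have e1 : `|e| <= k.+1%:R^-1.
 by rewrite (le_trans (norm_scale_delta _ _))// ger0_norm.
have kp : 0 < k.+1%:R :> R by [].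
rewrite indicE; have [zt|nzt] := pselect (tbox (fun l => t l + 1) z); last first.
 rewrite memNset// mulr0; move/existsNP: nzt => [l nl].
 have zl : t l + 1 <= `|z ord0 l|.
  rewrite leNgt; apply/negP => zl; apply: nl; rewrite -ler_norml; exact: ltW.
 have el : `|e ord0 l| <= 1.
  by rewrite (le_trans (coord_le e l))// (le_trans e1)// invf_le1// ler1n.
 have zel : t l <= `|(z + e) ord0 l|.
  by rewrite mxE (le_trans _ (lerB_normD _ _))// lerBrDr (le_trans _ zl)// lerD2l.
 rewrite (G0 (z + e) l zel) (G0 z l) ?subrr ?normr0 ?mulr0 ?mul0r//.
 by rewrite (le_trans _ zl)// lerDl.
rewrite mem_set// mulr1 ler_pM// ger0_norm// -ler_pdivlMl// mulrC (le_trans (GL _ _))//.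
by rewrite addrC addKr ler_wpM2l.
Qed.

(** Here the derivative falls on [F]: its difference quotients are bounded by [Lam] and converge
    almost everywhere by Rademacher's theorem. *)
Lemma conv_pd M L t (K F : Rn -> R) Lam S' i : ker M L t K -> 0 <= Lam -> lip Lam F -> normle F S' ->
 {ae mu, forall x, pd i (conv K F) x = conv K (pd i F) x}.
Proof.
move=> kK Lam0 FL FS.
have mK := ker_measurable kK; have mF := lip_meas FL.
have mP := meas_pd i FL.
have cl := conv_lip_bounded kK mF FS.
apply: filterS (ae_sdiff_pd cl) => x dx.
have d1 := sdiff_row1 dx.
have := @isdiff_partial _ _ _ _ _ _ i ord0 d1.
have -> : (\row_j pd j (conv K F) x)^T i ord0 = pd i (conv K F) x by rewrite !mxE.
move=> c1; apply: (cvg_unique _ c1) => //.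
pose q k (z : Rn) : R := K z * (k.+1%:R * (F (x - z + k.+1%:R^-1 *: delta_mx ord0 i) - F (x - z))).
have iKF (c : Rn) : intf mu (fun z => K z * F (c - z)).
 apply: (intg_mulb (M := S')) => //; first exact: ker_integrable kK.
 exact: meas_shift.
have -> : (fun k => k.+1%:R * (row1 (conv K F) (x + k.+1%:R^-1 *: delta_mx ord0 i) ord0 ord0 -
  row1 (conv K F) x ord0 ord0)) = (fun k => \int[mu]_y q k y).
 apply/funext => k; rewrite !mxE !conv_reflect// -RintegralB//.
 rewrite -RintegralZl//; last first.
  have := integrableB measurableT (iKF (x + k.+1%:R^-1 *: delta_mx ord0 i)) (iKF x).
  by apply: eq_integrable => // y _ /=; rewrite EFinB.
 by apply: eq_Rint => y; rewrite /q addrAC; ring.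
rewrite conv_reflect//.
have mF' (c : Rn) : measT (fun y : Rn => F (x - y + c)).
 have : measT (fun y : Rn => F (x + c - y)).
  exact: meas_shift.
 by apply: eq_measurable_fun => y _; rewrite addrAC.
have mF1 : measT (fun y : Rn => F (x - y)).
 exact: meas_shift.
apply: (@Rintegral_dominated_cvg _ _ _ mu q (fun z => K z * pd i F (x - z)) (fun y => Lam * `|K y|)).
- by move=> k; apply: measurable_funM => //; apply: measurable_funM => //; apply: measurable_funB.
- exact: measurable_funM mK (meas_shift x mP).
- apply: filterS (ae_reflect x (ae_sdiff_pd FL)) => z /sdiff_row1 dz.
 apply: cvgMr; have := @isdiff_partial _ _ _ _ _ _ i ord0 dz.
 have -> : (\row_j pd j F (x - z))^T i ord0 = pd i F (x - z) by rewrite !mxE.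
 by apply: cvg_trans; apply: near_eq_cvg; apply: nearW => k; rewrite !mxE.
- have := integrableZl measurableT Lam (intg_abs (ker_integrable kK)).
 by apply: eq_integrable.
move=> k z; rewrite /q normrM mulrC ler_wpM2r// normrM ger0_norm// -ler_pdivlMl// mulrC (le_trans (FL _ _))//.
rewrite addrC addKr ler_wpM2l// (le_trans (norm_scale_delta _ _))// ger0_norm//.
Qed.

Lemma conv_close M L t (K h : Rn -> R) Lam T A x : ker M L t K -> allnneg K -> \int[mu]_z K z = 1 ->
 (forall l, t l <= T) -> 0 <= T -> 0 <= Lam -> lip Lam h -> normle h A ->
 `|conv K h x - h x| <= Lam * T.
Proof.
move=> kK K0 K1 tT T0 Lam0 hL hA; have mh := lip_meas hL; have mK := ker_measurable kK.
have iK := ker_integrable kK.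
have i1 : intf mu (fun z => K z * h (x - z)).
 apply: (intg_mulb (M := A)) => //.
 exact: meas_shift.
rewrite conv_reflect// -[h x]mul1r -K1 -RintegralZr// -RintegralB//; last first.
 have := integrableZl measurableT (h x) iK; by apply: eq_integrable => // z _ /=; rewrite mulrC.
rewrite -[leRHS]mulr1 -K1 -RintegralZl//.
apply: Rint_abs_le.
- apply: measurable_funB; apply: measurable_funM => //.
 exact: meas_shift.
- move=> z; rewrite -mulrBr normrM (ger0_norm (K0 z)) mulrC.
 have [->|Kz] := eqVneq (K z) 0; first by rewrite !mulr0.
 rewrite ler_wpM2r// (le_trans (hL _ _))// ler_wpM2l// addrAC subrr add0r normrN.
 apply: norm_row_le => // l; rewrite (le_trans _ (tT l))// leNgt; apply/negP => zl.
 by case: kK => _ _ _ /(_ z l (ltW zl)) /eqP; rewrite (negPf Kz).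
- exact: (intg_scale _ iK).
Qed.

Lemma conv_rho_le M L t (K h : Rn -> R) A x : ker M L t K -> allnneg K -> \int[mu]_z K z = 1 ->
 measT h -> normle h A -> `|conv K h x| <= A.
Proof.
move=> kK K0 K1 mh hA; have mK := ker_measurable kK; have iK := ker_integrable kK.
rewrite conv_reflect// -[leRHS]mulr1 -K1 -RintegralZl//; apply: Rint_abs_le.
- by apply: measurable_funM => //; exact: meas_shift.
- by move=> z; rewrite normrM (ger0_norm (K0 z)) mulrC ler_wpM2r.
- exact: (intg_scale _ iK).
Qed.

End convolution.

Opaque conv pd rho ramp_ker ramp_deriv.

(** * Geometric series, integrals on intervals, powers and fast Cauchy sequences *)

Lemma geometric_tail {R : realType} (a : nat -> R) (l D q : R) (k : nat) : 0 <= q < 1 -> 0 <= D ->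
 (forall j, `|a j.+1 - a j| <= D * q ^+ j) -> a j @[j --> \oo] --> l ->
 `|l - a k| <= D * q ^+ k / (1 - q).
Proof.
move=> /andP[q0 q1] D0 aD al; have q2 : 0 < 1 - q by rewrite subr_gt0.
have H j : `|a (j + k)%N - a k| <= D * q ^+ k / (1 - q).
 suff : `|a (j + k)%N - a k| <= D * q ^+ k * ((1 - q ^+ j) / (1 - q)).
  move=> H; apply: le_trans H _; rewrite ler_wpM2l ?mulr_ge0 ?exprn_ge0//.
  by rewrite ler_pdivrMr// mulVf ?gt_eqF// lerBlDr lerDl exprn_ge0.
 elim: j => [|j IHj]; first by rewrite add0n subrr normr0 expr0 subrr mul0r mulr0.
 rewrite addSn -[X in X - _](subrK (a (j + k)%N)) -addrA (le_trans (ler_normD _ _))//.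
 rewrite (le_trans (lerD (aD _) IHj))//.
 apply: eq_ler.
 by rewrite exprD exprS; field; rewrite gt_eqF.
have c1 : `|a (j + k)%N - a k| @[j --> \oo] --> `|l - a k|.
 by apply: cvg_norm; apply: cvgB; [apply: (cvg_comp (fun j => (j + k)%N) a _ al); exact: cvg_addnr|exact: cvg_cst].
rewrite -(cvg_lim _ c1)//; apply: limr_le; first exact: cvgP c1.
exact: nearW.
Qed.

Lemma cvg_geometric_bound {R : realType} (a : nat -> R) (l D q : R) : 0 <= q < 1 ->
 (forall k, `|l - a k| <= D * q ^+ k) -> a k @[k --> \oo] --> l.
Proof.
move=> /andP[q0 q1] al; apply/cvgrPdist_le => e e0.
have cD : D * q ^+ k @[k --> \oo] --> D * 0.
 by apply: cvgMr; apply: cvg_expr; rewrite ger0_norm.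
rewrite mulr0 in cD; have /cvgrPdist_le /(_ e e0) := cD.
by apply: filterS => k; rewrite sub0r normrN => /(le_trans (ler_norm _)); exact: le_trans (al k).
Qed.

Lemma term_le_sum {R : realType} (I : finType) (F : I -> R) i : allnneg F -> F i <= \sum_j F j.
Proof. by move=> F0; rewrite (bigD1 i)//= lerDl sumr_ge0. Qed.


Section almost_everywhere_bounds.
Context d {T : measurableType d} {R : realType} (mu : {measure set T -> \bar R}).
Implicit Types f g : T -> R.

Lemma integrable_eq_ae f g : measT g -> {ae mu, forall x, f x = g x} -> intf mu f -> intf mu g.
Proof.
move=> mg fg iff; have mf := intg_meas iff; apply/integrableP; split; first exact/measurable_EFinP.
have <- : (\int[mu]_x `|(EFin \o f) x| = \int[mu]_x `|(EFin \o g) x|)%E.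
 apply: ae_eq_integral => //; try by apply: measurableT_comp => //; exact/measurable_EFinP.
 by apply: aeS fg => x fx _ /=; rewrite fx.
by case/integrableP: iff.
Qed.

Lemma Rintegral_abs_le_ae f g : measT f -> allnneg g ->
 {ae mu, forall x, `|f x| <= g x} -> intf mu g -> intf mu f /\ `|\int[mu]_x f x| <= \int[mu]_x g x.
Proof.
move=> mf g0 fg ig; have mg := intg_meas ig.
pose f' x := Num.max (- g x) (Num.min (g x) (f x)).
have mf' : measT f'.
 by apply: measurable_maxr; [exact: measurable_funN|exact: measurable_minr].
have f'g x : `|f' x| <= g x.
 by rewrite ler_norml /f' le_max lexx/= ge_max ge_min lexx/= (le_trans _ (g0 x)) ?oppr_le0.
have ff' : {ae mu, forall x, f' x = f x}.
 apply: aeS fg => x; rewrite ler_norml => /andP[f1 f2].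
 by rewrite /f' (min_idPr f2) (max_idPr f1).
split; first exact: integrable_eq_ae mf ff' (intg_le mf' f'g ig).
by rewrite -(eq_Rint_ae mf' mf ff'); exact: Rint_abs_le.
Qed.
End almost_everywhere_bounds.

Section interval_integrals.
Context {R : realType}.
Notation lam := (@lebesgue_measure R).
Implicit Types (g : R -> R) (a r s : R).

Lemma itv_integrable g a r : continuous g -> lam.-integrable `[a, r] (EFin \o g).
Proof.
move=> cg; apply: continuous_compact_integrable; first exact: segment_compact.
exact: continuous_subspaceT.
Qed.

Lemma itv_integral_le g (c K a r : R) : continuous g -> a <= r -> (forall s, a <= s <= r -> `|g s - c| <= K) ->
 `|\int[lam]_(s in `[a, r]) g s - (r - a) * c| <= K * (r - a).
Proof.
move=> cg ar gK.
have fm (e : R) : \int[lam]_(s in `[a, r]) e = e * (r - a).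
 rewrite Rintegral_cst//= lebesgue_measure_itv/= lte_fin; congr (_ * _).
 by move: ar; rewrite le_eqVlt => /predU1P[->|->]; rewrite ?ltxx ?subrr.
have ic (e : R) : lam.-integrable `[a, r] (EFin \o (fun=> e)) by apply: itv_integrable; exact: cst_continuous.
rewrite [(r - a) * c]mulrC -!fm -RintegralB//; last exact: itv_integrable.
have ig : lam.-integrable `[a, r] (EFin \o (fun s => g s - c)).
 by apply: itv_integrable => s; apply: cvgB; [exact: cg|exact: cvg_cst].
apply: le_trans (le_normr_Rintegral _ ig) _; first exact: measurable_itv.
apply: le_Rintegral => //.
by apply: itv_integrable => s; apply: cvg_norm; apply: cvgB; [exact: cg|exact: cvg_cst].
Qed.

Lemma itv_integral_sub g a r r' : continuous g -> a <= r -> r <= r' ->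
 \int[lam]_(s in `[a, r']) g s - \int[lam]_(s in `[a, r]) g s = \int[lam]_(s in `[r, r']) g s.
Proof.
move=> cg ar rr; rewrite Rintegral_itvB ?bnd_simp//; last exact: itv_integrable.
rewrite Rintegral_itv_obnd_cbnd//.
by apply: integrableS (itv_integrable r r' cg) => //; apply: subset_itvr; rewrite bnd_simp.
Qed.
End interval_integrals.

Section powers.
Context {R : realType}.
Implicit Types (e r x y : R).

Lemma prod_powR (I : finType) (f : I -> R) e : e != 0 -> \prod_j e `^ f j = e `^ (\sum_j f j).
Proof.
move=> e0; apply/esym; apply: (@big_morph _ _ (powR e) 1 *%R 0 +%R) => [x y|]; last exact: powRr0.
by rewrite powRD// e0 implybT.
Qed.

Lemma powR_add e x y : 0 < e -> e `^ (x + y) = e `^ x * e `^ y.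
Proof. by move=> e0; rewrite powRD// (gt_eqF e0) implybT. Qed.

Lemma powR_le_neg e r x : 0 < e -> e <= r -> x <= 0 -> r `^ x <= e `^ x.
Proof.
move=> e0 er x0; have r0 : 0 < r by exact: lt_le_trans er.
have E y : y `^ x = (y `^ (- x))^-1 by rewrite -powRN opprK.
rewrite !E lef_pV2 ?posrE ?powR_gt0//.
by apply: ge0_ler_powR; rewrite ?nnegrE ?oppr_ge0// ltW.
Qed.

(** The second term wins for [r <= e], the first one otherwise. It shows that a Hölder function of
    exponent [x] is, at scale [e], Lipschitz with slope of order [e^(x - 1)] up to an error of order
    [e^x]. *)
Lemma holder_interp e r x : 0 < e -> 0 <= r -> 0 <= x <= 1 -> r `^ x <= e `^ (x - 1) * r + e `^ x.
Proof.
move=> e0 r0 /andP[x0 x1]; have [re|er] := leP r e.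
 rewrite (@le_trans _ _ (e `^ x))//; first by apply: ge0_ler_powR; rewrite ?nnegrE// ltW.
 by rewrite lerDr mulr_ge0// powR_ge0.
have rp : 0 < r by exact: lt_trans er.
rewrite (@le_trans _ _ (e `^ (x - 1) * r))//; last by rewrite lerDl powR_ge0.
have -> : r `^ x = r `^ (x - 1) * r by rewrite -{3}(powRr1 r0) -powR_add// subrK.
rewrite ler_wpM2r//.
by apply: powR_le_neg => //; [exact: ltW|rewrite subr_le0].
Qed.
End powers.

Section fast_cauchy.
Context d {T : measurableType d} {R : realType} (mu : {measure set T -> \bar R}).
Variables (w : nat -> T -> R) (X q : R).
Hypotheses (iw : forall k, intf mu (w k)) (q01 : 0 <= q < 1) (X0 : 0 <= X).
Hypothesis wq : forall k, \int[mu]_x `|w k.+1 x - w k x| <= X * q ^+ k.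

Let D k x : R := `|w k.+1 x - w k x|.
Let G x : \bar R := (\sum_(0 <= k <oo) (D k x)%:E)%E.

Let mD k : measT (EFin \o D k).
Proof. by apply/measurable_EFinP; apply: intg_meas; exact: intg_dist (iw _) (iw _). Qed.

Let D0 k x : (0 <= (D k x)%:E)%E. Proof. by rewrite lee_fin; exact: normr_ge0. Qed.

Let G0 x : (0 <= G x)%E.
Proof. by apply: nneseries_ge0 => k _ _; exact: D0. Qed.

Let mG : measT G.
Proof. by apply: ge0_emeasurable_sum => [k x _ _|k _]; [exact: D0|exact: mD]. Qed.

Let intG : (\int[mu]_x G x < +oo)%E.
Proof.
have /andP[q0 q1] := q01.
rewrite integral_nneseries//.
apply: (@le_lt_trans _ _ (X / (1 - q))%:E); last exact: ltry.
apply: lime_le; first by apply: is_cvg_nneseries => k _ _; apply: integral_ge0 => x _; exact: D0.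
apply: nearW => k.
have H j : (\int[mu]_x (D j x)%:E <= (X * q ^+ j)%:E)%E.
 have := wq j; rewrite -lee_fin; apply: le_trans.
 by rewrite /Rintegral fineK//; apply: integrable_fin_num => //; exact: intg_dist (iw _) (iw _).
apply: (@le_trans _ _ (\sum_(0 <= j < k) (X * q ^+ j)%:E)%E); first exact: lee_sum.
rewrite sumEFin lee_fin -mulr_sumr ler_wpM2l//.
have E : (1 - q) * \sum_(0 <= j < k) q ^+ j = 1 - q ^+ k by rewrite big_mkord -opprB mulNr -subrX1 opprB.
by rewrite -[leRHS]mul1r ler_pdivlMr ?subr_gt0// mulrC E lerBlDr lerDl exprn_ge0.
Qed.

Let A : set T := [set x | (G x < +oo)%E].

Let mA : measurable A.
Proof. by have := emeasurable_fun_infty_o measurableT mG +oo%E; rewrite setTI. Qed.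

Let iG : mu.-integrable setT G.
Proof.
apply/integrableP; split; first exact: mG.
by under eq_integral do rewrite (gee0_abs (G0 _)).
Qed.

Let aeA : {ae mu, forall x, A x}.
Proof.
by apply: filterS (integrable_ae measurableT iG) => x /(_ I); rewrite (ge0_fin_numE (G0 x)).
Qed.

Let w' k x : R := w k x * \1_A x.

Let mw' k : measT (w' k).
Proof. by apply: measurable_funM; [exact: intg_meas (iw k)|exact: measurable_indic]. Qed.

Let partial k x : A x -> \sum_(0 <= j < k) D j x <= fine (G x).
Proof.
move=> Ax; rewrite -lee_fin fineK ?(ge0_fin_numE (G0 x))// -[X in (X <= _)%E]sumEFin.
by apply: nneseries_lim_ge => j _ _; exact: D0.
Qed.

Let w'_le k x : `|w' k x| <= `|w 0%N x| + fine (G x).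
Proof.
rewrite /w' indicE; have [Ax|nAx] := pselect (A x); last first.
 by rewrite memNset// mulr0 normr0 addr_ge0// fine_ge0//; exact: G0.
rewrite mem_set// mulr1 (le_trans _ (lerD (lexx _) (partial k Ax)))//.
elim: k => [|k IHk]; first by rewrite big_geq// addr0.
rewrite big_nat_recr//= addrA (le_trans _ (lerD IHk (lexx _)))//.
by rewrite -{1}(subrK (w k x) (w k.+1 x)) addrC ler_normD.
Qed.

Let w'_cvg x : cvgn (w' ^~ x).
Proof.
have [Ax|nAx] := pselect (A x); last first.
 rewrite (_ : w' ^~ x = fun=> 0); first exact: is_cvg_cst.
 by apply/funext => k; rewrite /w' indicE memNset// mulr0.
have c1 : cvgn (series (fun j => D j x)).
 apply: nondecreasing_is_cvgn; first by apply: nondecreasing_series => j _ _; exact: normr_ge0.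
 by exists (fine (G x)) => _ [k _ <-]; exact: partial.
have c2 : cvgn (series (fun j => w j.+1 x - w j x)) by exact: normed_cvg.
rewrite (_ : w' ^~ x = fun k => w 0%N x + series (fun j => w j.+1 x - w j x) k).
 by apply: is_cvgD c2; exact: is_cvg_cst.
apply/funext => k; rewrite /w' indicE mem_set// mulr1 /series/= telescope_sumr//.
by rewrite addrC subrK.
Qed.

(** The sum [G] of the differences is integrable, hence finite almost everywhere. Setting the
    sequence to 0 off the set [A] where [G] is finite makes it converge everywhere, dominated by
    [|w 0|] plus the finite values of [G]. *)
Lemma L1_fast_cauchy : exists v, intf mu v /\ forall k, \int[mu]_x `|v x - w k x| <= X * q ^+ k / (1 - q).
Proof.
pose v x := limn (w' ^~ x).
have v_lim x : w' k x @[k --> \oo] --> v x by exact: w'_cvg.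
have mv : measT v by apply: measurable_fun_cvg (fun k => mw' k) _ => x _; exact: v_lim.
have ig : intf mu (fun x => `|w 0%N x| + fine (G x)).
 apply: intg_add; first exact: intg_abs.
 exact: intg_fine.
have iw' k : intf mu (w' k) by exact: intg_le (mw' k) (w'_le k) ig.
have v_le x : `|v x| <= `|w 0%N x| + fine (G x).
 have c : `|w' k x| @[k --> \oo] --> `|v x| by apply: cvg_norm; exact: v_lim.
 rewrite -(cvg_lim _ c)//; apply: limr_le; first exact: cvgP c.
 by apply: nearW => k; exact: w'_le.
have iv : intf mu v by exact: intg_le mv v_le ig.
exists v; split => // k.
have ww' j : {ae mu, forall x, w' j x = w j x}.
 by apply: aeS aeA => x Ax; rewrite /w' indicE mem_set// mulr1.
have E (j l : nat) : \int[mu]_x `|w' j x - w' l x| = \int[mu]_x `|w j x - w l x|.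
 apply: eq_Rint_ae.
 - exact: intg_meas (intg_dist (iw' j) (iw' l)).
 - exact: intg_meas (intg_dist (iw j) (iw l)).
 - by apply: aeS2 (ww' j) (ww' l) => x -> ->.
have -> : \int[mu]_x `|v x - w k x| = \int[mu]_x `|v x - w' k x|.
 apply: eq_Rint_ae.
 - exact: intg_meas (intg_dist iv (iw k)).
 - exact: intg_meas (intg_dist iv (iw' k)).
 - by apply: aeS (ww' k) => x ->.
have cI : \int[mu]_x `|w' j x - w' k x| @[j --> \oo] --> \int[mu]_x `|v x - w' k x|.
 apply: (@Rintegral_dominated_cvg _ _ _ mu (fun j x => `|w' j x - w' k x|) _
  (fun x => 2 * (`|w 0%N x| + fine (G x)))).
 - by move=> j; exact: intg_meas (intg_dist (iw' j) (iw' k)).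
 - exact: intg_meas (intg_dist iv (iw' k)).
 - by apply: aeE => x; apply: cvg_norm; apply: cvgB; [exact: v_lim|exact: cvg_cst].
 - exact: intg_scale.
 - move=> j x; rewrite normr_id (le_trans (ler_normB _ _))//.
  by rewrite mulr_natl mulr2n lerD// w'_le.
have wk : \int[mu]_x `|w' k x - w' k x| = 0.
 by rewrite (@eq_Rint _ _ _ _ _ (fun=> 0)) ?/Rintegral ?integral0// => x; rewrite subrr normr0.
have := geometric_tail k q01 X0 _ cI; rewrite wk subr0 => H.
apply: le_trans (ler_norm _) (H _) => j; apply: le_trans (wq j).
have i1 l := intg_dist (iw l) (iw k); rewrite !E.
rewrite -RintegralB//; apply: Rint_abs_le.
- exact: measurable_funB (intg_meas (i1 _)) (intg_meas (i1 _)).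
- by move=> x; rewrite (le_trans (ler_dist_dist _ _))// opprB addrA subrK.
- exact: intg_dist.
Qed.

End fast_cauchy.

Lemma ae_eq_L1_small d {T : measurableType d} {R : realType} (mu : {measure set T -> \bar R}) (v w : T -> R) :
 intf mu v -> intf mu w ->
 (forall e, 0 < e -> \int[mu]_x `|v x - w x| <= e) -> {ae mu, forall x, v x = w x}.
Proof.
move=> iv iw vw; have ivw := intg_sub iv iw.
have I0 : \int[mu]_x `|v x - w x| = 0.
 apply/eqP; rewrite eq_le Rintegral_ge0// andbT; apply/ler_addgt0Pr => e e0; rewrite add0r; exact: vw.
pose g x := v x - w x.
have mg : measT (EFin \o g) := measurable_int _ ivw.
have : (\int[mu]_x `|(EFin \o g) x| = 0)%E.
 have ia := intg_abs ivw.
 by apply: etrans (congr1 EFin I0); rewrite /Rintegral fineK//; exact: integrable_fin_num.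
move=> /(ae_eq_integral_abs mu measurableT mg).
by apply: filterS => x /(_ Logic.I)/= [] /eqP; rewrite subr_eq0 => /eqP.
Qed.

(** * Essential support, and limits of bounds *)

Section essential_support.
Context {R : realType} {n : nat}.
Notation Rn := 'rV[R]_n.
Notation mu := (lebesgue_rV R n).
Implicit Types (u v : Rn -> R).

(** Each point outside the essential support lies in one of countably many rational balls on which
    [u] vanishes almost everywhere. *)
Lemma ae_ess_spt u : {ae mu, forall x, ~ ess_spt u x -> u x = 0}.
Proof.
pose B (qk : 'rV[rat]_n * nat) (y : Rn) := `|y - map_mx ratr qk.1| < qk.2.+1%:R^-1.
pose P qk := {ae mu, forall y, B qk y -> u y = 0}.
have aeP : {ae mu, forall y, forall qk, P qk -> B qk y -> u y = 0}.
 apply: ae_forall_countable => qk; have [Pq|nP] := pselect (P qk).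
  by apply: aeS Pq => y uy _.
 exact: aeE.
apply: aeS aeP => x xP; rewrite /ess_spt/= => /existsNP[U /not_implyP[xU /contrapT aeU]].
have /nbhs_ballP[e /= e0 eU] := xU.
have e2 : 0 < e / 2 by rewrite divr_gt0.
have [k ke] := exists_inv_nat e2.
have k0 : 0 < k.+1%:R^-1 :> R by rewrite invr_gt0.
have [q xq] := near_rat_row x k0.
apply: (xP (q, k)) => //; apply: aeS aeU => y uy yq; apply: uy; apply: eU.
rewrite mx_norm_ball /ball_/= (le_lt_trans (ler_distD (map_mx ratr q) _ _))// (splitr e).
by rewrite ltrD// ?(lt_le_trans xq)// distrC (lt_le_trans yq).
Qed.

Lemma L1c_ae_supp v N : 0 <= N -> intf mu v ->
 {ae mu, forall y, ~ cube N y -> v y = 0} -> L1c v.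
Proof.
move=> N0 iv vN; split => //.
apply: (closed_cube_compact N0).
 rewrite -[ess_spt v]setCK; apply: open_closedC; rewrite openE => x /=.
 move=> /existsNP[U /not_implyP[xU /contrapT aeU]].
 by move: (nbhs_interior xU); apply: filterS => y yU /= yE; exact: yE yU aeU.
move=> x xE; apply: contrapT => Nx; apply: (xE (~` cube N)) => //.
by apply: open_nbhs_nbhs; split => //; apply: closed_openC; exact: closed_box.
Qed.

End essential_support.

Section power_limits.
Context {R : realType}.

Lemma powR_prod n (x : 'I_n -> R) (e : R) : allnneg x -> (\prod_j x j) `^ e = \prod_j x j `^ e.
Proof.
move=> x0; suff [] : 0 <= \prod_j x j /\ (\prod_j x j) `^ e = \prod_j x j `^ e by [].
elim/big_rec2 : _ => [|j z y _ [y0 <-]]; first by rewrite powR1.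
by rewrite mulr_ge0// powRM.
Qed.

Lemma le_prod_limit n (X z : R) (c : 'I_n -> R) :
 (forall e, 0 < e -> X <= \prod_j (z * (c j + e))) -> X <= \prod_j (z * c j).
Proof.
move=> Xe; have cF : \prod_j (z * (c j + harmonic k)) @[k --> \oo] --> \prod_j (z * (c j + 0)).
 apply: cvg_big => [|j _]; first exact: mul_continuous.
 apply: cvgM; [exact: cvg_cst|apply: cvgD; [exact: cvg_cst|exact: cvg_harmonic]].
have -> : \prod_j (z * c j) = \prod_j (z * (c j + 0)) by apply: eq_bigr => j _; rewrite addr0.
rewrite -(cvg_lim _ cF)//; apply: limr_ge; first exact: cvgP cF.
by apply: nearW => k; apply: Xe; rewrite invr_gt0.
Qed.

(** The estimates are available for positive Hölder constants and for numbers above the variation,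
    hence with an excess [e]. The excess of [V] enters linearly and is removed first; the inequality
    is then raised to the power [p], so that the remaining limit is that of a polynomial in [e]. *)
Lemma le_mul_powR_limit n (N Y V z p : R) (c : 'I_n -> R) : 0 < p -> 0 <= Y -> 0 <= V -> 0 <= z ->
 allnneg c -> 0 <= N ->
 (forall e, 0 < e -> N <= Y * ((V + e) * (\prod_j (z * (c j + e))) `^ p^-1)) ->
 N <= Y * (V * (\prod_j (z * c j)) `^ p^-1).
Proof.
move=> p0 Y0 V0 z0 c0 N0 Ne; pose Q e := \prod_j (z * (c j + e)).
have Q0 e : 0 <= e -> 0 <= Q e by move=> e0; rewrite prodr_ge0// => j _; rewrite mulr_ge0// addr_ge0.
have QS e e' : 0 <= e -> e <= e' -> Q e <= Q e'.
 move=> e0 ee; apply: ler_prod => j _; rewrite mulr_ge0 ?addr_ge0//=.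
 by rewrite ler_wpM2l// lerD2l.
have pv : 0 < p^-1 by rewrite invr_gt0.
have step e : 0 < e -> N <= Y * (V * Q e `^ p^-1).
 move=> e0; apply/ler_addgt0Pr => d d0; pose W := Y * Q e `^ p^-1.
 have W0 : 0 <= W by rewrite mulr_ge0 ?powR_ge0.
 pose t := Num.min e (d / (W + 1)).
 have t0 : 0 < t by rewrite lt_min e0 divr_gt0// ltr_wpDl.
 apply: le_trans (Ne t t0) _; rewrite -/(Q t).
 apply: (@le_trans _ _ (Y * ((V + t) * Q e `^ p^-1))).
  rewrite !ler_wpM2l ?addr_ge0 ?(ltW t0)//; apply: ge0_ler_powR; rewrite ?nnegrE ?(ltW pv)//.
  - exact: Q0 (ltW t0).
  - exact: Q0 (ltW e0).
  - by apply: QS; [exact: ltW|rewrite ge_min lexx].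
 rewrite mulrDl mulrDr lerD2l (_ : Y * (t * _) = t * W); last by rewrite /W; ring.
 apply: (@le_trans _ _ (d / (W + 1) * W)); first by rewrite ler_wpM2r// ge_min lexx orbT.
 by rewrite -mulrA ler_piMr ?(ltW d0)// mulrC ler_pdivrMr ?ltr_wpDl// mul1r lerDl.
have [YV|YV] := eqVneq (Y * V) 0.
 by have := step 1 ltr01; rewrite !mulrA YV !mul0r.
have YVp : 0 < Y * V by rewrite lt_neqAle eq_sym YV mulr_ge0.
rewrite mulrA -ler_pdivrMl// mulrC.
have X0 : 0 <= N / (Y * V) by rewrite divr_ge0// ltW.
have XE : N / (Y * V) = ((N / (Y * V)) `^ p) `^ p^-1 by rewrite -powRrM mulfV ?gt_eqF// powRr1.
have h : (N / (Y * V)) `^ p <= \prod_j (z * c j).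
 apply: le_prod_limit => e e0; rewrite -/(Q e).
 have -> : Q e = (Q e `^ p^-1) `^ p by rewrite -powRrM mulVf ?gt_eqF// powRr1// Q0// ltW.
 apply: ge0_ler_powR; rewrite ?nnegrE ?(ltW p0) ?powR_ge0//.
 by rewrite ler_pdivrMr// mulrC -mulrA; exact: step.
rewrite XE; apply: ge0_ler_powR; rewrite ?nnegrE ?(ltW pv) ?powR_ge0//.
by rewrite prodr_ge0// => j _; rewrite mulr_ge0.
Qed.

End power_limits.

Section pushforward_theory.
Context {R : realType} {m : nat}.
Notation n := m.+1.
Notation Rn := 'rV[R]_n.
Notation mu := (lebesgue_rV R n).
Notation intg f := (intf mu f).
Notation pbut j L := (\prod_(k < n | k != j) L k).
Implicit Types (h w v u F G : Rn -> R) (t b : 'I_n -> R) (f : Rn -> Rn) (i l : 'I_n).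

(** * Mollification, and kernels between consecutive scales *)

Section mollification.

Lemma lip_le (L L' : R) F : L <= L' -> lip L F -> lip L' F.
Proof. by move=> LL FL x y; rewrite (le_trans (FL x y))// ler_wpM2r. Qed.

Lemma lip_supp_bounded (L N : R) F : 0 <= N -> lip L F -> vanish N F ->
 forall x, `|F x| <= (`|F 0| + `|L| * N) * \1_(cube N) x.
Proof.
move=> N0 FL F0 x; rewrite indicE; have [xN|xN] := pselect (cube N x); last first.
 by rewrite F0// normr0 mulr_ge0// addr_ge0// mulr_ge0.
rewrite mem_set// mulr1 -lerBlDl (le_trans (lerB_dist _ _))//.
rewrite (le_trans (lip_norm FL _ _))// subr0 ler_wpM2l//.
exact/(cubeP x N0).
Qed.

Lemma lip_supp_integrable (L N : R) F : 0 <= N -> lip L F -> vanish N F -> intg F.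
Proof.
move=> N0 FL F0; apply: intg_le (lip_supp_bounded N0 FL F0) _; first exact: lip_meas FL.
by apply: intg_scale; apply: intg_indic; [exact: meas_cube|exact: cube_lty].
Qed.

Lemma rho_even t (z : Rn) : rho t (- z) = rho t z.
Proof.
have he (s : R) : hat (- s) = hat s.
 rewrite /hat; have c0 (a : R) : (Num.max 0 a = 0 /\ a <= 0) \/ (Num.max 0 a = a /\ 0 <= a).
  by case: (leP 0 a) => a0; [right|left; split => //; exact: ltW].
 by case: (c0 s) => -[-> ?]; case: (c0 (s + 1)) => -[-> ?]; case: (c0 (s - 1)) => -[-> ?];
  case: (c0 (- s)) => -[-> ?]; case: (c0 (- s + 1)) => -[-> ?]; case: (c0 (- s - 1)) => -[-> ?]; lra.
by congr (_ * _); apply: eq_bigr => l _; rewrite mxE mulNr he.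
Qed.

Lemma rho_ker_exists t : allpos t -> exists M L, ker M L t (rho t).
Proof.
move=> t0; eexists; eexists; apply: (rho_ker t0 (T := \sum_l (t l)^-1)) => l.
by apply: (term_le_sum (F := fun l => (t l)^-1)) => k; rewrite invr_ge0 ltW.
Qed.

Lemma ramp_ker_exists t i : allpos t -> exists M L, ker M L t (ramp_ker t i).
Proof.
move=> t0; eexists; eexists; apply: (ramp_ker_ker i t0 (T := \sum_l (t l)^-1)) => l.
by apply: (term_le_sum (F := fun l => (t l)^-1)) => k; rewrite invr_ge0 ltW.
Qed.

Lemma conv_rho_fubini t w h A : allpos t -> intg w ->
 measT h -> normle h A ->
 \int[mu]_x (w x * conv (rho t) h x) = \int[mu]_y (conv (rho t) w y * h y).
Proof.
move=> t0 iw mh hA; have [M [L kr]] := rho_ker_exists t0.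
have rE : (fun z => rho t (- z)) = rho t by apply/funext => z; exact: rho_even.
by have := conv_fubini kr iw mh hA; rewrite rE.
Qed.

Lemma moll_pd t w F L' S' i : allpos t -> intg w -> 0 <= L' -> lip L' F -> normle F S' ->
 \int[mu]_x (conv (rho t) w x * pd i F x) = \int[mu]_x (w x * pd i (conv (rho t) F) x).
Proof.
move=> t0 iw L0 FL FS; have [M [L kr]] := rho_ker_exists t0.
have [P FP] := pd_bounded i FL; have mF := lip_meas FL.
have mP := meas_pd i FL.
have E := conv_rho_fubini t0 iw mP FP.
have cl := conv_lip_bounded kr mF FS.
have cl2 := conv_lip_bounded kr mP FP.
apply: etrans (esym E) _; apply: eq_Rint_ae.
- exact: measurable_funM (intg_meas iw) (lip_meas cl2).
- exact: measurable_funM (intg_meas iw) (meas_pd i cl).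
- by apply: filterS (conv_pd i kr L0 FL FS) => x ->.
Qed.

(** Dictated by [ramp_conv_lip]: [2 ^+ n] from [ramp_scale_le], [9 n] from the Lipschitz constant of
    the kernel, 2 from the two boxes of [conv_lip_bounded] and [2 ^+ n] from the volume of
    [tbox t]. *)
Definition ramp_const : R := 18 * n%:R * 4 ^+ n / @hat_mass R m.

Let hm0 := @hat_mass_gt0 R m.

Lemma ramp_const0 : 0 <= ramp_const.
Proof. by rewrite !mulr_ge0// ?exprn_ge0// invr_ge0 ltW. Qed.

(* For [s = 1 - 1/p] this holds, by Hölder, as soon as the norm of [h] in the dual of [L^p] is at most [A]. *)
Definition test (s A : R) h := [/\ 0 <= A, measT h, exists M, forall x, `|h x| <= M &
 forall x t, allpos t ->
  \int[mu]_y (`|h y| * \1_(tbox t) (x - y)) <= A * (\prod_l (2 * t l)) `^ (1 - s)].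

Let prod2 t : \prod_l (2 * t l) = 2 ^+ n * \prod_l t l.
Proof. by rewrite big_split/= prodr_const card_ord. Qed.

Lemma test_bounded A h : measT h -> normle h A -> test 0 A h.
Proof.
move=> mh hA; have A0 : 0 <= A by rewrite (le_trans _ (hA 0)).
split=> //; first by exists A.
move=> x t t0; rewrite subr0 powRr1 ?prodr_ge0//; last by move=> l _; rewrite mulr_ge0// ltW.
have it := intg_tbox_shift t x.
have -> : \prod_l (2 * t l) = fine (mu (tbox t)) := esym (congr1 fine (measure_tbox t0)).
rewrite -(tbox_shift_integral t x) -RintegralZl//.
apply: le_Rintegral => //; [|exact: intg_scale|by move=> y _; rewrite ler_wpM2r].
apply: intg_mulC; apply: intg_mulb (A) it _ _; first exact: measurableT_comp.
by move=> y; rewrite normr_id.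
Qed.

(** The kernel is of size [t i / \prod_l t l] on [tbox t], and [test] bounds the mass of [h] on a
    translate of that box by [A] times its volume to the power [1 - s]. *)
Lemma ramp_conv_le t i s A h x : allpos t -> 0 <= s <= 1 -> test s A h ->
 `|conv (ramp_ker t i) h x| <= ramp_const * t i * (\prod_l t l) `^ (- s) * A.
Proof.
move=> t0 /andP[s0 s1] [A0 mh [B hB] hs].
have tT l : (t l)^-1 <= \sum_l (t l)^-1.
 by rewrite [leRHS](bigD1 l)//= lerDl sumr_ge0// => k _; rewrite invr_ge0 ltW.
have P0 : 0 < \prod_l t l by exact: prodr_gt0.
rewrite (le_trans (conv_le_box (ramp_ker_ker i t0 tT) x mh hB))//.
rewrite (le_trans (ler_wpM2l (ramp_scale_ge0 i t0) (hs x t t0)))//.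
have p0 : 0 <= A * (\prod_l (2 * t l)) `^ (1 - s) by rewrite mulr_ge0// powR_ge0.
rewrite (le_trans (ler_wpM2r p0 (ramp_scale_le i t0)))//.
have e1 : (\prod_l (2 * t l)) `^ (1 - s) <= 2 ^+ n * (\prod_l t l * (\prod_l t l) `^ (- s)).
 rewrite prod2 powRM ?exprn_ge0 ?(ltW P0)// [X in _ * X]powRD; last by rewrite (gt_eqF P0) implybT.
 rewrite powRr1 ?(ltW P0)// ler_wpM2r ?mulr_ge0 ?powR_ge0 ?(ltW P0)//.
 by by apply: ler1_powR; [rewrite exprn_ege1// ler1n|rewrite lerBlDr lerDl].
have q0 : 0 <= 2 ^+ n * t i * (@hat_mass R m * \prod_l t l)^-1.
 by rewrite !mulr_ge0 ?exprn_ge0 ?(ltW (t0 i))// invr_ge0 mulr_ge0 ?ltW.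
rewrite (le_trans (ler_wpM2l q0 (ler_wpM2l A0 e1)))//.
have -> : 2 ^+ n * t i * (@hat_mass R m * \prod_l t l)^-1 * (A * (2 ^+ n * (\prod_l t l * (\prod_l t l) `^ (- s)))) =
  4 ^+ n / @hat_mass R m * (t i * (\prod_l t l) `^ (- s) * A).
 have -> : 4 ^+ n = 2 ^+ n * 2 ^+ n :> R by rewrite -exprMn; congr (_ ^+ _); ring.
 by field; rewrite !gt_eqF.
have X0 : 0 <= t i * (\prod_l t l) `^ (- s) * A by rewrite !mulr_ge0 ?powR_ge0 ?(ltW (t0 i)).
have -> : ramp_const * t i * (\prod_l t l) `^ (- s) * A = ramp_const * (t i * (\prod_l t l) `^ (- s) * A) by ring.
rewrite ler_wpM2r// /ramp_const -mulrA ler_peMl//.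
 by rewrite divr_ge0 ?exprn_ge0// ltW.
by have : 1 <= n%:R :> R; [rewrite ler1n|lra].
Qed.

Lemma ramp_conv_lip t i T A h : allpos t -> (forall l, (t l)^-1 <= T) ->
 measT h -> normle h A ->
 lip (ramp_const * (t i * T) * A) (conv (ramp_ker t i) h).
Proof.
move=> t0 tT mh hA; have A0 : 0 <= A by rewrite (le_trans _ (hA 0)).
have T0 : 0 <= T by rewrite (le_trans _ (tT ord0))// invr_ge0 ltW.
have P0 : 0 < \prod_l t l by exact: prodr_gt0.
apply: lip_le (conv_lip_bounded (ramp_ker_ker i t0 tT) mh hA).
have -> : fine (mu (tbox t)) = \prod_l (2 * t l) := congr1 fine (measure_tbox t0).
rewrite prod2 -!mulrA.
have q0 : 0 <= n%:R * (9 * (T * (A * (2 * (2 ^+ n * \prod_l t l))))).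
 by rewrite !mulr_ge0 ?exprn_ge0 ?(ltW P0).
rewrite (le_trans (ler_wpM2r q0 (ramp_scale_le i t0)))// /ramp_const.
have -> : 4 ^+ n = 2 ^+ n * 2 ^+ n :> R by rewrite -exprMn; congr (_ ^+ _); ring.
by apply: eq_ler; field; rewrite !gt_eqF.
Qed.

Lemma rho_half_conv t h A : allpos t -> measT h -> normle h A ->
 {ae mu, forall x, conv (rho (fun l => t l / 2)) h x - conv (rho t) h x =
   \sum_i pd i (conv (ramp_ker t i) h) x}.
Proof.
move=> t0 mh hA.
have t20 l : 0 < t l / 2 by rewrite divr_gt0.
have [M1 [L1 k1]] := rho_ker_exists t20; have [M2 [L2 k2]] := rho_ker_exists t0.
have E x : conv (rho (fun l => t l / 2)) h x - conv (rho t) h x = \sum_i conv (ramp_deriv t i) h x.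
 rewrite !convE -RintegralB//; try exact: (conv_intg k1 x mh hA); try exact: (conv_intg k2 x mh hA).
 rewrite -Rintegral_sum; last first.
  move=> i; have [mD [C DC]] := ramp_deriv_bounded i t0.
  apply: intg_mulb (A) _ mh hA.
  apply: (intg_le (meas_shift x mD) (fun y => DC (x - y))).
  by apply: intg_scale; exact: intg_tbox_shift.
 by apply: eq_Rint => y; rewrite -mulrBl rho_half_sub mulr_suml.
have : forall i, {ae mu, forall x, pd i (conv (ramp_ker t i) h) x = conv (ramp_deriv t i) h x}.
 move=> i; have [M [L k]] := ramp_ker_exists i t0.
 apply: conv_deriv k _ _ mh hA; first by have [] := ramp_deriv_bounded i t0.
 by move=> z; exact: ramp_ker_deriv.
move=> /ae_forall_countable; apply: filterS => x Hx.
by rewrite E; apply: eq_bigr => i _; rewrite Hx.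
Qed.

End mollification.

Notation cn := ramp_const.

(** * Variation in coordinate directions, scale by scale *)

Section total_variation_scales.

(** The [alpha]-Hölder constant of the test function is replaced by the interpolation between its
    sup bound [S'] and its Lipschitz constant [L], the two quantities that convolution estimates
    provide. For [alpha = 0] the number [b i] bounds the mass of the [i]-th distributional
    derivative. *)
Definition CV (alpha : R) b w := forall i F S' L, 0 <= S' -> 0 <= L -> lip L F -> normle F S' ->
 `|\int[mu]_x (w x * pd i F x)| <= b i * (S' `^ (1 - alpha) * L `^ alpha).

(** The difference of two mollifications is a sum of derivatives [pd i] of convolutions with
    [ramp_ker t i], so the variation of [w] applies; [A] enters through their sup bounds and [A0]
    through their Lipschitz constants. *)
Lemma rho_tel alpha b w s A A0 t T h : intg w -> CV alpha b w -> allnneg b ->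
 0 <= s <= 1 -> test s A h -> normle h A0 -> allpos t -> (forall l, (t l)^-1 <= T) ->
 `|\int[mu]_x (w x * conv (rho (fun l => t l / 2)) h x) - \int[mu]_x (w x * conv (rho t) h x)| <=
 \sum_i b i * ((cn * t i * (\prod_l t l) `^ (- s) * A) `^ (1 - alpha) * (cn * (t i * T) * A0) `^ alpha).
Proof.
move=> iw wb b0 s01 th hA t0 tT; have [A_0 mh _ _] := th.
have A00 : 0 <= A0 by rewrite (le_trans _ (hA 0)).
have c0 := ramp_const0.
have T0 : 0 <= T by rewrite (le_trans _ (tT ord0))// invr_ge0 ltW.
have t20 l : 0 < t l / 2 by rewrite divr_gt0.
have [M1 [L1 k1]] := rho_ker_exists t20; have [M2 [L2 k2]] := rho_ker_exists t0.
have l1 := conv_lip_bounded k1 mh hA; have l2 := conv_lip_bounded k2 mh hA.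
have lr i := ramp_conv_lip i t0 tT mh hA.
have rb t' (t'0 : forall l, 0 < t' l) x : `|conv (rho t') h x| <= A0.
 have [M [L k]] := rho_ker_exists t'0.
 by apply: (conv_rho_le x k _ (integral_rho t'0) mh hA) => z; exact: rho_ge0.
have i1 := intg_mulb iw (lip_meas l1) (rb _ t20).
have i2 := intg_mulb iw (lip_meas l2) (rb _ t0).
have ip i : intg (fun x => w x * pd i (conv (ramp_ker t i) h) x).
 by have [P hP] := pd_bounded i (lr i); exact: intg_mulb iw (meas_pd i (lr i)) hP.
have E : \int[mu]_x (w x * conv (rho (fun l => t l / 2)) h x) - \int[mu]_x (w x * conv (rho t) h x) =
  \sum_i \int[mu]_x (w x * pd i (conv (ramp_ker t i) h) x).
 rewrite -RintegralB// -Rintegral_sum//.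
 apply: eq_Rint_ae.
 - exact: intg_meas (intg_sub i1 i2).
 - by apply: measurable_sum => i; exact: intg_meas (ip i).
 - apply: filterS (rho_half_conv t0 mh hA) => x Ex.
  by rewrite -mulrBr Ex mulr_sumr.
rewrite E; apply: le_trans (ler_norm_sum _ _ _) _; apply: ler_sum => i _.
apply: wb => //.
- exact: mulr_ge0 (mulr_ge0 (mulr_ge0 c0 (ltW (t0 i))) (powR_ge0 _ _)) A_0.
- exact: mulr_ge0 (mulr_ge0 c0 (mulr_ge0 (ltW (t0 i)) T0)) A00.
- by move=> x; exact: ramp_conv_le.
Qed.

Lemma moll_integrable t N w : allpos t -> 0 <= N -> intg w -> vanish N w ->
 exists L, [/\ 0 <= L, lip L (conv (rho t) w) & intg (conv (rho t) w)].
Proof.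
move=> t0 N0 iw w0; have [M [L k]] := rho_ker_exists t0.
have tT l : t l <= \sum_l t l by apply: term_le_sum => j; rewrite ltW.
have T0 : 0 <= \sum_l t l by apply: sumr_ge0 => l _; rewrite ltW.
have cl := conv_lip_integrable k iw; have [L0 _ _ _] := k.
exists (L * \int[mu]_y `|w y|); split => //.
 by rewrite mulr_ge0// Rintegral_ge0.
apply: (lip_supp_integrable (N := N + \sum_l t l)) cl _; first by rewrite addr_ge0.
by move=> x; apply: (conv_supp k tT _ w0); rewrite addr_ge0.
Qed.

(** By duality [w] is tested against mollifications of [h] while the scale is halved repeatedly.
    Each halving gains the factor [2^(alpha - 1)]: the sup bounds of the ramp convolutions are
    halved and their Lipschitz constants stay the same. *)
Lemma moll_L1_close alpha b w t T N k : intg w -> 0 <= N -> vanish N w ->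
 0 <= alpha < 1 -> CV alpha b w -> allnneg b -> allpos t -> (forall l, (t l)^-1 <= T) ->
 \int[mu]_x `|w x - conv (rho (fun l => t l / 2 ^+ k)) w x| <=
 (\sum_i b i * ((cn * t i) `^ (1 - alpha) * (cn * (t i * T)) `^ alpha)) *
  (2^-1 `^ (1 - alpha)) ^+ k / (1 - 2^-1 `^ (1 - alpha)).
Proof.
move=> iw N0 w0 /andP[al0 al1] wb b0 t0 tT; set D := \sum_i _; set q := _ `^ _.
have T0 : 0 <= T by rewrite (le_trans _ (tT ord0))// invr_ge0 ltW.
have c0 := ramp_const0.
have D0 : 0 <= D by apply: sumr_ge0 => i _; rewrite !mulr_ge0 ?powR_ge0.
have q0 : 0 <= q by exact: powR_ge0.
have q1 : q < 1.
 have a1 : 0 < 1 - alpha by rewrite subr_gt0.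
 rewrite [X in _ < X](_ : 1 = 1 `^ (1 - alpha)); last by rewrite powR1.
 by apply: gt0_ltr_powR; rewrite ?nnegrE ?invr_ge0// invf_lt1// ltr1n.
pose s j l := t l / 2 ^+ j.
have s0 j l : 0 < s j l by rewrite divr_gt0 ?exprn_gt0.
have [Lk [Lk0 lk ik]] := moll_integrable (s0 k) N0 iw w0.
apply: L1_le_lip_dual; first exact: intg_sub.
move=> h L L0 hL h1; have mh := lip_meas hL.
pose a j := \int[mu]_x (w x * conv (rho (s j)) h x).
have wh : intg (fun x => w x * h x) by exact: intg_mulb iw mh h1.
have -> : \int[mu]_x ((w x - conv (rho (s k)) w x) * h x) = \int[mu]_x (w x * h x) - a k.
 by rewrite /a (conv_rho_fubini (s0 k) iw mh h1) (Rint_subM iw ik mh h1).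
apply: le_trans (ler_norm _) _; apply: geometric_tail => //; first by rewrite q0.
- move=> j; have sT l : (s j l)^-1 <= T * 2 ^+ j.
  by rewrite /s invf_div mulrC ler_wpM2r ?exprn_ge0.
 have -> : a j.+1 = \int[mu]_x (w x * conv (rho (fun l => s j l / 2)) h x).
  by rewrite /a (_ : s j.+1 = fun l => s j l / 2)//; apply/funext => l; rewrite /s exprSr invfM mulrA.
 have s01 : 0 <= (0 : R) <= 1 by rewrite lexx ler01.
 rewrite (le_trans (rho_tel iw wb b0 s01 (test_bounded mh h1) h1 (s0 j) sT))//.
 rewrite /D mulr_suml; apply: ler_sum => i _.
 rewrite oppr0 powRr0 !mulr1 -[leRHS]mulrA ler_wpM2l//; move: (cn) c0 => c c0.
 have -> : c * s j i = c * t i * 2^-1 ^+ j by rewrite /s -exprVn mulrA.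
 rewrite powRM ?exprn_ge0 ?invr_ge0 ?mulr_ge0 ?(ltW (t0 i))//.
 have -> : (2^-1 ^+ j) `^ (1 - alpha) = q ^+ j.
  rewrite -powR_mulrn ?invr_ge0// -powRrM mulrC powRrM powR_mulrn//.
 have -> : s j i * (T * 2 ^+ j) = t i * T by rewrite /s; field; rewrite expf_neq0.
 by apply: eq_ler; ring.
- pose E := L * (\sum_l t l) * \int[mu]_x `|w x|.
 have tT' l : t l <= \sum_l t l.
  by rewrite [leRHS](bigD1 l)//= lerDl sumr_ge0// => j _; rewrite ltW.
 have S0 : 0 <= \sum_l t l by apply: sumr_ge0 => l _; rewrite ltW.
 have H j : `|\int[mu]_x (w x * h x) - a j| <= E * 2^-1 ^+ j.
  have [M [Lj kj]] := rho_ker_exists (s0 j).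
  have lj := conv_lip_bounded kj mh h1.
  have rj x : `|conv (rho (s j)) h x| <= 1.
   by apply: (conv_rho_le x kj _ (integral_rho (s0 j)) mh h1) => z; exact: rho_ge0.
  have sj l : s j l <= (\sum_l t l) * 2^-1 ^+ j by rewrite /s -exprVn ler_wpM2r ?exprn_ge0 ?invr_ge0.
  rewrite /a -RintegralB//; last exact: intg_mulb iw (lip_meas lj) rj.
  have -> : E * 2^-1 ^+ j = \int[mu]_x (L * ((\sum_l t l) * 2^-1 ^+ j) * `|w x|).
   by rewrite RintegralZl//; [rewrite /E; ring|exact: intg_abs].
  apply: Rint_abs_le.
  - apply: measurable_funB; [exact: intg_meas wh|].
   exact: measurable_funM (intg_meas iw) (lip_meas lj).
  - move=> x; rewrite -mulrBr normrM mulrC ler_wpM2r// distrC.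
   apply: (conv_close x kj _ (integral_rho (s0 j)) sj _ L0 hL h1); first by move=> z; exact: rho_ge0.
   by rewrite mulr_ge0 ?exprn_ge0 ?invr_ge0.
  - by apply: intg_scale; exact: intg_abs.
 by apply: cvg_geometric_bound H; rewrite invr_ge0 ler0n invf_lt1// ltr1n.
Qed.

End total_variation_scales.

(** * Integration by parts in determinants *)

Section integration_by_parts.
Implicit Types (g : Rn -> Rn) (j : 'I_n).

Lemma lip_mul (L K A B : R) F G : 0 <= L -> 0 <= K -> lip L F -> lip K G ->
 normle F A -> normle G B -> lip (L * B + A * K) (fun x => F x * G x).
Proof.
move=> L0 K0 FL GK FA GB x y.
rewrite (_ : _ - _ = (F x - F y) * G x + F y * (G x - G y)); last by ring.
rewrite (le_trans (ler_normD _ _))// [leRHS]mulrDl !normrM lerD//.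
 by rewrite mulrAC ler_pM.
by rewrite -mulrA ler_pM.
Qed.

Lemma pd_supp (N : R) F i : 0 <= N -> vanish N F -> forall x, ~ cube N x -> pd i F x = 0.
Proof.
move=> N0 F0 x xN; have Nx : N < `|x| by rewrite ltNge; apply/negP => /(cubeP x N0).
have d0 : sdiff F x 0.
 move=> e e0; exists ((`|x| - N) / 2) => [|h hd]; first by rewrite divr_gt0// subr_gt0.
 rewrite (F0 x xN) F0.
  rewrite subr0 sub0r normrN big1 ?normr0 ?mulr_ge0 ?(ltW e0)// => l _.
  by rewrite mxE mul0r.
 move=> /(cubeP _ N0) yN.
 by have := lerB_normD x h; lra.
by rewrite (sdiff_pd i d0) mxE.
Qed.

Lemma pd_mul F G x a c i : sdiff F x a -> sdiff G x c ->
 pd i (fun y => F y * G y) x = G x * pd i F x + F x * pd i G x.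
Proof. by move=> s1 s2; rewrite (sdiff_pd i (sdiffM s1 s2)) (sdiff_pd i s1) (sdiff_pd i s2) !mxE. Qed.

Lemma pd_sub F G x a c i : sdiff F x a -> sdiff G x c ->
 pd i (fun y => F y - G y) x = pd i F x - pd i G x.
Proof.
move=> s1 s2; have s3 := sdiffD s1 (sdiffZ (-1) s2).
have s4 : sdiff (fun y => F y - G y) x (a + -1 *: c).
 by apply: eq_sdiff s3 => y; rewrite mulN1r.
by rewrite (sdiff_pd i s4) (sdiff_pd i s1) (sdiff_pd i s2) !mxE mulN1r.
Qed.

Lemma pd_integrable (L N : R) F i : 0 <= N -> lip L F -> vanish N F -> intg (pd i F).
Proof.
move=> N0 FL F0; have [P FP] := pd_bounded i FL.
apply: (@intg_le _ _ _ mu (fun x => P * \1_(cube N) x)); first exact: meas_pd FL.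
- move=> x; rewrite indicE; have [xN|xN] := pselect (cube N x).
  by rewrite mem_set// mulr1.
 by rewrite (pd_supp i N0 F0 xN) memNset// mulr0 normr0.
- by apply: intg_scale; apply: intg_indic; [exact: meas_cube|exact: cube_lty].
Qed.

(** [stokes] is applied with component [j] replaced by the compactly supported product of [w] and
    that component; the product rule splits the determinant into the two integrands. *)
Lemma stokes_parts (Lw N S' : R) (L : 'I_n -> R) w f j : 0 <= N -> 0 <= Lw -> lip Lw w ->
 vanish N w -> allnneg L -> lips L f -> (forall x, `|f x ord0 j| <= S') ->
 \int[mu]_x (w x * detD f x) = - \int[mu]_x (detD (updc j w f) x * f x ord0 j).
Proof.
move=> N0 Lw0 wL w0 L0 fL fS.
have wB x : `|w x| <= `|w 0| + `|Lw| * N.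
 rewrite (le_trans (lip_supp_bounded N0 wL w0 x))// ler_piMr ?addr_ge0 ?mulr_ge0//.
have wfL := lip_mul Lw0 (L0 j) wL (fL j) wB fS.
have lw := lips_updc j fL wL; have lwf := lips_updc j fL wfL.
have [M1 d1] := detD_bnd fL.
have iw : intg w by exact: lip_supp_integrable wL w0.
have i1 : intg (fun x => w x * detD f x) by exact: intg_mulb iw (lips_meas_detD fL) d1.
have aeD : {ae mu, forall x, detD (updc j (fun y => w y * f y ord0 j) f) x =
  w x * detD f x + detD (updc j w f) x * f x ord0 j}.
 have e0 := ae_detD_updc j fL (fL j); rewrite updc_id in e0.
 have e1 := ae_detD_updc j fL wL; have e2 := ae_detD_updc j fL wfL.
 apply: aeS2 (aeI e0 e1) (aeI e2 (aeI (ae_sdiff_pd wL) (ae_sdiff_pd (fL j)))).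
 move=> x [E0 E1] [E2 [s1 s2]]; rewrite E0 E1 E2 mulr_sumr mulr_suml -big_split/=.
 have Ei i : pd i (fun y => w y * f y ord0 j) x = f x ord0 j * pd i w x + w x * pd i (fun y => f y ord0 j) x.
  exact: pd_mul s1 s2.
 apply: eq_bigr => i _; rewrite Ei.
 move: (cofactor _ _ _) (pd i w x) (pd i _ x) (w x) (f x ord0 j) => c1 c2 c3 c4 c5; ring.
have md := lips_meas_detD lw; have mdf := lips_meas_detD lwf.
have mf : measT (fun x : Rn => f x ord0 j) by exact: lip_meas (fL j).
have i2 : intg (fun x => detD (updc j w f) x * f x ord0 j).
 have [M2 d2] := detD_bnd lw.
 have M20 : 0 <= M2 by rewrite (le_trans _ (d2 0)).
 have S0 : 0 <= S' by rewrite (le_trans _ (fS 0)).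
 apply: (proj1 (@Rintegral_abs_le_ae _ _ _ mu _ (fun x => M2 * S' * \1_(cube N) x) _ _ _ _)).
 - exact: measurable_funM md mf.
 - by move=> x; rewrite !mulr_ge0.
 - apply: aeS (ae_detD_updc j fL wL) => x E1; rewrite indicE; have [xN|xN] := pselect (cube N x).
   by rewrite mem_set// mulr1 normrM ler_pM.
  rewrite memNset// mulr0 E1 big1 ?mul0r ?normr0// => i _.
  by rewrite (pd_supp i N0 w0 xN) mul0r.
 - by apply: intg_scale; apply: intg_indic; [exact: meas_cube|exact: cube_lty].
apply/eqP; rewrite -addr_eq0 -RintegralD//; apply/eqP.
have <- : \int[mu]_x detD (updc j (fun y => w y * f y ord0 j) f) x = 0.
 apply: (stokes (j := j) N0 lwf) => x xN; by rewrite mxE eqxx w0// mul0r.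
by apply: eq_Rint_ae => //; [exact: intg_meas (intg_add i1 i2)|apply: aeS aeD => x ->].
Qed.

(** The case of [stokes_parts] where the map is the identity with component [i] replaced by [h]. *)
Lemma int_by_parts (Lw Lh N S' : R) w h i : 0 <= N -> 0 <= Lw -> lip Lw w ->
 vanish N w -> 0 <= Lh -> lip Lh h -> normle h S' ->
 \int[mu]_x (pd i w x * h x) = - \int[mu]_x (w x * pd i h x).
Proof.
move=> N0 Lw0 wL w0 Lh0 hL hS.
have fL := lips_updc i lips_id hL; have fw := lips_updc i lips_id wL.
have fi x : updc i h id x ord0 i = h x by rewrite mxE eqxx.
have iw : intg w by exact: lip_supp_integrable wL w0.
have ip := pd_integrable i N0 wL w0.
have E1 : \int[mu]_x (w x * pd i h x) = \int[mu]_x (w x * detD (updc i h id) x).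
 apply: eq_Rint_ae.
 - exact: measurable_funM (intg_meas iw) (meas_pd i hL).
 - exact: measurable_funM (intg_meas iw) (lips_meas_detD fL).
 - by apply: aeS (ae_detD_updc_id i hL) => x ->.
have E2 : \int[mu]_x (pd i w x * h x) = \int[mu]_x (detD (updc i w (updc i h id)) x * updc i h id x ord0 i).
 rewrite updcK; apply: eq_Rint_ae.
 - exact: measurable_funM (intg_meas ip) (lip_meas hL).
 - apply: measurable_funM; first exact: lips_meas_detD fw.
  by apply: eq_measurable_fun (lip_meas hL) => x _; rewrite fi.
 - by apply: aeS (ae_detD_updc_id i wL) => x ->; rewrite fi.
rewrite E1 E2; have L0 k : 0 <= (if k == i then Lh else 1) by case: ifP.
have fS x : `|updc i h id x ord0 i| <= S' by rewrite fi.
by rewrite (stokes_parts N0 Lw0 wL w0 L0 fL fS) opprK.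
Qed.

Lemma moll_CV0 b w t : allpos t -> intg w -> CV 0 b w -> CV 0 b (conv (rho t) w).
Proof.
move=> t0 iw wb i F S' L S0 L0 FL FS.
have [M [K k]] := rho_ker_exists t0; have mF := lip_meas FL.
(* The Lipschitz constant has exponent 0, so it contributes the factor 1 and that of the mollified
   test function can be put in its place. *)
rewrite (moll_pd i t0 iw L0 FL FS) powRr0 -[X in _ * (_ * X)](powRr0 `|K * S' * (2 * fine (mu (tbox t)))|).
apply: wb => //; first exact: lip_norm (conv_lip_bounded k mF FS).
move=> x; apply: (conv_rho_le x k _ (integral_rho t0) mF FS) => z; exact: rho_ge0.
Qed.

Lemma CV0_pd_L1 b w N L i : 0 <= N -> 0 <= L -> lip L w -> vanish N w -> CV 0 b w ->
 \int[mu]_x `|pd i w x| <= b i.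
Proof.
move=> N0 L0 wL w0 wb; apply: L1_le_lip_dual; first exact: pd_integrable wL w0.
move=> h Lh Lh0 hL h1; rewrite (int_by_parts i N0 L0 wL w0 Lh0 hL h1).
have := wb i h 1 Lh ler01 Lh0 hL h1; rewrite powRr0 powR1 !mulr1.
by apply: le_trans; rewrite lerNl lerNnormlW.
Qed.

Lemma moll_L1_cvg alpha b w N e : intg w -> 0 <= N -> vanish N w ->
 0 <= alpha < 1 -> CV alpha b w -> allnneg b -> 0 < e ->
 exists k, \int[mu]_x `|w x - conv (rho (fun l => (fun=> 1) l / 2 ^+ k)) w x| <= e.
Proof.
move=> iw N0 w0 al wb b0 e0.
have T1 (l : 'I_n) : ((fun=> 1) l)^-1 <= 1 :> R by rewrite invr1.
have t1 (l : 'I_n) : 0 < (fun=> 1) l :> R by [].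
have H k := moll_L1_close k iw N0 w0 al wb b0 t1 T1.
set q := 2^-1 `^ (1 - alpha) in H; move: H; set D := \sum_i _ => H.
have q0 : 0 <= q by exact: powR_ge0.
have q1 : q < 1.
 case/andP: al => al0 al1; rewrite /q [X in _ < X](_ : 1 = 1 `^ (1 - alpha)); last by rewrite powR1.
 by apply: gt0_ltr_powR; rewrite ?subr_gt0 ?nnegrE ?invr_ge0// invf_lt1// ltr1n.
have c1 : D * q ^+ k / (1 - q) @[k --> \oo] --> D * 0 / (1 - q).
 apply: cvgM; [apply: cvgM; [exact: cvg_cst|]|exact: cvg_cst].
 by apply: cvg_expr; rewrite ger0_norm.
rewrite mulr0 mul0r in c1; have /cvgrPdist_le /(_ e e0) [k _ /(_ k)] := c1.
rewrite /= leqnn sub0r normrN => /(_ isT) /(le_trans (ler_norm _)) Dk.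
by exists k; exact: le_trans (H k) Dk.
Qed.

(** Component [j] enters through its sup bound alone: once [w] is mollified, integration by parts
    moves the derivative from that component to [w], whose derivatives have mass at most [b i],
    while the cofactors are bounded by the Lipschitz constants of the other components. *)
Lemma CV0_detD b w N f (L : 'I_n -> R) j S' : intg w -> 0 <= N -> vanish N w ->
 CV 0 b w -> allnneg b -> lips L f -> allnneg L -> (forall x, `|f x ord0 j| <= S') ->
 `|\int[mu]_x (w x * detD f x)| <= n`!%:R * (\sum_i b i) * (S' * pbut j L).
Proof.
move=> iw N0 w0 wb b0 fL L0 fS.
have S0 : 0 <= S' by rewrite (le_trans _ (fS 0)).
have PL0 : 0 <= pbut j L by exact: prodr_ge0.
have [M dM] := detD_bnd fL; have M0 : 0 <= M by rewrite (le_trans _ (dM 0)).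
have md := lips_meas_detD fL.
apply/ler_addgt0Pr => e e0.
(* The determinant is bounded by [M], so this tolerance changes the integral by at most [e]. *)
have [k wk] := moll_L1_cvg iw N0 w0 (introT andP (conj (lexx 0) ltr01)) wb b0 (divr_gt0 e0 (ltr_wpDl M0 ltr01)).
have t0 (l : 'I_n) : 0 < (fun=> 1) l / 2 ^+ k :> R by rewrite divr_gt0 ?exprn_gt0.
move: wk; set w1 := conv _ w => wk.
have [Lk [Lk0 lk ik]] := moll_integrable t0 N0 iw w0.
have w1b : CV 0 b w1 by exact: moll_CV0.
pose N1 := N + \sum_(l < n) 1 / 2 ^+ k.
have N10 : 0 <= N1 by rewrite addr_ge0// sumr_ge0.
have w10 x : ~ cube N1 x -> w1 x = 0.
 have [M' [L' k']] := rho_ker_exists t0.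
 apply: (conv_supp k' _ _ w0); last by rewrite addr_ge0// sumr_ge0.
 by move=> l; rewrite (bigD1 l)//= lerDl sumr_ge0.
have iwd := intg_mulb iw md dM; have ikd := intg_mulb ik md dM.
rewrite (_ : \int[mu]_x (w x * detD f x) = \int[mu]_x (w1 x * detD f x) + \int[mu]_x ((w x - w1 x) * detD f x)); last first.
 rewrite -RintegralD//; last exact: intg_mulb (intg_sub iw ik) md dM.
 by apply: eq_Rint => x; ring.
rewrite (le_trans (ler_normD _ _))// lerD//; last first.
 have iab := intg_dist iw ik.
 apply: (@le_trans _ _ (\int[mu]_x (M * `|w x - w1 x|))).
  apply: Rint_abs_le; [|move=> x|exact: intg_scale].
   exact: measurable_funM (intg_meas (intg_sub iw ik)) md.
  by rewrite normrM mulrC ler_wpM2r.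
 rewrite RintegralZl// (le_trans (ler_wpM2l M0 wk))// mulrA ler_pdivrMr ?ltr_wpDl//.
 by rewrite mulrDr mulr1 mulrC lerDl ltW.
rewrite (stokes_parts (j := j) N10 Lk0 lk w10 L0 fL fS) normrN.
have lw := lips_updc j fL lk.
have ip i : intg (fun x => S' * pbut j L * n`!%:R * `|pd i w1 x|).
 apply: intg_scale; apply: intg_abs; exact: pd_integrable lk w10.
have -> : n`!%:R * (\sum_i b i) * (S' * pbut j L) =
 \sum_i S' * pbut j L * n`!%:R * b i by rewrite -mulr_sumr; ring.
apply: (@le_trans _ _ (\int[mu]_x \sum_i (S' * pbut j L * n`!%:R * `|pd i w1 x|))); last first.
 rewrite Rintegral_sum//; apply: ler_sum => i _.
 rewrite RintegralZl//; last by apply: intg_abs; exact: pd_integrable lk w10.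
 by rewrite ler_wpM2l ?mulr_ge0//; exact: CV0_pd_L1 lk w10 w1b.
refine (proj2 (@Rintegral_abs_le_ae _ _ _ mu _ _ _ _ _ _)).
- exact: measurable_funM (lips_meas_detD lw) (lip_meas (fL j)).
- by move=> x; apply: sumr_ge0 => i _; rewrite !mulr_ge0.
- have cb := ae_forall_countable (fun i => ae_cofactor_le i j L0 fL).
 apply: aeS2 (ae_detD_updc j fL lk) cb => x -> Hx.
 rewrite normrM mulrC (le_trans (ler_wpM2r (normr_ge0 _) (fS x)))//.
 rewrite (le_trans (ler_wpM2l S0 (ler_norm_sum _ _ _)))// mulr_sumr; apply: ler_sum => i _.
 rewrite -!mulrA ler_wpM2l// normrM mulrC (le_trans (ler_wpM2r (normr_ge0 _) (Hx i)))//.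
 by apply: eq_ler; ring.
- have := integrable_sum measurableT (index_enum 'I_n) (P := xpredT) (fun i _ => ip i).
 by apply: eq_integrable => // x _ /=; rewrite sumEFin.
Qed.

End integration_by_parts.

(** * Antiderivatives in one direction *)

Section antiderivative.
Notation lam := (@lebesgue_measure R).
Variables (h : Rn -> R) (L N : R) (j : 'I_n).
Hypotheses (L0 : 0 <= L) (hL : lip L h) (h1 : forall x, `|h x| <= 1) (N0 : 0 <= N).

Let line (y : Rn) (s : R) : Rn := y + (s - y ord0 j) *: delta_mx ord0 j.
(** The upper limit of integration is clipped so that [F] is bounded and Lipschitz on the whole
    space; the margin 1 beyond [N] leaves room for difference quotients at points of [cube N]. *)
Let clip (s : R) : R := Num.max (- (N + 1)) (Num.min (N + 1) s).
Let F (y : Rn) : R := \int[lam]_(s in `[- (N + 1), clip (y ord0 j)]) h (line y s).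

Let line_lip y s s' : `|line y s - line y s'| <= `|s - s'|.
Proof.
have -> : line y s - line y s' = (s - s') *: delta_mx ord0 j by apply/rowP => l; rewrite !mxE; ring.
exact: norm_scale_delta.
Qed.

Let hline_cont y : continuous (fun s => h (line y s)).
Proof.
apply: (@lip_continuous _ _ _ _ L) => s s'.
by rewrite (le_trans (hL _ _))// ler_wpM2l.
Qed.

Let clipE s : (clip s = - (N + 1) /\ s <= - (N + 1)) \/ (clip s = N + 1 /\ N + 1 <= s) \/
 (clip s = s /\ - (N + 1) <= s <= N + 1).
Proof.
rewrite /clip; case: (leP (N + 1) s) => s1; first by right; left; split => //; apply: max_idPr; have := N0; lra.
by case: (leP (- (N + 1)) s) => s2; [right; right; rewrite (ltW s1)|left; rewrite (ltW s2)].
Qed.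

Let clip_lip s s' : `|clip s - clip s'| <= `|s - s'|.
Proof.
have a1 := ler_norm (s - s'); have := ler_norm (s' - s); rewrite distrC => a2.
have := N0; rewrite ler_norml => ?; apply/andP.
by case: (clipE s) => [[-> ?]|[[-> ?]|[-> /andP[? ?]]]]; case: (clipE s') => [[-> ?]|[[-> ?]|[-> /andP[? ?]]]]; split; lra.
Qed.

Let clip_ge s : - (N + 1) <= clip s.
Proof. by have := N0; case: (clipE s) => [[-> ?]|[[-> ?]|[-> /andP[? ?]]]]; lra. Qed.

Let clip_le s : clip s <= N + 1.
Proof. by have := N0; case: (clipE s) => [[-> ?]|[[-> ?]|[-> /andP[? ?]]]]; lra. Qed.

Let clip_id s : `|s| <= N + 1 -> clip s = s.
Proof.
by rewrite ler_norml => /andP[? ?]; case: (clipE s) => [[-> ?]|[[-> ?]|[-> /andP[? ?]]]] => //; lra.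
Qed.

Let itv_diff y r r' : - (N + 1) <= r -> - (N + 1) <= r' ->
 `|\int[lam]_(s in `[- (N + 1), r]) h (line y s) - \int[lam]_(s in `[- (N + 1), r']) h (line y s)| <= `|r - r'|.
Proof.
wlog rr : r r' / r' <= r => [H a b|a b].
 have [rr|rr] := leP r' r; first exact: H.
 by rewrite distrC [leRHS]distrC; apply: H => //; exact: ltW.
rewrite itv_integral_sub//; have := @itv_integral_le _ (fun s => h (line y s)) 0 1 r' r (@hline_cont y) rr.
rewrite mulr0 subr0 mul1r [`|r - r'|]ger0_norm ?subr_ge0//; apply=> s _.
by rewrite subr0.
Qed.

Let line_shift y s s' : line (y + s *: delta_mx ord0 j) s' = line y s'.
Proof. by apply/rowP => l; rewrite !mxE !eqxx/=; ring. Qed.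

Let F_line y s : `|F (y + s *: delta_mx ord0 j) - F y| <= `|s|.
Proof.
rewrite /F; have -> : (fun s' => h (line (y + s *: delta_mx ord0 j) s')) = (fun s' => h (line y s')).
 by apply/funext => s'; rewrite line_shift.
rewrite (le_trans (itv_diff _ (clip_ge _) (clip_ge _)))// (le_trans (clip_lip _ _))//.
by rewrite (_ : _ - _ = s)// !mxE !eqxx mulr1; ring.
Qed.

Let F_lip : lip (2 * (N + 1) * L + 1) F.
Proof.
move=> y y'; pose G := \int[lam]_(s in `[- (N + 1), clip (y' ord0 j)]) h (line y s).
rewrite -(subrK G (F y)) -addrA (le_trans (ler_normD _ _))// mulrDl [leRHS]addrC lerD//.
 rewrite (le_trans (itv_diff _ (clip_ge _) (clip_ge _)))// (le_trans (clip_lip _ _))// mul1r.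
 by have := coord_le (y - y') j; rewrite !mxE.
rewrite /G /F -RintegralB//; try exact: itv_integrable.
have c : continuous (fun s => h (line y s) - h (line y' s)).
 by move=> s; apply: cvgB; exact: hline_cont.
have := @itv_integral_le _ _ 0 (L * `|y - y'|) _ _ c (clip_ge (y' ord0 j)).
rewrite mulr0 subr0 => H; apply: le_trans (H _) _.
 move=> s _; rewrite subr0 (le_trans (hL _ _))// ler_wpM2l//.
 apply: norm_row_le => // l; rewrite !mxE.
 have [->|lj] := eqVneq l j.
  by rewrite eqxx/= mulr1 mulr1 !(addrC _ (s - _)) !subrK subrr normr0.
 by rewrite andbF !mulr0 !addr0; have := coord_le (y - y') l; rewrite !mxE.
have := clip_le (y' ord0 j); have LN : 0 <= L * `|y - y'| by rewrite mulr_ge0.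
by move=> cl; rewrite mulrC -mulrA ler_wpM2r//; lra.
Qed.

Let F_deriv y : cube N y -> k.+1%:R * (F (y + k.+1%:R^-1 *: delta_mx ord0 j) - F y) @[k --> \oo] --> h y.
Proof.
move=> /(_ j); rewrite -ler_norml => yN.
have H k : `|k.+1%:R * (F (y + k.+1%:R^-1 *: delta_mx ord0 j) - F y) - h y| <= L * k.+1%:R^-1.
 set e := k.+1%:R^-1; have e0 : 0 <= e by rewrite invr_ge0.
 have e1 : e <= 1 by rewrite invf_le1// ler1n.
 have ke : k.+1%:R * e = 1 by rewrite mulfV.
 rewrite /F; have -> : (fun s' => h (line (y + e *: delta_mx ord0 j) s')) = (fun s' => h (line y s')).
  by apply/funext => s'; rewrite line_shift.
 have -> : (y + e *: delta_mx ord0 j) ord0 j = y ord0 j + e by rewrite !mxE !eqxx mulr1.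
 rewrite !clip_id; last 2 first.
 - by rewrite (le_trans yN)// lerDl.
 - by rewrite (le_trans (ler_normD _ _))// lerD// ger0_norm.
 have yN1 : - (N + 1) <= y ord0 j by move: yN; rewrite ler_norml => /andP[]; lra.
 rewrite itv_integral_sub//; last by rewrite lerDl.
 have := @itv_integral_le _ (fun s => h (line y s)) (h y) (L * e) (y ord0 j) (y ord0 j + e) (@hline_cont y).
 rewrite (_ : y ord0 j + e - y ord0 j = e); last by ring.
 rewrite lerDl => /(_ e0) HH.
 rewrite (_ : k.+1%:R * _ - _ = k.+1%:R *
  (\int[lam]_(s in `[y ord0 j, y ord0 j + e]) h (line y s) - e * h y)); last first.
  by rewrite mulrBr mulrA ke mul1r.
 rewrite normrM ger0_norm// mulrC -ler_pdivlMr ?ltr0n// (le_trans (HH _))//.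
 move=> s /andP[s1 s2]; have {2}-> : y = line y (y ord0 j) by rewrite /line subrr scale0r addr0.
 rewrite (le_trans (hL _ _))// ler_wpM2l// (le_trans (line_lip _ _ _))// ger0_norm; lra.
apply/cvgrPdist_le => e e0.
have [K Ke] := exists_inv_nat (divr_gt0 e0 (ltr_wpDl L0 ltr01)).
near=> k; rewrite distrC (le_trans (H k))//.
have kK : k.+1%:R^-1 <= e / (L + 1).
 apply: le_trans Ke; rewrite lef_pV2 ?posrE// ler_nat ltnS.
 by near: k; exact: nbhs_infty_ge.
rewrite (le_trans (ler_wpM2l L0 kK))// mulrCA ger_pMr// ler_pdivrMr ?ltr_wpDl//.
by rewrite mul1r lerDl.
Unshelve. all: by end_near. Qed.

Lemma exists_antiderivative : exists G : Rn -> R, [/\ lip (2 * (N + 1) * L + 1) G,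
 forall y s, `|G (y + s *: delta_mx ord0 j) - G y| <= `|s|, forall y, `|G y| <= 2 * (N + 1) &
 {ae mu, forall y, cube N y -> pd j G y = h y}].
Proof.
exists F; split; [exact: F_lip|exact: F_line|move=> y|].
 have := @itv_integral_le _ (fun s => h (line y s)) 0 1 _ _ (@hline_cont y) (clip_ge (y ord0 j)).
 rewrite mulr0 subr0 mul1r => H; apply: le_trans (H _) _ => [s _|]; first by rewrite subr0.
 by have := clip_le (y ord0 j); lra.
apply: aeS (ae_sdiff_pd F_lip) => y /sdiff_row1 dy yN.
have c1 := @isdiff_partial _ _ _ _ _ _ j ord0 dy.
have dE : (\row_i pd i F y)^T j ord0 = pd j F y by rewrite !mxE.
rewrite dE in c1.
apply: (cvg_unique _ c1) => //.
have -> : (fun k => k.+1%:R * (row1 F (y + k.+1%:R^-1 *: delta_mx ord0 j) ord0 ord0 - row1 F y ord0 ord0)) =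
 (fun k => k.+1%:R * (F (y + k.+1%:R^-1 *: delta_mx ord0 j) - F y)).
 by apply/funext => k; rewrite !mxE.
exact: F_deriv.
Qed.

End antiderivative.

Section duality_antiderivative.

(** Test functions are written as derivatives by [exists_antiderivative]. The gain is that [F] is
    nonexpansive in direction [j]: moving component [j] of a map by [d] moves its composite with [F]
    by at most [d], whatever the Lipschitz constant of [F]. *)
Lemma L1_le_pd_dual (v : Rn -> R) (N M : R) (j : 'I_n) : intg v -> 0 <= N -> vanish N v ->
 (forall F L, 0 <= L -> lip L F -> (forall y s, `|F (y + s *: delta_mx ord0 j) - F y| <= `|s|) ->
   `|\int[mu]_x (v x * pd j F x)| <= M) -> \int[mu]_x `|v x| <= M.
Proof.
move=> iv N0 v0 H; apply: L1_le_lip_dual => // h L L0 hL h1.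
have [G [GL G1 _ Gd]] := exists_antiderivative j L0 hL h1 N0.
have C0 : 0 <= 2 * (N + 1) * L + 1 by rewrite !(addr_ge0, mulr_ge0).
have -> : \int[mu]_x (v x * h x) = \int[mu]_x (v x * pd j G x).
 apply: eq_Rint_ae.
 - exact: measurable_funM (intg_meas iv) (lip_meas hL).
 - exact: measurable_funM (intg_meas iv) (meas_pd j GL).
 - apply: aeS Gd => x Gx; have [xN|xN] := pselect (cube N x); first by rewrite Gx.
  by rewrite v0// !mul0r.
exact: le_trans (ler_norm _) (H _ _ C0 GL G1).
Qed.

End duality_antiderivative.

(** * Dependence of push-forwards on the map *)

Section pushforward_estimates.
Implicit Types (L : 'I_n -> R) (g : Rn -> Rn) (j : 'I_n).

Lemma L1_triangle (u v w : Rn -> R) : intg u -> intg v -> intg w ->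
 \int[mu]_x `|u x - w x| <= \int[mu]_x `|u x - v x| + \int[mu]_x `|v x - w x|.
Proof.
move=> iu iv iw; have i1 := intg_dist iu iv; have i2 := intg_dist iv iw.
rewrite -RintegralD//; apply: le_Rintegral => //.
- exact: intg_dist iu iw.
- exact: intg_add.
- by move=> x _; exact: ler_distD.
Qed.

Definition csupp w := exists2 N : R, 0 <= N & vanish N w.

(** The change of variables formula carries all the estimates and determines [v] almost everywhere;
    the fibre sum stays in [pushforward_spec]. *)
Definition ispush w f v := [/\ intg v, csupp v & forall h M, measT h -> normle h M ->
 \int[mu]_y (v y * h y) = \int[mu]_x (w x * h (f x) * detD f x)].

Lemma csupp_sub w v : csupp w -> csupp v -> csupp (fun x => w x - v x).
Proof.
move=> [N N0 w0] [K K0 v0]; exists (N + K); first exact: addr_ge0.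
move=> x xNK; rewrite w0 ?v0 ?subrr// => /cubeP xc; apply: xNK; apply/cubeP; rewrite ?addr_ge0//.
 by rewrite (le_trans (xc K0))// lerDr.
by rewrite (le_trans (xc N0))// lerDl.
Qed.

Lemma pushforward_spec_ispush w f N v L : 0 <= N -> lips L f -> pushforward_spec w f N v -> ispush w f v.
Proof.
move=> N0 fL [iv sv cv _]; have [K K0 fK] := lips_lip fL.
split => //; have cf : compact (f @` cube N).
 apply: continuous_compact; last exact: compact_cube.
 by apply: continuous_subspaceT; exact: lip_continuous fK.
have [N' N'0 sub] := compact_sub_cube cf.
by exists N' => // y yN; apply: sv => fy; apply: yN; exact: sub.
Qed.

Lemma ispush_exists w f L : lips L f -> intg w -> csupp w -> exists v, ispush w f v.
Proof.
move=> fL iw [N N0 w0]; have [K K0 fK] := lips_lip fL.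
by have [v sv] := pushforward_exists fK N0 iw w0; exists v; exact: pushforward_spec_ispush sv.
Qed.

Lemma ispush_integrable w f L h M : lips L f -> intg w -> measT h -> normle h M ->
 intg (fun x => w x * h (f x) * detD f x).
Proof.
move=> fL iw mh hM; have [D fD] := detD_bnd fL.
apply: (intg_mulb _ (lips_meas_detD fL) fD).
by apply: (intg_mulb iw _ (fun x => hM (f x))); exact: (measurableT_comp mh (lips_meas fL)).
Qed.

Lemma ispush_sub w1 w2 f v1 v2 L : lips L f -> intg w1 -> intg w2 -> ispush w1 f v1 -> ispush w2 f v2 ->
 ispush (fun x => w1 x - w2 x) f (fun y => v1 y - v2 y).
Proof.
move=> fL i1 i2 [iv1 s1 c1] [iv2 s2 c2]; split; [exact: intg_sub|exact: csupp_sub|].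
move=> h M mh hM.
have -> : \int[mu]_y ((v1 y - v2 y) * h y) = \int[mu]_y (v1 y * h y) - \int[mu]_y (v2 y * h y).
 rewrite -RintegralB//; try exact: intg_mulb mh hM.
 by apply: eq_Rint => y; rewrite mulrBl.
rewrite (c1 h M mh hM) (c2 h M mh hM) -RintegralB//; try exact: (ispush_integrable fL _ mh hM).
by apply: eq_Rint => x; rewrite !mulrBl.
Qed.

Lemma ispush_L1_le w f v L : lips L f -> allnneg L -> intg w -> ispush w f v ->
 \int[mu]_y `|v y| <= n`!%:R * \prod_j L j * \int[mu]_x `|w x|.
Proof.
move=> fL L0 iw [iv _ cv]; apply: L1_le_lip_dual => // h Lh Lh0 hL h1.
have mh := lip_meas hL; rewrite (cv h 1 mh h1).
have iwa := intg_abs iw.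
rewrite -RintegralZl// (le_trans (ler_norm _))//.
refine (proj2 (@Rintegral_abs_le_ae _ _ _ mu _ _ _ _ _ _)).
- exact: intg_meas (ispush_integrable fL iw mh h1).
- by move=> x; rewrite !mulr_ge0// prodr_ge0.
- apply: aeS (ae_detD_le L0 fL) => x Dx; rewrite !normrM mulrC ler_pM//.
 by rewrite ler_piMr.
- exact: intg_scale.
Qed.

Lemma updc_comp i F f : updc i F id \o f = updc i (F \o f) f.
Proof. by apply/funext => x; apply/rowP => k; rewrite !mxE. Qed.

Lemma lip_comp K F f C : lip K F -> 0 <= K -> nlip C f -> lip (K * C) (F \o f).
Proof. by move=> FK K0 fC x y; rewrite (le_trans (FK _ _))// -mulrA ler_wpM2l. Qed.

(** [pd i F] is the determinant of the identity with component [i] replaced by [F]; by the chain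
    rule its pull-back is the determinant of [f] with component [i] replaced by the composite of [F]
    and [f]. *)
Lemma ispush_pd w f v L K F i : lips L f -> intg w -> ispush w f v -> 0 <= K -> lip K F ->
 \int[mu]_y (v y * pd i F y) = \int[mu]_x (w x * detD (updc i (F \o f) f) x).
Proof.
move=> fL iw [iv _ cv] K0 FK.
have [C C0 fC] := lips_lip fL.
have gL := lips_updc i lips_id FK; have [K' K'0 gK] := lips_lip gL.
have [M gM] := detD_bnd gL; have mg := lips_meas_detD gL.
have -> : \int[mu]_y (v y * pd i F y) = \int[mu]_y (v y * detD (updc i F id) y).
 apply: eq_Rint_ae.
 - exact: measurable_funM (intg_meas iv) (meas_pd i FK).
 - exact: measurable_funM (intg_meas iv) mg.
 - by apply: aeS (ae_detD_updc_id i FK) => y ->.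
apply: etrans (cv _ _ mg gM) _; apply: eq_Rint_ae.
- exact: intg_meas (ispush_integrable fL iw mg gM).
- apply: measurable_funM; first exact: intg_meas iw.
 exact: lips_meas_detD (lips_updc i fL (lip_comp FK K0 fC)).
- by apply: aeS (ae_detD_comp fC gK) => x; rewrite updc_comp => ->; rewrite mulrA.
Qed.

Lemma lip_sub K K' F G : lip K F -> lip K' G -> lip (K + K') (fun x => F x - G x).
Proof.
move=> FK GK x y; rewrite (_ : _ - _ = (F x - F y) - (G x - G y)); last by ring.
by rewrite (le_trans (ler_normB _ _))// mulrDl lerD.
Qed.

Lemma detD_updc_sub L f K K' F G i : lips L f -> lip K F -> lip K' G ->
 {ae mu, forall x, detD (updc i (fun y => F y - G y) f) x = detD (updc i F f) x - detD (updc i G f) x}.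
Proof.
move=> fL FK GK; have e1 := ae_detD_updc i fL FK; have e2 := ae_detD_updc i fL GK.
have e3 := ae_detD_updc i fL (lip_sub FK GK).
apply: aeS2 (aeI e1 e2) (aeI e3 (aeI (ae_sdiff_pd FK) (ae_sdiff_pd GK))).
move=> x [E1 E2] [E3 [s1 s2]]; rewrite E1 E2 E3 -sumrB; apply: eq_bigr => l _.
have E := pd_sub l s1 s2; rewrite E.
move: (cofactor _ _ _) (pd l F x) (pd l G x) => c1 c2 c3; ring.
Qed.

Lemma prod_updc L K j : \prod_(k < n | k != j) (if k == j then K else L k) = pbut j L.
Proof. by apply: eq_bigr => k /negPf ->. Qed.

Section coordinatewise.
Variables (w : Rn -> R) (b : 'I_n -> R).
Hypotheses (iw : intg w) (sw : csupp w) (wb : CV 0 b w) (b0 : forall i, 0 <= b i).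

(** [CV0_detD] with the sup bound placed on component [i], which is now the composite of [F] and
    [f]. *)
Lemma ispush_CV0 f v L : lips L f -> allnneg L -> ispush w f v ->
 CV 0 (fun i => n`!%:R * (\sum_i b i) * \prod_(k < n | k != i) L k) v.
Proof.
move=> fL L0 pv i F S' K S0 K0 FK FS; have [N N0 w0] := sw; have [C C0 fC] := lips_lip fL.
rewrite (ispush_pd i fL iw pv K0 FK) powRr0 subr0 powRr1// mulr1.
have gL := lips_updc i fL (lip_comp FK K0 fC).
have gL0 k : 0 <= (if k == i then K * C else L k) by case: ifP => _ //; exact: mulr_ge0.
have gS x : `|updc i (F \o f) f x ord0 i| <= S' by rewrite mxE eqxx; exact: FS.
rewrite (le_trans (CV0_detD iw N0 w0 wb b0 gL gL0 gS))// prod_updc.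
by rewrite -[leRHS]mulrA [S' * _]mulrC.
Qed.

(** By [L1_le_pd_dual] the test functions are nonexpansive in direction [j], so the two determinants
    differ by one whose component [j] is at most [d], and [CV0_detD] applies to it. *)
Lemma ispush_updc_dist f G K L j d v v' : lips L f -> allnneg L -> lip K G ->
 (forall x, `|G x - f x ord0 j| <= d) -> ispush w f v -> ispush w (updc j G f) v' ->
 \int[mu]_y `|v' y - v y| <= n`!%:R * (\sum_i b i) * (d * pbut j L).
Proof.
move=> fL L0 GK Gd pv pv'; have [N N0 w0] := sw; have [C C0 fC] := lips_lip fL.
have gL := lips_updc j fL GK; have [C' C'0 gC] := lips_lip gL.
have [iv sv _] := pv; have [iv' sv' _] := pv'.
have [N' N'0 s0] := csupp_sub sv' sv.
apply: (L1_le_pd_dual (j := j) (intg_sub iv' iv) N'0 s0) => F Lf Lf0 FL Fj.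
have [P FP] := pd_bounded j FL; have mP := meas_pd j FL.
have -> : \int[mu]_x ((v' x - v x) * pd j F x) = \int[mu]_x (v' x * pd j F x) - \int[mu]_x (v x * pd j F x).
 rewrite -RintegralB//; try exact: intg_mulb mP FP.
 by apply: eq_Rint => y; rewrite mulrBl.
rewrite (ispush_pd j fL iw pv Lf0 FL) (ispush_pd j gL iw pv' Lf0 FL) updcK.
have l1 := lip_comp FL Lf0 fC; have l2 := lip_comp FL Lf0 gC.
have h1 := lips_updc j fL l1; have h2 := lips_updc j fL l2; have h3 := lips_updc j fL (lip_sub l2 l1).
have [M1 d1] := detD_bnd h1; have [M2 d2] := detD_bnd h2.
rewrite -RintegralB//; last 2 first.
- exact: intg_mulb iw (lips_meas_detD h2) d2.
- exact: intg_mulb iw (lips_meas_detD h1) d1.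
have -> : \int[mu]_x (w x * detD (updc j (F \o updc j G f) f) x - w x * detD (updc j (F \o f) f) x) =
  \int[mu]_x (w x * detD (updc j (fun y => (F \o updc j G f) y - (F \o f) y) f) x).
 apply: eq_Rint_ae.
 - apply: measurable_funB; apply: measurable_funM; try exact: intg_meas iw.
   exact: lips_meas_detD h2.
  exact: lips_meas_detD h1.
 - exact: measurable_funM (intg_meas iw) (lips_meas_detD h3).
 - by apply: aeS (detD_updc_sub j fL l2 l1) => x ->; rewrite mulrBr.
set E := Lf * C' + Lf * C in h3.
have E0 k : 0 <= (if k == j then E else L k).
 by case: ifP => _ //; rewrite addr_ge0// mulr_ge0.
apply: le_trans (CV0_detD (j := j) (S' := d) iw N0 w0 wb b0 h3 E0 _) _; last by rewrite prod_updc.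
move=> x; rewrite mxE eqxx/=.
have -> : updc j G f x = f x + (G x - f x ord0 j) *: delta_mx ord0 j.
 apply/rowP => k; rewrite !mxE; case: eqP => [->|_]; rewrite ?eqxx/= ?andbF; ring.
exact: le_trans (Fj _ _) (Gd x).
Qed.

(** The maps [p q] take the first [q] components from [g] and the others from [f], so consecutive
    ones differ in a single component. *)
Lemma ispush_dist f g L d v v' : lips L f -> lips L g -> allnneg L ->
 (forall j x, `|g x ord0 j - f x ord0 j| <= d j) -> ispush w f v -> ispush w g v' ->
 \int[mu]_y `|v' y - v y| <= n`!%:R * (\sum_i b i) * \sum_j d j * pbut j L.
Proof.
move=> fL gL L0 fg pv pv'.
pose p (q : nat) x : Rn := \row_l (if (l < q)%N then g x ord0 l else f x ord0 l).
have pL q : lips L (p q).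
 move=> l x y; rewrite !mxE; case: ifP => _; [exact: gL|exact: fL].
have pS (q : 'I_n) : p q.+1 = updc q (fun x => g x ord0 q) (p q).
 apply/funext => x; apply/rowP => l; rewrite !mxE ltnS leq_eqVlt.
 case: (eqVneq l q) => [->|lq]; first by rewrite eqxx.
 by rewrite (negPf (_ : val l != val q)).
have ex q := ispush_exists (pL q) iw sw.
pose V q := projT1 (cid (ex q)); have VP q : ispush w (p q) (V q) := projT2 (cid (ex q)).
have p0 : p 0%N = f by apply/funext => x; apply/rowP => l; rewrite !mxE ltn0.
have pn : p n = g by apply/funext => x; apply/rowP => l; rewrite !mxE ltn_ord.
have H q : (q <= n)%N -> forall v1, ispush w (p q) v1 -> \int[mu]_y `|v1 y - v y| <=
  n`!%:R * (\sum_i b i) * \sum_(j < n | (j < q)%N) d j * pbut j L.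
 elim: q => [_|q IHq qn] v1 p1.
  rewrite p0 in p1; rewrite [X in _ * X]big_pred0 ?mulr0//.
  have := ispush_L1_le fL L0 (intg_sub iw iw) (ispush_sub fL iw iw p1 pv).
  have -> : \int[mu]_x `|w x - w x| = 0; last by rewrite mulr0.
  rewrite [LHS](@eq_Rint _ _ _ _ _ (fun=> 0)) ?/Rintegral ?integral0// => x.
  by rewrite subrr normr0.
 pose qo := Ordinal qn.
 have p1' : ispush w (updc qo (fun x => g x ord0 qo) (p q)) v1 by rewrite -(pS qo).
 have gd x : `|g x ord0 qo - p q x ord0 qo| <= d qo by rewrite mxE ltnn.
 have D1 := ispush_updc_dist (pL q) L0 (gL qo) gd (VP q) p1'.
 have D2 := IHq (ltnW qn) (V q) (VP q).
 have iV : intg (V q) by case: (VP q).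
 have iv1 : intg v1 by case: p1.
 have iv : intg v by case: pv.
 apply: le_trans (L1_triangle iv1 iV iv) _; apply: le_trans (lerD D1 D2) _.
 rewrite -mulrDr ler_wpM2l ?mulr_ge0 ?sumr_ge0// [leRHS](bigD1 qo)/=; last exact: ltnSn.
 rewrite lerD2l; apply: eq_ler; apply: eq_bigl => j.
 by rewrite ltn_neqAle andbC ltnS -(inj_eq val_inj).
have E : \sum_(j < n | (j < n)%N) d j * pbut j L = \sum_j d j * pbut j L.
 by apply: eq_bigl => j; exact: ltn_ord.
by rewrite -E; apply: (H _ (leqnn n)); rewrite pn.
Qed.

End coordinatewise.
End pushforward_estimates.

(** * Interpolation between mass and variation *)

Section dual_bounds.
Implicit Types (j : 'I_n).

Lemma half_powR_lt1 (x : R) : 0 < x -> 0 <= 2^-1 `^ x < 1.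
Proof.
move=> x0; rewrite powR_ge0/= [X in _ < X](_ : 1 = 1 `^ x); last by rewrite powR1.
by apply: gt0_ltr_powR; rewrite ?nnegrE ?invr_ge0// invf_lt1// ltr1n.
Qed.

Lemma exp_powR (x y : R) (k : nat) : 0 <= x -> (x ^+ k) `^ y = (x `^ y) ^+ k.
Proof. by move=> x0; rewrite -powR_mulrn// -powRrM mulrC powRrM powR_mulrn// powR_ge0. Qed.

Let hm0 := @hat_mass_gt0 R m.

Let prod2 t : \prod_l (2 * t l) = 2 ^+ n * \prod_l t l.
Proof. by rewrite big_split/= prodr_const card_ord. Qed.

Let four : 4 ^+ n = 2 ^+ n * 2 ^+ n :> R.
Proof. by rewrite -exprMn; congr (_ ^+ _); ring. Qed.

Let two_le_cn (x : R) : 0 <= x -> 8 * n%:R * 2 ^+ n / @hat_mass R m * x <= cn * x.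
Proof.
move=> x0; rewrite ler_wpM2r// /ramp_const ler_wpM2r ?invr_ge0 ?(ltW hm0)//.
have p1 : 1 <= 2 ^+ n :> R by rewrite exprn_ege1// ler1n.
rewrite ler_pM ?mulr_ge0 ?exprn_ge0//; first by rewrite ler_wpM2r// ler_nat.
by rewrite four ler_peMl// (le_trans ler01).
Qed.

Lemma rho_conv_le t s A h x : allpos t -> 0 <= s <= 1 -> test s A h ->
 `|conv (rho t) h x| <= cn * ((\prod_l t l) `^ (- s) * A).
Proof.
move=> t0 /andP[s0 s1] [A0 mh [B hB] hs].
have tT l : (t l)^-1 <= \sum_l (t l)^-1.
 by rewrite [leRHS](bigD1 l)//= lerDl sumr_ge0// => k _; rewrite invr_ge0 ltW.
have P0 : 0 < \prod_l t l by exact: prodr_gt0.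
have M0 : 0 <= (@hat_mass R m * \prod_l t l)^-1 by rewrite invr_ge0 mulr_ge0 ?ltW.
rewrite (le_trans (conv_le_box (rho_ker t0 tT) x mh hB))//.
rewrite (le_trans (ler_wpM2l M0 (hs x t t0)))//.
have e1 : (\prod_l (2 * t l)) `^ (1 - s) <= 2 ^+ n * (\prod_l t l * (\prod_l t l) `^ (- s)).
 rewrite prod2 powRM ?exprn_ge0 ?(ltW P0)// [X in _ * X]powRD; last by rewrite (gt_eqF P0) implybT.
 rewrite powRr1 ?(ltW P0)// ler_wpM2r ?mulr_ge0 ?powR_ge0 ?(ltW P0)//.
 by apply: ler1_powR; [rewrite exprn_ege1// ler1n|rewrite lerBlDr lerDl].
rewrite (le_trans (ler_wpM2l M0 (ler_wpM2l A0 e1)))//.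
have X0 : 0 <= (\prod_l t l) `^ (- s) * A by rewrite mulr_ge0// powR_ge0.
apply: le_trans (two_le_cn X0).
have -> : (@hat_mass R m * \prod_l t l)^-1 * (A * (2 ^+ n * (\prod_l t l * (\prod_l t l) `^ (- s)))) =
  2 ^+ n / @hat_mass R m * ((\prod_l t l) `^ (- s) * A) by field; rewrite !gt_eqF.
rewrite ler_wpM2r// ler_wpM2r ?invr_ge0 ?(ltW hm0)// ler_peMl ?exprn_ge0//.
by have : 1 <= n%:R :> R; [rewrite ler1n|lra].
Qed.

Lemma rho_conv_lip t T A h : allpos t -> (forall l, (t l)^-1 <= T) ->
 measT h -> normle h A -> lip (cn * (T * A)) (conv (rho t) h).
Proof.
move=> t0 tT mh hA; have A0 : 0 <= A by rewrite (le_trans _ (hA 0)).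
have T0 : 0 <= T by rewrite (le_trans _ (tT ord0))// invr_ge0 ltW.
have P0 : 0 < \prod_l t l by exact: prodr_gt0.
apply: lip_le (conv_lip_bounded (rho_ker t0 tT) mh hA).
have -> : fine (mu (tbox t)) = \prod_l (2 * t l) := congr1 fine (measure_tbox t0).
apply: le_trans (two_le_cn (mulr_ge0 T0 A0)); rewrite prod2.
by apply: eq_ler; field; rewrite !gt_eqF.
Qed.

(** For [s = 1 - 1/p] this bounds the [L^p] norm of [w] by [M]. Through [test] a test function is
    measured by its masses on boxes, all that the kernels see of it. *)
Definition dual (s M : R) w := forall h A, test s A h -> `|\int[mu]_x (w x * h x)| <= M * A.

(** A function of mass [a] whose variation in direction [i] is [a / t i] obeys the bound of a mass
    [a] spread over a box of sides [t]. Below that scale, each halving gains a factor 2 from the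
    ramp kernels and loses [2^(n s)] because the boxes shrink, so the sum converges when
    [n s < 1]. *)
Lemma dual_CV0 (s : R) : 0 <= s -> n%:R * s < 1 -> exists2 C : R, 0 <= C &
 forall w a t, intg w -> csupp w -> 0 <= a -> allpos t -> CV 0 (fun i => a / t i) w ->
  \int[mu]_x `|w x| <= a -> dual s (C * (a * (\prod_l t l) `^ (- s))) w.
Proof.
move=> s0 ns1; pose q : R := 2^-1 `^ (1 - n%:R * s).
have /andP[q0 q1] : 0 <= q < 1 by apply: half_powR_lt1; rewrite subr_gt0.
have c0 := ramp_const0.
have s1 : s <= 1.
 by rewrite (le_trans _ (ltW ns1))// ler_peMl// ler1n.
have q2 : 0 <= (1 - q)^-1 by rewrite invr_ge0 subr_ge0 ltW.
exists (cn + n%:R * cn / (1 - q)); first exact: addr_ge0 c0 (mulr_ge0 (mulr_ge0 (ler0n _ _) c0) q2).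
move=> w a t iw [N N0 w0] a0 t0 wb wa h A th; have [A0 mh [B hB] _] := th.
have B0 : 0 <= B by rewrite (le_trans _ (hB 0)).
have s01 : 0 <= s <= 1 by rewrite s0.
have b0 i : 0 <= a / t i by rewrite divr_ge0// ltW.
pose T := \sum_l (t l)^-1.
have tT l : (t l)^-1 <= T.
 by rewrite /T [leRHS](bigD1 l)//= lerDl sumr_ge0// => k _; rewrite invr_ge0 ltW.
pose P := \prod_l t l; have P0 : 0 < P by exact: prodr_gt0.
pose tk k l := t l / 2 ^+ k.
have tk0 k l : 0 < tk k l by rewrite divr_gt0 ?exprn_gt0.
pose x k := \int[mu]_x (w x * conv (rho (tk k)) h x).
have mc k : measT (conv (rho (tk k)) h).
 have [M' [L' k']] := rho_ker_exists (tk0 k); exact: lip_meas (conv_lip_bounded k' mh hB).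
have bc k y : `|conv (rho (tk k)) h y| <= B.
 have [M' [L' k']] := rho_ker_exists (tk0 k).
 by apply: (conv_rho_le y k' _ (integral_rho (tk0 k)) mh hB) => z; exact: rho_ge0.
have xl : x k @[k --> \oo] --> \int[mu]_x (w x * h x).
 have [/= al1 al2] : (0 <= (0 : R)) /\ (0 : R) < 1 by [].
 have al : 0 <= (0 : R) < 1 by rewrite al1.
 have C1 k := moll_L1_close k iw N0 w0 al wb b0 t0 tT.
 rewrite subr0 in C1; move: C1; set D := \sum_i _; set q' := _ `^ _ => C1.
 have /andP[q'0 q'1] : 0 <= q' < 1 by exact: half_powR_lt1.
 have H k : `|\int[mu]_x (w x * h x) - x k| <= B * (D * q' ^+ k / (1 - q')).
  have [Lk [_ _ ik]] := moll_integrable (tk0 k) N0 iw w0.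
  have iwk := intg_sub iw ik.
  rewrite /x (conv_rho_fubini (tk0 k) iw mh hB) (Rint_subM iw ik mh hB).
  exact: le_trans (L1_dual_bnd iwk mh hB) (ler_wpM2l B0 (C1 k)).
 apply: (@cvg_geometric_bound _ _ _ (B * D / (1 - q')) q') => [|k]; first by rewrite q'0.
 by apply: le_trans (H k) _; apply: eq_ler; ring.
pose D := n%:R * (cn * (a * P `^ (- s) * A)).
have X0 : 0 <= cn * (a * P `^ (- s) * A) by exact: mulr_ge0 c0 (mulr_ge0 (mulr_ge0 a0 (powR_ge0 _ _)) A0).
have D0 : 0 <= D by exact: mulr_ge0.
have xd k : `|x k.+1 - x k| <= D * q ^+ k.
 have tkT l : (tk k l)^-1 <= T * 2 ^+ k by rewrite /tk invf_div mulrC ler_wpM2r ?exprn_ge0.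
 have -> : x k.+1 = \int[mu]_x (w x * conv (rho (fun l => tk k l / 2)) h x).
  by rewrite /x (_ : tk k.+1 = fun l => tk k l / 2)//; apply/funext => l; rewrite /tk exprSr invfM mulrA.
 rewrite (le_trans (rho_tel iw wb b0 s01 th hB (tk0 k) tkT))//.
 have E : (\prod_l tk k l) `^ (- s) * 2^-1 ^+ k = P `^ (- s) * q ^+ k.
  have -> : \prod_l tk k l = P * (2^-1 ^+ n) ^+ k.
   rewrite /tk big_split/= prodr_const card_ord; congr (_ * _).
   by rewrite -exprVn -!exprM mulnC.
  rewrite powRM ?exprn_ge0 ?invr_ge0 ?(ltW P0)// -mulrA; congr (_ * _).
  rewrite exp_powR ?exprn_ge0 ?invr_ge0// -exprMn; congr (_ ^+ _).
  rewrite exp_powR ?invr_ge0// -powR_mulrn ?powR_ge0// -powRrM -[X in _ * X]powRr1 ?invr_ge0//.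
  rewrite -powRD; last by rewrite invr_eq0 pnatr_eq0 implybT.
  by congr (_ `^ _); ring.
 rewrite [leLHS](eq_bigr (fun=> cn * (a * P `^ (- s) * A) * q ^+ k)); last first.
  move=> i _; rewrite subr0 powRr0 mulr1 powRr1; last first.
   by apply: mulr_ge0 => //; apply: mulr_ge0; [apply: mulr_ge0 => //; exact: ltW|exact: powR_ge0].
  move: (cn) => c.
  have -> : a / t i * (c * tk k i * (\prod_l tk k l) `^ (- s) * A) =
    c * (a * A) * ((\prod_l tk k l) `^ (- s) * 2^-1 ^+ k).
   by rewrite {1}/tk -exprVn; field; rewrite gt_eqF.
  by rewrite E; ring.
 rewrite sumr_const card_ord -mulr_natl /D.
 by apply: eq_ler; ring.
have q01 : 0 <= q < 1 by rewrite q0.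
have G := geometric_tail 0 q01 D0 xd xl; rewrite expr0 mulr1 in G.
have G0 : `|x 0%N| <= cn * (a * P `^ (- s) * A).
 have tE : tk 0%N = t by apply/funext => l; rewrite /tk expr0 divr1.
 have -> : cn * (a * P `^ (- s) * A) = a * (cn * (P `^ (- s) * A)) by ring.
 have p0 : 0 <= cn * (P `^ (- s) * A) by exact: mulr_ge0 c0 (mulr_ge0 (powR_ge0 _ _) A0).
 rewrite (le_trans _ (ler_wpM2r p0 wa))// -RintegralZr//; last exact: intg_abs.
 apply: Rint_abs_le.
 - exact: measurable_funM (intg_meas iw) (mc _).
 - by move=> y; rewrite normrM ler_wpM2l// tE; exact: rho_conv_le.
 - by apply: intg_mulC; apply: intg_scale; exact: intg_abs.
rewrite -[\int[mu]_x _](subrK (x 0%N)) (le_trans (ler_normD _ _))// (le_trans (lerD G G0))//.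
by rewrite /D; apply: eq_ler; field; rewrite subr_eq0 gt_eqF.
Qed.

End dual_bounds.

(** * Smooth approximation controlled by the variation *)

Section smooth_decomposition.
Implicit Types (j : 'I_n).

(** A mollified test function keeps the sup bound [S'] and has Lipschitz constant at most
    [cn / s * S'], so variation of order [alpha] controls that of order 0 at the cost of a negative
    power of [s]. *)
Lemma moll_CV alpha B w (s : R) : 0 < s -> intg w -> 0 <= alpha < 1 -> CV alpha (fun=> B) w -> 0 <= B ->
 CV 0 (fun=> B * (cn / s) `^ alpha) (conv (rho (fun=> s)) w).
Proof.
move=> s0 iw /andP[al0 al1] wB B0 i F S' L S0 L0 FL FS.
have c0 := ramp_const0.
have t0 (l : 'I_n) : 0 < (fun=> s) l by [].
have tT (l : 'I_n) : ((fun=> s) l)^-1 <= s^-1 by [].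
have [M [K k]] := rho_ker_exists t0; have mF := lip_meas FL.
have cl := rho_conv_lip t0 tT mF FS.
rewrite (moll_pd i t0 iw L0 FL FS) powRr0 subr0 powRr1// mulr1.
have is0 : 0 <= s^-1 by rewrite invr_ge0 ltW.
have K0 : 0 <= cn * (s^-1 * S') by exact: mulr_ge0 c0 (mulr_ge0 is0 S0).
have rS x : `|conv (rho (fun=> s)) F x| <= S'.
 by apply: (conv_rho_le x k _ (integral_rho t0) mF FS) => z; exact: rho_ge0.
apply: le_trans (wB i _ _ _ S0 K0 cl rS) _; rewrite -mulrA ler_wpM2l//.
move: (cn) c0 K0 {cl} => c c0 K0; rewrite mulrA powRM ?divr_ge0 ?(ltW s0)//.
rewrite mulrCA -powRD ?subrK ?powRr1//; apply/implyP; by rewrite oner_eq0.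
Qed.

Lemma L1_le_add u w : intg u -> intg w -> \int[mu]_x `|u x| <= \int[mu]_x `|w x| + \int[mu]_x `|u x - w x|.
Proof.
move=> iu iw; have i1 := intg_abs iw; have i2 := intg_dist iu iw.
rewrite -RintegralD//; apply: le_Rintegral => //; [exact: intg_abs|exact: intg_add|move=> x _].
by rewrite -{1}(subrK (w x) (u x)) addrC ler_normD.
Qed.

(** The difficulty is to bound the mass of the coarsest term [U 0] by [B] alone. At a large scale
    [s] the mollified test functions are almost constant on the cube, so [U 0] sees mostly the total
    integral of [u], which the variation bounds; the rest is absorbed. *)
Lemma smooth_decomposition (alpha N : R) : 0 <= alpha < 1 -> 0 <= N -> exists2 C : R, 0 <= C &
 exists2 K : R, 0 <= K & forall u B, intg u -> vanish N u -> 0 <= B ->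
  CV alpha (fun=> B) u ->
 exists U : nat -> Rn -> R, \int[mu]_x `|U 0%N x| <= C * B /\ forall k,
  [/\ intg (U k), vanish K (U k),
    \int[mu]_x `|u x - U k x| <= C * B * (2^-1 `^ (1 - alpha)) ^+ k &
    CV 0 (fun=> C * B * (2 `^ alpha) ^+ k) (U k)].
Proof.
move=> al01 N0; have /andP[al0 al1] := al01.
have c0 := ramp_const0.
pose q : R := 2^-1 `^ (1 - alpha).
have /andP[q0 q1] : 0 <= q < 1 by apply: half_powR_lt1; rewrite subr_gt0.
(* Large enough for [cn / s * N <= 1 / 2]: on the cube, a mollified test function then deviates from
   its value at 0 by at most [1 / 2]. *)
pose s : R := 2 * (cn * N) + 1.
have cN0 : 0 <= cn * N by exact: mulr_ge0.
have s0 : 0 < s by rewrite ltr_wpDl// mulr_ge0.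
pose D : R := n%:R * ((cn * s) `^ (1 - alpha) * (cn * (s * s^-1)) `^ alpha) / (1 - q).
have D0 : 0 <= D by rewrite !mulr_ge0 ?powR_ge0// invr_ge0 subr_ge0 ltW.
pose E : R := (2 * (N + 1)) `^ (1 - alpha).
have E0 : 0 <= E by exact: powR_ge0.
pose C : R := D + (cn / s) `^ alpha + (2 * E + D).
have is0 : 0 <= s^-1 by rewrite invr_ge0 ltW.
have cs0 : 0 <= cn / s by exact: mulr_ge0.
have P0 : 0 <= (cn / s) `^ alpha by exact: powR_ge0.
have C0 : 0 <= C by rewrite /C; lra.
exists C => //; exists (N + s); first by rewrite addr_ge0// ltW.
move=> u B iu u0 B0 uB.
pose t (l : 'I_n) := s; have t0 l : 0 < t l by [].
have tT l : (t l)^-1 <= s^-1 by [].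
pose U k := conv (rho (fun l => t l / 2 ^+ k)) u.
have tk0 k l : 0 < t l / 2 ^+ k by rewrite divr_gt0 ?exprn_gt0.
have uU k : \int[mu]_x `|u x - U k x| <= D * B * q ^+ k.
 rewrite (le_trans (moll_L1_close k iu N0 u0 al01 uB (fun=> B0) t0 tT))// -/q.
 rewrite /t /= sumr_const card_ord -[X in X * _ / _]mulr_natl /D.
 by apply: eq_ler; ring.
have iU k : intg (U k) by have [L [_ _]] := moll_integrable (tk0 k) N0 iu u0.
exists U; split; last first.
 move=> k; split => //.
 - move=> x; have [M [L kk]] := rho_ker_exists (tk0 k).
  apply: (conv_supp kk _ _ u0); last by rewrite addr_ge0// ltW.
  by move=> l; rewrite ler_pdivrMr ?exprn_gt0// ler_peMr ?(ltW s0)// exprn_ege1// ler1n.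
 - rewrite (le_trans (uU k))// ler_wpM2r ?exprn_ge0// ler_wpM2r//.
  by rewrite /C; lra.
 - have sk0 : 0 < s / 2 ^+ k by rewrite divr_gt0 ?exprn_gt0.
  have H := moll_CV sk0 iu al01 uB B0.
  move=> i F S' L S0 L0 FL FS; apply: le_trans (H i F S' L S0 L0 FL FS) _.
  rewrite ler_wpM2r ?mulr_ge0 ?powR_ge0//.
  have -> : cn / (s / 2 ^+ k) = cn / s * 2 ^+ k by move: (cn) => c; field; rewrite expf_neq0 ?gt_eqF.
  rewrite powRM ?exprn_ge0// exp_powR// mulrA ler_wpM2r ?exprn_ge0 ?powR_ge0// mulrC ler_wpM2r//.
  by rewrite /C; lra.
have U0E : U 0%N = conv (rho t) u.
 by rewrite /U; congr (conv (rho _) _); apply/funext => l; rewrite expr0 divr1.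
(* On the cube the constant 1 is [pd ord0 G] for a bounded Lipschitz [G], so the variation bounds
   the integral of [u]. *)
have int_u : `|\int[mu]_x u x| <= B * E.
 have z1 x : `|(fun=> 1 : R) (x : Rn)| <= 1 by rewrite normr1.
 have zl : lip 0 (fun x : Rn => 1 : R) by move=> x y; rewrite subrr normr0 mul0r.
 have [G [GL _ GB Gd]] := exists_antiderivative ord0 (lexx 0) zl z1 N0.
 rewrite mulr0 add0r in GL.
 have -> : \int[mu]_x u x = \int[mu]_x (u x * pd ord0 G x).
  apply: eq_Rint_ae; first exact: intg_meas iu.
   exact: measurable_funM (intg_meas iu) (meas_pd _ GL).
  apply: aeS Gd => x Gx; have [xN|xN] := pselect (cube N x); first by rewrite Gx// mulr1.
  by rewrite u0// !mul0r.
 have NN : 0 <= 2 * (N + 1) by rewrite mulr_ge0// addr_ge0.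
 by have := uB ord0 G _ 1 NN ler01 GL GB; rewrite powR1 mulr1.
have H1 : \int[mu]_x `|U 0%N x| <= B * E + 2^-1 * \int[mu]_x `|u x|.
 apply: L1_le_lip_dual => // h L L0 hL h1; have mh := lip_meas hL.
 rewrite U0E -(conv_rho_fubini t0 iu mh h1).
 have [M [K kk]] := rho_ker_exists t0.
 have cl := rho_conv_lip t0 tT mh h1; rewrite mulr1 in cl.
 have c1 x : `|conv (rho t) h x| <= 1.
  by apply: (conv_rho_le x kk _ (integral_rho t0) mh h1) => z; exact: rho_ge0.
 have mc := lip_meas cl.
 have ic : intg (fun x => u x * conv (rho t) h x) by exact: intg_mulb iu mc c1.
 have -> : \int[mu]_x (u x * conv (rho t) h x) = conv (rho t) h 0 * \int[mu]_x u x +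
   \int[mu]_x (u x * (conv (rho t) h x - conv (rho t) h 0)).
  rewrite -RintegralZl// -RintegralD//; [|exact: intg_scale|]; last first.
   apply: (intg_mulb (M := 2)) => //; first exact: measurable_funB.
   by move=> x; rewrite (le_trans (ler_normB _ _))// (le_trans (lerD (c1 x) (c1 0)))//.
  by apply: eq_Rint => x; ring.
 apply: lerD.
  by rewrite (le_trans (ler_norm _))// normrM (le_trans _ int_u)// ler_piMl.
 rewrite -RintegralZl//; last exact: intg_abs.
 rewrite (le_trans (ler_norm _))//; apply: Rint_abs_le.
 - by apply: measurable_funM; [exact: intg_meas iu|exact: measurable_funB].
 - move=> x; have [xN|xN] := pselect (cube N x); last by rewrite u0// mul0r normr0 mulr0.
  rewrite normrM mulrC ler_wpM2r// (le_trans (cl x 0))// subr0.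
  have xn : `|x| <= N by exact/(cubeP x N0).
  rewrite (le_trans (ler_wpM2l cs0 xn))// mulrAC ler_pdivrMr// /s; lra.
 - by apply: intg_scale; exact: intg_abs.
(* The mass of [u] enters [H1] with coefficient [1 / 2], so the two inequalities together bound the
   mass of [U 0]. *)
have H2 : \int[mu]_x `|u x| <= \int[mu]_x `|U 0%N x| + D * B.
 by rewrite (le_trans (L1_le_add iu (iU 0%N)))// lerD2l (le_trans (uU 0%N))// expr0 mulr1.
have H3 : \int[mu]_x `|U 0%N x| <= (2 * E + D) * B by lra.
by rewrite (le_trans H3)// ler_wpM2r// /C; lra.
Qed.

End smooth_decomposition.

(** * Lipschitz approximation of Hölder maps *)

Section holder_maps.
Variables (al H : 'I_n -> R).
Hypotheses (al01 : forall j, 0 < al j <= 1) (H0 : forall j, 0 < H j).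
Implicit Types (g : Rn -> Rn) (e : R) (j : 'I_n).

Definition hol f := forall j x y, `|f x ord0 j - f y ord0 j| <= H j * `|x - y| `^ al j.

(** All components are regularized at the same scale [e] of the domain: component [j] gets the
    Lipschitz constant [H j * e^(al j - 1)] and moves by at most [H j * e^(al j)], the balance given
    by [holder_interp]. *)
Definition apx e f (x : Rn) : Rn := \row_j infconv (H j * e `^ (al j - 1)) (fun y => f y ord0 j) x.

Let hol_almost e f j : 0 < e -> hol f -> almost_lip (H j * e `^ (al j - 1)) (H j * e `^ al j) (fun y => f y ord0 j).
Proof.
move=> e0 fH x y; have := fH j x y; rewrite ler_distl => /andP[_ /le_trans]; apply.
rewrite -[leRHS]addrA lerD2l -mulrA -mulrDr ler_wpM2l ?(ltW (H0 j))//.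
by apply: holder_interp => //; case/andP: (al01 j) => /ltW -> ->.
Qed.

Lemma apx_lips e f : 0 < e -> hol f -> lips (fun j => H j * e `^ (al j - 1)) (apx e f).
Proof.
move=> e0 fH j x y; rewrite !mxE; apply: infconv_lip (hol_almost j e0 fH) _ _.
by rewrite mulr_ge0 ?powR_ge0// ltW.
Qed.

Lemma apx_hol e f : 0 < e -> hol f -> hol (apx e f).
Proof.
move=> e0 fH j x y; rewrite !mxE.
exact: (infconv_modulus (hol_almost j e0 fH) (w := fun r => H j * r `^ al j)).
Qed.

Lemma apx_lips_le e f L : 0 < e -> hol f -> lips L f -> lips L (apx e f).
Proof.
move=> e0 fH fL j x y; rewrite !mxE.
by apply: (infconv_modulus (hol_almost j e0 fH) (w := fun r => L j * r)) => x' y'; exact: fL.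
Qed.

Lemma apx_close e f j x : 0 < e -> hol f -> `|apx e f x ord0 j - f x ord0 j| <= H j * e `^ al j.
Proof.
move=> e0 fH; rewrite mxE; have A := hol_almost j e0 fH.
have := infconv_le x A; have := infconv_ge x A.
have := mulr_ge0 (ltW (H0 j)) (powR_ge0 e (al j)).
by rewrite ler_norml => *; apply/andP; split; lra.
Qed.

Lemma apx_dist e f g d j x : 0 < e -> hol f -> hol g -> (forall x, `|f x ord0 j - g x ord0 j| <= d) ->
 `|apx e f x ord0 j - apx e g x ord0 j| <= d.
Proof.
by move=> e0 fH gH fg; rewrite !mxE; apply: infconv_close (hol_almost j e0 fH) (hol_almost j e0 gH) fg x.
Qed.

End holder_maps.

Section CV_algebra.

Lemma CV_le (x : R) b b' w : (forall i, b i <= b' i) -> CV x b w -> CV x b' w.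
Proof.
move=> bb wb i F S' L S0 L0 FL FS; apply: le_trans (wb i F S' L S0 L0 FL FS) _.
by rewrite ler_wpM2r// mulr_ge0 ?powR_ge0.
Qed.

Lemma CV_sub (x : R) b b' w v : intg w -> intg v -> CV x b w -> CV x b' v ->
 CV x (fun i => b i + b' i) (fun y => w y - v y).
Proof.
move=> iw iv wb vb i F S' L S0 L0 FL FS; have [P FP] := pd_bounded i FL.
have mP := meas_pd i FL.
have -> : \int[mu]_y ((w y - v y) * pd i F y) = \int[mu]_y (w y * pd i F y) - \int[mu]_y (v y * pd i F y).
 rewrite -RintegralB//; try exact: intg_mulb mP FP.
 by apply: eq_Rint => y; rewrite mulrBl.
by rewrite (le_trans (ler_normB _ _))// mulrDl lerD//; [exact: wb|exact: vb].
Qed.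
End CV_algebra.

Section holder_component.
Implicit Types (L : 'I_n -> R) (j : 'I_n).

(* The component [f_j] is split into its infimal convolution at scale [e] and a remainder of size [e ^ b]. *)
Lemma CV0_detD_holder w f t L j (a0 y b e : R) : intg w -> csupp w -> 0 <= a0 ->
 allpos t -> \int[mu]_x `|w x| <= a0 -> CV 0 (fun i => a0 / t i) w ->
 0 < e -> 0 <= y -> 0 <= b <= 1 -> allnneg L -> lips L f ->
 (forall x z, `|f x ord0 j - f z ord0 j| <= y * `|x - z| `^ b) ->
 `|\int[mu]_x (w x * detD f x)| <=
  n`!%:R * a0 * (e `^ (b - 1) * (1 + \sum_i e / t i)) * (y * pbut j L).
Proof.
move=> iw [N N0 wN] a00 t0 wa cw e0 y0 b01 L0 fL fb.
pose F x := f x ord0 j; pose K := y * e `^ (b - 1); pose G := infconv K F.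
have K0 : 0 <= K by rewrite mulr_ge0 ?powR_ge0.
have aF : almost_lip K (y * e `^ b) F.
 move=> x z; have := fb x z; rewrite ler_distl => /andP[_ /le_trans]; apply.
 rewrite -addrA lerD2l /K -mulrA -mulrDr ler_wpM2l//.
 exact: holder_interp.
have GL : lip K G := infconv_lip K0 aF.
have FG x : `|F x - G x| <= y * e `^ b.
 rewrite ger0_norm; last by rewrite subr_ge0; exact: infconv_le aF.
 by have := infconv_ge x aF; rewrite lerBlDr -lerBlDl.
have dE := detD_updc_sub j fL (fL j) GL.
have g1 := lips_updc j fL GL.
have g2 := lips_updc j fL (lip_sub (fL j) GL).
have [M1 hM1] := detD_bnd g1; have [M2 hM2] := detD_bnd g2.
have i1 : intg (fun x => w x * detD (updc j G f) x) by exact: intg_mulb iw (lips_meas_detD g1) hM1.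
have i2 : intg (fun x => w x * detD (updc j (fun x => F x - G x) f) x).
 exact: intg_mulb iw (lips_meas_detD g2) hM2.
pose P := pbut j L.
have P0 : 0 <= P by exact: prodr_ge0.
have gen (w1 w2 w3 : Rn -> R) : intg w1 -> intg w2 -> measT w3 ->
  {ae mu, forall x, w3 x = w1 x + w2 x} -> \int[mu]_x w3 x = \int[mu]_x w1 x + \int[mu]_x w2 x.
 move=> h1 h2 h3 ae3; rewrite -RintegralD//; apply: eq_Rint_ae => //.
 exact: measurable_funD (intg_meas h1) (intg_meas h2).
have -> : \int[mu]_x (w x * detD f x) =
  \int[mu]_x (w x * detD (updc j G f) x) + \int[mu]_x (w x * detD (updc j (fun x => F x - G x) f) x).
 have m3 : measT (fun x => w x * detD f x).
  by apply: measurable_funM; [exact: intg_meas iw|exact: lips_meas_detD fL].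
 refine (gen _ _ _ i1 i2 m3 _).
 by apply: aeS dE => x ->; rewrite updc_id -mulrDr addrC subrK.
have b1 : `|\int[mu]_x (w x * detD (updc j G f) x)| <= n`!%:R * (K * P) * a0.
 have L1 l : 0 <= (fun i => if i == j then K else L i) l by rewrite /=; case: ifP.
 have PE : \prod_(l < n) (fun i => if i == j then K else L i) l = K * P.
  by rewrite (bigD1 j)//= eqxx prod_updc.
 have ae1 := ae_detD_le L1 g1; rewrite PE in ae1.
 have c0 : 0 <= n`!%:R * (K * P) := mulr_ge0 (ler0n _ _) (mulr_ge0 K0 P0).
 have [||_ h] := Rintegral_abs_le_ae (mu := mu) (f := fun x => w x * detD (updc j G f) x)
  (g := fun x => n`!%:R * (K * P) * `|w x|) (intg_meas i1) _ _ (intg_scale _ (intg_abs iw)).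
 - by move=> x; rewrite mulr_ge0.
 - apply: aeS ae1 => x hx; rewrite normrM mulrC; exact: ler_wpM2r.
 apply: le_trans h _; rewrite RintegralZl//; last exact: intg_abs.
 exact: ler_wpM2l.
have b2 : `|\int[mu]_x (w x * detD (updc j (fun x => F x - G x) f) x)| <=
  n`!%:R * (\sum_i a0 / t i) * (y * e `^ b * P).
 have L2 l : 0 <= (fun i => if i == j then L j + K else L i) l by rewrite /=; case: ifP => //; rewrite addr_ge0.
 have at0 i : 0 <= (fun i => a0 / t i) i by rewrite divr_ge0// ltW.
 have S2 x : `|updc j (fun x => F x - G x) f x ord0 j| <= y * e `^ b by rewrite mxE eqxx.
 by have := CV0_detD iw N0 wN cw at0 g2 L2 S2; rewrite prod_updc.
apply: le_trans (ler_normD _ _) _; apply: le_trans (lerD b1 b2) _.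
have -> : e `^ b = e `^ (b - 1) * e by rewrite -[X in _ * X]powRr1 ?ltW// -powR_add// subrK.
rewrite -mulr_sumr -/P /K -mulr_sumr; move: (\sum_i _) => z.
by apply: eq_ler; ring.
Qed.

End holder_component.

(** * The series of differences of push-forwards *)

Section pieces.
Variables (al H : 'I_n -> R) (a C B K : R) (u : Rn -> R) (U : nat -> Rn -> R).
Hypotheses (al01 : forall j, 0 < al j <= 1) (H0 : forall j, 0 < H j) (a01 : 0 <= a < 1).
Hypotheses (al_gt : m%:R + a < \sum_j al j) (C0 : 0 <= C) (B0 : 0 <= B) (K0 : 0 <= K).
Hypotheses (iu : intg u) (su : csupp u) (U0 : \int[mu]_x `|U 0%N x| <= C * B).
Hypothesis UP : forall k, [/\ intg (U k), vanish K (U k),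
    \int[mu]_x `|u x - U k x| <= C * B * (2^-1 `^ (1 - a)) ^+ k &
    CV 0 (fun=> C * B * (2 `^ a) ^+ k) (U k)].
Implicit Types (g : Rn -> Rn) (e : R) (j : 'I_n) (k : nat).

Notation tau := (\sum_j al j).
Notation PH := (\prod_j H j).
Let ep (k : nat) : R := 2^-1 ^+ k.
Let ep0 k : 0 < ep k. Proof. by rewrite exprn_gt0. Qed.
Let epS k : ep k = 2 * ep k.+1. Proof. by rewrite /ep exprS mulrA mulfV// mul1r. Qed.
Let ep1 k : ep k <= 1. Proof. by rewrite exprn_ile1// ?invr_ge0// invf_le1// ler1n. Qed.

Let intU k : intg (U k). Proof. by case: (UP k). Qed.
Let cU k : csupp (U k). Proof. by case: (UP k) => _ s _ _; exists K. Qed.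

Let pE k : (2 `^ a) ^+ k = ep k `^ (- a).
Proof.
rewrite -exp_powR// /ep exprVn -powR_inv1 ?exprn_ge0// -powRrM; congr (_ `^ _).
by rewrite mulrN mulN1r opprK.
Qed.

Let qE k : (2^-1 `^ (1 - a)) ^+ k = ep k `^ (1 - a).
Proof. by rewrite -exp_powR ?invr_ge0. Qed.

Let Lk e j := H j * e `^ (al j - 1).
Let Lk0 e j : 0 <= Lk e j. Proof. by rewrite mulr_ge0 ?powR_ge0// ltW. Qed.
Let PH0 : 0 < PH. Proof. exact: prodr_gt0. Qed.

Let prodL e : 0 < e -> \prod_j Lk e j = PH * e `^ (tau - n%:R).
Proof.
move=> e0; rewrite /Lk big_split/= prod_powR ?gt_eqF//; congr (_ * _ `^ _).
by rewrite sumrB sumr_const card_ord.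
Qed.

Let prodLj e i : 0 < e -> \prod_(l < n | l != i) Lk e l = PH * e `^ (tau - m%:R) / (H i * e `^ al i).
Proof.
move=> e0; have := prodL e0; rewrite (bigD1 i)//= => E.
have Li : Lk e i != 0 by rewrite gt_eqF// mulr_gt0 ?powR_gt0.
apply: (mulfI Li); rewrite E /Lk.
have -> : tau - n%:R = (tau - m%:R) + - 1 by rewrite -natr1; ring.
rewrite !(powR_add _ _ e0) powR_inv1 ?(ltW e0)//.
by field; rewrite !gt_eqF ?powR_gt0//.
Qed.

(** [3 n^2] comes from changing the map between two scales, [2 * 2 ^+ n] from changing the smoothed
    function, and [n (1 + 2 ^+ n)] from the variations of the two terms of a difference; [2 ^+ n]
    converts powers of [ep k] into powers of [ep k.+1]. *)
Definition piece_const : R := n`!%:R * C * (3 * n%:R ^+ 2 + 2 * 2 ^+ n + n%:R * (1 + 2 ^+ n)).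
Definition piece_size k : R := piece_const * B * PH * ep k `^ (tau - (m%:R + a)).

Let tau_le : tau <= n%:R.
Proof.
rewrite -[n in n%:R]card_ord -sumr_const; apply: ler_sum => j _.
by case/andP: (al01 j).
Qed.

Let two_pow k x : x <= n%:R -> ep k `^ x <= 2 ^+ n * ep k.+1 `^ x.
Proof.
move=> xn; rewrite (epS k) powRM ?(ltW (ep0 _))// ler_wpM2r ?powR_ge0// -powR_mulrn//.
by apply: ler_powR; rewrite ?ler1n.
Qed.

Section one_map.
Variables (f : Rn -> Rn) (V : nat -> Rn -> R).
Hypotheses (fH : hol al H f) (VP : forall k, ispush (U k) (apx al H (ep k) f) (V k)).

Definition piece k : Rn -> R := if k is k'.+1 then (fun x => V k'.+1 x - V k' x) else V 0%N.

Let fL k : lips (Lk (ep k)) (apx al H (ep k) f). Proof. exact: apx_lips. Qed.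
Let b0 k (i : 'I_n) : 0 <= (fun=> C * B * (2 `^ a) ^+ k) i.
Proof. by rewrite !mulr_ge0 ?exprn_ge0 ?powR_ge0. Qed.

Lemma piece_integrable k : intg (piece k).
Proof.
have iV q : intg (V q) by case: (VP q).
case: k => [|k].
 exact: (iV 0%N).
exact: (intg_sub (iV k.+1) (iV k)).
Qed.

Lemma piece_csupp k : csupp (piece k).
Proof.
have sV q : csupp (V q) by case: (VP q).
case: k => [|k].
 exact: (sV 0%N).
exact: (csupp_sub (sV k.+1) (sV k)).
Qed.

Let cB k : n`!%:R * (\sum_(i < n) C * B * (2 `^ a) ^+ k) = n`!%:R * n%:R * C * B * ep k `^ (- a).
Proof. by rewrite sumr_const card_ord -mulr_natl pE; ring. Qed.

Let V_CV k : CV 0 (fun i => n`!%:R * C * B * PH * n%:R * (ep k `^ (tau - (m%:R + a) - al i) / H i)) (V k).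
Proof.
have [_ _ _ Ub] := UP k.
have H1 := ispush_CV0 (intU k) (cU k) Ub (b0 k) (fL k) (Lk0 (ep k)) (VP k).
apply: CV_le H1 => i; rewrite cB prodLj//; apply: eq_ler.
have -> : tau - (m%:R + a) - al i = - a + (tau - m%:R) + - al i by ring.
rewrite !(powR_add _ _ (ep0 k)) [ep k `^ (- al i)]powRN; field; rewrite !gt_eqF ?powR_gt0//.
Qed.

Let E0 k : 0 <= ep k `^ (tau - (m%:R + a)). Proof. exact: powR_ge0. Qed.
Let nf0 : 0 <= n`!%:R * C * B * PH.
Proof. by rewrite !mulr_ge0// ltW. Qed.

Let le_piece_size c k : c <= 3 * n%:R ^+ 2 + 2 * 2 ^+ n + n%:R * (1 + 2 ^+ n) ->
 n`!%:R * C * B * PH * c * ep k `^ (tau - (m%:R + a)) <= piece_size k.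
Proof.
move=> cc; rewrite /piece_size /piece_const ler_wpM2r//.
have -> : n`!%:R * C * (3 * n%:R ^+ 2 + 2 * 2 ^+ n + n%:R * (1 + 2 ^+ n)) * B * PH =
 n`!%:R * C * B * PH * (3 * n%:R ^+ 2 + 2 * 2 ^+ n + n%:R * (1 + 2 ^+ n)) by ring.
by rewrite ler_wpM2l.
Qed.

Let n1 : 1 <= n%:R :> R. Proof. by rewrite ler1n. Qed.
Let p1 : 1 <= 2 ^+ n :> R. Proof. by rewrite exprn_ege1// ler1n. Qed.
Let d0 : 0 <= tau - (m%:R + a). Proof. by have := al_gt; lra. Qed.

(** Two changes are made one after the other: the map at fixed [U k.+1], and the function at the
    fixed map of scale [ep k]. [W] is the intermediate push-forward. *)
Lemma piece_L1 k : \int[mu]_x `|piece k x| <= piece_size k.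
Proof.
have m0 : 0 <= m%:R :> R by [].
case: k => [|k]; rewrite /piece.
 rewrite (le_trans (ispush_L1_le (fL 0%N) (Lk0 _) (intU 0%N) (VP 0%N)))//.
 have nL : 0 <= n`!%:R * \prod_j Lk (ep 0%N) j by rewrite mulr_ge0// prodr_ge0.
 rewrite (le_trans (ler_wpM2l nL U0))// prodL// /piece_size /ep expr0 !powR1.
 have := @le_piece_size 1 0%N; rewrite /piece_size /ep expr0 powR1 !mulr1.
 rewrite [n`!%:R * PH * _](_ : _ = n`!%:R * C * B * PH); last by ring.
 by apply; have := n1; have := p1; nra.
have [W WP] := ispush_exists (fL k) (intU k.+1) (cU k.+1).
have iW : intg W by case: WP.
have iV1 : intg (V k.+1) by case: (VP k.+1).
have iV0 : intg (V k) by case: (VP k).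
have le_ep : ep k.+1 <= ep k by rewrite (epS k); have := ep0 k.+1; lra.
have fL' : lips (Lk (ep k.+1)) (apx al H (ep k) f).
 move=> j; apply: lip_le (fL k j); rewrite ler_wpM2l ?(ltW (H0 j))//.
 by apply: powR_le_neg => //; case/andP: (al01 j) => _; rewrite subr_le0.
(* [1 + 2], from the distances to [f] at the two scales: the coarser one costs [2^(al j) <= 2] times
   the finer one. *)
pose d j : R := 3 * (H j * ep k.+1 `^ al j).
have fd j x : `|apx al H (ep k.+1) f x ord0 j - apx al H (ep k) f x ord0 j| <= d j.
 rewrite (le_trans (ler_distD (f x ord0 j) _ _))//.
 have ck := apx_close al01 H0 j x (ep0 k) fH; rewrite distrC in ck.
 rewrite (le_trans (lerD (apx_close al01 H0 j x (ep0 k.+1) fH) ck))//.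
 rewrite /d (epS k) powRM ?(ltW (ep0 _))//.
 have h2 : 2 `^ al j <= 2 :> R.
  by rewrite -[leRHS]powRr1//; apply: ler_powR; rewrite ?ler1n//; case/andP: (al01 j).
 have h3 : 0 <= H j * ep k.+1 `^ al j by rewrite mulr_ge0 ?powR_ge0// ltW.
 by rewrite mulrCA; have := ler_wpM2r h3 h2; lra.
have [_ _ _ Ub] := UP k.+1.
have D1 := ispush_dist (intU k.+1) (cU k.+1) Ub (b0 k.+1) fL' (fL k.+1) (Lk0 _) fd WP (VP k.+1).
have D2 := ispush_L1_le (fL k) (Lk0 _) (intg_sub (intU k.+1) (intU k)) (ispush_sub (fL k) (intU k.+1) (intU k) WP (VP k)).
have D3 : \int[mu]_x `|U k.+1 x - U k x| <= 2 * C * B * ep k `^ (1 - a).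
 have [_ _ c1 _] := UP k.+1; have [_ _ c2 _] := UP k.
 rewrite (le_trans (L1_triangle (intU k.+1) iu (intU k)))//.
 rewrite (eq_Rint _ (h := fun x => `|u x - U k.+1 x|)); last by move=> x; rewrite distrC.
 rewrite (le_trans (lerD c1 c2))// !qE -!mulrA -mulrDr -mulrDr.
 have : ep k.+1 `^ (1 - a) <= ep k `^ (1 - a).
  by apply: ge0_ler_powR; rewrite ?nnegrE ?(ltW (ep0 _))// subr_ge0; case/andP: a01 => _ /ltW.
 move=> h1; have := ler_wpM2l (mulr_ge0 C0 B0) (lerD h1 (lexx (ep k `^ (1 - a)))).
 by rewrite -!mulrA => /le_trans; apply; apply: eq_ler; ring.
rewrite (le_trans (L1_triangle iV1 iW iV0))//.
apply: le_trans (lerD D1 (le_trans D2 _)) _.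
 by apply: ler_wpM2l D3; rewrite mulr_ge0// prodr_ge0.
have cc : 3 * n%:R ^+ 2 + 2 * 2 ^+ n <= 3 * n%:R ^+ 2 + 2 * 2 ^+ n + n%:R * (1 + 2 ^+ n) :> R.
 by have := n1; have := p1; nra.
apply: le_trans (le_piece_size k.+1 cc); rewrite mulrDr mulrDl lerD//.
 rewrite cB [X in _ * X <= _](eq_bigr (fun=> 3 * (PH * ep k.+1 `^ (tau - m%:R)))); last first.
  by move=> j _; rewrite prodLj// /d; field; rewrite !gt_eqF ?powR_gt0.
 rewrite sumr_const card_ord -[X in _ * X]mulr_natl.
 have -> : tau - (m%:R + a) = - a + (tau - m%:R) by ring.
 by rewrite (powR_add (- a) (tau - m%:R) (ep0 k.+1)); apply: eq_ler; ring.
have dn : tau - (m%:R + a) <= n%:R by case/andP: a01 => a0 _; have := tau_le; lra.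
have := ler_wpM2l nf0 (two_pow k dn) => h4.
rewrite (@le_trans _ _ (2 * (n`!%:R * C * B * PH * ep k `^ (tau - (m%:R + a)))))//; last first.
 rewrite (_ : n`!%:R * C * B * PH * (2 * 2 ^+ n) * ep k.+1 `^ _ =
  2 * (n`!%:R * C * B * PH * (2 ^+ n * ep k.+1 `^ (tau - (m%:R + a))))); last by ring.
 by rewrite ler_wpM2l.
rewrite prodL// (_ : tau - (m%:R + a) = (tau - n%:R) + (1 - a)); last by rewrite -natr1; ring.
by rewrite (powR_add (tau - n%:R) (1 - a) (ep0 k)); apply: eq_ler; ring.
Qed.

(** With [piece_L1] it makes the piece behave like the mass [piece_size k] spread over a box of
    sides [H i * ep k^(al i)], the form required by [dual_CV0]. *)
Lemma piece_CV0 k : CV 0 (fun i => piece_size k / (H i * ep k `^ al i)) (piece k).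
Proof.
have scale c q (i : 'I_n) : c <= 3 * n%:R ^+ 2 + 2 * 2 ^+ n + n%:R * (1 + 2 ^+ n) ->
  n`!%:R * C * B * PH * c * (ep q `^ (tau - (m%:R + a) - al i) / H i) <= piece_size q / (H i * ep q `^ al i).
 move=> cc; have Hi : 0 <= (H i * ep q `^ al i)^-1 by rewrite invr_ge0 mulr_ge0 ?powR_ge0// ltW.
 apply: le_trans (ler_wpM2r Hi (le_piece_size q cc)).
 rewrite (powR_add (tau - (m%:R + a)) _ (ep0 q)) [ep q `^ (- al i)]powRN.
 by apply: eq_ler; field; rewrite !gt_eqF ?powR_gt0.
case: k => [|k]; rewrite /piece.
 by apply: CV_le (V_CV 0%N) => i; refine (@scale n%:R 0%N i _); have := n1; have := p1; nra.
apply: CV_le (CV_sub _ _ (V_CV k.+1) (V_CV k)) => [i||]; last 2 first.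
- by case: (VP k.+1).
- by case: (VP k).
apply: le_trans (scale (n%:R * (1 + 2 ^+ n)) k.+1 i _); last by have := n1; have := p1; nra.
have dn : tau - (m%:R + a) - al i <= n%:R.
 by case/andP: a01 => a0 _; case/andP: (al01 i) => ai _; have := tau_le; have m0 : 0 <= m%:R :> R by []; lra.
have h5 : 0 <= n`!%:R * C * B * PH * n%:R / H i by rewrite mulr_ge0 ?invr_ge0 ?(ltW (H0 i))//; exact: mulr_ge0 nf0 (ler0n _ _).
have := ler_wpM2l h5 (two_pow k dn) => h4.
rewrite mulrDr mulr1 mulrDr mulrDl lerD2l; apply: le_trans (le_trans _ h4) _.
 by apply: eq_ler; ring.
by apply: eq_ler; ring.
Qed.

End one_map.

Section one_lipschitz_map.
Variables (f : Rn -> Rn) (L : 'I_n -> R) (V : nat -> Rn -> R) (v : Rn -> R).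
Hypotheses (fH : hol al H f) (VP : forall k, ispush (U k) (apx al H (2^-1 ^+ k) f) (V k)).
Hypotheses (fL : lips L f) (L0 : forall j, 0 <= L j) (uv : ispush u f v).

(** The [m] other exponents are at most 1 each. For a Lipschitz map, replacing component [j] by its
    regularization costs a multiple of [2^(- k (al j - a))], which must tend to 0. *)
Let al_gt_a j : a < al j.
Proof.
have : \sum_(i < n | i != j) al i <= m%:R.
 rewrite (@le_trans _ _ (\sum_(i < n | i != j) 1))//.
  by apply: ler_sum => i _; case/andP: (al01 i).
 by rewrite sumr_const cardC1 card_ord.
by have := al_gt; rewrite (bigD1 j)//=; lra.
Qed.

Let bnd k : R := n`!%:R * \prod_j L j * (C * B * (2^-1 `^ (1 - a)) ^+ k) +
 n`!%:R * n%:R * C * B * \sum_j (H j * (2^-1 `^ (al j - a)) ^+ k * \prod_(l < n | l != j) L l).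

Let V_close k : \int[mu]_x `|v x - V k x| <= bnd k.
Proof.
have [iUk sk uUk Ub] := UP k.
have sU : csupp (U k) by exists K.
have e0 : 0 < (2^-1 ^+ k : R) by rewrite exprn_gt0.
have [W WP] := ispush_exists fL iUk sU.
have iW : intg W by case: WP.
have iV : intg (V k) by case: (VP k).
have iv : intg v by case: uv.
rewrite (le_trans (L1_triangle iv iW iV))// lerD//.
 have := ispush_L1_le fL L0 (intg_sub iu iUk) (ispush_sub fL iu iUk uv WP).
 by move=> /le_trans; apply; rewrite ler_wpM2l// mulr_ge0// prodr_ge0.
have b0 (i : 'I_n) : 0 <= (fun=> C * B * (2 `^ a) ^+ k) i.
 by rewrite !mulr_ge0 ?exprn_ge0 ?powR_ge0.
have gL := apx_lips_le al01 H0 e0 fH fL.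
have fd j x : `|f x ord0 j - apx al H (2^-1 ^+ k) f x ord0 j| <= H j * (2^-1 ^+ k) `^ al j.
 by rewrite distrC; exact: apx_close.
rewrite (le_trans (ispush_dist iUk sU Ub b0 gL fL L0 fd (VP k) WP))//.
rewrite sumr_const card_ord -[X in _ * X * _ <= _]mulr_natl [leLHS]mulr_sumr [leRHS]mulr_sumr.
apply: ler_sum => j _.
have -> : (2^-1 `^ (al j - a)) ^+ k = (2^-1 ^+ k) `^ al j * (2 `^ a) ^+ k.
 rewrite -exp_powR ?invr_ge0// powR_add//; congr (_ * _).
 rewrite -exp_powR// exprVn -powR_inv1 ?exprn_ge0// -powRrM; congr (_ `^ _).
 by rewrite mulrN mulN1r opprK.
by apply: eq_ler; ring.
Qed.

(** The regularizations of a Lipschitz map keep its Lipschitz constants [L], so the sequence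
    converges to the actual push-forward. This ties the limits built for Hölder maps to those of
    Lipschitz maps. *)
Lemma push_series_cvg h M : measT h -> normle h M ->
 \int[mu]_x (V k x * h x) @[k --> \oo] --> \int[mu]_x (v x * h x).
Proof.
move=> mh hM; have M0 : 0 <= M by rewrite (le_trans _ (hM 0)).
have iv : intg v by case: uv.
have E k : `|\int[mu]_x (v x * h x) - \int[mu]_x (V k x * h x)| <= M * bnd k.
 have iV : intg (V k) by case: (VP k).
 rewrite (Rint_subM iv iV mh hM).
 rewrite (le_trans (L1_dual_bnd (intg_sub iv iV) mh hM))// ler_wpM2l//.
apply/cvgrPdist_le => e e0.
have cE : M * bnd k @[k --> \oo] --> M * (n`!%:R * \prod_j L j * (C * B * 0) +
  n`!%:R * n%:R * C * B * \sum_j (H j * 0 * \prod_(l < n | l != j) L l)).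
 have hq x : 0 < x -> (2^-1 `^ x) ^+ k @[k --> \oo] --> (0 : R).
  move=> /half_powR_lt1/andP[q0 q1]; by apply: cvg_expr; rewrite ger0_norm.
 apply: cvgMr; apply: cvgD; apply: cvgMr.
  by apply: cvgMr; apply: hq; rewrite subr_gt0; case/andP: a01.
 apply: cvg_big => [|j _]; [exact: add_continuous|apply: cvgMl; apply: cvgMr; apply: hq].
 by rewrite subr_gt0.
have z0 : \sum_j H j * 0 * \prod_(l < n | l != j) L l = 0 by rewrite big1// => j _; rewrite mulr0 mul0r.
rewrite z0 in cE.
rewrite !mulr0 addr0 mulr0 in cE.
have /cvgrPdist_le /(_ e e0) := cE.
by apply: filterS => k; rewrite sub0r normrN => /(le_trans (ler_norm _)); exact: le_trans (E k).
Qed.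

End one_lipschitz_map.

Definition approx_seq f (V : nat -> Rn -> R) := forall k, ispush (U k) (apx al H (2^-1 ^+ k) f) (V k).

Lemma approx_seq_exists f : hol al H f -> exists V, approx_seq f V.
Proof.
move=> fH; have ex k : exists V, ispush (U k) (apx al H (2^-1 ^+ k) f) V.
 have [iUk sk _ _] := UP k.
 have e0 : 0 < (2^-1 ^+ k : R) by rewrite exprn_gt0.
 by apply: ispush_exists (apx_lips al01 H0 e0 fH) iUk _; exists K.
by exists (fun k => projT1 (cid (ex k))) => k; exact: projT2 (cid (ex k)).
Qed.

(** Common description of push-forwards by Lipschitz maps and of the limits built for Hölder maps,
    so that both obey the same bounds, which depend on [f] through [H] alone. *)
Definition repr f v := [/\ hol al H f, intg v & exists2 V, approx_seq f V &
 forall h M, measT h -> normle h M ->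
  \int[mu]_x (V k x * h x) @[k --> \oo] --> \int[mu]_x (v x * h x)].

Lemma repr_lips f L v : hol al H f -> lips L f -> allnneg L -> ispush u f v -> repr f v.
Proof.
move=> fH fL L0 uv; have [V VP] := approx_seq_exists fH.
split => //; first by case: uv.
exists V => // h M mh hM.
exact: (push_series_cvg fH VP fL L0 uv mh hM).
Qed.

Let pc0 : 0 <= piece_const.
Proof. by rewrite /piece_const mulr_ge0 ?mulr_ge0 ?addr_ge0 ?mulr_ge0 ?addr_ge0 ?exprn_ge0. Qed.

Let sz0 k : 0 <= piece_size k.
Proof. by rewrite /piece_size !mulr_ge0 ?powR_ge0 ?(ltW PH0). Qed.

Let piece_sizeE k : piece_size k = piece_const * B * PH * (2^-1 `^ (tau - (m%:R + a))) ^+ k.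
Proof. by rewrite /piece_size -exp_powR ?invr_ge0. Qed.

Lemma repr_exists f : hol al H f -> exists v, repr f v.
Proof.
move=> fH; have [V VP] := approx_seq_exists fH.
have th : 0 < tau - (m%:R + a) by rewrite subr_gt0.
have q01 := half_powR_lt1 th; set q := _ `^ _ in q01; have /andP[q0 q1] := q01.
have iV k : intg (V k) by case: (VP k).
pose X := piece_const * B * PH.
have X0 : 0 <= X by rewrite !mulr_ge0// ltW.
have Vq k : \int[mu]_x `|V k.+1 x - V k x| <= X * q ^+ k.
 have := piece_L1 fH VP k.+1; rewrite piece_sizeE => /le_trans; apply.
 by rewrite ler_wpM2l// exprS ler_piMl ?exprn_ge0// ltW.
have [v [iv vV]] := L1_fast_cauchy iV q01 X0 Vq.
exists v; split => //; exists V => // h M mh hM.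
have M0 : 0 <= M by rewrite (le_trans _ (hM 0)).
apply: (@cvg_geometric_bound _ _ _ (M * X / (1 - q)) q) => // k.
rewrite (Rint_subM iv (iV k) mh hM) (le_trans (L1_dual_bnd (intg_sub iv (iV k)) mh hM))//.
by rewrite (le_trans (ler_wpM2l M0 (vV k)))//; apply: eq_ler; ring.
Qed.

Lemma approx_seq_tail f V v h X q k : approx_seq f V ->
 \int[mu]_x (V k x * h x) @[k --> \oo] --> \int[mu]_x (v x * h x) ->
 measT h -> (exists M, forall x, `|h x| <= M) -> 0 <= q < 1 -> 0 <= X ->
 (forall k, `|\int[mu]_x (piece V k x * h x)| <= X * q ^+ k) ->
 `|\int[mu]_x (v x * h x) - \int[mu]_x (V k x * h x)| <= X * q ^+ k / (1 - q).
Proof.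
move=> VP cV mh [M hM] q01 X0 Xq; have /andP[q0 q1] := q01.
apply: (geometric_tail (a := fun k => \int[mu]_x (V k x * h x)) k q01 X0 _ cV) => j.
have iV k' : intg (V k') by case: (VP k').
rewrite (Rint_subM (iV j.+1) (iV j) mh hM).
by rewrite (le_trans (Xq j.+1))// ler_wpM2l// exprS ler_piMl ?exprn_ge0// ltW.
Qed.

Lemma approx_seq_le f V v h X q : approx_seq f V ->
 \int[mu]_x (V k x * h x) @[k --> \oo] --> \int[mu]_x (v x * h x) ->
 measT h -> (exists M, forall x, `|h x| <= M) -> 0 <= q < 1 -> 0 <= X ->
 (forall k, `|\int[mu]_x (piece V k x * h x)| <= X * q ^+ k) ->
 `|\int[mu]_x (v x * h x)| <= 2 * X / (1 - q).
Proof.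
move=> VP cV mh hM q01 X0 Xq; have /andP[q0 q1] := q01.
have := approx_seq_tail 0 VP cV mh hM q01 X0 Xq; have := Xq 0%N; rewrite expr0 !mulr1 => h1 h2.
rewrite -(subrK (\int[mu]_x (V 0%N x * h x)) (\int[mu]_x (v x * h x))).
rewrite (le_trans (ler_normD _ _))// (le_trans (lerD h2 h1))//.
rewrite (_ : 2 * X / (1 - q) = X / (1 - q) + X / (1 - q)); last by ring.
by rewrite lerD2l ler_pdivlMr ?subr_gt0// ler_piMr// gerBl.
Qed.

(** [CV0_detD_holder] is used at the scale [2^(-k M)]. As [M] is at least every exponent, this is at
    most [t i / H i] for each side [t i] of the piece, and [\sum_i e / t i] stays bounded. The
    series then decays with exponent [tau - d - M (1 - b)], where [d = m + a]. *)
Lemma repr_BV f v (b M : R) : repr f v -> (forall j, al j <= M) -> 0 <= b <= 1 ->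
 0 < tau - (m%:R + a) - M * (1 - b) ->
 exists2 Y : R, 0 <= Y & forall g L y j, allnneg L -> lips L g -> 0 <= y ->
  (forall x z, `|g x ord0 j - g z ord0 j| <= y * `|x - z| `^ b) ->
  `|\int[mu]_x (v x * detD g x)| <= Y * (y * pbut j L).
Proof.
move=> [fH iv [V VP cV]] alM b01 th.
have q01 := half_powR_lt1 th; set q := _ `^ _ in q01; have /andP[q0 q1] := q01.
pose X := n`!%:R * (piece_const * B * PH) * (1 + \sum_i (H i)^-1).
have X0 : 0 <= X.
 rewrite mulr_ge0 ?addr_ge0 ?sumr_ge0// => [|i _]; last by rewrite invr_ge0 ltW.
 by rewrite mulr_ge0// mulr_ge0 ?(ltW PH0)// mulr_ge0.
exists (2 * X / (1 - q)); first by apply: divr_ge0; [exact: mulr_ge0|rewrite subr_ge0 ltW].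
move=> g L y j L0 gL y0 gb.
have P0 : 0 <= y * pbut j L by rewrite mulr_ge0// prodr_ge0.
have [Md hMd] := detD_bnd gL.
have mD := lips_meas_detD gL.
have X'0 := mulr_ge0 X0 P0.
suff H' k : `|\int[mu]_x (piece V k x * detD g x)| <= X * (y * pbut j L) * q ^+ k.
 have := approx_seq_le VP (cV _ _ mD hMd) mD (ex_intro _ Md hMd) q01 X'0 H'.
 by move=> /le_trans; apply; apply: eq_ler; ring.
have e0 : 0 < (2^-1 ^+ k : R) by rewrite exprn_gt0.
have e1 : (2^-1 ^+ k : R) <= 1 by rewrite exprn_ile1// invf_le1// ler1n.
pose t i := H i * (2^-1 ^+ k) `^ al i.
have t0 i : 0 < t i by rewrite mulr_gt0 ?powR_gt0.
have eM : 0 < (2^-1 ^+ k : R) `^ M by rewrite powR_gt0.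
have := CV0_detD_holder (piece_integrable VP k) (piece_csupp VP k) (sz0 k) t0
 (piece_L1 fH VP k) (piece_CV0 fH VP k) eM y0 b01 L0 gL gb.
move=> /le_trans; apply.
have -> : X * (y * pbut j L) * q ^+ k = X * q ^+ k * (y * pbut j L) by ring.
apply: (ler_wpM2r P0).
rewrite piece_sizeE.
have -> : q ^+ k = (2^-1 `^ (tau - (m%:R + a))) ^+ k * ((2^-1 ^+ k) `^ M) `^ (b - 1).
 rewrite -powRrM !exp_powR ?invr_ge0// -exprMn -powR_add ?invr_gt0//; congr (_ `^ _ ^+ _); ring.
have s1 : \sum_i (2^-1 ^+ k) `^ M / t i <= \sum_i (H i)^-1.
 apply: ler_sum => i _; rewrite /t invfM mulrCA ler_piMr ?invr_ge0 ?(ltW (H0 i))//.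
 rewrite ler_pdivrMr ?powR_gt0// mul1r; apply: ger_powR; rewrite ?e0//; exact: alM.
have -> (z : R) : n`!%:R * (piece_const * B * PH * (2^-1 `^ (tau - (m%:R + a))) ^+ k) *
  (((2^-1 ^+ k) `^ M) `^ (b - 1) * z) = n`!%:R * (piece_const * B * PH) * ((2^-1 `^ (tau - (m%:R + a))) ^+ k * ((2^-1 ^+ k) `^ M) `^ (b - 1)) * z.
 ring.
rewrite /X -mulrA [leRHS]mulrAC mulrA.
apply: ler_wpM2l; last by rewrite lerD2l.
by rewrite !mulr_ge0 ?exprn_ge0 ?powR_ge0 ?(ltW PH0).
Qed.

Section dual_estimates.
Variables (s Cs : R).
Hypotheses (s0 : 0 <= s) (ths : 0 < tau - (m%:R + a) - tau * s) (Cs0 : 0 <= Cs).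
Hypothesis CsP : forall w a t, intg w -> csupp w -> 0 <= a -> allpos t -> CV 0 (fun i => a / t i) w ->
  \int[mu]_x `|w x| <= a -> dual s (Cs * (a * (\prod_l t l) `^ (- s))) w.

Let X := Cs * piece_const * B * PH `^ (1 - s).
Let q : R := 2^-1 `^ (tau - (m%:R + a) - tau * s).
Let q01 : 0 <= q < 1. Proof. exact: half_powR_lt1. Qed.
Let X0 : 0 <= X. Proof. by rewrite !mulr_ge0 ?powR_ge0. Qed.

(** The sides multiply to [PH * 2^(- k tau)], so the mass [piece_size k] yields the exponent
    [tau - d - tau s] with [d = m + a]. For [s = 1 - 1/p] it equals [tau / p - d]. *)
Lemma piece_dual f V k h A : hol al H f -> approx_seq f V -> test s A h ->
 `|\int[mu]_x (piece V k x * h x)| <= X * A * q ^+ k.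
Proof.
move=> fH VP th; have [A0 _ _ _] := th.
have e0 : 0 < (2^-1 ^+ k : R) by rewrite exprn_gt0.
pose t i := H i * (2^-1 ^+ k) `^ al i.
have t0 i : 0 < t i by rewrite mulr_gt0 ?powR_gt0.
have ip := piece_integrable VP k; have sp := piece_csupp VP k.
have := CsP ip sp (sz0 k) t0 (piece_CV0 fH VP k)
 (piece_L1 fH VP k) th.
move=> /le_trans; apply; apply: eq_ler.
rewrite /t big_split/= prod_powR ?gt_eqF// powRM ?powR_ge0 ?(ltW PH0)// -powRrM /piece_size /X.
rewrite (powR_add 1 (- s) PH0) powRr1 ?(ltW PH0)// /q -exp_powR ?invr_ge0//.
rewrite (powR_add _ (- (tau * s)) e0) mulrN; ring.
Qed.

Lemma repr_dual f v : repr f v -> dual s (2 * X / (1 - q)) v.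
Proof.
move=> [fH iv [V VP cV]] h A th; have [A0 mh [M hM] _] := th.
rewrite (_ : 2 * X / (1 - q) * A = 2 * (X * A) / (1 - q)); last by ring.
apply: (approx_seq_le VP (cV h M mh hM) mh _ q01) => [||k]; [by exists M|exact: mulr_ge0|exact: piece_dual].
Qed.

(** The tails beyond [k] are small uniformly in the map. For fixed [k] the terms of two close maps
    differ by a function of small mass and bounded variation, which [dual_CV0] interpolates. All
    constants involve the maps through [H] alone, so [e] is uniform. *)
Lemma repr_dual_close (eta : R) : n%:R * s < 1 -> 0 < eta -> exists2 e : R, 0 < e &
 forall f g v v', repr f v -> repr g v' -> (forall j x, `|f x ord0 j - g x ord0 j| <= e) ->
  dual s eta (fun x => v x - v' x).
Proof.
move=> ns1 eta0; have /andP[q0 q1] := q01.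
have cX : X * q ^+ k / (1 - q) @[k --> \oo] --> X * 0 / (1 - q).
 apply: cvgM; [apply: cvgM; [exact: cvg_cst|]|exact: cvg_cst].
 by apply: cvg_expr; rewrite ger0_norm.
have eta4 : 0 < eta / 4 by rewrite divr_gt0.
rewrite mulr0 mul0r in cX; have /cvgrPdist_le /(_ _ eta4) [k _ /(_ k)] := cX.
rewrite /= leqnn sub0r normrN => /(_ isT) /(le_trans (ler_norm _)) Xk.
pose e1 : R := 2^-1 ^+ k; have e10 : 0 < e1 by rewrite exprn_gt0.
pose Le j := H j * e1 `^ (al j - 1).
have Le0 j : 0 <= Le j by rewrite mulr_ge0 ?powR_ge0// ltW.
pose b : R := C * B * (2 `^ a) ^+ k; have b0 (i : 'I_n) : 0 <= (fun=> b) i by rewrite !mulr_ge0 ?exprn_ge0 ?powR_ge0.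
pose M1 : R := n`!%:R * (\sum_(i < n) b) * \sum_j \prod_(l < n | l != j) Le l.
have sb0 : 0 <= \sum_(i < n) b by apply: sumr_ge0 => i _; exact: b0.
have pL j : 0 <= \prod_(l < n | l != j) Le l by exact: prodr_ge0.
have M10 : 0 <= M1 by apply: mulr_ge0; [exact: mulr_ge0|exact: sumr_ge0].
pose M2 : R := 2 * M1 + 1; have M20 : 0 < M2 by rewrite ltr_wpDl// mulr_ge0.
pose Y : R := Cs * M2 `^ (n%:R * s) + 1.
have Y0 : 0 < Y by rewrite ltr_wpDl// mulr_ge0 ?powR_ge0.
(* The mass for which [dual_CV0], with all sides equal to [x / M2], returns at most [eta / 2]. This
   side makes mass over side equal to the variation bound [M2], which does not shrink with [x]. *)
pose x := ((eta / 2) / Y) `^ (1 - n%:R * s)^-1.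
have x0 : 0 < x by rewrite powR_gt0// !divr_gt0.
have xE : x `^ (1 - n%:R * s) = (eta / 2) / Y.
 rewrite /x -powRrM mulVf ?powRr1 ?gt_eqF ?subr_gt0//.
 by rewrite !divr_ge0 ?ltW.
exists (x / (M1 + 1)); first by rewrite divr_gt0// ltr_wpDl.
move=> f g v v' [fH iv [V VP cV]] [gH iv' [V' VP' cV']] fg h A th.
have [A0 mh [M hM] _] := th.
have iVk : intg (V k) by case: (VP k).
have iVk' : intg (V' k) by case: (VP' k).
have T f0 V0 (fH0 : hol al H f0) (VP0 : approx_seq f0 V0) v0
  (cV0 : \int[mu]_x (V0 k x * h x) @[k --> \oo] --> \int[mu]_x (v0 x * h x)) :
  `|\int[mu]_x (v0 x * h x) - \int[mu]_x (V0 k x * h x)| <= eta / 4 * A.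
 have := approx_seq_tail k VP0 cV0 mh (ex_intro _ M hM) q01 (mulr_ge0 X0 A0) (fun k => piece_dual k fH0 VP0 th).
 by move=> /le_trans; apply; rewrite (_ : _ * _ / _ = X * q ^+ k / (1 - q) * A) ?ler_wpM2r//; ring.
have T1 := T _ _ fH VP _ (cV h M mh hM); have T2 := T _ _ gH VP' _ (cV' h M mh hM).
have [iUk sk _ Ub] := UP k; have sU : csupp (U k) by exists K.
have iW := intg_sub iVk iVk'.
have sW : csupp (fun y => V k y - V' k y).
 by apply: csupp_sub; [case: (VP k)|case: (VP' k)].
have W1 : \int[mu]_y `|V k y - V' k y| <= x.
 have fL := apx_lips al01 H0 e10 fH; have gL := apx_lips al01 H0 e10 gH.
 have d1 j y : `|apx al H e1 f y ord0 j - apx al H e1 g y ord0 j| <= x / (M1 + 1).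
  by apply: apx_dist => //; exact: fg.
 have := ispush_dist iUk sU Ub b0 gL fL Le0 d1 (VP' k) (VP k).
 move=> /le_trans; apply; rewrite -mulr_sumr.
 rewrite (_ : n`!%:R * (\sum_(i < n) b) * (x / (M1 + 1) * _) = x * (M1 / (M1 + 1))); last by rewrite /M1; ring.
 by rewrite ler_piMr ?(ltW x0)// ler_pdivrMr ?ltr_wpDl// mul1r lerDl.
have W2 : CV 0 (fun i => x / (fun=> x / M2) i) (fun y => V k y - V' k y).
 have c1 := ispush_CV0 iUk sU Ub b0 (apx_lips al01 H0 e10 fH) Le0 (VP k).
 have c2 := ispush_CV0 iUk sU Ub b0 (apx_lips al01 H0 e10 gH) Le0 (VP' k).
 apply: CV_le (CV_sub iVk iVk' c1 c2) => i.
 have -> : x / (x / M2) = M2 by field; rewrite !gt_eqF.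
 have hle : n`!%:R * (\sum_(i < n) b) * \prod_(l < n | l != i) Le l <= M1.
  rewrite ler_wpM2l ?mulr_ge0// [leRHS](bigD1 i)//= lerDl sumr_ge0// => j _; exact: prodr_ge0.
 apply: le_trans (lerD hle hle) _; by rewrite /M2 mulr_natl mulr2n lerDl.
have xM0 (l : 'I_n) : 0 < (fun=> x / M2) l by rewrite divr_gt0.
have D1 := CsP iW sW (ltW x0) xM0 W2 W1 th.
have E1 : Cs * (x * (\prod_(l < n) (x / M2)) `^ (- s)) <= eta / 2.
 have xq0 : 0 <= x / M2 by rewrite divr_ge0 ?(ltW x0) ?(ltW M20).
 rewrite prodr_const card_ord exp_powR// -powR_mulrn ?powR_ge0// -powRrM.
 rewrite powRM ?invr_ge0 ?(ltW x0) ?(ltW M20)// -powR_inv1 ?(ltW M20)// -powRrM.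
 have -> : x * (x `^ (- s * n%:R) * M2 `^ (-1 * (- s * n%:R))) = M2 `^ (n%:R * s) * x `^ (1 - n%:R * s).
  rewrite (powR_add 1 _ x0) powRr1 ?(ltW x0)//.
  have -> : - s * n%:R = - (n%:R * s) by ring.
  have -> : -1 * - (n%:R * s) = n%:R * s by ring.
  ring.
 rewrite xE mulrA (mulrC (eta / 2)) mulrA ler_piMl ?divr_ge0 ?(ltW eta0)//.
 by rewrite ler_pdivrMr// mul1r lerDl.
have -> : \int[mu]_y ((v y - v' y) * h y) = (\int[mu]_y (v y * h y) - \int[mu]_y (V k y * h y)) -
  (\int[mu]_y (v' y * h y) - \int[mu]_y (V' k y * h y)) + \int[mu]_y ((V k y - V' k y) * h y).
 by rewrite -(Rint_subM iv iv' mh hM) -(Rint_subM iVk iVk' mh hM); ring.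
rewrite (le_trans (ler_normD _ _))// (le_trans (lerD (ler_normB _ _) (lexx _)))//.
rewrite (_ : eta * A = eta / 4 * A + eta / 4 * A + eta / 2 * A); last by field.
exact: (lerD (lerD T1 T2) (le_trans D1 (ler_wpM2r A0 E1))).
Qed.

End dual_estimates.
End pieces.

(** * From dual bounds to [L^p] norms *)

Section dual_to_Lp.

Lemma dual0_L1 (M : R) w : intg w -> dual 0 M w -> \int[mu]_x `|w x| <= M.
Proof.
move=> iw wM; apply: L1_le_lip_dual => // h L L0 hL h1.
have := wM h 1 (test_bounded (lip_meas hL) h1); rewrite mulr1.
exact: le_trans (ler_norm _).
Qed.

Lemma Lp_norm_1 w : intg w -> Lp_norm 1 w = (\int[mu]_x `|w x|)%:E.
Proof.
move=> iw; rewrite /Lp_norm Lnorm1 /Rintegral fineK//.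
by apply: integrable_fin_num => //; exact: intg_abs.
Qed.

(** Hölder's inequality against the indicator of a box, with the conjugate exponents [p / (p - 1)]
    and [p]. *)
Lemma test_hoelder (p : R) h : 1 < p -> measT h -> (exists M, forall x, `|h x| <= M) ->
 intg (fun x => `|h x| `^ (p / (p - 1))) ->
 test (1 - p^-1) ((\int[mu]_x `|h x| `^ (p / (p - 1))) `^ (1 - p^-1)) h.
Proof.
move=> p1 mh hM ih; have p0 : 0 < p by exact: lt_trans p1.
have pp : 0 < p - 1 by rewrite subr_gt0.
split => //; first exact: powR_ge0.
move=> x t t0; rewrite subKr.
have mb : measurable (tbox t) by exact: meas_box.
pose ind y : R := \1_(tbox t) (x - y).
have mi : measT ind by apply: meas_shift; exact: measurable_indic.
pose q := p / (p - 1).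
have q0 : 0 < q by rewrite divr_gt0.
have pq : q^-1 + p^-1 = 1.
 by rewrite /q invf_div; field; rewrite !gt_eqF.
have := hoelder mu mh mi q0 p0 pq.
have ei : intg ind := intg_tbox_shift t x.
have ind0 y : 0 <= ind y by rewrite /ind indicE.
have indp y : ind y `^ p = ind y.
 by rewrite /ind indicE; case: (_ \in _); rewrite ?powR1 ?powR0// gt_eqF.
have NE r (g : Rn -> R) : intg (fun y => `|g y| `^ r) -> 'N[mu]_(r%:E)[EFin \o g]%E = ((\int[mu]_y (`|g y| `^ r)) `^ r^-1)%:E.
 move=> ig; rewrite unlock /Lnorm -[RHS]poweR_EFin; congr (_ `^ _)%E.
 by rewrite /Rintegral fineK//; exact: integrable_fin_num.
have iip : intg (fun y => `|ind y| `^ p).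
 by apply: eq_integrable ei => // y _ /=; rewrite ger0_norm// indp.
have ihi : intg (fun y => `|h y| * ind y).
 have [M hM'] := hM; have mah : measT (fun y => `|h y|) by exact: measurableT_comp.
 apply: eq_integrable (intg_mulb (M := M) ei mah _) => // [y _ /=|y]; first by rewrite mulrC.
 by rewrite normr_id.
rewrite Lnorm1 NE// NE// -EFinM.
have -> : (\int[mu]_y `|(EFin \o (h \* ind)%R) y| = (\int[mu]_y (`|h y| * ind y))%:E)%E.
 rewrite /Rintegral fineK; last exact: integrable_fin_num.
 by apply: eq_integral => y _ /=; rewrite normrM (ger0_norm (ind0 y)).
rewrite lee_fin => /le_trans; apply.
have -> : \int[mu]_y (`|ind y| `^ p) = \prod_l (2 * t l).
 have -> : \int[mu]_y (`|ind y| `^ p) = \int[mu]_y ind y.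
  by apply: eq_Rint => y; rewrite ger0_norm// indp.
 by rewrite tbox_shift_integral measure_tbox.
apply: eq_ler; congr (_ `^ _ * _).
by rewrite -pq addrK.
Qed.

(** The extremal test function, the sign of [w] times [|w|^(p - 1)], is truncated at height [k]. It
    is then bounded, and the integral [I] of the truncated power is finite, so it can be divided out
    of [I <= M * I^(1 - 1/p)]. Monotone convergence removes the truncation. *)
Lemma dual_Lp_norm (p M : R) w : 1 <= p -> 0 <= M -> intg w -> dual (1 - p^-1) M w -> (Lp_norm p w <= M%:E)%E.
Proof.
rewrite le_eqVlt => /predU1P[<-|p1] M0 iw wM.
 by rewrite Lp_norm_1// lee_fin; apply: dual0_L1 => //; move: wM; rewrite invr1 subrr.
have p0 : 0 < p by exact: lt_trans p1.
have pp : 0 < p - 1 by rewrite subr_gt0.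
have mw := intg_meas iw.
pose wk (k : nat) x : R := Num.min `|w x| k%:R.
have mwk k : measT (wk k) by apply: measurable_minr => //; exact: measurableT_comp.
have wk0 k x : 0 <= wk k x by rewrite le_min normr_ge0/=.
have iwk k : intg (fun x => wk k x `^ p).
 apply: (@intg_le _ _ _ mu (fun x => k%:R `^ (p - 1) * `|w x|)).
 - exact: (measurableT_comp (measurable_powR p)).
 - move=> x; rewrite ger0_norm ?powR_ge0//.
  have -> : wk k x `^ p = wk k x `^ (p - 1) * wk k x.
   by rewrite mulrC mulr_powRB1.
  apply: ler_pM; rewrite ?powR_ge0//; last by rewrite ge_min lexx.
  by apply: ge0_ler_powR; rewrite ?nnegrE ?(ltW pp)// ge_min lexx orbT.
 - by apply: intg_scale; exact: intg_abs.
have I0 k : 0 <= \int[mu]_x (wk k x `^ p) by apply: Rintegral_ge0 => x _; exact: powR_ge0.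
have H k : \int[mu]_x (wk k x `^ p) <= M `^ p.
 pose h x := Num.sg (w x) * wk k x `^ (p - 1).
 have mh : measT h.
  apply: measurable_funM; first exact: (measurableT_comp measurable_sg).
  exact: (measurableT_comp (measurable_powR _)).
 have hE x : `|h x| `^ (p / (p - 1)) = wk k x `^ p.
  have [wx|wx] := eqVneq (w x) 0.
   rewrite /h wx sgr0 mul0r normr0 /wk wx normr0 (min_idPl _)// !powR0 ?gt_eqF// divr_gt0//.
  rewrite /h normrM normr_sg wx mul1r ger0_norm ?powR_ge0// -powRrM; congr (_ `^ _).
  by rewrite mulrC divfK ?gt_eqF.
 have hM x : `|h x| <= k%:R `^ (p - 1).
  rewrite /h normrM (le_trans (ler_pM _ _ (_ : _ <= 1) (lexx _)))//; first by rewrite normr_sg; case: (_ != _).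
  rewrite mul1r ger0_norm ?powR_ge0//.
  by apply: ge0_ler_powR; rewrite ?nnegrE ?(ltW pp)// ge_min lexx orbT.
 have ih : intg (fun x => `|h x| `^ (p / (p - 1))).
  by apply: eq_integrable (iwk k) => // x _ /=; rewrite hE.
 have th := test_hoelder p1 mh (ex_intro _ _ hM) ih.
 have := wM h _ th.
 have E : \int[mu]_x (`|h x| `^ (p / (p - 1))) = \int[mu]_x (wk k x `^ p) by apply: eq_Rint => x; exact: hE.
 rewrite E.
 have ge : \int[mu]_x (wk k x `^ p) <= \int[mu]_x (w x * h x).
  apply: le_Rintegral => //; first exact: intg_mulb iw mh hM.
  move=> x _; rewrite /h mulrA [w x * _]mulrC -normrEsg -(mulr_powRB1 (wk0 k x) p0).
  by rewrite ler_wpM2r ?powR_ge0// ge_min lexx.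
 move=> /(le_trans (ler_norm _)) /(le_trans ge); move: (I0 k); move: (\int[mu]_x _) => I I'0 II.
 have [->|In] := eqVneq I 0; first exact: powR_ge0.
 have Ip : 0 < I by rewrite lt_neqAle eq_sym In.
 have : I `^ p^-1 <= M.
  have EI : I = I `^ p^-1 * I `^ (1 - p^-1) by rewrite -powRD ?subrKC ?powRr1//; apply/implyP => _; rewrite gt_eqF.
  by move: II; rewrite {1}EI ler_pM2r// powR_gt0.
 move=> IM; have -> : I = (I `^ p^-1) `^ p by rewrite -powRrM mulVf ?gt_eqF// powRr1.
 by apply: ge0_ler_powR; rewrite ?nnegrE ?(ltW p0) ?powR_ge0.
have mp (k : nat) : measT (fun x => (wk k x `^ p)%:E).
 by apply/measurable_EFinP; exact: (measurableT_comp (measurable_powR p)).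
have -> : (Lp_norm p w = (\int[mu]_x (`|w x| `^ p)%:E) `^ p^-1)%E by rewrite /Lp_norm unlock.
have cw x : (wk k x `^ p)%:E @[k --> \oo] --> (`|w x| `^ p)%:E.
 apply: cvg_near_cst; exists (Num.truncn `|w x|).+1 => // k /= wk'.
 by rewrite /wk (min_idPl _)//; apply: le_trans (ltW (truncnS_gt _)) _; rewrite ler_nat.
have := @cvg_monotone_convergence _ _ _ mu _ measurableT _ mp.
have -> : (\int[mu]_x (`|w x| `^ p)%:E = \int[mu]_x limn (fun k => (wk k x `^ p)%:E))%E.
 by apply: eq_integral => x _; rewrite (cvg_lim _ (cw x)).
have n0 k x : setT x -> (0 <= (wk k x `^ p)%:E)%E by rewrite lee_fin powR_ge0.
have nd x : setT x -> nondecreasing_seq (fun k => (wk k x `^ p)%:E).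
 move=> _ k k' kk; rewrite lee_fin; apply: ge0_ler_powR; rewrite ?nnegrE ?(ltW p0)//.
 by rewrite /wk le_min !ge_min lexx/= ler_nat kk orbT.
move=> /(_ n0 nd) cI.
have : (\int[mu]_x limn (fun k => (wk k x `^ p)%:E) <= (M `^ p)%:E)%E.
 rewrite -(cvg_lim _ cI)//; apply: lime_le; first by apply/cvg_ex; eexists; exact: cI.
 apply: nearW => k; have := H k; rewrite /Rintegral -lee_fin fineK//.
 by apply: integrable_fin_num => //; exact: iwk.
have : (0 <= \int[mu]_x limn (fun k => (wk k x `^ p)%:E))%E.
 apply: integral_ge0 => x _; rewrite (cvg_lim _ (cw x))// lee_fin; exact: powR_ge0.
move: (integral _ _ _) => I'; case: I' => [I'||]//; rewrite !lee_fin => I0' IM.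
apply: le_trans (ge0_ler_powR _ _ _ IM) _; rewrite ?invr_ge0 ?(ltW p0) ?nnegrE ?powR_ge0//.
by rewrite -powRrM mulfV ?gt_eqF// powRr1.
Qed.

End dual_to_Lp.

(** * Hölder constants and the variation of the statement *)

Section lipschitz_constants.
Implicit Types (g : Rn -> R) (x y : Rn) (j : 'I_n).

Lemma norm_le_enorm x : `|x| <= enorm x.
Proof.
have e0 : 0 <= enorm x by exact: sqrtr_ge0.
apply: norm_row_le => // i.
rewrite -sqrtr_sqr ler_wsqrtr// (bigD1 i)//= lerDl sumr_ge0// => j _; exact: sqr_ge0.
Qed.

Lemma enorm_le_norm x : enorm x <= n%:R * `|x|.
Proof.
have nx : 0 <= n%:R * `|x| by rewrite mulr_ge0.
rewrite -(ger0_norm nx) -sqrtr_sqr ler_wsqrtr//.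
apply: (@le_trans _ _ (\sum_(i < n) `|x| ^+ 2)).
 apply: ler_sum => i _; rewrite -[leLHS]real_normK ?num_real// ler_sqr ?nnegrE//.
 exact: coord_le.
have -> : \sum_(i < n) `|x| ^+ 2 = n%:R * `|x| ^+ 2 by rewrite sumr_const card_ord mulr_natl.
rewrite exprMn; apply: ler_wpM2r; first exact: sqr_ge0.
by rewrite -natrX ler_nat expnS leq_pmulr.
Qed.

Lemma Lip_ge0 (b : R) g : (0 <= Lip b g)%E.
Proof.
have ne : (0 : Rn) != const_mx 1 by rewrite eq_sym; apply/eqP => /rowP /(_ ord0); rewrite !mxE; exact/eqP/oner_neq0.
apply: le_trans (ereal_sup_ubound _); last by exists (0, const_mx 1).
by rewrite lee_fin divr_ge0 ?powR_ge0.
Qed.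

Lemma Lip_le (b c : R) g : 0 <= b -> 0 <= c -> (forall x y, `|g x - g y| <= c * `|x - y| `^ b) -> (Lip b g <= c%:E)%E.
Proof.
move=> b0 c0 gc; apply: ge_ereal_sup => _ [[x y] /= xy <-]; rewrite lee_fin.
have e0 : 0 < enorm (x - y) by rewrite (lt_le_trans _ (norm_le_enorm _))// normr_gt0 subr_eq0.
rewrite ler_pdivrMr ?powR_gt0// (le_trans (gc x y))// ler_wpM2l//.
by apply: ge0_ler_powR; rewrite ?nnegrE ?norm_le_enorm// ltW.
Qed.

(** The factor [n] converts the Euclidean norm in [Lip] into the sup norm; it is at least [n] to the
    power [b]. *)
Lemma le_Lip (b c : R) g : 0 <= b <= 1 -> 0 <= c -> (Lip b g <= c%:E)%E ->
 forall x y, `|g x - g y| <= n%:R * c * `|x - y| `^ b.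
Proof.
move=> /andP[b0 b1] c0 gc x y; have [->|xy] := eqVneq x y.
 by rewrite !subrr !normr0 !mulr_ge0 ?powR_ge0.
have e0 : 0 < enorm (x - y) by rewrite (lt_le_trans _ (norm_le_enorm _))// normr_gt0 subr_eq0.
have : ((`|g x - g y| / enorm (x - y) `^ b)%:E <= c%:E)%E.
 by apply: le_trans gc; apply: ereal_sup_ubound; exists (x, y).
rewrite lee_fin ler_pdivrMr ?powR_gt0// => /le_trans; apply.
rewrite [n%:R * c]mulrC -mulrA ler_wpM2l//.
apply: (@le_trans _ _ ((n%:R * `|x - y|) `^ b)).
 by apply: ge0_ler_powR; rewrite ?nnegrE ?enorm_le_norm ?mulr_ge0// ltW.
rewrite powRM// ler_wpM2r ?powR_ge0// -[leRHS]powRr1// ler_powR// ler1n//.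
Qed.

Lemma Lip_fin (b : R) g : (Lip b g < +oo)%E -> exists2 c : R, 0 <= c & Lip b g = c%:E.
Proof.
move: (Lip_ge0 b g); case: (Lip b g) => [c||]//; rewrite lee_fin => c0 _; by exists c.
Qed.

Lemma is_Lip_lip g : is_Lip g -> exists2 c : R, 0 <= c & Lip 1 g = c%:E /\ lip (n%:R * c) g.
Proof.
move=> /Lip_fin[c c0 gc]; exists c => //; split => // x y.
by rewrite -[`|x - y|]powRr1//; apply: le_Lip; rewrite ?ler01 ?lexx ?gc.
Qed.

Lemma lip_is_Lip L F : 0 <= L -> lip L F -> (Lip 1 F <= L%:E)%E.
Proof. by move=> L0 FL; apply: Lip_le => // x y; rewrite powRr1. Qed.

End lipschitz_constants.

Section variation.
Implicit Types (x y : Rn).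

Lemma rV_cons0 (z : R) (y : 'rV[R]_m) : rV_cons (z, y) ord0 ord0 = z.
Proof. by have /(congr1 fst) := rV_consK (z, y). Qed.

(** The variation puts the scalar function in the first component. Completed by the coordinates
    other than [i], this is the identity with component [i] replaced by [F], up to a permutation of
    the components and hence a sign. *)
Lemma ae_detD_cons L F i : lip L F ->
 exists b : bool, {ae mu, forall x,
  detD (fun z => rV_cons (F z, \row_j z ord0 (lift i j))) x = (-1) ^+ b * pd i F x}.
Proof.
move=> FL; exists (lift_perm ord0 i 1%g : bool); pose s : 'S_n := lift_perm ord0 i 1%g.
pose p (x : Rn) : Rn := x *m perm_mx s^-1%g.
have pE x : p x = \row_j x ord0 (s j).
 apply/rowP => j; rewrite /p !mxE (bigD1 (s j))//= big1 => [|k ks].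
  by rewrite !mxE permK eqxx mulr1 addr0.
 rewrite !mxE; case: eqP => [E|]; last by rewrite mulr0.
 by move: ks; rewrite -E permKV eqxx.
have pD x : isdiff p x (perm_mx s^-1%g).
 move=> e e0; exists 1 => // h _; rewrite /p mulmxDl [_ + h *m _]addrC addrK subrr normr0.
 by rewrite mulr_ge0 ?(ltW e0).
have cE : (fun z : Rn => rV_cons (F z, \row_j z ord0 (lift i j))) = p \o updc i F id.
 apply/funext => z; apply/rowP => j /=; rewrite pE [RHS]mxE [RHS]mxE.
 have [k ->|->] := unliftP ord0 j.
  by rewrite rV_cons_lift mxE lift_perm_lift permE eq_sym (negbTE (neq_lift _ _)).
 by rewrite rV_cons0 lift_perm_id eqxx.
have uL := lips_updc i (@lips_id R m) FL.
rewrite cE; apply: aeS2 (ae_lips_isdiff uL) (ae_detD_updc_id i FL) => x dx <-.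
rewrite (detD_isdiff_comp dx (pD _)) (detD_isdiff (pD _)) det_perm.
by rewrite odd_permV.
Qed.

(** The remaining components are coordinates, with Lipschitz constants at most 1. The factor 2
    arises when the [a]-Hölder constant of [F] is interpolated between its oscillation [2 * S'] and
    its Lipschitz constant. The strict inequality yields an admissible constant below [B] without
    attaining the infimum. *)
Lemma Valpha_CV (a B : R) u : 0 <= a < 1 -> intg u -> (Valpha a u < B%:E)%E -> CV a (fun=> 2 * B) u.
Proof.
move=> /andP[a0 a1] iu /ereal_inf_lt[C [C0 CP] CB] i F S' L S0 L0 FL FS.
have FLip : (Lip 1 F <= L%:E)%E := lip_is_Lip L0 FL.
pose g (z : Rn) : 'rV[R]_m := \row_j z ord0 (lift i j).
have gL j : lip 1 (component g j).
 by move=> x y; rewrite mul1r /component !mxE; apply: le_trans (coord_le (x - y) (lift i j)); rewrite !mxE.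
have gLip j : (Lip 1 (component g j) <= 1%:E)%E := lip_is_Lip ler01 (gL j).
have Fa : (Lip a F <= (2 * (S' `^ (1 - a) * L `^ a))%:E)%E.
 apply: Lip_le => [||x y]//; first by rewrite !mulr_ge0 ?powR_ge0.
 have z0 := normr_ge0 (F x - F y); have z1 := FL x y.
 have z2 : `|F x - F y| <= 2 * S'.
  by rewrite (le_trans (ler_normB _ _))// mulr_natl mulr2n lerD.
 have zE : `|F x - F y| = `|F x - F y| `^ (1 - a) * `|F x - F y| `^ a.
  by rewrite -powRD ?subrK ?powRr1// oner_eq0.
 have a1' : 0 <= 1 - a by rewrite subr_ge0 ltW.
 rewrite zE; apply: (@le_trans _ _ ((2 * S') `^ (1 - a) * (L * `|x - y|) `^ a)).
  by apply: ler_pM; rewrite ?powR_ge0//; apply: ge0_ler_powR; rewrite ?nnegrE// mulr_ge0.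
 rewrite !powRM// -!mulrA ler_wpM2r ?mulr_ge0 ?powR_ge0//.
 by rewrite -[leRHS]powRr1// ler_powR ?ler1n// gerBl.
have FL1 : is_Lip F by exact: le_lt_trans FLip (ltry _).
have gL1 : is_Lip_map g by move=> j; exact: le_lt_trans (gLip j) (ltry _).
have := CP F g FL1 gL1; set D := fun z => rV_cons _.
have C0' : (0 <= B%:E)%E by rewrite (le_trans C0)// ltW.
have up : (C * Lip a F * \prod_(j < m) Lip 1 (component g j) <= (2 * B * (S' `^ (1 - a) * L `^ a))%:E)%E.
 have -> : 2 * B * (S' `^ (1 - a) * L `^ a) = B * (2 * (S' `^ (1 - a) * L `^ a)) * 1 by ring.
 rewrite !EFinM; apply: lee_pmul; rewrite ?mule_ge0 ?Lip_ge0//.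
 - by apply: prode_ge0 => j _; exact: Lip_ge0.
 - by apply: lee_pmul; rewrite ?Lip_ge0// ltW.
 - suff /andP[] : (0 <= \prod_(j < m) Lip 1 (component g j) <= 1%:E)%E by [].
  elim/big_rec : _ => [|j z _ /andP[z0 z1]]; first by rewrite lee01 lexx.
  rewrite mule_ge0 ?Lip_ge0//= -[leRHS]mule1; apply: lee_pmul; rewrite ?Lip_ge0//; exact: gLip.
move=> /le_trans /(_ up).
have DL : lips (fun k => if unlift ord0 k is Some j then 1 else L) D.
 move=> k; have [j ->|->] := unliftP ord0 k.
  by move=> x y; rewrite /D !rV_cons_lift; exact: gL.
 by move=> x y; rewrite /D !rV_cons0; exact: FL.
have [MD hMD] := detD_bnd DL; have mD := lips_meas_detD DL.
have iD := intg_mulb iu mD hMD.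
have -> : (\int[mu]_x (u x * detD D x)%:E = (\int[mu]_x (u x * detD D x))%:E)%E.
 by rewrite /Rintegral fineK//; exact: integrable_fin_num.
rewrite lee_fin => /(le_trans _); apply.
have [c aec] := ae_detD_cons i FL.
suff -> : \int[mu]_x (u x * detD D x) = (-1) ^+ c * \int[mu]_x (u x * pd i F x).
 by rewrite normrM normrX normrN1 expr1n mul1r.
have [MP hMP] := pd_bounded i FL; have mP := meas_pd i FL.
have ip := intg_mulb iu mP hMP.
rewrite -RintegralZl//; apply: eq_Rint_ae; first exact: intg_meas iD.
 exact: intg_meas (intg_scale _ ip).
by apply: aeS aec => x ->; rewrite mulrCA.
Qed.

Lemma Valpha_lty (b Y : R) v : 0 <= b <= 1 -> intg v -> 0 <= Y ->
 (forall (f : Rn -> Rn) (L : 'I_n -> R) (y : R), allnneg L -> lips L f -> 0 <= y ->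
  (forall x z, `|f x ord0 ord0 - f z ord0 ord0| <= y * `|x - z| `^ b) ->
  `|\int[mu]_x (v x * detD f x)| <= Y * (y * \prod_(k < n | k != ord0) L k)) ->
 (Valpha b v < +oo)%E.
Proof.
move=> b01 iv Y0 vY.
pose Y' := Y * (n%:R * n%:R ^+ m) + 1.
have Y'0 : 0 < Y' by rewrite ltr_wpDl// !mulr_ge0// exprn_ge0.
apply: (@le_lt_trans _ _ Y'%:E); last exact: ltry.
apply: ereal_inf_lbound; split; first by rewrite lee_fin ltW.
move=> f g fL gL.
have [c c0 [cE fc]] := is_Lip_lip fL.
have /choice[G GP] j : exists d : R, 0 <= d /\ Lip 1 (component g j) = d%:E /\ lip (n%:R * d) (component g j).
 by have [d d0 dP] := is_Lip_lip (gL j); exists d.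
pose L (k : 'I_n) := if unlift ord0 k is Some j then n%:R * G j else n%:R * c.
have L0 l : 0 <= L l.
 by rewrite /L; case: unlift => [j|]; rewrite mulr_ge0//; case: (GP j).
pose Phi z := rV_cons (f z, g z).
have PL : lips L Phi.
 move=> k; have [j ->|->] := unliftP ord0 k.
  by rewrite /L liftK => x y; rewrite !rV_cons_lift; case: (GP j) => _ [_]; exact.
 by rewrite /L unlift_none => x y; rewrite !rV_cons0; exact: fc.
have PLE : \prod_(k < n | k != ord0) L k = n%:R ^+ m * \prod_j G j.
 rewrite big_mkcond big_ord_recl eqxx/= mul1r.
 rewrite (eq_bigr (fun j => n%:R * G j)) => [|j _]; last by rewrite /L liftK.
 by rewrite big_split/= prodr_const card_ord.
have [MD hMD] := detD_bnd PL; have mD := lips_meas_detD PL.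
have iD := intg_mulb iv mD hMD.
have -> : (\int[mu]_x (v x * detD Phi x)%:E = (\int[mu]_x (v x * detD Phi x))%:E)%E.
 by rewrite /Rintegral fineK//; exact: integrable_fin_num.
have -> : (\prod_(j < m) Lip 1 (component g j) = (\prod_j G j)%:E)%E.
 by rewrite (big_morph EFin EFinM (erefl : 1%:E = 1%E)); apply: eq_bigr => j _; case: (GP j) => _ [].
have PG0 : 0 <= \prod_j G j by apply: prodr_ge0 => j _; case: (GP j).
(* If some [G j] is 0, the determinant vanishes almost everywhere while the right-hand side is
   nonnegative, even for infinite [Lip b f]. *)
have [Z|nZ] := eqVneq (\prod_j G j) 0.
 have -> : \int[mu]_x (v x * detD Phi x) = 0.
  apply: etrans (eq_Rint_ae (h := fun=> 0) (intg_meas iD) _ _) _ => //; last by rewrite /Rintegral integral0.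
  apply: aeS (ae_detD_le L0 PL) => x.
  rewrite (bigD1 ord0)//= PLE Z !mulr0 normr_le0 => /eqP ->; exact: mulr0.
 by rewrite abse0 !mule_ge0 ?Lip_ge0// lee_fin ltW.
have PGp : 0 < \prod_j G j by rewrite lt_neqAle eq_sym nZ.
(* For infinite [Lip b f] the right-hand side is infinite, its other factors being positive. *)
have [yoo|/Lip_fin[y y0 yE]] := leP +oo%E (Lip b f).
 move: yoo; rewrite leye_eq => /eqP ->.
 by rewrite gt0_muley ?lte_fin// gt0_mulye ?lte_fin// leey.
rewrite yE -!EFinM lee_fin.
have fb x z : `|Phi x ord0 ord0 - Phi z ord0 ord0| <= n%:R * y * `|x - z| `^ b.
 by rewrite !rV_cons0; apply: le_Lip => //; rewrite yE.
have ny : 0 <= n%:R * y by rewrite mulr_ge0.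
apply: le_trans (vY _ _ _ L0 PL ny fb) _; rewrite PLE.
rewrite (_ : Y * _ = Y * (n%:R * n%:R ^+ m) * y * \prod_j G j); last by ring.
by rewrite !ler_wpM2r// lerDl.
Qed.

End variation.

(** * Limits of push-forwards, independent of sequences *)

Section limits_of_pushforwards.
Variables (al : 'I_n -> R) (u : Rn -> R).

Lemma dual_ae (s M : R) (v w : Rn -> R) : intg v -> intg w -> {ae mu, forall x, v x = w x} -> dual s M v -> dual s M w.
Proof.
move=> iv iw vw vM h A th; have [_ mh _ _] := th.
rewrite (_ : \int[mu]_x (w x * h x) = \int[mu]_x (v x * h x)); first exact: vM.
apply: eq_Rint_ae; [exact: measurable_funM (intg_meas iw) mh|exact: measurable_funM (intg_meas iv) mh|].
by apply: aeS vw => x ->.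
Qed.

Implicit Types (g : Rn -> Rn) (j : 'I_n) (H : 'I_n -> R).

(** Approximation without sequences: [e] is uniform over all Lipschitz [g] with Hölder constants
    [H], so that uniqueness and independence of the approximating sequence follow at once. *)
Definition push_lim H f v := forall eta, 0 < eta -> exists2 e : R, 0 < e & forall g L w,
 hol al H g -> lips L g -> allnneg L -> ispush u g w ->
 (forall j x, `|f x ord0 j - g x ord0 j| <= e) -> \int[mu]_x `|v x - w x| <= eta.

(** Every bound [H] is allowed because an approximating sequence may have larger Hölder constants
    than [f]. *)
Definition islim f v := intg v /\ forall H, allpos H -> hol al H f -> push_lim H f v.

Lemma hol_le H H' f : (forall j, H j <= H' j) -> hol al H f -> hol al H' f.
Proof. by move=> HH fH j x y; rewrite (le_trans (fH j x y))// ler_wpM2r ?powR_ge0. Qed.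

Lemma push_lim_le H H' f v : (forall j, H j <= H' j) -> push_lim H' f v -> push_lim H f v.
Proof.
move=> HH fv eta eta0; have [e e0 eP] := fv eta eta0; exists e => // g L w gH.
exact: eP (hol_le HH gH).
Qed.

Hypotheses (al01 : forall j, 0 < al j <= 1) (iu : intg u) (su : csupp u).

Lemma apx_exists H f e : allpos H -> hol al H f -> 0 < e -> exists g L,
 [/\ hol al H g, lips L g, forall j, 0 <= L j & forall j x, `|f x ord0 j - g x ord0 j| <= e].
Proof.
move=> H0 fH e0; pose F j := (e / H j) `^ (al j)^-1.
have F0 j : 0 < F j by rewrite powR_gt0// divr_gt0.
pose r := \big[Num.min/1]_j F j.
have r0 : 0 < r by apply: lt_bigmin.
exists (apx al H r f), (fun j => H j * r `^ (al j - 1)); split.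
- exact: apx_hol.
- exact: apx_lips.
- by move=> j; rewrite mulr_ge0 ?powR_ge0// ltW.
move=> j x; rewrite distrC (le_trans (apx_close al01 H0 j x r0 fH))//.
rewrite mulrC -ler_pdivlMr//; have /andP[a0 _] := al01 j.
have : r `^ al j <= F j `^ al j.
 by apply: ge0_ler_powR; rewrite ?nnegrE ?(ltW a0) ?(ltW r0) ?(ltW (F0 j))//; exact: bigmin_le_cond.
by rewrite /F -powRrM mulVf ?gt_eqF// powRr1// divr_ge0// ltW.
Qed.

Lemma push_lim_unique H f v v' : allpos H -> hol al H f -> intg v -> intg v' ->
 push_lim H f v -> push_lim H f v' -> {ae mu, forall x, v x = v' x}.
Proof.
move=> H0 fH iv iv' fv fv'; apply: ae_eq_L1_small => // eta eta0.
have eta2 : 0 < eta / 2 by rewrite divr_gt0.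
have [e e0 eP] := fv _ eta2; have [e' e'0 eP'] := fv' _ eta2.
have me0 : 0 < Num.min e e' by rewrite lt_min e0.
have [g [L [gH gL L0 fg]]] := apx_exists H0 fH me0.
have [w uw] := ispush_exists gL iu su; have [iw _ _] := uw.
apply: le_trans (L1_triangle iv iw iv') _; rewrite [leRHS](splitr eta); apply: lerD.
 by apply: eP gH gL L0 uw _ => j x; rewrite (le_trans (fg j x))// ge_min lexx.
rewrite (eq_Rint _ (h := fun x => `|v' x - w x|)); last by move=> x; exact: distrC.
by apply: eP' gH gL L0 uw _ => j x; rewrite (le_trans (fg j x))// ge_min lexx orbT.
Qed.

Lemma push_lim_ae H f v v' : intg v -> intg v' -> {ae mu, forall x, v x = v' x} -> push_lim H f v -> push_lim H f v'.
Proof.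
move=> iv iv' vv fv eta eta0; have [e e0 eP] := fv eta eta0; exists e => // g L w gH gL L0 uw fg.
have [iw _ _] := uw; apply: le_trans (eP g L w gH gL L0 uw fg).
apply: eq_ler; apply: eq_Rint_ae.
- exact: intg_meas (intg_dist iv' iw).
- exact: intg_meas (intg_dist iv iw).
by apply: aeS vv => x ->.
Qed.

Lemma islim_ae f v v' : intg v' -> {ae mu, forall x, v x = v' x} -> islim f v -> islim f v'.
Proof. by move=> iv' vv [iv fv]; split => // H H0 fH; apply: push_lim_ae vv _ => //; exact: fv. Qed.

(** Testing against the sign of [w] outside the cube gives the mass of [w] there; the other side
    vanishes because [g] maps the cube that carries [u] into [cube N']. *)
Lemma ispush_ae0 g w L N N' : lips L g -> ispush u g w -> vanish N u ->
 (forall x, cube N x -> cube N' (g x)) -> {ae mu, forall y, ~ cube N' y -> w y = 0}.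
Proof.
move=> gL [iw _ wE] uN gN; have mw := intg_meas iw.
pose ind (y : Rn) : R := \1_(~` cube N') y.
have mi : measT ind by apply: measurable_indic; apply: measurableC; exact: meas_cube.
have ms : measT (fun y => Num.sg (w y)) by exact: (measurableT_comp measurable_sg).
have ind1 y : `|ind y| <= 1 by rewrite /ind indicE; case: (_ \in _); rewrite ?normr1 ?normr0.
have sg1 y : `|Num.sg (w y) * ind y| <= 1.
 by rewrite normrM normr_sg -[leRHS]mulr1 ler_pM//; case: (_ != _).
have ii : intg (fun y => w y * ind y) := intg_mulb iw mi ind1.
have i0 : intg (fun=> 0 : R) by apply: eq_integrable (integrable0 mu setT).
have := wE _ _ (measurable_funM ms mi) sg1.
have -> : \int[mu]_x (u x * (Num.sg (w (g x)) * ind (g x)) * detD g x) = 0.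
 rewrite (eq_Rint _ (h := fun=> 0)); first by rewrite /Rintegral integral0.
 move=> x; have [Nx|Nx] := pselect (cube N x); last by rewrite uN// !mul0r.
 rewrite /ind indicE memNset ?mulr0 ?mul0r//= => h; apply: h; exact: gN.
move=> I0; have : {ae mu, forall x, w x * ind x = (fun=> 0) x}.
 apply: ae_eq_L1_small => // e e0; rewrite (le_trans _ (ltW e0))//.
 apply: eq_ler; apply: etrans I0; apply: eq_Rint => y.
 have y0 : 0 <= ind y by rewrite /ind indicE.
 by rewrite subr0 normrM (ger0_norm y0) normrEsg /= mulrCA mulrA.
apply: aeS => y /= + Ny; rewrite /ind indicE mem_set// mulr1; exact.
Qed.

Lemma islim_supp f v H N : allpos H -> hol al H f -> islim f v -> 0 <= N ->
 vanish N u -> exists2 N' : R, 0 <= N' & {ae mu, forall y, ~ cube N' y -> v y = 0}.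
Proof.
move=> H0 fH [iv fv] N0 uN.
pose b := `|f 0| + \sum_j H j * N `^ al j.
have b0 : 0 <= b by rewrite addr_ge0// sumr_ge0// => j _; rewrite mulr_ge0 ?powR_ge0// ltW.
have fb x : cube N x -> `|f x| <= b.
 move=> /(cubeP _ N0) xN; apply: norm_row_le => // j.
 rewrite -[f x ord0 j](subrK (f 0 ord0 j)) addrC (le_trans (ler_normD _ _))// lerD ?coord_le//.
 apply: le_trans (fH j x 0) _; rewrite subr0 (bigD1 j)//=.
 apply: (@le_trans _ _ (H j * N `^ al j)).
  have /andP[a0 _] := al01 j.
  by rewrite ler_wpM2l ?(ltW (H0 j))//; apply: ge0_ler_powR; rewrite ?nnegrE// ltW.
 by rewrite lerDl sumr_ge0// => l _; rewrite mulr_ge0 ?powR_ge0// ltW.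
have N'0 : 0 <= b + 1 by rewrite addr_ge0.
exists (b + 1) => //.
pose ind (y : Rn) : R := \1_(~` cube (b + 1)) y.
have mi : measT ind by apply: measurable_indic; apply: measurableC; exact: meas_cube.
have ind01 y : 0 <= ind y <= 1 by rewrite /ind indicE; case: (_ \in _); rewrite ?lexx ?ler01.
have ind1 y : `|ind y| <= 1 by have /andP[? ?] := ind01 y; rewrite ger0_norm.
have i0 : intg (fun=> 0 : R) by apply: eq_integrable (integrable0 mu setT).
have iw' := intg_mulb iv mi ind1.
suff : {ae mu, forall x, v x * ind x = (fun=> 0) x}.
 by apply: aeS => y /= + Ny; rewrite /ind indicE mem_set// mulr1; exact.
apply: ae_eq_L1_small => // eta eta0.
have [e e0 eP] := fv H H0 fH eta eta0.
have me : 0 < Num.min e 1 by rewrite lt_min e0 ltr01.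
have [g [L [gH gL L0 fg]]] := apx_exists H0 fH me.
have [w uw] := ispush_exists gL iu su; have [iw _ _] := uw.
have gN x : cube N x -> cube (b + 1) (g x).
 move=> Nx; apply/cubeP => //; rewrite -[g x](subrK (f x)) addrC.
 rewrite (le_trans (ler_normD _ _))// lerD ?fb//; apply: norm_row_le => // j.
 by rewrite !mxE distrC (le_trans (fg j x))// ge_min lexx orbT.
have w0 := ispush_ae0 gL uw uN gN.
apply: le_trans (eP g L w gH gL L0 uw _); last first.
 by move=> j x; rewrite (le_trans (fg j x))// ge_min lexx.
have -> : \int[mu]_x `|v x * ind x - 0| = \int[mu]_x (`|v x - w x| * ind x).
 apply: eq_Rint_ae.
 - by apply: intg_meas; apply: intg_abs; exact: intg_sub iw' i0.
 - by apply: measurable_funM => //; exact: intg_meas (intg_dist iv iw).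
 apply: aeS w0 => y wy; rewrite subr0 /ind indicE.
 case: (boolP (y \in _)) => [|_]; last by rewrite !mulr0 normr0.
 by move=> /set_mem /wy ->; rewrite !mulr1 subr0.
apply: le_Rintegral => //.
- exact: intg_mulb (intg_dist iv iw) mi ind1.
- exact: intg_dist iv iw.
by move=> y _; rewrite ler_piMr//; case/andP: (ind01 y).
Qed.

Section decomposed.
Variables (a C B K : R) (U : nat -> Rn -> R).
Hypotheses (a01 : 0 <= a < 1) (al_gt : m%:R + a < \sum_j al j) (C0 : 0 <= C) (B0 : 0 <= B) (K0 : 0 <= K).
Hypotheses (U0 : \int[mu]_x `|U 0%N x| <= C * B).
Hypothesis UP : forall k : nat, [/\ intg (U k), vanish K (U k),
    \int[mu]_x `|u x - U k x| <= C * B * (2^-1 `^ (1 - a)) ^+ k &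
    CV 0 (fun=> C * B * (2 `^ a) ^+ k) (U k)].

(** The case [s = 0] of [repr_dual_close], where [dual] controls the [L^1] norm. *)
Lemma repr_push_lim H f v : allpos H -> repr al H U f v -> push_lim H f v.
Proof.
move=> H0 fv eta eta0; have [fH iv _] := fv.
have z0 : n%:R * 0 < 1 :> R by rewrite mulr0.
have ths : 0 < \sum_j al j - (m%:R + a) - (\sum_j al j) * 0 by rewrite mulr0 subr0 subr_gt0.
have [Cs Cs0 CsP] := dual_CV0 (lexx 0) z0.
have [e e0 eP] := repr_dual_close al01 H0 a01 C0 B0 K0 iu U0 UP ths Cs0 CsP z0 eta0.
exists e => // g L w gH gL L0 uw fg.
have gw := repr_lips al01 H0 a01 al_gt C0 B0 K0 iu UP gH gL L0 uw.
have [iw _ _] := uw; apply: dual0_L1 (intg_sub iv iw) _.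
exact: eP fv gw fg.
Qed.

Lemma islim_repr H f v v' : allpos H -> islim f v -> repr al H U f v' -> {ae mu, forall x, v x = v' x}.
Proof.
move=> H0 [iv fv] fv'; have [fH iv' _] := fv'.
exact: push_lim_unique H0 fH iv iv' (fv H H0 fH) (repr_push_lim H0 fv').
Qed.

Lemma push_lim_islim H f v : allpos H -> hol al H f -> intg v -> push_lim H f v -> islim f v.
Proof.
move=> H0 fH iv fv; split => // H' H'0 fH'.
pose G j := Num.max (H j) (H' j).
have G0 j : 0 < G j by rewrite lt_max H0.
have HG j : H j <= G j by rewrite le_max lexx.
have HG' j : H' j <= G j by rewrite le_max lexx orbT.
have [v2 fv2] := repr_exists al01 G0 a01 al_gt C0 B0 K0 iu U0 UP (hol_le HG fH).
have [_ iv2 _] := fv2; have lv2 := repr_push_lim G0 fv2.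
apply: (push_lim_ae iv2 iv) (push_lim_le HG' lv2).
exact: push_lim_unique H0 fH iv2 iv (push_lim_le HG lv2) fv.
Qed.

Lemma islim_exists H f : allpos H -> hol al H f -> exists v, islim f v.
Proof.
move=> H0 fH; have [v fv] := repr_exists al01 H0 a01 al_gt C0 B0 K0 iu U0 UP fH.
have [_ iv _] := fv; exists v; exact: push_lim_islim H0 fH iv (repr_push_lim H0 fv).
Qed.

Lemma islim_repr_exists H f v : allpos H -> hol al H f -> islim f v ->
 exists2 v', repr al H U f v' & {ae mu, forall x, v' x = v x}.
Proof.
move=> H0 fH fv; have [v' fv'] := repr_exists al01 H0 a01 al_gt C0 B0 K0 iu U0 UP fH.
by exists v' => //; apply: aeS (islim_repr H0 fv fv').
Qed.

Lemma islim_close H (s eta : R) : allpos H -> 0 <= s -> n%:R * s < 1 ->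
 0 < \sum_j al j - (m%:R + a) - (\sum_j al j) * s -> 0 < eta ->
 exists2 e : R, 0 < e & forall f g v v', hol al H f -> hol al H g -> islim f v -> islim g v' ->
  (forall j x, `|f x ord0 j - g x ord0 j| <= e) -> dual s eta (fun x => v x - v' x).
Proof.
move=> H0 s0 s1 ths eta0; have [Cs Cs0 CsP] := dual_CV0 s0 s1.
have [e e0 eP] := repr_dual_close al01 H0 a01 C0 B0 K0 iu U0 UP ths Cs0 CsP s1 eta0.
exists e => // f g v v' fH gH fv gv' fg.
have [w fw wv] := islim_repr_exists H0 fH fv; have [w' gw' wv'] := islim_repr_exists H0 gH gv'.
have [_ iw _] := fw; have [_ iw' _] := gw'; have [iv _] := fv; have [iv' _] := gv'.
apply: (dual_ae (intg_sub iw iw') (intg_sub iv iv')); last exact: eP fw gw' fg.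
by apply: aeS2 wv wv' => x -> ->.
Qed.

Lemma islim_BV H f v (b M : R) : allpos H -> hol al H f -> islim f v -> (forall j, al j <= M) ->
 0 <= b <= 1 -> 0 < \sum_j al j - (m%:R + a) - M * (1 - b) -> (Valpha b v < +oo)%E.
Proof.
move=> H0 fH fv alM b01 th; have [w fw wv] := islim_repr_exists H0 fH fv.
have [Y Y0 YP] := repr_BV al01 H0 a01 C0 B0 K0 iu U0 UP fw alM b01 th.
have [_ iw _] := fw; have [iv _] := fv.
apply: (Valpha_lty b01 iv Y0) => g L y L0 gL y0 gb.
have -> : \int[mu]_x (v x * detD g x) = \int[mu]_x (w x * detD g x).
 have mg := lips_meas_detD gL.
 apply: eq_Rint_ae; [exact: measurable_funM (intg_meas iv) mg|exact: measurable_funM (intg_meas iw) mg|].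
 by apply: aeS wv => x ->.
exact: YP.
Qed.

End decomposed.
End limits_of_pushforwards.

(** * Agreement with the push-forward of currents *)

Section lipschitz_pushforward.
Variables (u : Rn -> R) (r : R).
Hypotheses (r0 : 0 <= r) (iu : intg u) (us : ess_spt u `<=` cube r).
Implicit Types (g psi : Rn -> Rn) (j : 'I_n).

(** The support hypothesis makes [u] vanish outside the cube almost everywhere; the estimates ask
    for a representative that vanishes there pointwise. *)
Definition cutoff : Rn -> R := fun x => u x * \1_(cube r) x.

Lemma cutoff_supp x : ~ cube r x -> cutoff x = 0.
Proof. by move=> Nx; rewrite /cutoff indicE memNset ?mulr0. Qed.

Lemma ae_cutoff : {ae mu, forall x, u x = cutoff x}.
Proof.
apply: aeS (ae_ess_spt u) => x xP; rewrite /cutoff indicE.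
case: (boolP (x \in _)) => [|xr]; first by rewrite mulr1.
rewrite mulr0; apply: xP => /us xr'; move: xr; rewrite mem_set//.
Qed.

Lemma cutoff_integrable : intg cutoff.
Proof.
apply: (intg_mulb (M := 1)) => // [|x].
 by apply: measurable_indic; exact: meas_cube.
by rewrite indicE; case: (_ \in _); rewrite ?normr1 ?normr0.
Qed.

Lemma cutoff_csupp : csupp cutoff.
Proof. by exists r => //; exact: cutoff_supp. Qed.

(** The null set where [u] and its cutoff differ has a null image under a Lipschitz map, so almost
    every fibre avoids it. *)
Lemma fiber_cutoff psi L : lips L psi -> {ae mu, forall y,
 \sum_(x \in psi @^-1` [set y]) u x * Num.sg (detD psi x) =
 \sum_(x \in psi @^-1` [set y]) cutoff x * Num.sg (detD psi x)}.
Proof.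
move=> pL; have [K K0 pK] := lips_lip pL.
have [N [mN N0 sN]] := ae_cutoff.
have := lipschitz_image_negligible pK mN N0; apply: negligibleS => y /= yP.
apply: contrapT => nN; apply: yP; apply: eq_fsbigr => x /set_mem /= xy.
congr (_ * _); apply: contrapT => ux; apply: nN; exists x => //; exact: sN.
Qed.

Lemma is_Lip_map_lips psi : is_Lip_map psi -> exists2 L, forall j, 0 <= L j & lips L psi.
Proof.
move=> pL; have /choice[L LP] j : exists c, 0 <= c /\ lip c (fun x => psi x ord0 j).
 by have [c c0 [_ pc]] := is_Lip_lip (pL j); exists (n%:R * c); rewrite mulr_ge0.
by exists L => j; case: (LP j).
Qed.

Lemma lips_is_Lip_map L psi : allnneg L -> lips L psi -> is_Lip_map psi.
Proof. by move=> L0 pL j; exact: le_lt_trans (lip_is_Lip (L0 j) (pL j)) (ltry _). Qed.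

Lemma push_is_pushforward_Lip psi L v : lips L psi -> pushforward_spec cutoff psi r v -> is_pushforward_Lip u psi v.
Proof.
move=> pL [iv sv cv fv]; have cp := ae_cutoff; have ic := cutoff_integrable.
have [K K0 pK] := lips_lip pL.
have cf : compact (psi @` cube r).
 apply: continuous_compact; last exact: compact_cube.
 exact: continuous_subspaceT (lip_continuous pK).
have [N N0 pN] := compact_sub_cube cf.
split.
- by apply: (L1c_ae_supp N0 iv); apply: aeE => y Ny; apply: sv => /pN.
- move=> f g fL gL; have [c c0 [_ fc]] := is_Lip_lip fL; have [G G0 gG'] := is_Lip_map_lips gL.
 (* [f] may be unbounded. Truncating it outside a cube that contains the image of [cube r] changes
    neither integral and gives a bounded test function. *)
 pose h y := f y * \1_(cube N) y * detD g y.
 have [M hM] := detD_bnd gG'.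
 have mf := lip_meas fc.
 have mN : measT (\1_(cube N) : Rn -> R) by apply: measurable_indic; exact: meas_cube.
 have mh : measT h.
  by apply: measurable_funM (lips_meas_detD gG'); exact: measurable_funM.
 have c1 : 0 <= n%:R * c by rewrite mulr_ge0.
 have fb y : `|f y * \1_(cube N) y| <= `|f 0| + n%:R * c * N.
  rewrite normrM indicE; case: (boolP (y \in _)) => [/set_mem /(cubeP _ N0) yN|_]; last first.
   by rewrite normr0 mulr0 addr_ge0 ?mulr_ge0.
  rewrite normr1 mulr1 -[f y](subrK (f 0)) addrC (le_trans (ler_normD _ _))// lerD2l.
  by apply: le_trans (fc y 0) _; rewrite subr0 ler_wpM2l.
 have hb y : `|h y| <= (`|f 0| + n%:R * c * N) * M by rewrite normrM ler_pM.
 have E1 : current_of v f g = \int[mu]_y (v y * h y).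
  apply: eq_Rint => y; rewrite /h.
  have [Ny|Ny] := pselect (cube N y); first by rewrite indicE mem_set// mulr1 !mulrA.
  by rewrite sv ?mul0r// => /pN.
 rewrite E1 (cv _ _ mh hb) /pushforward_functional /current_of.
 have mfp : measT (f \o psi) := measurableT_comp mf (lips_meas pL).
 have gpL : lips (fun j => G j * K) (g \o psi) by move=> j; exact: lip_comp (gG' j) (G0 j) pK.
 have [Kg Kg0 gK] := lips_lip gG'.
 apply: eq_Rint_ae.
 + apply: measurable_funM (lips_meas_detD gpL).
  by apply: measurable_funM => //; exact: intg_meas iu.
 + apply: measurable_funM (lips_meas_detD pL).
  apply: measurable_funM; first exact: intg_meas ic.
  by apply: measurableT_comp mh _; exact: lips_meas pL.
 + apply: aeS2 cp (ae_detD_comp pK gK) => x ux dx; rewrite ux dx /h /=.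
  have : cutoff x = 0 \/ \1_(cube N) (psi x) = 1 :> R.
   have [Nx|Nx] := pselect (cube r x); last by left; exact: cutoff_supp.
   by right; rewrite indicE mem_set//; apply: pN; exists x.
  move: (cutoff x) (\1_(cube N) (psi x)) (detD psi x) (detD g (psi x)) => z1 z2 z3 z4.
  by case=> ->; [rewrite !mul0r|ring].
by apply: aeS2 fv (fiber_cutoff pL) => y -> ->.
Qed.

Lemma is_pushforward_Lip_ispush psi v : is_Lip_map psi -> is_pushforward_Lip u psi v ->
 intg v /\ exists L w, [/\ forall j, 0 <= L j, lips L psi, ispush cutoff psi w & {ae mu, forall y, v y = w y}].
Proof.
move=> pL [[iv _] _ fv]; split => //; have [L L0 pL1] := is_Lip_map_lips pL.
have [K K0 pK] := lips_lip pL1.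
have [w wP] := pushforward_exists pK r0 cutoff_integrable cutoff_supp.
exists L, w; split => //; first exact: pushforward_spec_ispush wP.
case: wP => _ _ _ fw.
by apply: filterS3 fv fw (fiber_cutoff pL1) => y -> -> ->.
Qed.

End lipschitz_pushforward.

(** * The definition by approximation *)

Section pushforward_by_approximation.
Variable al : 'I_n -> R.
Hypothesis al01 : forall j, 0 < al j <= 1.
Implicit Types (g psi phi : Rn -> Rn) (j : 'I_n) (H : 'I_n -> R).

Lemma Lp_cvgP p (v_ : nat -> Rn -> R) v :
 (forall e, 0 < e -> \forall k \near \oo, (Lp_norm p (v_ k \- v)%R <= e%:E)%E) -> Lp_cvg p v_ v.
Proof.
move=> ve; have N0 k : (0 <= Lp_norm p (v_ k \- v)%R)%E by exact: Lnorm_ge0.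
apply/fine_cvgP; split.
 by apply: filterS (ve 1 ltr01) => k k1; rewrite ge0_fin_numE// (le_lt_trans k1)// ltry.
apply/cvgrPdist_le => e e0; apply: filterS (ve e e0) => k ke.
rewrite sub0r normrN ger0_norm ?fine_ge0//=.
by rewrite -lee_fin fineK// ge0_fin_numE// (le_lt_trans ke)// ltry.
Qed.

Lemma Lp_cvg1 (v_ : nat -> Rn -> R) v e : (forall k, intg (v_ k)) -> intg v -> Lp_cvg 1 v_ v -> 0 < e ->
 \forall k \near \oo, \int[mu]_x `|v_ k x - v x| <= e.
Proof.
move=> iv_ iv /fine_cvgP[_ /cvgrPdist_le /(_ e)] h e0; apply: filterS (h e0) => k.
have ik : intg (v_ k \- v) := intg_sub (iv_ k) iv.
rewrite sub0r normrN /= (Lp_norm_1 ik)/= ger0_norm//.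
by apply: Rintegral_ge0 => x _; exact: normr_ge0.
Qed.

(** An excess [e > 0] makes the constants positive even where a Hölder constant is 0, as the
    divisions by [H j] require. *)
Lemma Lip_hol (c : 'I_n -> R) (e : R) phi : allnneg c -> 0 <= e ->
 (forall j, (Lip (al j) (component phi j) <= (c j)%:E)%E) -> hol al (fun j => n%:R * (c j + e)) phi.
Proof.
move=> c0 e0 pc j x y; have /andP[a0 a1] := al01 j.
have a01 : 0 <= al j <= 1 by rewrite ltW.
by apply: (le_Lip (g := component phi j) a01 (addr_ge0 (c0 j) e0)); rewrite (le_trans (pc j))// lee_fin lerDl.
Qed.

Lemma hol_Lip H phi j : allpos H -> hol al H phi -> (Lip (al j) (component phi j) <= (H j)%:E)%E.
Proof.
move=> H0 pH; have /andP[a0 _] := al01 j.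
by apply: Lip_le; [exact: ltW|exact: ltW|exact: pH].
Qed.

Lemma Lip_fin_hol phi : (forall i, (Lip (al i) (component phi i) < +oo)%E) ->
 exists2 H, forall j, 0 < H j & hol al H phi.
Proof.
move=> pL; have /choice[c cP] j : exists c : R, 0 <= c /\ Lip (al j) (component phi j) = c%:E.
 by have [c c0 cE] := Lip_fin (pL j); exists c.
exists (fun j => n%:R * (c j + 1)).
 by move=> j; have [c0 _] := cP j; rewrite mulr_gt0// ltr_wpDl.
by apply: Lip_hol => // j; have [c0 cE] := cP j; rewrite ?cE.
Qed.

Lemma cvg_bounded_hol (psi_ : nat -> Rn -> Rn) phi : cvg_bounded_Lip al psi_ phi ->
 (exists2 H, forall j, 0 < H j & forall k, hol al H (psi_ k)) /\
 forall e : R, 0 < e -> \forall k \near \oo, forall j x, `|phi x ord0 j - psi_ k x ord0 j| <= e.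
Proof.
move=> [cu bL]; split.
 set s := ereal_sup _ in bL.
 have sk i k : (Lip (al i) (component (psi_ k) i) <= s)%E by apply: ereal_sup_ubound; exists (i, k).
 have [c c0 sE] : exists2 c : R, 0 <= c & s = c%:E.
  have : (0 <= s)%E by exact: le_trans (Lip_ge0 _ _) (sk ord0 0%N).
  by move: bL; case: s {sk} => [c||]// _; rewrite lee_fin => c0; exists c.
 exists (fun=> n%:R * (c + 1)); first by move=> j; rewrite mulr_gt0// ltr_wpDl.
 move=> k; apply: (Lip_hol (c := fun=> c)) => // j; by rewrite -sE.
move=> e e0.
have hn : nbhs (phi : {uniform Rn -> Rn}) [set g : Rn -> Rn | forall x, ball (phi x) e (g x)].
 apply/uniform_nbhs; exists [set xy | ball xy.1 e xy.2]; split.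
  by rewrite -entourage_ballE; exists e.
 by move=> g /= gE x; exact: gE.
have := cu _ hn; rewrite /nbhs/=; apply: filterS => k kP j x.
have := kP x; rewrite mx_norm_ball /ball_/= => /ltW; apply: le_trans.
by have := coord_le (phi x - psi_ k x) j; rewrite !mxE.
Qed.

Lemma hol_cvg_bounded (psi_ : nat -> Rn -> Rn) phi H : allpos H -> (forall k, hol al H (psi_ k)) ->
 (forall e : R, 0 < e -> \forall k \near \oo, forall j x, `|phi x ord0 j - psi_ k x ord0 j| <= e) ->
 cvg_bounded_Lip al psi_ phi.
Proof.
move=> H0 pH pe; split.
 move=> P /uniform_nbhs[E [/= Eb EP]].
 have [e /= e0 eE] : exists2 e : R, 0 < e & forall x y : Rn, ball x e y -> E (x, y).
  by move: Eb; rewrite -entourage_ballE => -[e e0 eE]; exists e => // x y xy; exact: eE.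
 have e2 : 0 < e / 2 by rewrite divr_gt0.
 apply: filterS (pe _ e2) => k kP; apply: EP => x _; apply: eE; rewrite mx_norm_ball /ball_/=.
 apply: (@le_lt_trans _ _ (e / 2)); last by rewrite ltr_pdivrMr// ltr_pMr// ltr1n.
 by apply: norm_row_le => [|j]; [exact: ltW|rewrite !mxE; exact: kP].
apply: (@le_lt_trans _ _ (\sum_j H j)%:E); last exact: ltry.
apply: ge_ereal_sup => _ [[i k] _ <-] /=; apply: le_trans (hol_Lip i H0 (pH k)) _.
by rewrite lee_fin (bigD1 i)//= lerDl sumr_ge0// => j _; exact: ltW.
Qed.

Variables (u : Rn -> R) (r : R).
Hypotheses (r0 : 0 <= r) (iu : intg u) (us : ess_spt u `<=` cube r).
Notation u1 := (cutoff u r).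

(** An admissible sequence may have Hölder constants above [H]; [islim] is used for the maximum of
    [H] and the uniform bound [G] of the sequence. *)
Lemma islim_is_pushforward phi v H : allpos H -> hol al H phi -> islim al u1 phi v -> is_pushforward al u phi v.
Proof.
move=> H0 pH lv; have [iv _] := lv; split.
 have [N N0 vN] := islim_supp al01 (cutoff_integrable r iu) (cutoff_csupp u r0) H0 pH lv r0 (@cutoff_supp u r).
 exact: L1c_ae_supp vN.
move=> psi_ pL /cvg_bounded_hol[[G G0 pG] pe].
have /choice[v_ vP] k : exists w, is_pushforward_Lip u (psi_ k) w /\
  exists L, [/\ forall j, 0 <= L j, lips L (psi_ k) & ispush u1 (psi_ k) w].
 have [L L0 kL] := is_Lip_map_lips (pL k); have [K K0 kK] := lips_lip kL.
 have [w wP] := pushforward_exists kK r0 (cutoff_integrable r iu) (@cutoff_supp u r).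
 exists w; split; first exact: push_is_pushforward_Lip wP.
 by exists L; split => //; exact: pushforward_spec_ispush wP.
exists v_; first by move=> k; case: (vP k).
pose M j := Num.max (H j) (G j).
have M0 j : 0 < M j by rewrite lt_max H0.
have HM j : H j <= M j by rewrite le_max lexx.
have GM j : G j <= M j by rewrite le_max lexx orbT.
apply: Lp_cvgP => e e0; have [d d0 dP] := lv.2 M M0 (hol_le HM pH) e e0.
apply: filterS (pe d d0) => k kd; have [_ [L [L0 kL kp]]] := vP k; have [ik _ _] := kp.
have i1 : intg (v_ k \- v) := intg_sub ik iv.
rewrite (Lp_norm_1 i1) lee_fin.
have := dP _ _ _ (hol_le GM (pG k)) kL L0 kp kd; apply: le_trans.
apply: eq_ler; apply: eq_Rint => x; exact: distrC.
Qed.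

(** One sequence is enough to identify [v]: regularizations of [phi] at distance [1/(k+1)] are
    admissible, and their push-forwards converge to [v] by definition and to [v0] by [islim]. *)
Lemma is_pushforward_islim phi v v0 H : allpos H -> hol al H phi -> islim al u1 phi v0 ->
 is_pushforward al u phi v -> islim al u1 phi v.
Proof.
move=> H0 pH lv [[iv _] vP]; have [iv0 lv0] := lv; apply: (islim_ae iv _ lv).
have e0 k : 0 < (k.+1%:R^-1 : R) by rewrite invr_gt0.
have /choice[psi_ pP] k : exists psi, exists L, [/\ hol al H psi, lips L psi, forall j, 0 <= L j &
  forall j x, `|phi x ord0 j - psi x ord0 j| <= k.+1%:R^-1].
 have [g [L gP]] := apx_exists al01 H0 pH (e0 k); by exists g, L.
have pL k : is_Lip_map (psi_ k).
 by have [L [_ kL L0 _]] := pP k; exact: lips_is_Lip_map kL.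
have pe e : 0 < e -> \forall k \near \oo, forall j x, `|phi x ord0 j - psi_ k x ord0 j| <= e.
 move=> ep; have [k0 ke] := exists_inv_nat ep; exists k0 => // k /= k0k j x.
 have [L [_ _ _ h]] := pP k; apply: le_trans (h j x) (le_trans _ ke).
 by rewrite lef_pV2 ?posrE// ler_nat.
have pb : cvg_bounded_Lip al psi_ phi.
 by apply: hol_cvg_bounded H0 _ pe => k; have [L []] := pP k.
have [v_ v_P v_v] := vP psi_ pL pb.
have iv_ k : intg (v_ k) by have [[]] := v_P k.
apply: ae_eq_L1_small => // e ep; have e2 : 0 < e / 2 by rewrite divr_gt0.
have [d d0 dP] := lv0 H H0 pH _ e2.
have [k [kd k1]] : exists k, (forall j x, `|phi x ord0 j - psi_ k x ord0 j| <= d) /\ \int[mu]_x `|v_ k x - v x| <= e / 2.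
 have [k1 _ k1P] := pe d d0; have [k2 _ k2P] := Lp_cvg1 iv_ iv v_v e2.
 exists (maxn k1 k2); split; [apply: k1P|apply: k2P] => /=; [exact: leq_maxl|exact: leq_maxr].
have [_ [L [w [L0 kL kw vw]]]] := is_pushforward_Lip_ispush r0 iu us (pL k) (v_P k).
have [iw _ _] := kw; have [L' [kH _ _ _]] := pP k.
apply: le_trans (L1_triangle iv0 (iv_ k) iv) _; rewrite [leRHS](splitr e); apply: lerD => //.
apply: le_trans (dP _ _ _ kH kL L0 kw kd); apply: eq_ler.
apply: eq_Rint_ae.
- exact: intg_meas (intg_dist iv0 (iv_ k)).
- exact: intg_meas (intg_dist iv0 iw).
by apply: aeS vw => x ->.
Qed.

End pushforward_by_approximation.

(** * The quantitative bound *)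

Section quantitative.
Implicit Types (phi : Rn -> Rn) (al H : 'I_n -> R) (j : 'I_n).

Lemma Valpha_fin (b : R) u : (Valpha b u < +oo)%E -> exists2 V : R, 0 <= V & Valpha b u = V%:E.
Proof.
have : (0 <= Valpha b u)%E by apply: le_ereal_inf_tmp => z [].
by case: (Valpha b u) => [V||]//; rewrite lee_fin => V0 _; exists V.
Qed.

Lemma cutoff_decomposition (a r : R) : 0 <= a < 1 -> 0 <= r ->
 exists2 C : R, 0 <= C & exists2 K : R, 0 <= K & forall u B, intg u -> ess_spt u `<=` cube r ->
  (Valpha a u < B%:E)%E -> 0 <= B -> exists2 U : nat -> Rn -> R, \int[mu]_x `|U 0%N x| <= C * B &
  forall k, [/\ intg (U k), vanish K (U k),
    \int[mu]_x `|cutoff u r x - U k x| <= C * B * (2^-1 `^ (1 - a)) ^+ k &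
    CV 0 (fun=> C * B * (2 `^ a) ^+ k) (U k)].
Proof.
move=> a01 r0; have [C C0 [K K0 CP]] := smooth_decomposition a01 r0.
exists (2 * C); first by rewrite mulr_ge0.
exists K => // u B iu us uB B0.
have ic := cutoff_integrable r iu; have B2 : 0 <= 2 * B by rewrite mulr_ge0.
have cu : CV a (fun=> 2 * B) (cutoff u r).
 move=> i F S' L S0 L0 FL FS; have := Valpha_CV a01 iu uB i S0 L0 FL FS.
 suff -> : \int[mu]_x (u x * pd i F x) = \int[mu]_x (cutoff u r x * pd i F x) by [].
 have mF := meas_pd i FL.
 apply: eq_Rint_ae; [exact: measurable_funM (intg_meas iu) mF|exact: measurable_funM (intg_meas ic) mF|].
 by apply: aeS (ae_cutoff us) => x ->.
have [U [U0 UP]] := CP _ _ ic (@cutoff_supp u r) B2 cu.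
have E : C * (2 * B) = 2 * C * B by ring.
by exists U; rewrite -E.
Qed.

Lemma islim_Lp_bound (a r tau p : R) : 0 <= a < 1 -> 0 <= r -> 1 <= p -> n%:R * (1 - p^-1) < 1 ->
 0 < tau - (m%:R + a) - tau * (1 - p^-1) ->
 exists2 Y : R, 0 <= Y & forall al u phi v H B, (forall j, 0 < al j <= 1) -> \sum_j al j = tau ->
  intg u -> ess_spt u `<=` cube r -> (Valpha a u < B%:E)%E -> 0 <= B -> allpos H ->
  hol al H phi -> islim al (cutoff u r) phi v ->
  (Lp_norm p v <= (Y * (B * (\prod_j H j) `^ p^-1))%:E)%E.
Proof.
move=> a01 r0 p1 ns th; set s := 1 - p^-1 in ns th *.
have p0 : 0 < p by exact: lt_le_trans p1.
have s0 : 0 <= s by rewrite subr_ge0 invf_le1.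
have [C C0 [K K0 CP]] := cutoff_decomposition a01 r0.
have [Cs Cs0 CsP] := dual_CV0 s0 ns.
have q01 := half_powR_lt1 th; have /andP[q0 q1] := q01.
have pc0 : 0 <= piece_const C.
 by rewrite /piece_const mulr_ge0 ?mulr_ge0 ?addr_ge0 ?mulr_ge0 ?addr_ge0 ?exprn_ge0.
exists (2 * (Cs * piece_const C) / (1 - 2^-1 `^ (tau - (m%:R + a) - tau * s))).
 by apply: divr_ge0; [exact: mulr_ge0 (ler0n _ _) (mulr_ge0 Cs0 pc0)|rewrite subr_ge0 ltW].
move=> al u phi v H B al01 alt iu us uB B0 H0 pH lv.
have [U U0 UP] := CP u B iu us uB B0; have ic := cutoff_integrable r iu.
have sc := cutoff_csupp u r0.
have tm : m%:R + a < \sum_j al j.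
 rewrite alt -subr_gt0; apply: lt_le_trans th _; rewrite gerBl mulr_ge0// -alt sumr_ge0// => j _.
 by case/andP: (al01 j) => /ltW.
have [w fw wv] := islim_repr_exists al01 ic sc a01 tm C0 B0 K0 U0 UP H0 pH lv.
have [_ iw _] := fw; have [iv _] := lv.
rewrite -alt in th; have := repr_dual al01 H0 a01 C0 B0 K0 ic U0 UP th Cs0 CsP fw.
rewrite alt => /(dual_ae iw iv wv) dv.
have -> : 2 * (Cs * piece_const C) / (1 - 2^-1 `^ (tau - (m%:R + a) - tau * s)) * (B * (\prod_j H j) `^ p^-1) =
 2 * (Cs * piece_const C * B * (\prod_j H j) `^ (1 - s)) / (1 - 2^-1 `^ (tau - (m%:R + a) - tau * s)).
 rewrite (_ : 1 - s = p^-1); last by rewrite /s subKr.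
 move: (piece_const C) => pc; move: (_ `^ p^-1) (2^-1 `^ _) => z1 z2; ring.
apply: dual_Lp_norm => //.
apply: divr_ge0; last by rewrite subr_ge0 ltW.
by apply: mulr_ge0 => //; apply: mulr_ge0 (powR_ge0 _ _); apply: mulr_ge0 B0; exact: mulr_ge0 Cs0 pc0.
Qed.

(** Isolates what the constant must satisfy, so that it can be selected from the dimension, [tau],
    [d], [p] and [r] alone. *)
Definition Lp_bound (tau d p r Y : R) := forall al u phi v,
 (forall j, 0 < al j <= 1) -> \sum_j al j = tau -> BVc (d - (n%:R - 1)) u -> ess_spt u `<=` cube r ->
 (forall j, (Lip (al j) (component phi j) < +oo)%E) -> is_pushforward al u phi v ->
 (Lp_norm p v <= Y%:E * Valpha (d - (n%:R - 1)) u * \prod_j poweR (Lip (al j) (component phi j)) p^-1)%E.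

(** [p < tau / d] means [d < tau / p], which is the second conclusion for positive [d]. The first
    one follows: [n - 1 <= d] and [tau <= n] give [n - 1 < n / p]. *)
Lemma exponent_range (d tau p : R) : n%:R - 1 <= d < n%:R -> d < tau -> tau <= n%:R -> 1 <= p ->
 p < tau / d \/ (d = n%:R - 1 /\ n%:R - 1 = 0 :> R) ->
 n%:R * (1 - p^-1) < 1 /\ 0 < tau - d - tau * (1 - p^-1).
Proof.
move=> /andP[nd dn] dt tn p1 hp; have p0 : 0 < p by exact: lt_le_trans p1.
have m0 : 0 <= n%:R - 1 :> R by rewrite subr_ge0 ler1n.
have d0 : 0 <= d by exact: le_trans nd.
have t0 : 0 < tau by exact: le_lt_trans dt.
case: hp => [pt|[dE nE]]; last first.
 have -> : n%:R = 1 :> R by apply/eqP; rewrite -subr_eq0 nE.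
 have := invr_gt0 p; rewrite p0 dE nE => pv; split; first by rewrite mul1r gtrBl.
 by rewrite subr0 mulrBr mulr1 opprB addrCA subrr addr0 mulr_gt0.
have dp : 0 < d.
 rewrite lt_neqAle d0 andbT eq_sym; apply/eqP => dE; move: pt.
 by rewrite dE invr0 mulr0 ltNge (le_trans ler01 p1).
have dtp : d < tau * p^-1 by rewrite ltr_pdivlMr// mulrC -ltr_pdivlMr.
split; last by rewrite (_ : tau - d - tau * (1 - p^-1) = tau / p - d) ?subr_gt0//; ring.
rewrite mulrBr mulr1 ltrBlDr -ltrBlDl (le_lt_trans nd)// (lt_le_trans dtp)//.
by rewrite ler_wpM2r// invr_ge0 ltW.
Qed.

(** [islim_Lp_bound] holds with any excess [e > 0] in the variation and in the Hölder constants;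
    [le_mul_powR_limit] lets [e] tend to 0. The factor [n ^+ n] to the power [1/p] comes from the
    change of norms in [le_Lip]. *)
Lemma Lp_bound_exists (tau d p r : R) : n%:R - 1 <= d < n%:R -> d < tau -> tau <= n%:R -> 0 <= r -> 1 <= p ->
 p < tau / d \/ (d = n%:R - 1 /\ n%:R - 1 = 0 :> R) -> exists Y, Lp_bound tau d p r Y.
Proof.
move=> nd dt tn r0 p1 hp; have [ns th] := exponent_range nd dt tn p1 hp.
have p0 : 0 < p by exact: lt_le_trans p1.
pose a := d - (n%:R - 1).
have ma : m%:R + a = d by rewrite /a -natr1 addrK subrKC.
have a01 : 0 <= a < 1 by move: nd => /andP[h1 h2]; rewrite subr_ge0 h1 ltrBlDr subrKC.
rewrite -ma in th; have [Y Y0 YP] := islim_Lp_bound a01 r0 p1 ns th.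
exists (Y * (n%:R ^+ n) `^ p^-1) => al u phi v al01 alt [[iu _] uV] us pL pv.
have [H H0 pH] := Lip_fin_hol al01 pL.
have [V V0 VE] := Valpha_fin uV; rewrite -/a in VE *; rewrite VE.
have /choice[c cP] j : exists c : R, 0 <= c /\ Lip (al j) (component phi j) = c%:E.
 by have [c c0 cE] := Lip_fin (pL j); exists c.
have c0 j : 0 <= c j by case: (cP j).
have VB e : 0 < e -> (Valpha a u < (V + e)%:E)%E by move=> e0; rewrite VE lte_fin ltrDl.
have tm : m%:R + a < \sum_j al j by rewrite alt ma.
have [C C0 [K K0 CP]] := cutoff_decomposition a01 r0.
have V1 : 0 <= V + 1 by rewrite addr_ge0.
have [U U0 UP] := CP u (V + 1) iu us (VB 1 ltr01) V1.
have ic := cutoff_integrable r iu; have sc := cutoff_csupp u r0.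
have [v0 lv0] := islim_exists al01 ic sc a01 tm C0 V1 K0 U0 UP H0 pH.
have lv := is_pushforward_islim al01 r0 iu us H0 pH lv0 pv.
have bound e : 0 < e -> (Lp_norm p v <= (Y * ((V + e) * (\prod_j (n%:R * (c j + e))) `^ p^-1))%:E)%E.
 move=> e0; apply: (YP al u phi v _ _ al01 alt iu us (VB e e0)) lv.
 - by rewrite addr_ge0// ltW.
 - by move=> j; rewrite mulr_gt0// ltr_wpDl.
 - by apply: (Lip_hol al01 c0 (ltW e0)) => j; case: (cP j) => _ ->.
have N0 : (0 <= Lp_norm p v)%E by exact: Lnorm_ge0.
have [N NE] : exists N : R, Lp_norm p v = N%:E.
 by move: N0 (bound 1 ltr01); case: (Lp_norm p v) => [N||]//; exists N.
rewrite NE in N0 bound *; rewrite lee_fin in N0.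
have -> : (\prod_j poweR (Lip (al j) (component phi j)) p^-1 = (\prod_j c j `^ p^-1)%:E)%E.
 rewrite (big_morph EFin EFinM (erefl : 1%:E = 1%E)); apply: eq_bigr => j _.
 by case: (cP j) => _ ->.
rewrite -!EFinM lee_fin -powR_prod//.
have -> : Y * (n%:R ^+ n) `^ p^-1 * V * (\prod_j c j) `^ p^-1 = Y * (V * (\prod_j (n%:R * c j)) `^ p^-1).
 rewrite big_split/= prodr_const card_ord powRM ?exprn_ge0 ?prodr_ge0//.
 move: (_ `^ p^-1) ((\prod_j _) `^ p^-1) => z1 z2; ring.
apply: le_mul_powR_limit => // e e0; rewrite -lee_fin; exact: bound.
Qed.

End quantitative.

End pushforward_theory.

Theorem theorem1p2 (R : realType) :
  exists C : nat -> R -> R -> R -> R -> R,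
  forall (m : nat) (d : R) (u : 'rV[R]_m.+1 -> R)
    (phi : 'rV[R]_m.+1 -> 'rV[R]_m.+1) (r : R) (alpha : 'I_m.+1 -> R),
  let n := m.+1 in
  let tau := \sum_i alpha i in
  let p_range := fun p : R =>
    1 <= p /\ (p < tau / d \/ (d = n%:R - 1 /\ n%:R - 1 = 0 :> R)) in
  n%:R - 1 <= d < n%:R ->
  BVc (d - (n%:R - 1)) u ->
  0 < r ->
  (forall i, 0 < alpha i <= 1) ->
  ess_spt u `<=` [set x : 'rV[R]_m.+1 | forall i, - r <= x ord0 i <= r] ->
  (forall i, Lip (alpha i) (component phi i) < +oo)%E ->
  d < tau ->
  exists v : 'rV[R]_m.+1 -> R,
  [/\ is_pushforward alpha u phi v,
      forall p, p_range p ->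
        (Lp_norm p v <=
         (C n tau d p r)%:E * Valpha (d - (n%:R - 1)) u *
         \prod_i poweR (Lip (alpha i) (component phi i)) p^-1)%E,
      forall (phi_ : nat -> 'rV[R]_m.+1 -> 'rV[R]_m.+1)
        (v_ : nat -> 'rV[R]_m.+1 -> R),
        cvg_bounded_Lip alpha phi_ phi ->
        (forall k, is_pushforward alpha u (phi_ k) (v_ k)) ->
        forall p, p_range p -> Lp_cvg p v_ v &
      forall delta : R,
        n%:R + (d - tau) / \big[Num.max/0]_i alpha i < delta < n%:R ->
        BVc (delta - (n%:R - 1)) v].
Proof.
(* A choice function: a valid bound wherever one exists, and 0 for the other parameters. [n.-1]
   turns the dimension back into the [m] of the construction. *)
exists (fun n tau d p r => xget 0 [set Y | @Lp_bound R n.-1 tau d p r Y]).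
move=> m d u phi r al n tau p_range nd uBV r0 al01 us pL dt.
have [[iu _] uV] := uBV; have us' : ess_spt u `<=` cube r by [].
have r0' : 0 <= r by exact: ltW.
pose a := d - (n%:R - 1).
have ma : m%:R + a = d by rewrite /a /n -natr1 addrK subrKC.
have a01 : 0 <= a < 1 by move: nd => /andP[h1 h2]; rewrite subr_ge0 h1 ltrBlDr subrKC.
have [H H0 pH] := Lip_fin_hol al01 pL; have [V V0 VE] := Valpha_fin uV.
have tn : tau <= n%:R.
 have -> : n%:R = \sum_(i < n) 1 :> R by rewrite sumr_const card_ord.
 by apply: ler_sum => i _; case/andP: (al01 i).
have tm : m%:R + a < \sum_j al j by rewrite ma.
have [C C0 [K K0 CP]] := @cutoff_decomposition R m a r a01 r0'.
have V1 : 0 <= V + 1 by rewrite addr_ge0.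
(* For the qualitative conclusions any number strictly above the variation will do. *)
have VB : (Valpha a u < (V + 1)%:E)%E by rewrite VE lte_fin ltrDl.
have [U U0 UP] := CP u (V + 1) iu us' VB V1.
have ic := cutoff_integrable r iu; have sc := cutoff_csupp u r0'.
have [v lv] := islim_exists al01 ic sc a01 tm C0 V1 K0 U0 UP H0 pH.
have [iv _] := lv; have pv := islim_is_pushforward al01 r0' iu us' H0 pH lv.
exists v; split.
- exact: pv.
- move=> p [p1 pr]; have ex := Lp_bound_exists nd dt tn r0' p1 pr.
 exact: (xgetPex 0 ex) al u phi v al01 erefl uBV us' pL pv.
- move=> phi_ v_ pb vP p [p1 pr]; have [ns th] := exponent_range nd dt tn p1 pr.
 have p0 : 0 < p by exact: lt_le_trans p1.
 have s0 : 0 <= 1 - p^-1 by rewrite subr_ge0 invf_le1.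
 have [[G G0 gG] pe] := cvg_bounded_hol al01 pb.
 pose M j := Num.max (H j) (G j).
 have M0 j : 0 < M j by rewrite lt_max H0.
 have HM j : H j <= M j by rewrite le_max lexx.
 have GM j : G j <= M j by rewrite le_max lexx orbT.
 rewrite -ma in th; apply: Lp_cvgP => e e0.
 have [b b0 bP] := islim_close al01 ic sc a01 tm C0 V1 K0 U0 UP M0 s0 ns th e0.
 apply: filterS (pe b b0) => k kb.
 have [w lw] := islim_exists al01 ic sc a01 tm C0 V1 K0 U0 UP G0 (gG k).
 have lv_ := is_pushforward_islim al01 r0' iu us' G0 (gG k) lw (vP k).
 have [iv_ _] := lv_.
 apply: (dual_Lp_norm p1 (ltW e0) (intg_sub iv_ iv)).
 apply: (bP _ _ _ _ (hol_le GM (gG k)) (hol_le HM pH) lv_ lv) => j x.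
 by rewrite distrC; exact: kb.
- move=> delta; set M := \big[_/_]_i _ => /andP[d1 d2].
 have alM j : al j <= M by exact: le_bigmax.
 have M0 : 0 < M by case/andP: (al01 ord0) => h _; exact: lt_le_trans (alM ord0).
 have M1 : M <= 1 by apply: bigmax_le => // i _; case/andP: (al01 i).
 split; first by case: pv.
 have dE : 1 - (delta - (n%:R - 1)) = n%:R - delta by ring.
 have dM : M * (n%:R - delta) < tau - d.
  rewrite mulrC -ltr_pdivlMr// (_ : (tau - d) / M = - ((d - tau) / M)); last by rewrite -mulNr opprB.
  by rewrite ltrBlDr addrC ltrBrDr.
 (* From [tau <= n M], [M <= 1] and [n - 1 <= d]. With [dM] it forces [delta > n - 1], so the order
    [delta - (n - 1)] is nonnegative. *)
 have tM : tau - d <= M.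
  have h1 : tau <= n%:R * M.
   have -> : n%:R * M = \sum_(i < n) M by rewrite sumr_const card_ord mulr_natl.
   by apply: ler_sum => i _.
  have h2 : (n%:R - 1) * M <= n%:R - 1 by rewrite ler_piMr// subr_ge0 ler1n.
  have /andP[h3 _] := nd.
  rewrite lerBlDr (le_trans h1)// -lerBlDl (le_trans _ h3)// (le_trans _ h2)//.
  by rewrite mulrBl mul1r.
 have b0 : 0 <= delta - (n%:R - 1).
  have : M * (n%:R - delta) < M * 1 by rewrite mulr1 (lt_le_trans dM).
  by rewrite ltr_pM2l// ltrBlDr subr_ge0 lerBlDl => /ltW.
 apply: (islim_BV al01 ic sc a01 tm C0 V1 K0 U0 UP H0 pH lv alM).
 - by rewrite b0 /= -subr_ge0 dE subr_ge0 ltW.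
 - by rewrite dE ma subr_gt0.
Qed.
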